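(* Let $d \geq 1$ and let $\Gamma \subseteq \mathbb{R}^{2d}$ be a lattice such that \[ \operatorname{covol}(\Gamma) < 1 - \frac{d-1}{n_\Gamma}, \] where $(d-1)/n_\Gamma$ is interpreted as $0$ if $n_\Gamma = \infty$. Then there exists a Schwartz function $g \in \mathcal{S}(\mathbb{R}^d)$ such that the Gabor system $\pi(\Gamma)g = (\pi(\gamma)g)_{\gamma \in \Gamma}$ is a frame for $L^2(\mathbb{R}^d)$, i.e. there exist constants $A,B>0$ such that \[ A \|f\|_2^2 \leq \sum_{\gamma \in \Gamma} |\langle f, \pi(\gamma) g\rangle|^2 \leq B \|f\|_2^2 \qquad \text{for all } f \in L^2(\mathbb{R}^d). \]
   Context: A lattice in $\mathbb{R}^{2d}$ is a subgroup of the form $\Gamma = M\mathbb{Z}^{2d}$ with $M \in \mathrm{GL}(2d,\mathbb{R})$; its covolume is $\operatorname{covol}(\Gamma) = |\det M|$. For $z = (x,\omega) \in \mathbb{R}^d \times \mathbb{R}^d \cong \mathbb{R}^{2d}$, the time-frequency shift $\pi(z)$ is the unitary operator on $L^2(\mathbb{R}^d)$ given by $(\pi(z)f)(t) = e^{2\pi i \langle \omega, t\rangle} f(t-x)$ for $f \in L^2(\mathbb{R}^d)$, $t \in \mathbb{R}^d$. The standard symplectic form on $\mathbb{R}^{2d}$ is $\Omega((x,\omega),(x',\omega')) = \langle x,\omega'\rangle - \langle x',\omega\rangle$. For a lattice $\Gamma \subseteq \mathbb{R}^{2d}$ put \[ \Gamma_\Omega = \{\gamma \in \Gamma : \Omega(\gamma,\gamma')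 \in \mathbb{Z} \text{ for all } \gamma' \in \Gamma\}, \] a subgroup of $\Gamma$. Define $n_\Gamma = [\Gamma : \Gamma_\Omega]^{1/2}$ if the index $[\Gamma:\Gamma_\Omega]$ is finite, and $n_\Gamma = \infty$ otherwise. *)

(* Defs.v *)
From HB Require Import structures.
From mathcomp Require Import all_boot all_order all_algebra.
From mathcomp Require Import finmap.
From mathcomp Require Import all_classical all_reals all_analysis.
From mathcomp Require Export complex.

Set Implicit Arguments.
Unset Strict Implicit.
Unset Printing Implicit Defensive.

Import Order.TTheory GRing.Theory Num.Theory.
Import numFieldNormedType.Exports.

Local Open Scope classical_set_scope.
Local Open Scope ring_scope.
Local Open Scope complex_scope.

(* The Borel sigma-algebra of R^n, generated by the coordinate maps, on the row
   vectors 'rV_n (the library has it only on n-tuples). *)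
Definition measure_rV_display : measure_display -> measure_display.
Proof. exact. Qed.

Section measurable_rV.
Context {d : measure_display} {T : sigmaRingType d} (n : nat).

Definition rV_coord (i : 'I_n) (v : 'rV[T]_n) : T := v ord0 i.

Let rV_set0 : g_sigma_preimage rV_coord set0.
Proof. exact: sigma_algebra0. Qed.

Let rV_setC A : g_sigma_preimage rV_coord A -> g_sigma_preimage rV_coord (~` A).
Proof. exact: sigma_algebraC. Qed.

Let rV_bigcup (F : _^nat) : (forall i, g_sigma_preimage rV_coord (F i)) ->
  g_sigma_preimage rV_coord (\bigcup_i (F i)).
Proof. exact: sigma_algebra_bigcup. Qed.

HB.instance Definition _ := @isMeasurable.Build (measure_rV_display d)
  'rV[T]_n (g_sigma_preimage rV_coord) rV_set0 rV_setC rV_bigcup.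

Lemma measurable_rV_coord (i : 'I_n) : measurable_fun [set: 'rV[T]_n] (rV_coord i).
Proof.
move=> _ Y mY; rewrite setTI; apply: sub_sigma_algebra => /=.
rewrite -bigcup_seq/=; exists i => /=; first by rewrite mem_index_enum.
by exists Y => //; rewrite setTI.
Qed.

End measurable_rV.

Lemma measurable_fun_rV d1 d2 (T1 : measurableType d1) (T2 : measurableType d2)
    n (f : T1 -> 'rV[T2]_n) :
  (forall i, measurable_fun [set: T1] (fun x => f x ord0 i)) ->
  measurable_fun [set: T1] f.
Proof.
move=> mf; suff: g_sigma_preimage (fun i => @rV_coord _ T2 n i \o f) `<=` measurable.
  by rewrite g_sigma_preimage_comp => H _ A mA; apply: H; exists A.
apply: smallest_sub; first exact: sigma_algebra_measurable.
move: f mf; case: n => [|n] f mf; first by rewrite big_ord0.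
rewrite -bigcup_mkord_ord; apply: bigcup_sub => i Ii.
by move=> A [B mB <-]; exact: mf.
Qed.

Lemma sigma_finite_product d1 d2 (T1 : measurableType d1)
    (T2 : measurableType d2) (R : realType)
    (m1 : {sigma_finite_measure set T1 -> \bar R})
    (m2 : {sigma_finite_measure set T2 -> \bar R}) :
  sigma_finite setT (m1 \x m2)%E.
Proof.
have /sigma_finiteP[F [TF ndF Foo]] := sigma_finiteT m1.
have /sigma_finiteP[G [TG ndG Goo]] := sigma_finiteT m2.
exists (fun n => F n `*` G n).
  rewrite -setXTT TF TG predeqE => -[x y]; split.
    move=> [/= [n _ Fnx] [k _ Gky]]; exists (maxn n k) => //; split.
    - by move: x Fnx; exact/subsetPset/ndF/leq_maxl.
    - by move: y Gky; exact/subsetPset/ndG/leq_maxr.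
  by move=> [n _ []/= ? ?]; split; exists n.
move=> k; have [? ?] := Foo k; have [? ?] := Goo k.
split; first exact: measurableX.
by rewrite product_measure1E// lte_mul_pinfty// ge0_fin_numE.
Qed.

Lemma sigma_finite_pushforward d1 d2 (T1 : measurableType d1)
    (T2 : measurableType d2) (R : realType) (m : {measure set T1 -> \bar R})
    (f : T1 -> T2) (g : T2 -> T1) :
  measurable_fun setT f -> measurable_fun setT g -> cancel f g ->
  sigma_finite setT m ->
  exists m' : {sigma_finite_measure set T2 -> \bar R},
    pushforward m f = m' :> (set T2 -> \bar R).
Proof.
move=> mf mg fK [F FT Foo].
have p_sf : sigma_finite setT (pushforward m f).
  exists (fun k => g @^-1` F k); first by rewrite -preimage_bigcup -FT.
  move=> k; have [mF Fk] := Foo k; split.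
    by rewrite -[X in measurable X]setTI; exact: mg.
  rewrite /pushforward (_ : f @^-1` _ = F k)//.
  by apply/seteqP; split => x /=; rewrite fK.
pose pM := measure_function_pushforward__canonical__measure_function_Measure m mf.
pose S := Measure_isSigmaFinite.Build _ _ _ pM p_sf.
pose pS : {sigma_finite_measure set T2 -> \bar R} := HB.pack (Measure.sort pM) S.
by exists pS.
Qed.

Section lebesgue_rV.
Context {R : realType}.

Definition cons_rV n (p : measurableTypeR R * 'rV[R]_n) : 'rV[R]_n.+1 :=
  row_mx (p.1%:M : 'rV[R]_1) p.2.

Definition uncons_rV n (v : 'rV[R]_n.+1) : measurableTypeR R * 'rV[R]_n :=
  (v ord0 ord0, rsubmx (v : 'rV[R]_(1 + n))).

Lemma cons_rV0 n p : @cons_rV n p ord0 ord0 = p.1.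
Proof.
have := row_mxEl (p.1%:M : 'rV[R]_1) p.2 ord0 ord0.
rewrite [X in _ = X]mxE eqxx mulr1n => <-.
by congr (row_mx _ _ _ _); apply/val_inj.
Qed.

Lemma cons_rVS n p i : @cons_rV n p ord0 (lift ord0 i) = p.2 ord0 i.
Proof.
rewrite -(row_mxEr (p.1%:M : 'rV[R]_1) p.2 ord0 i) /cons_rV.
by congr (row_mx _ _ _ _); apply/val_inj.
Qed.

Lemma cons_rVK n : cancel (@cons_rV n) (@uncons_rV n).
Proof.
move=> [a v]; rewrite /uncons_rV cons_rV0; congr pair.
exact: row_mxKr.
Qed.

Lemma uncons_rVK n : cancel (@uncons_rV n) (@cons_rV n).
Proof.
move=> v; apply/rowP => i; case: (unliftP ord0 i) => [j|] ->.
  by rewrite cons_rVS /= mxE; congr (v _ _); apply/val_inj.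
by rewrite cons_rV0.
Qed.

Lemma measurable_cons_rV n : measurable_fun setT (@cons_rV n).
Proof.
apply: measurable_fun_rV => i; case: (unliftP ord0 i) => [j|] ->.
  under eq_fun do rewrite cons_rVS.
  by apply: (measurableT_comp (@measurable_rV_coord _ R n j) measurable_snd).
under eq_fun do rewrite cons_rV0.
exact: measurable_fst.
Qed.

Lemma measurable_uncons_rV n : measurable_fun setT (@uncons_rV n).
Proof.
apply/measurable_fun_pair; first exact: (@measurable_rV_coord _ R n.+1 ord0).
apply: measurable_fun_rV => i.
rewrite (_ : (fun x => _) = (fun x : 'rV[R]_n.+1 => rV_coord (lift ord0 i) x)).
  exact: (@measurable_rV_coord _ R n.+1 (lift ord0 i)).
apply/funext => v; rewrite /= mxE /rV_coord.
by congr (v _ _); apply/val_inj.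
Qed.

(* Lebesgue measure on R^n as the n-fold product of Lebesgue measure on R
   (the Dirac mass when n = 0). *)
Fixpoint lebesgue_rV n : set 'rV[R]_n -> \bar R :=
  match n with
  | 0 => \d_(0 : 'rV[R]_0)
  | n.+1 => pushforward (lebesgue_measure \x @lebesgue_rV n)%E (@cons_rV n)
  end.
Arguments lebesgue_rV n : clear implicits.

Let lebesgue_rV_spec n : exists m : {sigma_finite_measure set 'rV[R]_n -> \bar R},
  lebesgue_rV n = m :> (set 'rV[R]_n -> \bar R).
Proof.
elim: n => [|n [m IH]]; first by exists (\d_(0 : 'rV[R]_0)).
rewrite /= IH.
exact: (sigma_finite_pushforward (@measurable_cons_rV n)
  (@measurable_uncons_rV n) (@cons_rVK n) (sigma_finite_product _ m)).
Qed.

Let lebesgue_rV_set0 n : lebesgue_rV n set0 = 0%E.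
Proof. by have [m ->] := lebesgue_rV_spec n; exact: measure0. Qed.

Let lebesgue_rV_ge0 n A : (0 <= lebesgue_rV n A)%E.
Proof. by have [m ->] := lebesgue_rV_spec n; exact: measure_ge0. Qed.

Let lebesgue_rV_semi_sigma_additive n : semi_sigma_additive (lebesgue_rV n).
Proof.
by have [m ->] := lebesgue_rV_spec n; exact: measure_semi_sigma_additive.
Qed.

HB.instance Definition _ n := isMeasure.Build _ _ _ (lebesgue_rV n)
  (lebesgue_rV_set0 n) (@lebesgue_rV_ge0 n) (@lebesgue_rV_semi_sigma_additive n).

Let lebesgue_rV_sigma_finite n : sigma_finite setT (lebesgue_rV n).
Proof. by have [m ->] := lebesgue_rV_spec n; exact: sigma_finiteT. Qed.

HB.instance Definition _ n := Measure_isSigmaFinite.Build _ _ _ (lebesgue_rV n)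
  (lebesgue_rV_sigma_finite n).

End lebesgue_rV.
Arguments lebesgue_rV {R} n.

Lemma lebesgue_rV_box (R : realType) n (A : 'I_n -> set R) :
  (forall i, measurable (A i)) ->
  lebesgue_rV n [set v | forall i, A i (v ord0 i)] =
  (\prod_(i < n) lebesgue_measure (A i))%E.
Proof.
elim: n A => [|n IH] A mA.
  by rewrite big_ord0 /= diracE mem_set// => -[].
rewrite big_ord_recl -IH// /= /pushforward.
have mB : measurable [set v : 'rV[R]_n | forall i, A (lift ord0 i) (v ord0 i)].
  rewrite (_ : [set _ | _] = \bigcap_(i in [set: 'I_n]) (@rV_coord _ R n i @^-1` A (lift ord0 i))).
    apply: fin_bigcap_measurable => // i _.
    by rewrite -[X in measurable X]setTI; exact: measurable_rV_coord.
  by apply/seteqP; split => v /= Hv i; [move=> _|]; exact: Hv.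
transitivity ((lebesgue_measure \x lebesgue_rV n)%E
    (A ord0 `*` [set v : 'rV[R]_n | forall i, A (lift ord0 i) (v ord0 i)])); last first.
  apply: product_measure1E; [exact: (mA ord0)|exact: mB].
congr (product_measure1 _ _ _); apply/seteqP; split => -[a v] /= H.
  by split=> [|i]; [have := H ord0|have := H (lift ord0 i)]; rewrite ?cons_rV0 ?cons_rVS.
by move=> i; case: (unliftP ord0 i) => [j|] ->; rewrite ?cons_rV0 ?cons_rVS; [apply H.2|apply H.1].
Qed.

Section lattices.
Context {R : realType}.

(* The row vectors (M k)^T = k^T M^T, k an integer column. *)
Definition lattice_of n (M : 'M[R]_n) : set 'rV[R]_n :=
  [set map_mx intr k *m M^T | k in [set: 'rV[int]_n]].

Definition is_lattice n (G : set 'rV[R]_n) : Prop :=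
  exists2 M : 'M[R]_n, M \in unitmx & G = lattice_of M.

(* |det M| for any M with G = lattice_of M, see covolE. *)
Definition covol n (G : set 'rV[R]_n) : R :=
  `|\det (xget (0 : 'M[R]_n) [set M | M \in unitmx /\ G = lattice_of M])|.

Let lattice_of_sub n (M N : 'M[R]_n) : lattice_of M `<=` lattice_of N ->
  exists A : 'M[int]_n, M^T = map_mx intr A *m N^T.
Proof.
move=> MN.
have H i : exists k : 'rV[int]_n, map_mx intr k *m N^T = row i M^T.
  have [|k _ kE] := MN (row i M^T); last by exists k.
  exists (delta_mx ord0 i) => //.
  rewrite rowE; congr (_ *m _); apply/matrixP => a b; rewrite !mxE.
  by case: (_ && _).
have [k kE] := choice H.
exists (\matrix_(i, j) k i ord0 j).
apply/row_matrixP => i; rewrite -kE row_mul; congr (_ *m _).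
by apply/rowP => j; rewrite !mxE.
Qed.

Lemma covolE n (M : 'M[R]_n) : M \in unitmx -> covol (lattice_of M) = `|\det M|.
Proof.
move=> uM; rewrite /covol; case: xgetP => [N _ [uN MN]|/(_ M)]; last first.
  by case; split.
have [A AE] : exists A : 'M[int]_n, M^T = map_mx intr A *m N^T.
  by apply: lattice_of_sub; rewrite MN.
have [B BE] : exists B : 'M[int]_n, N^T = map_mx intr B *m M^T.
  by apply: lattice_of_sub; rewrite MN.
have dM : \det M = (\det A)%:~R * \det N.
  by rewrite -det_tr AE det_mulmx det_map_mx det_tr.
have dN : \det N = (\det B)%:~R * \det M.
  by rewrite -det_tr BE det_mulmx det_map_mx det_tr.
have nzN : \det N != 0 by rewrite -unitfE -unitmxE.
have AB : \det A * \det B = 1.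
  apply: (@intr_inj R); apply: (mulIf nzN).
  by rewrite rmorphM rmorph1 mul1r mulrAC -dM mulrC -dN.
have : `|\det A| = 1.
  have : \det A \is a GRing.unit by apply/unitrPr; exists (\det B).
  by rewrite qualifE /= => /orP[] /eqP ->.
by rewrite dM normrM -intr_norm => ->; rewrite mul1r.
Qed.

End lattices.

Section symplectic.
Context {R : realType} (d : nat).

Definition dotr (x y : 'rV[R]_d) : R := \sum_(i < d) x ord0 i * y ord0 i.

(* z = (x, w) in R^d x R^d, with x = lsubmx z and w = rsubmx z. *)
Definition symp (z z' : 'rV[R]_(d + d)) : R :=
  dotr (lsubmx z) (rsubmx z') - dotr (lsubmx z') (rsubmx z).

Definition symp_dual (G : set 'rV[R]_(d + d)) : set 'rV[R]_(d + d) :=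
  [set g | G g /\ forall g', G g' -> symp g g' \is a Num.int].

Definition cosets n (G H : set 'rV[R]_n) : set (set 'rV[R]_n) :=
  [set [set g + h | h in H] | g in G].

(* [G : G_Omega]^(1/2), or +oo when the index is infinite. *)
Definition nindex (G : set 'rV[R]_(d + d)) : \bar R :=
  let C := cosets G (symp_dual G) in
  if `[< finite_set C >] then (Num.sqrt ((#|` fset_set C|)%:R : R))%:E else +oo%E.

End symplectic.

Section complex_functions.
Context {R : realType} (d : nat).
Implicit Types (f g : 'rV[R]_d -> R[i]) (u : 'rV[R]_d -> R).

(* d_{i1} (d_{i2} (... u)) for s = [:: i1; i2; ...]. *)
Definition partials (s : seq 'I_d) u : 'rV[R]_d -> R :=
  foldr (fun i h => 'D_(delta_mx ord0 i) h) u s.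

Definition smooth u : Prop :=
  forall (s : seq 'I_d) (x : 'rV[R]_d), differentiable (partials s u) x.

(* Complex-valued functions are differentiated and integrated componentwise. *)
Definition cpartials (s : seq 'I_d) f (x : 'rV[R]_d) : R[i] :=
  partials s (@complex.Re R \o f) x +i* partials s (@complex.Im R \o f) x.

Definition csmooth f : Prop :=
  smooth (@complex.Re R \o f) /\ smooth (@complex.Im R \o f).

Definition monomial (a : 'I_d -> nat) (x : 'rV[R]_d) : R :=
  \prod_(i < d) x ord0 i ^+ a i.

Definition schwartz f : Prop :=
  csmooth f /\
  forall (a : 'I_d -> nat) (s : seq 'I_d), exists C : R, forall x,
    ComplexField.Normc.normc ((monomial a x)%:C * cpartials s f x) <= C.

Definition L2norm2 f : \bar R :=
  (\int[lebesgue_rV d]_x (ComplexField.Normc.normc (f x) ^+ 2)%:E)%E.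

(* Representatives of the classes in L^2(R^d). *)
Definition L2fun f : Prop :=
  [/\ measurable_fun setT (@complex.Re R \o f),
      measurable_fun setT (@complex.Im R \o f) &
      (L2norm2 f < +oo)%E].

Definition cintegral f : R[i] :=
  Rintegral (lebesgue_rV d) setT (@complex.Re R \o f) +i*
  Rintegral (lebesgue_rV d) setT (@complex.Im R \o f).

Definition L2inner f g : R[i] := cintegral (fun x => f x * (g x)^*).

Definition expi (t : R) : R[i] := cos t +i* sin t.

Definition tfshift (z : 'rV[R]_(d + d)) f : 'rV[R]_d -> R[i] :=
  fun t => expi (2 * pi * dotr (rsubmx z) t) * f (t - lsubmx z).

Definition gabor_frame (G : set 'rV[R]_(d + d)) g : Prop :=
  exists A B : R, [/\ 0 < A, 0 < B & forall f, L2fun f ->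
    (A%:E * L2norm2 f <=
       \esum_(z in G) (ComplexField.Normc.normc (L2inner f (tfshift z g)) ^+ 2)%:E
     <= B%:E * L2norm2 f)%E].

End complex_functions.

(* Main.v *)
(** By the duality principle (derived from the fundamental identity of Gabor
    analysis, with a product of step functions built from [exp (-1/x)] as a
    smooth window) it is enough to find a nice [g] whose shifts along the adjoint
    lattice L form a Riesz sequence.  Since L has covolume > 1, some p admits more
    than [p^(2d)] nearly biorthogonal vectors over the sublattice [p L].
    If the symplectic form is irrational on L, nearly central elements of L with
    almost rational commutation provide approximate matrix units, and these
    vectors, spread over a single [g], have an almost diagonal dual system.
    If it is rational, let B be a maximal isotropic sublattice of L, of index r and
    determinant [N0 >= n_Gamma]; the Gram brackets over the dual torus of B have
    rank at least the ceiling of N0 in every fibre, which exceeds by d the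
    number r of unknown functions, so that counting on a grid of coefficients
    gives one [g] avoiding every degenerate fibre at once. *)
Require Import Defs.
From mathcomp Require Import all_boot all_order all_algebra perm finmap.
From mathcomp Require Import all_classical all_reals all_analysis.
From mathcomp Require Import measurable_realfun ring lra zify.

Set Implicit Arguments.
Unset Strict Implicit.
Unset Printing Implicit Defensive.

Import Order.TTheory GRing.Theory Num.Theory.
Import numFieldNormedType.Exports.

Local Open Scope classical_set_scope.
Local Open Scope ring_scope.

(** A degenerate fibre is a point of the 2d-dimensional dual torus together with a line in C^r,
    hence 2d + 2(r - 1) real parameters, and a bracket matrix of rank n imposes 2n real conditions
    on the coefficients of g. Since the lower bound is wanted on every fibre, not on almost every
    one, the parameters must be fewer than the conditions: r + d <= n. Here r = covol * N0, so that
    covol < 1 - (d-1)/n_Gamma and N0 >= n_Gamma give r + d - 1 < N0 <= n; this is the origin of the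
    hypothesis. The irrational case takes from it that L has covolume above 1. All windows are
    finite sums of products of compactly supported smooth functions of one variable, so that
    integrals, Poisson summation and the decay of the short-time Fourier transform are settled on
    the line. The fundamental identity starts from Z^2, passes to Z^(2d) by products, to rational
    lattices by integral changes of basis and scalings of single basis vectors, and to every lattice
    by continuity. *)

Local Notation nc := (@ComplexField.Normc.normc _).
Local Notation Re := (@complex.Re _).
Local Notation Im := (@complex.Im _).

(** * Moduli of complex numbers and characters of the line *)

Section complex_norm.
Context {R : realType}.
Implicit Types (x y z : R[i]) (s t : R).

Lemma nc_ge0 x : 0 <= nc x.
Proof. by case: x => a b; exact: sqrtr_ge0. Qed.
Lemma ncM x y : nc (x * y) = nc x * nc y.
Proof. exact: ComplexField.Normc.normcM. Qed.
Lemma ncN x : nc (- x) = nc x.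
Proof. exact: normcN. Qed.
Lemma ncD x y : nc (x + y) <= nc x + nc y.
Proof. exact: le_normcD. Qed.
Lemma nc0 : nc (0 : R[i]) = 0.
Proof. exact: ComplexField.Normc.normc0. Qed.
Lemma nc1 : nc (1 : R[i]) = 1.
Proof. exact: ComplexField.Normc.normc1. Qed.
Lemma nc_eq0 x : (nc x == 0) = (x == 0).
Proof.
by apply/eqP/eqP => [|->]; [exact: ComplexField.Normc.eq0_normc|exact: nc0].
Qed.

Lemma nc_gt0 x : (0 < nc x) = (x != 0).
Proof. by rewrite lt_neqAle nc_ge0 andbT eq_sym nc_eq0. Qed.
Lemma ncB x y : nc (x - y) = nc (y - x).
Proof. by rewrite -ncN opprB. Qed.
Lemma ncBD x y : nc (x - y) <= nc x + nc y.
Proof. by rewrite (le_trans (ncD _ _))// ncN. Qed.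
Lemma nc_sub x y : nc x - nc y <= nc (x - y).
Proof. by rewrite lerBlDr -{1}(subrK y x); exact: ncD. Qed.
Lemma ncX x n : nc (x ^+ n) = nc x ^+ n.
Proof. by  idtac; elim: n => [|n IH]; rewrite ?expr0 ?nc1// !exprS ncM IH. Qed.
Lemma ncV x : nc x^-1 = (nc x)^-1.
Proof. exact: ComplexField.Normc.normcV. Qed.
Lemma nc_real t : nc t%:C%C = `|t|.
Proof. by rewrite /ComplexField.Normc.normc/= expr0n/= addr0 sqrtr_sqr. Qed.
Lemma nc_sqr x : nc x ^+ 2 = Re x ^+ 2 + Im x ^+ 2.
Proof. by case: x => a b; rewrite sqr_sqrtr//= addr_ge0 ?sqr_ge0. Qed.
Lemma nc_conj x : nc (x^*)%C = nc x.
Proof. by case: x => a b; rewrite /ComplexField.Normc.normc/= sqrrN. Qed.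
Lemma mul_conj x : x * (x^*)%C = (nc x ^+ 2)%:C%C.
Proof. by rewrite nc_sqr; case: x => a b; simpc; rewrite -!expr2 (mulrC b) addNr. Qed.
Lemma sqrn (t : R) : `|t| ^+ 2 = t ^+ 2.
Proof. by rewrite real_normK ?num_real. Qed.
Lemma Re_le_nc x : `|Re x| <= nc x.
Proof.
rewrite -ler_sqr ?nnegrE ?nc_ge0// nc_sqr sqrn.
by rewrite lerDl sqr_ge0.
Qed.

Lemma Im_le_nc x : `|Im x| <= nc x.
Proof.
rewrite -ler_sqr ?nnegrE ?nc_ge0// nc_sqr sqrn.
by rewrite lerDr sqr_ge0.
Qed.

Lemma nc_le_ReIm x : nc x <= `|Re x| + `|Im x|.
Proof.
rewrite -ler_sqr ?nnegrE ?nc_ge0 ?addr_ge0// nc_sqr sqrrD !sqrn.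
by rewrite -addrA lerD2l lerDr mulrn_wge0// mulr_ge0.
Qed.

Lemma nc_sum I (r : seq I) (P : pred I) (F : I -> R[i]) :
 nc (\sum_(i <- r | P i) F i) <= \sum_(i <- r | P i) nc (F i).
Proof.
elim/big_ind2 : _ => [|x a y b xa yb|//]; first by rewrite nc0.
by rewrite (le_trans (ncD _ _))// lerD.
Qed.

Lemma nc_prod I (r : seq I) (P : pred I) (F : I -> R[i]) :
 nc (\prod_(i <- r | P i) F i) = \prod_(i <- r | P i) nc (F i).
Proof. by apply: (big_morph nc ncM nc1). Qed.
Lemma nc_nat n : nc (n%:R : R[i]) = n%:R.
Proof. by rewrite -(rmorph_nat (real_complex R)) nc_real normr_nat. Qed.
Lemma conj_sum I (r : seq I) (P : pred I) (F : I -> R[i]) :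
 ((\sum_(i <- r | P i) F i)^*)%C = \sum_(i <- r | P i) (F i)^*%C.
Proof. exact: (rmorph_sum (conjc)). Qed.
Lemma ReE_sum I (r : seq I) (P : pred I) (F : I -> R[i]) :
 Re (\sum_(i <- r | P i) F i) = \sum_(i <- r | P i) Re (F i).
Proof. by elim/big_rec2 : _ => //= i y1 y2 _ <-; case: (F i) y2 => ? ? []. Qed.
Lemma ImE_sum I (r : seq I) (P : pred I) (F : I -> R[i]) :
 Im (\sum_(i <- r | P i) F i) = \sum_(i <- r | P i) Im (F i).
Proof. by elim/big_rec2 : _ => //= i y1 y2 _ <-; case: (F i) y2 => ? ? []. Qed.
Lemma RecM x y : Re (x * y) = Re x * Re y - Im x * Im y.
Proof. by case: x y => ? ? []. Qed.
Lemma ImcM x y : Im (x * y) = Re x * Im y + Im x * Re y.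
Proof. by case: x y => ? ? []. Qed.
Lemma RecD x y : Re (x + y) = Re x + Re y. Proof. by case: x y => ? ? []. Qed.
Lemma ImcD x y : Im (x + y) = Im x + Im y. Proof. by case: x y => ? ? []. Qed.
Lemma RecN x : Re (- x) = - Re x. Proof. by case: x. Qed.
Lemma ImcN x : Im (- x) = - Im x. Proof. by case: x. Qed.
Lemma RecJ x : Re (x^*)%C = Re x. Proof. by case: x. Qed.
Lemma ImcJ x : Im (x^*)%C = - Im x. Proof. by case: x. Qed.
Definition ee t : R[i] := expi (2 * pi * t).

Lemma expiD s t : expi (s + t) = expi s * expi t :> R[i].
Proof. by rewrite /expi sinD cosD; simpc; congr (_ +i* _)%C; rewrite addrC. Qed.
Lemma eD s t : ee (s + t) = ee s * ee t.
Proof. by rewrite /ee mulrDr expiD. Qed.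
Lemma e0 : ee 0 = 1.
Proof. by rewrite /ee mulr0 /expi sin0 cos0 . Qed.
Lemma eN t : ee (- t) = ((ee t)^*)%C.
Proof. by rewrite /ee mulrN /expi sinN cosN. Qed.
Lemma nc_e t : nc (ee t) = 1.
Proof.
by rewrite /ee /expi /ComplexField.Normc.normc cos2Dsin2 sqrtr1.
Qed.

Lemma eNM t : ee t * ee (- t) = 1.
Proof. by rewrite -eD subrr e0. Qed.
Lemma eB s t : ee (s - t) = ee s * ((ee t)^*)%C.
Proof. by rewrite eD eN. Qed.
Lemma e_sum I (r : seq I) (P : pred I) (F : I -> R) :
 ee (\sum_(i <- r | P i) F i) = \prod_(i <- r | P i) ee (F i).
Proof. by apply: (big_morph ee eD e0). Qed.
Lemma e1 : ee 1 = 1.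
Proof.
rewrite /ee mulr1 /expi mulr2n mulrDl mul1r.
rewrite sinDpi cosDpi sinpi cospi oppr0 opprK//.
Qed.

Lemma eMn t (n : nat) : ee (n%:R * t) = ee t ^+ n.
Proof.
elim: n => [|n IH]; first by rewrite mul0r e0 expr0.
by rewrite -natr1 mulrDl mul1r eD IH exprSr.
Qed.

Lemma e_nat (n : nat) : ee n%:R = 1.
Proof. by rewrite -(mulr1 n%:R) eMn e1 expr1n. Qed.
Lemma e_int (n : int) : ee n%:~R = 1.
Proof.
case: n => n; first exact: e_nat.
by rewrite NegzE mulrNz eN e_nat rmorph1.
Qed.

Lemma e_Num_int t : t \is a Num.int -> ee t = 1.
Proof. by move=> /intrP[n ->]; exact: e_int. Qed.
Lemma normr_sinB s t : `|sin s - sin t| <= `|s - t| :> R.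
Proof.
wlog st : s t / t <= s.
 by move=> H; case/orP: (le_total t s) => /H//; rewrite distrC (distrC s).
move: st; rewrite le_eqVlt => /orP[/eqP ->|ts]; first by rewrite !subrr.
have [|c _ ->] := @MVT R sin cos t s ts (fun u _ => is_derive_sin u).
 by apply: continuous_subspaceT => u; exact: continuous_sin.
by rewrite normrM ler_piMl// cos_max.
Qed.

Lemma normr_cosB s t : `|cos s - cos t| <= `|s - t| :> R.
Proof.
rewrite -!(sinDpihalf) (le_trans (normr_sinB _ _))//.
by rewrite opprD addrACA subrr addr0.
Qed.

(** Each coordinate is 2 pi-Lipschitz; bounding the modulus by the sum of the two coordinates
    doubles the constant. *)
Lemma nc_eB s t : nc (ee s - ee t) <= 4 * pi * `|s - t|.
Proof.
rewrite (le_trans (nc_le_ReIm _))//= /ee /expi/=.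
have p : `|2 * pi * s - 2 * pi * t| = 2 * pi * `|s - t| :> R.
 by rewrite -mulrBr normrM gtr0_norm// mulr_gt0// pi_gt0.
have := normr_cosB (2 * pi * s) (2 * pi * t).
have := normr_sinB (2 * pi * s) (2 * pi * t).
rewrite p; lra.
Qed.

End complex_norm.

(** * Unconditional summation over arbitrary index types *)

Section unconditional_sums.
Context {R : realType}.

(** Unconditional convergence, along the net of finite index sets, represented by duplicate-free
    lists. No lattice ever has to be enumerated, and sums can be reindexed freely. *)
Definition hs (T : eqType) (F : T -> R[i]) (S : R[i]) := forall eps : R, 0 < eps ->
 exists A : seq T, forall B, uniq B -> {subset A <= B} ->
  nc (\sum_(i <- B) F i - S) <= eps.

(** For nonnegative [b] this bounds the l^1 norm, without mentioning the value of the sum. *)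
Definition bs (T : eqType) (b : T -> R) (M : R) := forall A : seq T, uniq A ->
 \sum_(i <- A) b i <= M.

Lemma sum_split (T : eqType) (V : nmodType) (F : T -> V) (A B : seq T) :
 uniq A -> uniq B -> {subset A <= B} ->
 \sum_(i <- B) F i = \sum_(i <- A) F i + \sum_(i <- B | i \notin A) F i.
Proof.
move=> uA uB AB; rewrite (bigID (mem A))/= -[X in X + _]big_filter; congr (_ + _).
apply: perm_big; apply: uniq_perm => //; first exact: filter_uniq.
by move=> x; rewrite mem_filter andb_idr//; exact: AB.
Qed.

Lemma bs_tail (T : eqType) (b : T -> R) M : (forall i, 0 <= b i) -> bs b M ->
 forall eps, 0 < eps -> exists2 A : seq T, uniq A &
  forall B, uniq B -> \sum_(i <- B | i \notin A) b i <= eps.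
Proof.
move=> b0 bM eps eps0.
pose E : set R := [set x | exists2 A : seq T, uniq A & x = \sum_(i <- A) b i].
have hE : has_sup E.
 split; first by exists 0, [::]; rewrite ?big_nil.
 by exists M => x [A uA ->]; exact: bM.
have [x [A uA ->] xlt] := sup_adherent eps0 hE.
exists A => // B uB.
have : \sum_(i <- undup (A ++ B)) b i <= sup E.
 apply: ub_le_sup; first by case: hE.
 by exists (undup (A ++ B)) => //; exact: undup_uniq.
rewrite (@sum_split _ _ _ A) ?undup_uniq//; last first.
 by move=> y yA; rewrite mem_undup mem_cat yA.
have -> : \sum_(i <- undup (A ++ B) | i \notin A) b i =
     \sum_(i <- B | i \notin A) b i.
 rewrite -[LHS]big_filter -[RHS]big_filter; apply: perm_big; apply: uniq_perm.
 - by rewrite filter_uniq// undup_uniq.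
 - by rewrite filter_uniq.
 - by move=> y; rewrite !mem_filter mem_undup mem_cat; case: (y \in A).
lra.
Qed.

Lemma hs_unique (T : eqType) (F : T -> R[i]) S S' : hs F S -> hs F S' -> S = S'.
Proof.
move=> hS hS'; apply/eqP; rewrite -subr_eq0 -nc_eq0 eq_le nc_ge0 andbT.
apply/ler_addgt0Pl => eps eps0; rewrite addr0.
have [A HA] := hS _ (divr_gt0 eps0 (@ltr0n R 2)).
have [B HB] := hS' _ (divr_gt0 eps0 (@ltr0n R 2)).
have := HA (undup (A ++ B)) (undup_uniq _).
have := HB (undup (A ++ B)) (undup_uniq _).
set s := \sum_(i <- _) _ => h1 h2.
have -> : S - S' = (s - S') - (s - S) by ring.
rewrite (le_trans (ncBD _ _))// (splitr eps) lerD//.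
 by apply: h1 => x xB; rewrite mem_undup mem_cat xB orbT.
by apply: h2 => x xB; rewrite mem_undup mem_cat xB.
Qed.

Lemma hs_ext (T : eqType) (F G : T -> R[i]) S : F =1 G -> hs F S -> hs G S.
Proof.
move=> FG h eps /h[A HA]; exists A => B uB AB.
by rewrite -(eq_bigr _ (fun i _ => FG i)); exact: HA.
Qed.

Lemma hs0 (T : eqType) : hs (fun _ : T => 0) 0.
Proof. by move=> eps e0; exists [::] => B _ _; rewrite big1// subrr nc0 ltW. Qed.
Lemma hsD (T : eqType) (F G : T -> R[i]) S S' :
 hs F S -> hs G S' -> hs (fun i => F i + G i) (S + S').
Proof.
move=> hF hG eps eps0.
have [A HA] := hF _ (divr_gt0 eps0 (@ltr0n R 2)).
have [A' HA'] := hG _ (divr_gt0 eps0 (@ltr0n R 2)).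
exists (A ++ A') => B uB AB.
rewrite big_split/= opprD addrACA (le_trans (ncD _ _))// (splitr eps) lerD//.
 by apply: HA => // x xA; apply: AB; rewrite mem_cat xA.
by apply: HA' => // x xA; apply: AB; rewrite mem_cat xA orbT.
Qed.

Lemma hsZ (T : eqType) c (F : T -> R[i]) S : hs F S -> hs (fun i => c * F i) (c * S).
Proof.
move=> hF eps eps0.
have c0 : 0 < nc c + 1 by rewrite ltr_wpDl// nc_ge0.
have [A HA] := hF _ (divr_gt0 eps0 c0).
exists A => B uB AB; rewrite -mulr_sumr -mulrBr ncM.
have := HA B uB AB; rewrite ler_pdivlMr// => h.
rewrite (le_trans _ h)// mulrC ler_wpM2l ?nc_ge0//; lra.
Qed.

Lemma hs_sum (T : eqType) I (r : seq I) (F : I -> T -> R[i]) S :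
 (forall i, hs (F i) (S i)) ->
 hs (fun t => \sum_(i <- r) F i t) (\sum_(i <- r) S i).
Proof.
move=> h; elim: r => [|i r IH].
 by rewrite big_nil; apply: hs_ext (@hs0 T) => t; rewrite big_nil.
rewrite big_cons; apply: hs_ext (hsD (h i) IH) => t.
by rewrite big_cons.
Qed.

Lemma hs_bound (T : eqType) (F : T -> R[i]) S M :
 hs F S -> bs (fun i => nc (F i)) M -> nc S <= M.
Proof.
move=> hF bF; apply/ler_addgt0Pl => eps eps0.
have [A HA] := hF _ eps0.
have := HA (undup A) (undup_uniq _).
set s := \sum_(i <- _) _ => h.
have -> : S = s - (s - S) by ring.
rewrite (le_trans (ncBD _ _))// addrC lerD//.
 by apply: h => x; rewrite mem_undup.
by rewrite (le_trans (nc_sum _ _ _))// bF// undup_uniq.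
Qed.

(** The condition on [g] says that [F] vanishes off the image of [f]. With its converse [hs_injV] it
    moves sums to and from a sublattice. *)
Lemma hs_inj (T U : eqType) (f : T -> U) (g : U -> T) (F : U -> R[i]) S :
 cancel f g -> (forall u, f (g u) != u -> F u = 0) ->
 hs F S -> hs (fun t => F (f t)) S.
Proof.
move=> fK F0 hF eps /hF[A HA]; exists (map g A) => B uB AB.
have := HA (undup (map f B ++ A)) (undup_uniq _).
rewrite (@sum_split _ _ _ (map f B)) ?undup_uniq//; last 2 first.
- by rewrite (map_inj_uniq (can_inj fK)).
- by move=> x xB; rewrite mem_undup mem_cat xB.
rewrite big_map [X in _ + X - _]big1_seq ?addr0; last first.
 move=> u /andP[nB]; rewrite mem_undup mem_cat (negbTE nB)/= => uA.
 apply: F0; apply: contra nB => /eqP <-; apply: map_f; apply: AB.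
 exact: map_f.
by apply => x xA; rewrite mem_undup mem_cat xA orbT.
Qed.

Lemma hs_injV (T U : eqType) (f : T -> U) (g : U -> T) (F : U -> R[i]) S :
 cancel f g -> (forall u, f (g u) != u -> F u = 0) ->
 hs (fun t => F (f t)) S -> hs F S.
Proof.
move=> fK F0 hF eps /hF[A HA]; exists (map f A) => B uB AB.
rewrite (bigID (fun u => f (g u) == u))/= [X in _ + X - _]big1 ?addr0//.
pose B0 := [seq u <- B | f (g u) == u].
have <- : \sum_(t <- map g B0) F (f t) = \sum_(u <- B | f (g u) == u) F u.
 by rewrite big_map big_filter; apply: eq_bigr => u /eqP ->.
apply: HA.
 rewrite map_inj_in_uniq ?filter_uniq// => x y.
 by rewrite !mem_filter => /andP[/eqP fx _] /andP[/eqP fy _] gxy; rewrite -fx -fy gxy.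
move=> t tA; rewrite -(fK t); apply: map_f; rewrite mem_filter fK eqxx/=.
by apply: AB; exact: map_f.
Qed.

Lemma hs_bij (T U : eqType) (f : T -> U) (g : U -> T) (F : U -> R[i]) S :
 cancel f g -> cancel g f -> hs F S <-> hs (fun t => F (f t)) S.
Proof.
move=> fK gK; split; first by apply: hs_inj fK _ => u; rewrite gK eqxx.
by apply: hs_injV fK _ => u; rewrite gK eqxx.
Qed.

Lemma hs_rows (T U : eqType) (r : seq T) (F : T * U -> R[i]) (S : T -> R[i]) :
 uniq r -> (forall t u, t \notin r -> F (t, u) = 0) ->
 (forall t, hs (fun u => F (t, u)) (S t)) -> hs F (\sum_(t <- r) S t).
Proof.
move=> ur F0 h.
have H t : hs (fun p : T * U => F p *+ (p.1 == t)) (S t).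
 apply: (@hs_injV _ _ (fun u => (t, u)) snd) => //.
  by move=> [t' u] /=; rewrite xpair_eqE eqxx andbT eq_sym => /negbTE ->.
 by apply: hs_ext (h t) => u /=; rewrite eqxx mulr1n.
apply: hs_ext (hs_sum r H) => -[t u] /=.
have [tr|/F0 ->] := boolP (t \in r); last by rewrite big1// => ? _; rewrite mul0rn.
rewrite (bigD1_seq t)//= eqxx mulr1n big1 ?addr0// => i; rewrite eq_sym => /negbTE ->.
by rewrite mulr0n.
Qed.

(** Dominated convergence without sequences: [F] has sum [S] as soon as, on each finite set, it is
    approximated by a family under the same majorant whose sum is close to [S]. *)
Lemma hs_dom (T : eqType) (F : T -> R[i]) (b : T -> R) M S :
 bs b M -> (forall i, nc (F i) <= b i) ->
 (forall eps (A : seq T), 0 < eps -> exists (F' : T -> R[i]) S',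
  [/\ forall i, nc (F' i) <= b i, forall i, i \in A -> nc (F' i - F i) <= eps,
   hs F' S' & nc (S' - S) <= eps]) ->
 hs F S.
Proof.
move=> bM Fb H eps eps0.
have b0 i : 0 <= b i by exact: le_trans (nc_ge0 _) (Fb i).
(* One fifth each for the tails of [F] and [F'], their difference on [A], the convergence of [F'],
   and the gap between the two sums. *)
have e5 : 0 < eps / 5 by rewrite divr_gt0.
have [A uA HA] := bs_tail b0 bM e5.
have sA : 0 < eps / 5 / ((size A)%:R + 1) by rewrite divr_gt0// ltr_wpDl.
have [F' [S' [F'b F'F hF' S'S]]] := H _ A sA.
have sAe : eps / 5 / ((size A)%:R + 1) <= eps / 5.
 by rewrite ler_pdivrMr ?ltr_wpDl// mulrDr mulr1 lerDr mulr_ge0// ltW.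
exists A => B uB AB.
have [A' HA'] := hF' _ e5.
pose B' := undup (B ++ A').
have uB' : uniq B' by exact: undup_uniq.
have AB' : {subset A <= B'}.
 by move=> x /AB xB; rewrite mem_undup mem_cat xB.
have h1 : nc (\sum_(i <- B') F' i - S') <= eps / 5.
 by apply: HA' => // x xA; rewrite mem_undup mem_cat xA orbT.
rewrite (sum_split _ uA uB AB).
move: h1; rewrite (sum_split _ uA uB' AB').
set a' := \sum_(i <- A) F' i; set a := \sum_(i <- A) F i.
set t := \sum_(i <- B | _) _; set t' := \sum_(i <- B' | _) _ => h1.
have ht : nc t <= eps / 5.
 rewrite (le_trans (nc_sum _ _ _))//; apply: le_trans (HA _ uB).
 by apply: ler_sum.
have ht' : nc t' <= eps / 5.
 rewrite (le_trans (nc_sum _ _ _))//; apply: le_trans (HA _ uB').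
 by apply: ler_sum.
have ha : nc (a' - a) <= eps / 5.
 rewrite /a' /a -sumrB (le_trans (nc_sum _ _ _))//.
 apply: (@le_trans _ _ (\sum_(i <- A) (eps / 5 / ((size A)%:R + 1)))).
  by rewrite big_seq [X in _ <= X]big_seq; apply: ler_sum => i iA; exact: F'F.
 rewrite big_const_seq count_predT iter_addr_0 -[_ *+ size A]mulr_natr.
 by rewrite mulrAC ler_pdivrMr ?ltr_wpDl// mulrDr mulr1 lerDl ltW.
have -> : a + t - S = - (a' - a) + t - t' + (a' + t' - S') + (S' - S) by ring.
have -> : eps = eps / 5 + eps / 5 + eps / 5 + eps / 5 + eps / 5 by field.
rewrite (le_trans (ncD _ _))// lerD//; last exact: le_trans S'S sAe.
rewrite (le_trans (ncD _ _))// lerD//.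
rewrite (le_trans (ncBD _ _))// lerD//.
by rewrite (le_trans (ncD _ _))// lerD// ncN.
Qed.

Lemma bs_le (T : eqType) (b b' : T -> R) M :
 (forall i, b' i <= b i) -> bs b M -> bs b' M.
Proof. by move=> bb h A uA; rewrite (le_trans _ (h A uA))// ler_sum. Qed.
Lemma bsZ (T : eqType) (b : T -> R) M c : 0 <= c -> bs b M -> bs (fun i => c * b i) (c * M).
Proof. by move=> c0 h A uA; rewrite -mulr_sumr ler_wpM2l// h. Qed.
Lemma bs_inj (T U : eqType) (f : T -> U) (b : U -> R) M :
 injective f -> bs b M -> bs (fun t => b (f t)) M.
Proof.
move=> fi h A uA; have := h (map f A); rewrite big_map; apply.
by rewrite map_inj_uniq.
Qed.

Lemma ffun_box (n : nat) (T : eqType) (A : seq {ffun 'I_n -> T}) (A1 : seq T) :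
 exists2 B : seq T, {subset A1 <= B} & uniq B /\
  forall g, g \in A -> forall i, g i \in B.
Proof.
exists (undup (A1 ++ flatten [seq [seq g i | i <- enum 'I_n] | g : {ffun 'I_n -> T} <- A])).
 by move=> x xA; rewrite mem_undup mem_cat xA.
split; first exact: undup_uniq.
move=> g gA i; rewrite mem_undup mem_cat; apply/orP; right; apply/flattenP.
exists [seq g i | i <- enum 'I_n]; last by apply: map_f; rewrite mem_enum.
by apply/mapP; exists g.
Qed.

Definition boxf (n : nat) (T : choiceType) (B : seq T) : seq {ffun 'I_n -> T} :=
 [seq [ffun i => val (f i)] | f : {ffun 'I_n -> seq_sub B}].

Lemma boxf_uniq n (T : choiceType) (B : seq T) : uniq (boxf n B).
Proof.
rewrite map_inj_uniq ?enum_uniq// => f g /ffunP fg; apply/ffunP => i.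
by have := fg i; rewrite !ffunE; exact: val_inj.
Qed.

Lemma mem_boxf n (T : choiceType) (B : seq T) (g : {ffun 'I_n -> T}) :
 (g \in boxf n B) = [forall i, g i \in B].
Proof.
apply/mapP/forallP => [[f _ ->] i|H]; first by rewrite ffunE ssvalP.
exists [ffun i => SeqSub (H i)]; first by rewrite mem_enum.
by apply/ffunP => i; rewrite !ffunE.
Qed.

Lemma sum_boxf (K : comPzSemiRingType) n (T : choiceType) (B : seq T) (F : 'I_n -> T -> K) :
 uniq B -> \sum_(g <- boxf n B) \prod_i F i (g i) = \prod_i \sum_(t <- B) F i t.
Proof.
move=> uB; rewrite big_map big_enum/=.
rewrite (eq_bigr (fun i => \sum_(t : seq_sub B) F i (val t))); last first.
 move=> i _; rewrite -big_enum/= -[RHS](big_map val xpredT (F i)).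
 apply: perm_big.
 apply: uniq_perm => //; first by rewrite map_inj_uniq ?enum_uniq//; exact: val_inj.
 move=> t; apply/idP/mapP => [tB|[x _ ->]]; last exact: ssvalP.
 by exists (SeqSub tB); rewrite ?mem_enum.
rewrite bigA_distr_bigA; apply: eq_bigr => f _.
by apply: eq_bigr => i _; rewrite ffunE.
Qed.

Lemma bs_prod n (T : choiceType) (b : 'I_n -> T -> R) (M : 'I_n -> R) :
 (forall i t, 0 <= b i t) -> (forall i, bs (b i) (M i)) ->
 bs (fun g : {ffun 'I_n -> T} => \prod_i b i (g i)) (\prod_i M i).
Proof.
move=> b0 bM A uA; have [B _ [uB AB]] := ffun_box A [::].
apply: (@le_trans _ _ (\sum_(g <- boxf n B) \prod_i b i (g i))).
 rewrite [leRHS](@sum_split _ _ _ A) ?boxf_uniq//; last first.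
  by move=> g gA; rewrite mem_boxf; apply/forallP => i; exact: AB.
 by rewrite lerDl; apply: sumr_ge0 => g _; exact: prodr_ge0.
rewrite sum_boxf//; apply: ler_prod => i _.
by rewrite sumr_ge0//= bM.
Qed.

Lemma nc_prodB n (x y : 'I_n -> R[i]) (M d : R) : 1 <= M ->
 (forall i, nc (x i) <= M) -> (forall i, nc (y i) <= M) ->
 (forall i, nc (x i - y i) <= d) ->
 nc (\prod_i x i - \prod_i y i) <= n%:R * M ^+ n * d.
Proof.
move=> M1; elim: n x y => [|n IH] x y xM yM xy.
 by rewrite !big_ord0 subrr nc0 !mul0r.
rewrite !big_ord_recl.
set p := \prod_(i < n) _; set q := \prod_(i < n) _.
have -> : x ord0 * p - y ord0 * q = x ord0 * (p - q) + (x ord0 - y ord0) * q by ring.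
have M0 : 0 <= M by rewrite (le_trans ler01).
rewrite (le_trans (ncD _ _))// !ncM.
have h1 : nc (p - q) <= n%:R * M ^+ n * d.
 by apply: IH => i; [exact: xM|exact: yM|exact: xy].
have h2 : nc q <= M ^+ n.
 rewrite nc_prod -[X in M ^+ X](card_ord n) -prodr_const.
 by apply: ler_prod => i _; rewrite nc_ge0/= yM.
have d0 : 0 <= d by exact: le_trans (nc_ge0 _) (xy ord0).
have -> : n.+1%:R * M ^+ n.+1 * d = M * (n%:R * M ^+ n * d) + d * (M ^+ n.+1).
 by rewrite -natr1 exprS; ring.
rewrite lerD// ?ler_pM ?nc_ge0//.
by rewrite (le_trans h2)// exprS ler_peMl// exprn_ge0.
Qed.

(** Over a box the sum of products is the product of the sums; a larger finite set differs from the
    box by a tail of the product of the moduli. *)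
Lemma hs_prod n (T : choiceType) (F : 'I_n -> T -> R[i]) (S : 'I_n -> R[i]) (M : R) :
 (forall i, bs (fun t => nc (F i t)) M) -> (forall i, hs (F i) (S i)) ->
 hs (fun g : {ffun 'I_n -> T} => \prod_i F i (g i)) (\prod_i S i).
Proof.
wlog M1 : M / 1 <= M.
 move=> H bM; apply: (H (Num.max 1 M)); first by rewrite le_max lexx.
 by move=> i A uA; rewrite (le_trans (bM i A uA))// le_max lexx orbT.
move=> bM hF eps eps0.
have M0 : 0 < M by rewrite (lt_le_trans ltr01).
pose P (g : {ffun 'I_n -> T}) : R := \prod_i nc (F i (g i)).
have bP : bs P (\prod_(i < n) M) by apply: (bs_prod (b := fun i t => nc (F i t))) => // i t; exact: nc_ge0.
have e2 : 0 < eps / 2 by rewrite divr_gt0.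
have P0 g : 0 <= P g by apply: prodr_ge0 => i _; exact: nc_ge0.
have [A uA HA] := bs_tail P0 bP e2.
pose d := eps / 2 / (n%:R * M ^+ n + 1).
have K0 : 0 < n%:R * M ^+ n + 1 by rewrite ltr_wpDl// mulr_ge0// exprn_ge0 ?ltW.
have d0 : 0 < d by rewrite divr_gt0.
have /choice[A1 HA1] : forall i, exists A1 : seq T, forall B, uniq B -> {subset A1 <= B} ->
 nc (\sum_(t <- B) F i t - S i) <= d by move=> i; exact: hF.
have [B B1 [uB AB]] := ffun_box A (flatten [seq A1 i | i <- enum 'I_n]).
have ABx : {subset A <= boxf n B}.
 by move=> g gA; rewrite mem_boxf; apply/forallP => i; exact: AB.
exists (boxf n B) => B' uB' BB'.
have AB' : {subset A <= B'} by move=> g /ABx/BB'.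
have hbox : nc (\sum_(g <- boxf n B) \prod_i F i (g i) - \prod_i S i) <= eps / 2.
 rewrite sum_boxf//.
 apply: (@le_trans _ _ (n%:R * M ^+ n * d)).
  apply: nc_prodB => //.
  - by move=> i; rewrite (le_trans (nc_sum _ _ _))// bM.
  - by move=> i; exact: hs_bound (hF i) (bM i).
  - move=> i; apply: HA1 => // x xA; apply: B1; apply/flattenP.
   by exists (A1 i) => //; apply: map_f; rewrite mem_enum.
 rewrite /d mulrCA mulrA -[leRHS]mulr1 -mulrA ler_wpM2l ?ltW//.
 by rewrite ltr_pdivrMr// mul1r ltrDl.
rewrite (@sum_split _ _ _ (boxf n B)) ?boxf_uniq// addrAC.
rewrite (le_trans (ncD _ _))// (splitr eps) lerD//.
rewrite (le_trans (nc_sum _ _ _))//; apply: le_trans (HA _ uB').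
rewrite [leLHS](eq_bigr P); last by move=> g _; rewrite nc_prod.
rewrite big_mkcond [leRHS]big_mkcond/=; apply: ler_sum => g _.
case: ifPn => gB; first by rewrite (contra (@ABx g) gB).
by case: ifP => // _; apply: prodr_ge0 => i _; exact: nc_ge0.
Qed.

(** Chosen to telescope: the weight is 1/(1 + |n|) - 1/(2 + |n|), so each half line contributes at
    most 1. *)
Definition wt1 (n : int) : R := ((1 + `|n|%N%:R) * (2 + `|n|%N%:R))^-1.

Lemma wt1_gt0 n : 0 < wt1 n.
Proof. by rewrite invr_gt0 mulr_gt0// ltr_wpDr. Qed.
Lemma bs_wt1 : bs wt1 2.
Proof.
have hn (A : seq nat) : uniq A ->
  \sum_(n <- A) ((1 + n%:R) * (2 + n%:R))^-1 <= 1 :> R.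
 move=> uA; pose K := (\max_(n <- A) n).+1.
 apply: (@le_trans _ _ (\sum_(n <- iota 0 K) ((1 + n%:R) * (2 + n%:R))^-1)).
  rewrite [leRHS](@sum_split _ _ _ A) ?iota_uniq//; last first.
   by move=> n nA; rewrite mem_iota/= add0n ltnS; exact: leq_bigmax_seq.
  by rewrite lerDl sumr_ge0// => n _; rewrite invr_ge0 mulr_ge0// addr_ge0.
 have -> : iota 0 K = index_iota 0 K by rewrite /index_iota subn0.
 have -> : \sum_(0 <= n < K) ((1 + n%:R) * (2 + n%:R))^-1 = 1 - (1 + K%:R)^-1 :> R.
  elim: K => [|K IH]; first by rewrite big_nil addr0 invr1 subrr.
  rewrite big_nat_recr//= IH -[K.+1%:R]natr1.
  have h : 0 <= K%:R :> R by [].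
  by field; apply/andP; split; rewrite lt0r_neq0//; lra.
 by rewrite lerBlDr lerDl invr_ge0 addr_ge0.
move=> A uA.
rewrite (bigID (fun n : int => n >= 0))/= -[X in X + _]big_filter -[X in _ + X]big_filter.
have -> : 2 = 1 + 1 :> R by ring.
rewrite lerD//.
 have -> : [seq i <- A | 0 <= i] = map Posz (map absz [seq i <- A | 0 <= i]).
  rewrite -map_comp -[LHS]map_id; apply/eq_in_map => n.
  by rewrite mem_filter => /andP[n0 _] /=; rewrite gez0_abs.
 rewrite big_map; apply: hn.
 rewrite map_inj_in_uniq ?filter_uniq// => x y.
 by rewrite !mem_filter => /andP[x0 _] /andP[y0 _]; lia.
have -> : [seq i <- A | ~~ (0 <= i)] =
  map (fun n => - Posz n) (map absz [seq i <- A | ~~ (0 <= i)]).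
 rewrite -map_comp -[LHS]map_id; apply/eq_in_map => n.
 by rewrite mem_filter => /andP[n0 _] /=; lia.
rewrite big_map; set B := [seq absz _ | _ <- _].
rewrite (eq_bigr (fun n => ((1 + n%:R) * (2 + n%:R))^-1)); last first.
 by move=> n _; rewrite /wt1 abszN.
apply: hn; rewrite map_inj_in_uniq ?filter_uniq// => x y.
by rewrite !mem_filter => /andP[x0 _] /andP[y0 _]; lia.
Qed.

Definition wt m (k : 'rV[int]_m) : R := \prod_j wt1 (k ord0 j).

Lemma wt_gt0 m (k : 'rV[int]_m) : 0 < wt k.
Proof. by apply: prodr_gt0 => j _; exact: wt1_gt0. Qed.
Lemma bs_wt m : bs (@wt m) (2 ^+ m).
Proof.
pose f (k : 'rV[int]_m) := [ffun j => k ord0 j].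
have fi : injective f.
 by move=> k l /ffunP fkl; apply/rowP => j; have := fkl j; rewrite !ffunE.
have -> : (2 ^+ m : R) = \prod_(i < m) 2 by rewrite prodr_const card_ord.
apply: bs_le (bs_inj fi (bs_prod (b := fun _ => wt1) (M := fun _ => 2) _ _)).
- by move=> k; rewrite le_eqVlt; apply/orP; left; apply/eqP; apply: eq_bigr => j _; rewrite ffunE.
- by move=> _ t; rewrite ltW// wt1_gt0.
- by move=> _; exact: bs_wt1.
Qed.

End unconditional_sums.

(** * Smooth step functions *)

Section smooth_functions.
Context {R : realType}.
Implicit Types (f g : R -> R) (x k c : R) (n : nat).

Definition dv f g := forall x, is_derive x 1 f (g x).

Lemma dv_continuous f g : dv f g -> continuous f.
Proof.
move=> fg x; apply: differentiable_continuous; apply/derivable1_diffP.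
by case: (fg x).
Qed.

Lemma dv_cst c : dv (fun=> c) (fun=> 0).
Proof. by move=> x; exact: is_derive_cst. Qed.
Lemma dvD f f' g g' : dv f f' -> dv g g' -> dv (fun x => f x + g x) (fun x => f' x + g' x).
Proof. by move=> ff gg x; apply: is_deriveD. Qed.
Lemma dvM f f' g g' : dv f f' -> dv g g' ->
 dv (fun x => f x * g x) (fun x => f' x * g x + f x * g' x).
Proof.
move=> ff gg x; have -> : f' x * g x + f x * g' x = f x *: g' x + g x *: f' x.
 by rewrite /GRing.scale/= addrC (mulrC (g x)).
exact: is_deriveM.
Qed.

Lemma dv_affine f f' k c : dv f f' ->
 dv (fun x => f (k * x + c)) (fun x => k * f' (k * x + c)).
Proof.
move=> ff x; rewrite mulrC.
have h : is_derive x 1 (fun x => k * x + c) k.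
 have := dvD (dvM (dv_cst k) (fun x => is_derive_id x (1 : R))) (dv_cst c) x.
 by rewrite mul0r add0r addr0 mulr1.
have := @is_derive1_comp _ f (fun x => k * x + c) x (f' (k * x + c)) k.
by apply.
Qed.

(** Caratheodory's criterion for the slope f x / x, whose value at 0 is 0 by the convention on
    inverses; it tends to 0 there by the quadratic bound. *)
Lemma quadratic_is_derive0 f C : f 0 = 0 -> (forall x, `|f x| <= C * x ^+ 2) ->
 is_derive (0 : R) (1 : R) f 0.
Proof.
move=> f0 fC; apply/is_derive1_caratheodory.
exists (fun x => f x / x); split; last by rewrite invr0 mulr0.
 move=> z; rewrite f0 !subr0; have [->|z0] := eqVneq z 0; first by rewrite f0 mulr0.
 by rewrite divfK.
have C0 : 0 <= C by have := fC 1; rewrite expr1n mulr1; apply: le_trans.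
suff h : (fun x => f x / x) @ (0 : R) --> (0 : R).
 by rewrite /prop_for /continuous_at invr0 mulr0.
apply/cvgrPdist_le => eps e0.
have d0 : 0 < eps / (C + 1) by rewrite divr_gt0// ltr_wpDl.
near=> z; rewrite sub0r normrN.
have zd : `|z| <= eps / (C + 1).
 near: z; exists (eps / (C + 1)) => //= t.
 by rewrite /ball_/= sub0r normrN => /ltW.
have [->|z0] := eqVneq z 0; first by rewrite invr0 mulr0 normr0 ltW.
rewrite normrM normfV ler_pdivrMr ?normr_gt0// (le_trans (fC _))//.
rewrite -(real_normK (num_real z)) expr2 mulrA ler_wpM2r//.
rewrite (le_trans (ler_wpM2l C0 zd))// mulrCA ler_piMr ?ltW//.
by rewrite ltr_pdivrMr ?ltr_wpDl// mul1r ltrDl.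
Unshelve. all: by end_near.
Qed.

(* The functions [bumpf n x = x^-n exp (-1/x)], for [x > 0], extended by 0, are
  closed under differentiation. *)
Definition bumpf n x : R := if 0 < x then x^-1 ^+ n * expR (- x^-1) else 0.

Lemma expR_ge_pow n (x : R) : 0 <= x -> x ^+ n / n`!%:R <= expR x.
Proof.
case: n => [|n] x0; first by rewrite expr0 fact0 invr1 mulr1 (le_trans _ (expR_ge1Dx x))// lerDl.
by rewrite (le_trans _ (expR_ge1Dxn n x0))// lerDr.
Qed.

(** From y^(n+2) <= (n+2)! exp y at y = 1/x. The quadratic bound provides the derivative at the
    origin, the only point where no formula is available. *)
Lemma bump_fun_quadratic n x : `|bumpf n x| <= (n.+2)`!%:R * x ^+ 2.
Proof.
rewrite /bumpf; case: ifPn => x0; last by rewrite normr0 mulr_ge0// sqr_ge0.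
have y0 : 0 < x^-1 by rewrite invr_gt0.
rewrite ger0_norm ?mulr_ge0 ?expR_ge0 ?exprn_ge0 ?(ltW y0)//.
rewrite expRN ler_pdivrMr ?expR_gt0//.
have := expR_ge_pow n.+2 (ltW y0); rewrite ler_pdivrMr ?ltr0n ?fact_gt0//.
have -> : x^-1 ^+ n = x^-1 ^+ n.+2 * x ^+ 2.
 by rewrite -addn2 exprD -mulrA -exprMn mulVf ?gt_eqF// expr1n mulr1.
move=> h; have -> : (n.+2)`!%:R * x ^+ 2 * expR x^-1 = expR x^-1 * (n.+2)`!%:R * x ^+ 2 by ring.
by rewrite ler_wpM2r// sqr_ge0.
Qed.

Lemma dv_bump_fun n : dv (bumpf n) (fun x => bumpf n.+2 x - n%:R * bumpf n.+1 x).
Proof.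
move=> x; have [x0|x0|->] := ltrgt0P x.
- have h : is_derive x 1 (fun x => x^-1 ^+ n * expR (- x^-1))
   (bumpf n.+2 x - n%:R * bumpf n.+1 x).
  have hV : is_derive x 1 (fun x : R => x^-1) (- x ^- 2).
   have -> : - x ^- 2 = - x ^- 2 *: 1 by rewrite /GRing.scale/= mulr1.
   exact: (@is_deriveV _ id) (lt0r_neq0 x0) _.
  have hX : is_derive x 1 (fun x : R => x^-1 ^+ n) (n%:R * x^-1 ^+ n.-1 * (- x ^- 2)).
   by have := @is_deriveX _ _ (fun x : R => x^-1) n x 1 _ hV; rewrite exprfctE.
  have hE : is_derive x 1 (fun x : R => expR (- x^-1)) (expR (- x^-1) * x ^- 2).
   apply: (@is_derive1_comp _ expR (fun x => - x^-1)).
   by rewrite -[X in is_derive _ _ _ X]opprK; exact: is_deriveN.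
  have h2 := is_deriveM hX hE.
  rewrite (_ : bumpf n.+2 x - _ =
   x^-1 ^+ n *: (expR (- x^-1) * x ^- 2) +
   expR (- x^-1) *: (n%:R * x^-1 ^+ n.-1 * - x ^- 2)); first exact: h2.
  rewrite /GRing.scale/= /bumpf x0 -!exprVn.
  by case: n {hX h2} => [|n]; rewrite ?mul0r ?mulr0 ?expr0 ?oppr0 ?addr0 ?subr0 /= ?exprS; ring.
 apply: near_eq_is_derive h; near=> z.
 by rewrite /bumpf; case: ifPn => //; rewrite (_ : 0 < z)//; near: z; exact: lt_nbhsr.
- rewrite /bumpf ltNge (ltW x0)/= mulr0 subr0.
 apply: near_eq_is_derive (is_derive_cst (0 : R) x 1); near=> z.
 rewrite ltNge (_ : z <= 0)//.
 by near: z; apply: filterS (lt_nbhsl x0) => z /ltW.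
- rewrite /bumpf ltxx mulr0 subr0.
 apply: (@quadratic_is_derive0 _ (n.+2)`!%:R); last exact: bump_fun_quadratic.
 by rewrite /bumpf ltxx.
Unshelve. all: by end_near.
Qed.

Lemma bump_fun_ge0 n x : 0 <= bumpf n x.
Proof.
by rewrite /bumpf; case: ifPn => // x0; rewrite mulr_ge0 ?expR_ge0// exprn_ge0// invr_ge0 ltW.
Qed.

Lemma bump_fun_gt0 n x : 0 < x -> 0 < bumpf n x.
Proof. by move=> x0; rewrite /bumpf x0 mulr_gt0 ?expR_gt0// exprn_gt0// invr_gt0. Qed.
Lemma antiderivative f (a : R) : continuous f -> (forall x, x <= a -> f x = 0) ->
 exists2 F, dv F f & forall x, x <= a -> F x = 0.
Proof.
move=> cf f0.
(* Starting at [a - 1] makes the point [a] itself interior to the range of the fundamental theorem;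
   nothing is added, as [f] vanishes up to [a]. *)
pose F x := (\int[lebesgue_measure]_(t in `[a - 1, x]) (f t))%R.
have F0 x : x <= a -> F x = 0.
 move=> xa; rewrite /F (@eq_Rintegral _ _ _ _ _ (fun=> 0)).
  by rewrite /Rintegral integral0.
 move=> t; rewrite inE/= in_itv/= => /andP[_ tx]; apply: f0; exact: le_trans xa.
exists F => // x; have [xa|ax] := ltP x a.
 rewrite f0 ?ltW//; apply: near_eq_is_derive (is_derive_cst (0 : R) x 1); near=> z.
 by rewrite F0//; near: z; apply: filterS (lt_nbhsl xa) => z /ltW.
have x1 : x < x + 1 by rewrite ltrDl.
have := @continuous_FTC1_closed R f (a - 1) x (x + 1) x1.
case.
- apply: continuous_compact_integrable; first exact: segment_compact.
 exact: continuous_subspaceT.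
- lra.
- exact: cf.
move=> dF <-; rewrite derive1E; exact: DeriveDef.
Unshelve. all: by end_near.
Qed.

Lemma dv_homo f f' x y : dv f f' -> (forall t, 0 <= f' t) -> x <= y -> f x <= f y.
Proof.
move=> ff f0 xy; rewrite -subr_ge0.
have [|c _ ->] := @MVT_segment R f f' x y xy (fun t _ => ff t).
 apply: continuous_subspaceT; exact: dv_continuous ff.
by rewrite mulr_ge0// subr_ge0.
Qed.

Lemma dv_lipschitz f f' K x y : dv f f' -> (forall t, `|f' t| <= K) ->
 `|f x - f y| <= K * `|x - y|.
Proof.
move=> ff fK; wlog xy : x y / x <= y.
 by move=> H; case/orP: (le_total x y) => /H//; rewrite distrC (distrC x).
have [|c _] := @MVT_segment R f f' x y xy (fun t _ => ff t).
 apply: continuous_subspaceT; exact: dv_continuous ff.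
by move=> h; rewrite distrC h normrM (distrC y) ler_wpM2r.
Qed.

Let beta x := bumpf 0 x * bumpf 0 (1 - x).

Let beta_eq x : beta x = bumpf 0 x * bumpf 0 (-1 * x + 1).
Proof. by rewrite /beta mulN1r addrC. Qed.
(** A normalised primitive of bumpf(x) bumpf(1 - x). Its derivative is recorded with affine
    arguments so that the step can enter a class of functions closed under differentiation. *)
Lemma smooth_step_exists : exists2 th : R -> R,
 exists2 K, dv th (fun x => K * (bumpf 0 x * bumpf 0 (-1 * x + 1))) & 0 < K &
 [/\ forall x, x <= 0 -> th x = 0, forall x, 1 <= x -> th x = 1,
   forall x, 0 <= th x <= 1 & forall x y, x <= y -> th x <= th y].
Proof.
have db : dv beta (fun x => (bumpf 2 x - 0%:R * bumpf 1 x) * bumpf 0 (-1 * x + 1) +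
  bumpf 0 x * (-1 * (bumpf 2 (-1 * x + 1) - 0%:R * bumpf 1 (-1 * x + 1)))).
 have -> : beta = fun x => bumpf 0 x * bumpf 0 (-1 * x + 1).
  by apply/funext => x; exact: beta_eq.
 apply: (@dvM (bumpf 0) _ (fun x => bumpf 0 (-1 * x + 1))); first exact: dv_bump_fun.
 exact: (dv_affine (f := bumpf 0)) (dv_bump_fun 0).
have b0 x : 0 <= beta x by rewrite mulr_ge0// bump_fun_ge0.
have [|F dF F0] := @antiderivative beta 0 (dv_continuous db).
 by move=> x x0; rewrite /beta /bumpf ltNge x0 mul0r.
have Fh x y : x <= y -> F x <= F y by apply: dv_homo dF b0.
have F1 : 0 < F 1.
 rewrite lt_neqAle eq_sym; apply/andP; split; last by rewrite -(F0 0)// Fh.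
 (* Otherwise the monotone [F] vanishes on (0, 1), against its positive derivative at 1/2. *)
 apply/eqP => F10.
 have F00 x : 0 < x < 1 -> F x = 0.
  move=> /andP[x0 x1]; apply/eqP; rewrite eq_le -{1}F10 -{1}(F0 0)//.
  by rewrite !Fh// ltW.
 have : is_derive (2^-1 : R) (1 : R) F 0.
  apply: near_eq_is_derive (is_derive_cst (0 : R) (2^-1 : R) (1 : R)); near=> z.
  rewrite F00//; apply/andP; split; near: z.
   by apply: lt_nbhsr; rewrite invr_gt0.
  by apply: lt_nbhsl; rewrite invf_lt1// ltr1n.
 move=> /@derive_val; have := dF (2^-1) => /@derive_val -> /eqP.
 by rewrite mulf_eq0 !gt_eqF//; apply: bump_fun_gt0; lra.
have Fc x : 1 <= x -> F x = F 1.
 move=> x1; have [|c] := @MVT_segment R F beta 1 x x1 (fun t _ => dF t).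
  apply: continuous_subspaceT; exact: dv_continuous dF.
 rewrite in_itv/= => /andP[c1 _] /eqP.
 rewrite {1}/beta {2}/bumpf subr_gt0 ltNge c1/= mulr0 mul0r subr_eq0.
 by move/eqP.
exists (fun x => (F 1)^-1 * F x).
 exists (F 1)^-1; last by rewrite invr_gt0.
 move=> x; have := dvM (dv_cst (F 1)^-1) dF x.
 by rewrite mul0r add0r beta_eq.
split.
- by move=> x x0; rewrite (F0 x)// mulr0.
- by move=> x x1; rewrite Fc// mulVf// gt_eqF.
- move=> x; rewrite mulr_ge0 ?invr_ge0 ?(ltW F1)//=; last first.
  by case/orP: (le_total x 0) => h; [rewrite F0|rewrite -(F0 0)// Fh].
 rewrite mulrC ler_pdivrMr// mul1r.
 by case/orP: (le_total x 1) => h; [rewrite Fh|rewrite Fc].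
- by move=> x y xy; rewrite ler_wpM2l ?invr_ge0 ?(ltW F1)// Fh.
Unshelve. all: by end_near.
Qed.

Definition step : R -> R := projT1 (cid2 smooth_step_exists).

Lemma stepP : exists2 K, dv step (fun x => K * (bumpf 0 x * bumpf 0 (-1 * x + 1))) & 0 < K.
Proof. by rewrite /step; case: cid2. Qed.
Lemma step0 x : x <= 0 -> step x = 0.
Proof. by rewrite /step; case: cid2 => /= th _ [h _ _ _]; exact: h. Qed.
Lemma step1 x : 1 <= x -> step x = 1.
Proof. by rewrite /step; case: cid2 => /= th _ [_ h _ _]; exact: h. Qed.
Lemma step_01 x : 0 <= step x <= 1.
Proof. by rewrite /step; case: cid2 => /= th _ [_ _ h _]; exact: h. Qed.

(** A syntactic class: the derivative of each generator is again a combination of generators, so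
    that one induction, [sm_dv], yields derivatives of all orders. *)
Inductive sm : (R -> R) -> Prop :=
| sm_cst c : sm (fun=> c)
| sm_id : sm (fun x => x)
| sm_bump n k c : sm (fun x => bumpf n (k * x + c))
| sm_step k c : sm (fun x => step (k * x + c))
| sm_cos k c : sm (fun x => cos (k * x + c))
| sm_sin k c : sm (fun x => sin (k * x + c))
| smD f g : sm f -> sm g -> sm (fun x => f x + g x)
| smM f g : sm f -> sm g -> sm (fun x => f x * g x).

Lemma smZ k f : sm f -> sm (fun x => k * f x).
Proof. by move=> sf; apply: smM => //; exact: sm_cst. Qed.
Lemma sm_dv f : sm f -> exists2 g, sm g & dv f g.
Proof.
elim=> {f} [c||n k c|k c|k c|k c|f g sf [f' sf' ff'] sg [g' sg' gg']|f g sf [f' sf' ff'] sg [g' sg' gg']].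
- by exists (fun=> 0); [exact: sm_cst|exact: dv_cst].
- by exists (fun=> 1); [exact: sm_cst|move=> x; exact: is_derive_id].
- exists (fun x => k * (bumpf n.+2 (k * x + c) - n%:R * bumpf n.+1 (k * x + c))).
  apply: smZ; apply: smD; first exact: sm_bump.
  have -> : (fun x => - (n%:R * bumpf n.+1 (k * x + c))) =
       (fun x => - n%:R * bumpf n.+1 (k * x + c)).
   by apply/funext => x; rewrite mulNr.
  by apply: smZ; exact: sm_bump.
 exact: (dv_affine (f := bumpf n)) (dv_bump_fun n).
- have [K dK _] := stepP.
 exists (fun x => k * (K * (bumpf 0 (k * x + c) * bumpf 0 (- k * x + (1 - c))))).
  by do 2 apply: smZ; apply: smM; exact: sm_bump.
 have := dv_affine k c dK; congr dv; apply/funext => x.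
 by congr (k * (K * (_ * bumpf _ _))); ring.
- exists (fun x => k * (- 1 * sin (k * x + c))).
  by do 2 apply: smZ; exact: sm_sin.
 apply: (dv_affine (f := cos) (f' := fun x => -1 * sin x)) => x.
 by rewrite mulN1r; exact: is_derive_cos.
- exists (fun x => k * cos (k * x + c)); first by apply: smZ; exact: sm_cos.
 by apply: (dv_affine (f := sin)) => x; exact: is_derive_sin.
- by exists (fun x => f' x + g' x); [exact: smD|exact: dvD].
- exists (fun x => f' x * g x + f x * g' x); last exact: dvM.
 by apply: smD; exact: smM.
Qed.

Lemma sm_continuous f : sm f -> continuous f.
Proof. by move=> /sm_dv[g _]; exact: dv_continuous. Qed.
Lemma sm_affine f k c : sm f -> sm (fun x => f (k * x + c)).
Proof.
have H k' c' : (fun x => k' * (k * x + c) + c') = (fun x => (k' * k) * x + (k' * c + c')).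
 by apply/funext => x; ring.
elim=> {f} [c'||n k' c'|k' c'|k' c'|k' c'|f g sf sf' sg sg'|f g sf sf' sg sg'].
- exact: sm_cst.
- by apply: smD; [apply: smM; [exact: sm_cst|exact: sm_id]|exact: sm_cst].
- by have := sm_bump n (k' * k) (k' * c + c'); congr sm; apply/funext => x; congr bumpf; ring.
- by have := sm_step (k' * k) (k' * c + c'); congr sm; apply/funext => x; congr step; ring.
- by have := sm_cos (k' * k) (k' * c + c'); congr sm; apply/funext => x; congr cos; ring.
- by have := sm_sin (k' * k) (k' * c + c'); congr sm; apply/funext => x; congr sin; ring.
- exact: smD.
- exact: smM.
Qed.

End smooth_functions.

(** * Integrals of compactly supported smooth functions on the line *)

Section compactly_supported.
Context {R : realType}.
Implicit Types (f g : R -> R) (u v : R -> R[i]).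

Local Notation mu := (@lebesgue_measure R).

Definition out (V : nmodType) (B : R) (f : R -> V) := forall x, B <= `|x| -> f x = 0.

Definition cs f := sm f /\ exists B, out B f.

Definition Int f : R := Rintegral mu setT f.

Lemma out_le (V : nmodType) (B B' : R) (f : R -> V) : B <= B' -> out B f -> out B' f.
Proof. by move=> BB h x /(le_trans BB); exact: h. Qed.
Lemma cs_integrable f : cs f -> mu.-integrable setT (EFin \o f).
Proof.
move=> [sf [B oB]].
have mI : measurable `[- B, B]%classic by exact: measurable_itv.
have -> : EFin \o f = (EFin \o f) \_ `[- B, B].
 apply/funext => x /=; rewrite patchE; case: ifPn => //.
 rewrite notin_setE/= in_itv/=; rewrite -ler_norml => /negP; rewrite -ltNge => h.
 by rewrite oB// ltW.
apply/(integrable_restrict mu mI measurableT); rewrite setTI.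
apply: continuous_compact_integrable; first exact: segment_compact.
by apply: continuous_subspaceT; exact: sm_continuous.
Qed.

(** Integrals are used through primitives: translation invariance, integration by parts and size
    estimates all become statements on an increment of a primitive. *)
Lemma Int_antider f F (B a b : R) : sm f -> out B f -> dv F f -> a <= - B -> B <= b -> a < b ->
 Int f = F b - F a.
Proof.
move=> sf oB dF aB Bb ab.
have mI : measurable `[a, b]%classic by exact: measurable_itv.
rewrite /Int (_ : f = f \_ `[a, b]); last first.
 apply/funext => x /=; rewrite patchE; case: ifPn => //.
 rewrite notin_setE/= in_itv/= => /negP xab; apply: oB; rewrite leNgt; apply/negP.
 rewrite ltr_norml => /andP[h1 h2]; move/negP: xab; apply; apply/andP; split; lra.
rewrite -Rintegral_mkcond /Rintegral (continuous_FTC2 (F := F))//.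
- by apply: continuous_subspaceT; exact: sm_continuous.
- have cF := dv_continuous dF.
 split; first by move=> x _; case: (dF x).
  by apply: cvg_at_right_filter; exact: cF.
 by apply: cvg_at_left_filter; exact: cF.
- by move=> x _; rewrite derive1E; exact: derive_val.
Qed.

Lemma cs_antider f : cs f -> exists F, dv F f.
Proof.
move=> [sf [B oB]]; have [|F dF _] := @antiderivative R f (- `|B|) (sm_continuous sf).
 move=> x xB; apply: oB; have := ler_norm B; have := ler_norm (- x).
 rewrite normrN; lra.
by exists F.
Qed.

Lemma IntD f g : cs f -> cs g -> Int (fun x => f x + g x) = Int f + Int g.
Proof. by move=> cf cg; rewrite /Int RintegralD//; exact: cs_integrable. Qed.
Lemma IntZ k f : cs f -> Int (fun x => k * f x) = k * Int f.
Proof. by move=> cf; rewrite /Int RintegralZl//; exact: cs_integrable. Qed.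
Lemma Int_shift f c : cs f -> Int (fun x => f (x + c)) = Int f.
Proof.
move=> cf; have [F dF] := cs_antider cf; case: cf => sf [B0 oB0].
pose B := `|B0| + `|c| + 1.
have cc : `|c| >= c /\ `|c| >= - c by rewrite ler_norm -normrN ler_norm.
have BB := ler_norm B0; have c0 := normr_ge0 c.
have B00 : 0 <= `|B0| by [].
have -> : (fun x => f (x + c)) = fun x => f (1 * x + c).
 by apply/funext => x; rewrite mul1r.
rewrite (@Int_antider (fun x => f (1 * x + c)) (fun x => F (1 * x + c)) B (- B) B); last first.
- by rewrite /B; lra.
- by [].
- by [].
- by have := dv_affine 1 c dF; congr dv; apply/funext => x; rewrite mul1r.
- move=> x; rewrite mul1r => xB; apply: oB0.
 have := ler_normD (x + c) (- c); rewrite addrK normrN => h.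
 move: xB; rewrite /B; lra.
- exact: sm_affine.
rewrite (@Int_antider f F `|B0| (1 * - B + c) (1 * B + c))//.
- exact: out_le oB0.
- by rewrite /B; lra.
- by rewrite /B; lra.
- by rewrite /B; lra.
Qed.

Lemma dv_out f F B : out B F -> dv F f -> out (`|B| + 1) f.
Proof.
move=> oB dF x xC; have BB := ler_norm B.
have -> : f x = 'D_1 F x by rewrite (@derive_val _ _ _ _ _ _ _ (dF x)).
suff: is_derive x 1 F 0 by move=> /@derive_val.
apply: near_eq_is_derive (is_derive_cst (0 : R) x 1); near=> z.
rewrite oB//.
have : `|x - z| < 1 by near: z; apply: nbhsx_ballx.
have := ler_normD (x - z) z; rewrite subrK; lra.
Unshelve. all: by end_near.
Qed.

Lemma Int_dv f F : cs F -> sm f -> dv F f -> Int f = 0.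
Proof.
move=> [sF [B oB]] sf dF; pose C := `|B| + 1.
have BB := ler_norm B; have B0 := normr_ge0 B.
rewrite (@Int_antider f F C (- C) C)//.
- by rewrite !oB ?subrr// ?normrN ger0_norm; rewrite /C; lra.
- exact: dv_out dF.
- by rewrite /C; lra.
Qed.

Lemma Int_bound f (B K : R) : 0 <= B -> sm f -> out B f -> (forall x, `|f x| <= K) ->
 `|Int f| <= 2 * (B + 1) * K.
Proof.
move=> B0 sf oB fK; have [|F dF] := @cs_antider f; first by split => //; exists B.
(* The margin 1 keeps the interval nondegenerate when [B] is 0. *)
rewrite (@Int_antider f F B (- (B + 1)) (B + 1))//; [|lra..].
rewrite (le_trans (dv_lipschitz _ _ dF fK))// mulrC ler_wpM2r//; last first.
 by rewrite opprK ger0_norm; lra.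
by rewrite (le_trans (normr_ge0 (f 0))).
Qed.

Definition csm u := sm (Re \o u) /\ sm (Im \o u).

Definition cc u := csm u /\ exists B, out B u.

Definition cdv u v := dv (Re \o u) (Re \o v) /\ dv (Im \o u) (Im \o v).

Definition cInt u : R[i] := (Int (Re \o u) +i* Int (Im \o u))%C.

Lemma csm_cst (c : R[i]) : csm (fun=> c).
Proof. by split; exact: sm_cst. Qed.
Lemma csm_real f : sm f -> csm (fun x => (f x)%:C%C).
Proof. by move=> sf; split => //=; exact: sm_cst. Qed.
Lemma csmD u v : csm u -> csm v -> csm (fun x => u x + v x).
Proof.
move=> [uR uI] [vR vI]; split.
 by have := smD uR vR; congr sm; apply/funext => x /=; rewrite RecD.
by have := smD uI vI; congr sm; apply/funext => x /=; rewrite ImcD.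
Qed.

Lemma csmM u v : csm u -> csm v -> csm (fun x => u x * v x).
Proof.
move=> [uR uI] [vR vI]; split.
 have := smD (smM uR vR) (smZ (-1) (smM uI vI)); congr sm.
 by apply/funext => x /=; rewrite RecM mulN1r.
have := smD (smM uR vI) (smM uI vR); congr sm.
by apply/funext => x /=; rewrite ImcM.
Qed.

Lemma csm_conj u : csm u -> csm (fun x => (u x)^*%C).
Proof.
move=> [uR uI]; split; first by move: uR; congr sm; apply/funext => x /=; rewrite RecJ.
by have := smZ (-1) uI; congr sm; apply/funext => x /=; rewrite ImcJ mulN1r.
Qed.

Lemma csm_affine u k c : csm u -> csm (fun x => u (k * x + c)).
Proof. by move=> [uR uI]; split; [exact: (sm_affine k c uR)|exact: (sm_affine k c uI)]. Qed.
Lemma csm_shift u c : csm u -> csm (fun x => u (x + c)).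
Proof.
by move=> /(csm_affine 1 c); congr csm; apply/funext => x; rewrite mul1r.
Qed.

Lemma csm_ee w : csm (fun x => ee (w * x)).
Proof.
split; rewrite /ee /expi/=.
 have := @sm_cos R (2 * pi * w) 0; congr sm.
 by apply/funext => x /=; rewrite addr0 mulrA.
have := @sm_sin R (2 * pi * w) 0; congr sm.
by apply/funext => x /=; rewrite addr0 mulrA.
Qed.

Lemma csm_dv u : csm u -> exists2 v, csm v & cdv u v.
Proof.
move=> [/sm_dv[f sf df] /sm_dv[g sg dg]].
by exists (fun x => (f x +i* g x)%C).
Qed.

Lemma cc_dv u v : cc u -> csm v -> cdv u v -> cc v.
Proof.
move=> [_ [B oB]] sv [dR dI]; split => //; exists (`|B| + 1) => x xB.
have := @dv_out _ (Re \o u) B _ dR x xB; have := @dv_out _ (Im \o u) B _ dI x xB.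
rewrite /= => hI hR; apply/eqP; rewrite eq_complex /= hR ?hI ?eqxx// => y yB /=; by rewrite oB.
Qed.

Lemma cdvM u u' v v' : cdv u u' -> cdv v v' ->
 cdv (fun x => u x * v x) (fun x => u' x * v x + u x * v' x).
Proof.
move=> [uR uI] [vR vI]; split.
 have := dvD (dvM uR vR) (dvM (@dv_cst R (-1)) (dvM uI vI)); congr dv; apply/funext => x /=.
  by rewrite RecM; ring.
 by rewrite RecD !RecM; ring.
have := dvD (dvM uR vI) (dvM uI vR); congr dv; apply/funext => x /=.
 by rewrite ImcM.
by rewrite ImcD !ImcM; ring.
Qed.

Lemma cdv_conj u u' : cdv u u' -> cdv (fun x => (u x)^*%C) (fun x => (u' x)^*%C).
Proof.
move=> [uR uI]; split.
 by move: uR; congr dv; apply/funext => x /=; rewrite RecJ.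
by have := dvM (@dv_cst R (-1)) uI; congr dv; apply/funext => x /=; rewrite ImcJ; ring.
Qed.

Lemma cdv_shift u u' c : cdv u u' -> cdv (fun x => u (x + c)) (fun x => u' (x + c)).
Proof.
move=> [uR uI]; split.
 by have := dv_affine 1 c uR; congr dv; apply/funext => x /=; rewrite !mul1r.
by have := dv_affine 1 c uI; congr dv; apply/funext => x /=; rewrite !mul1r.
Qed.

Definition tpi (w : R) : R[i] := (0 +i* (2 * pi * w))%C.

Lemma cdv_ee w : cdv (fun x => ee (w * x)) (fun x => tpi w * ee (w * x)).
Proof.
split; rewrite /ee /expi/= /tpi.
 have := @dv_affine R cos _ (2 * pi * w) 0 (fun x => is_derive_cos x).
 congr dv; apply/funext => x /=; rewrite addr0 !mulrA//.
 by ring.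
have := @dv_affine R sin _ (2 * pi * w) 0 (fun x => is_derive_sin x).
congr dv; apply/funext => x /=; rewrite addr0 !mulrA//.
by ring.
Qed.

Lemma nc_tpi w : nc (tpi w) = 2 * pi * `|w|.
Proof.
rewrite /ComplexField.Normc.normc/= expr0n/= add0r sqrtr_sqr normrM.
by rewrite [X in X * _]gtr0_norm// mulr_gt0// pi_gt0.
Qed.

Lemma cc_cs u : cc u -> cs (Re \o u) /\ cs (Im \o u).
Proof.
by move=> [[uR uI] [B oB]]; split; split => //; exists B => x xB /=; rewrite oB.
Qed.

Lemma ccM u v : cc u -> csm v -> cc (fun x => u x * v x).
Proof.
move=> [su [B oB]] sv; split; first exact: csmM.
by exists B => x xB; rewrite oB// mul0r.
Qed.

Lemma ccMl u v : csm u -> cc v -> cc (fun x => u x * v x).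
Proof.
move=> su [sv [B oB]]; split; first exact: csmM.
by exists B => x xB; rewrite oB// mulr0.
Qed.

Lemma ccZ c u : cc u -> cc (fun x => c * u x).
Proof. by apply: ccMl; exact: csm_cst. Qed.
Lemma ccD u v : cc u -> cc v -> cc (fun x => u x + v x).
Proof.
move=> [su [B oB]] [sv [B' oB']]; split; first exact: csmD.
exists (Num.max B B') => x; rewrite ge_max => /andP[h h'].
by rewrite oB// oB'// addr0.
Qed.

Lemma cc0 : cc (fun=> 0).
Proof. by split; [exact: csm_cst|exists 0]. Qed.
Lemma cc_sum I (r : seq I) (F : I -> R -> R[i]) : (forall i, cc (F i)) ->
 cc (fun x => \sum_(i <- r) F i x).
Proof.
move=> h; elim: r => [|i r IH].
 by have := cc0; congr cc; apply/funext => x; rewrite big_nil.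
by have := ccD (h i) IH; congr cc; apply/funext => x; rewrite big_cons.
Qed.

Lemma cc_conj u : cc u -> cc (fun x => (u x)^*%C).
Proof.
move=> [su [B oB]]; split; first exact: csm_conj.
by exists B => x xB; rewrite oB// conjc0.
Qed.

Lemma out_shift (V : nmodType) B (f : R -> V) c :
 out B f -> out (B + `|c|) (fun x => f (x + c)).
Proof.
move=> oB x xB; apply: oB; have := ler_normD (x + c) (- c).
rewrite addrK normrN; lra.
Qed.

Lemma cc_shift u c : cc u -> cc (fun x => u (x + c)).
Proof.
move=> [su [B oB]]; split; first exact: csm_shift.
by exists (B + `|c|); exact: out_shift.
Qed.

Lemma cIntD u v : cc u -> cc v -> cInt (fun x => u x + v x) = cInt u + cInt v.
Proof.
move=> /cc_cs[uR uI] /cc_cs[vR vI]; rewrite /cInt; simpc.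
rewrite -(IntD uR vR) -(IntD uI vI); congr (_ +i* _)%C; congr Int; apply/funext => x /=.
 by rewrite RecD.
by rewrite ImcD.
Qed.

Lemma cIntZ c u : cc u -> cInt (fun x => c * u x) = c * cInt u.
Proof.
move=> /cc_cs[uR uI]; rewrite /cInt; case: c => a b; simpc.
have cZ k f : cs f -> cs (fun x => k * f x).
 by move=> [sf [B oB]]; split; [exact: smZ|exists B => x xB; rewrite oB// mulr0].
rewrite -mulNr -!IntZ// -!IntD; [|exact: cZ..].
congr (_ +i* _)%C; congr Int; apply/funext => x /=.
 by case: (u x) => ? ? /=; rewrite mulNr.
by case: (u x).
Qed.

Lemma cInt0 : cInt (fun=> 0) = 0.
Proof. by have := cIntZ 0 cc0; rewrite !mul0r. Qed.
Lemma cInt_sum I (r : seq I) (F : I -> R -> R[i]) : (forall i, cc (F i)) ->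
 cInt (fun x => \sum_(i <- r) F i x) = \sum_(i <- r) cInt (F i).
Proof.
move=> h; elim: r => [|i r IH].
 by rewrite [RHS]big_nil -[RHS]cInt0; congr cInt; apply/funext => x; rewrite big_nil.
rewrite big_cons -IH -cIntD//; last exact: cc_sum.
by congr cInt; apply/funext => x; rewrite big_cons.
Qed.

Lemma cInt_conj u : cInt (fun x => (u x)^*%C) = ((cInt u)^*)%C \/ ~ cc u.
Proof.
have [cu|] := pselect (cc u); [left|by right].
have [uR uI] := cc_cs cu; rewrite /cInt; simpc; congr (_ +i* _)%C.
 by congr Int; apply/funext => x /=; rewrite RecJ.
rewrite -mulN1r -IntZ//; congr Int; apply/funext => x /=.
by rewrite ImcJ mulN1r.
Qed.

Lemma cIntJ u : cc u -> cInt (fun x => (u x)^*%C) = ((cInt u)^*)%C.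
Proof. by case: (cInt_conj u). Qed.
Lemma cInt_shift u c : cc u -> cInt (fun x => u (x + c)) = cInt u.
Proof.
by move=> /cc_cs[uR uI]; rewrite /cInt -(Int_shift c uR) -(Int_shift c uI).
Qed.

Lemma cInt_dv u v : cc u -> csm v -> cdv u v -> cInt v = 0.
Proof.
move=> /cc_cs[uR uI] [vR vI] [dR dI]; rewrite /cInt.
by rewrite (Int_dv uR vR dR) (Int_dv uI vI dI).
Qed.

Lemma cInt_bound u (B K : R) : 0 <= B -> csm u -> out B u -> (forall x, nc (u x) <= K) ->
 nc (cInt u) <= 4 * (B + 1) * K.
Proof.
move=> B0 [uR uI] oB uK; rewrite (le_trans (nc_le_ReIm _))//=.
have -> : 4 * (B + 1) * K = 2 * (B + 1) * K + 2 * (B + 1) * K by ring.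
rewrite lerD// Int_bound//.
- by move=> x xB /=; rewrite oB.
- by move=> x /=; rewrite (le_trans (Re_le_nc _)).
- by move=> x xB /=; rewrite oB.
- by move=> x /=; rewrite (le_trans (Im_le_nc _)).
Qed.

Lemma cs_bounded f : cs f -> exists2 K, 0 <= K & forall x, `|f x| <= K.
Proof.
move=> [sf [B oB]]; pose C := `|B|.
have CC : - C <= C by rewrite /C; have := normr_ge0 B; lra.
have cf : {within `[- C, C], continuous f}.
 by apply: continuous_subspaceT; exact: sm_continuous.
have cNf : {within `[- C, C], continuous (fun x => (-1) * f x)}.
 by apply: continuous_subspaceT; apply: sm_continuous; exact: smZ.
have [c _ hc] := EVT_max CC cf; have [c' _ hc'] := EVT_max CC cNf.
exists (`|f c| + `|f c'|) => [|x]; first by rewrite addr_ge0.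
have [xC|xC] := boolP (x \in `[- C, C]).
 have := hc x xC; have := hc' x xC.
 have := ler_norm (f c); have := ler_norm (- f c'); rewrite normrN.
 have := normr_ge0 (f c); have := normr_ge0 (f c').
 rewrite ler_norml; lra.
rewrite oB ?normr0 ?addr_ge0//.
move: xC; rewrite in_itv/= -ler_norml -ltNge => /ltW.
by apply: le_trans; exact: ler_norm.
Qed.

Lemma cc_bounded u : cc u -> exists B K, [/\ 0 <= B, 0 <= K, out B u & forall x, nc (u x) <= K].
Proof.
move=> cu; have [/cs_bounded[K K0 hK] /cs_bounded[L L0 hL]] := cc_cs cu.
case: cu => _ [B oB]; exists `|B|, (K + L); split => //.
- exact: addr_ge0.
- by apply: out_le oB; exact: ler_norm.
- by move=> x; rewrite (le_trans (nc_le_ReIm _))// lerD//; [exact: hK|exact: hL].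
Qed.

End compactly_supported.

(** * Poisson summation on the line *)

Section poisson.
Context {R : realType}.
Implicit Types (f g : R -> R) (u v a b : R -> R[i]) (N n : nat).

Lemma rc_nat (n : nat) : (n%:R : R)%:C%C = n%:R :> R[i].
Proof. exact: (rmorph_nat (real_complex R)). Qed.
Lemma rcM (x y : R) : (x * y)%:C%C = x%:C%C * y%:C%C :> R[i].
Proof. exact: (rmorphM (real_complex R)). Qed.

(** Wallis product, equal to 4^N / C(2N, N) by [cw_bin]: the factor that gives cos(pi t)^(2N) mean
    one over a period. *)
Fixpoint cw N : R := if N is N'.+1 then cw N' * ((2 * N' + 2)%:R / (2 * N' + 1)%:R) else 1.

Lemma cw_gt0 N : 0 < cw N.
Proof. by elim: N => //= N IH; rewrite mulr_gt0// divr_gt0// ltr0n; lia. Qed.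
Lemma cw_bin N : cw N * 'C(2 * N, N)%:R = 4 ^+ N.
Proof.
elim: N => [|N IH]; first by rewrite muln0 bin0 mulr1 expr0.
have h : ('C(2 * N.+1, N.+1) * (N.+1) * N.+1 = (2 * N + 2) * (2 * N + 1) * 'C(2 * N, N))%N.
 have h1 := mul_bin_diag (2 * N.+1) N.
 have h2 := mul_bin_down (2 * N).+1 N.
 have e1 : ((2 * N.+1).-1 = (2 * N).+1)%N by lia.
 have e2 : ((2 * N).+1 - N = N.+1)%N by lia.
 rewrite e1 in h1; rewrite e2 /= in h2.
 by rewrite mulnAC [('C(_, _) * _)%N]mulnC -h1; nia.
have hR : 'C(2 * N.+1, N.+1)%:R * N.+1%:R * N.+1%:R =
  (2 * N + 2)%:R * (2 * N + 1)%:R * 'C(2 * N, N)%:R :> R.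
 by rewrite -!natrM h.
rewrite exprS -IH /=.
have N0 : N.+1%:R != 0 :> R by rewrite pnatr_eq0.
have N1 : (2 * N + 1)%:R != 0 :> R by rewrite pnatr_eq0; lia.
apply: (mulIf N0); apply: (mulIf N0).
rewrite -mulrA -[LHS]mulrA [X in _ * X = _](_ : _ = (2 * N + 2)%:R * (2 * N + 1)%:R * 'C(2 * N, N)%:R); last first.
 by rewrite -hR; ring.
have -> : (2 * N + 2)%:R = 2 * N.+1%:R :> R by rewrite -natrM; congr _%:R; lia.
by field.
Qed.

(** A nonnegative 1-periodic kernel of mean one, concentrating at the integers as N grows. Being a
    trigonometric polynomial, it involves only finitely many Fourier coefficients of the function
    integrated against it. *)
Definition pk N t : R := cw N * cos (pi * t) ^+ (2 * N).

Lemma pk_ge0 N t : 0 <= pk N t.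
Proof. by rewrite mulr_ge0 ?(ltW (cw_gt0 N))// exprM exprn_ge0// sqr_ge0. Qed.
Lemma dv_cospi : dv (fun t : R => cos (pi * t)) (fun t => - pi * sin (pi * t)).
Proof.
have := @dv_affine R cos _ pi 0 (fun x => is_derive_cos x).
by congr dv; apply/funext => x /=; rewrite addr0 ?mulrN ?mulNr.
Qed.

Lemma dv_sinpi : dv (fun t : R => sin (pi * t)) (fun t => pi * cos (pi * t)).
Proof.
have := @dv_affine R sin _ pi 0 (fun x => is_derive_sin x).
by congr dv; apply/funext => x /=; rewrite addr0.
Qed.

Lemma dvX f f' n : dv f f' -> dv (fun t => f t ^+ n.+1) (fun t => n.+1%:R * f t ^+ n * f' t).
Proof.
move=> ff; elim: n => [|n IH].
 by move: ff; congr dv; apply/funext => t; rewrite ?expr1 ?expr0 ?mul1r ?mulr1.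
have := dvM IH ff; congr dv; apply/funext => t; first by rewrite -exprSr.
by rewrite -[n.+2%:R]natr1 !exprS; ring.
Qed.

Lemma cosDpi1 t : cos (pi * (t + 1)) = - cos (pi * t) :> R.
Proof. by rewrite mulrDr mulr1 cosDpi. Qed.
Lemma sinDpi1 t : sin (pi * (t + 1)) = - sin (pi * t) :> R.
Proof. by rewrite mulrDr mulr1 sinDpi. Qed.
(** The increment of [F] over a period says that the mean is one. The induction is the reduction
    formula: a multiple of cos^(2N+1) sin has derivative [pk N.+1] - [pk N]. *)
Lemma pk_antider N : exists2 F, dv F (pk N) & forall t, F (t + 1) = F t + 1.
Proof.
elim: N => [|N [F dF F1]].
 exists id => // t; rewrite /pk muln0 expr0 mulr1; exact: is_derive_id.
pose k := cw N.+1 / (pi * (2 * N + 2)%:R).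
exists (fun t => F t + k * (cos (pi * t) ^+ (2 * N).+1 * sin (pi * t))); last first.
 move=> t; rewrite F1 cosDpi1 sinDpi1 exprNn -signr_odd /= oddM/= expr1.
 by ring.
have := dvD dF (dvM (@dv_cst R k) (dvM (dvX (2 * N) dv_cospi) dv_sinpi)).
congr dv; apply/funext => t; rewrite mul0r add0r.
have s2 : sin (pi * t) * sin (pi * t) = 1 - cos (pi * t) ^+ 2 :> R.
 by rewrite -expr2 sin2cos2.
have -> : (2 * N).+1%:R * cos (pi * t) ^+ (2 * N) * (- pi * sin (pi * t)) * sin (pi * t) =
 - (2 * N).+1%:R * cos (pi * t) ^+ (2 * N) * pi * (sin (pi * t) * sin (pi * t)) :> R by ring.
rewrite s2 /pk /k mulnS add2n /= !exprS addn1 addn2.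
set c := cos _; set C := c ^+ (2 * N).
have pi0 : pi != 0 :> R by rewrite gt_eqF// pi_gt0.
have eA : (2 * N).+2%:R = (2 * N).+1%:R + 1 :> R by rewrite natr1.
have p0 : (2 * N).+1%:R != 0 :> R by rewrite pnatr_eq0.
have p1 : (2 * N).+1%:R + 1 != 0 :> R by rewrite -eA pnatr_eq0.
rewrite eA !expr0; move: p0 p1; move: (2 * N).+1%:R => p p0 p1.
clear s2 k; clearbody C; clearbody c; move: pi pi0 => P P0.
by field; rewrite ?p0 ?p1 ?P0.
Qed.

(** Halve the angle: with y = pi t / 2 <= pi / 4, sin 2y = 2 cos y sin y and sin y = y cos c for
    some c below y, so sin 2y >= 2 y (cos y)^2 >= y >= t, since pi >= 2. *)
Lemma sin_ge_id (t : R) : 0 <= t <= 1 / 2 -> t <= sin (pi * t).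
Proof.
move=> /andP[t0 t1].
have pi2 : pi >= 2 :> R by have := @pi_ge2 R.
have c4 (x : R) : 0 <= x <= pi / 4 -> 1 / 2 <= cos x ^+ 2.
 move=> /andP[x0 x4].
 have -> : cos x ^+ 2 = (1 + cos (x *+ 2)) / 2 :> R by rewrite cos_mulr2n; field.
 suff : 0 <= cos (x *+ 2) by lra.
 by apply: cos_ge0_pihalf; rewrite (mulr2n x); have := @pi_gt0 R => ?; apply/andP; split; lra.
have c0 (x : R) : 0 <= x <= pi / 4 -> 0 <= cos x.
 by move=> /andP[x0 x4]; apply: cos_ge0_pihalf; have := @pi_gt0 R; lra.
pose y := pi * t / 2.
have y0 : 0 <= y by rewrite /y; have := @pi_gt0 R; nra.
have y4 : y <= pi / 4 by rewrite /y; have := @pi_gt0 R; nra.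
have -> : pi * t = y *+ 2 by rewrite /y mulr2n; field.
rewrite sin_mulr2n mulr2n.
have [|c] := @MVT_segment R sin cos 0 y y0 (fun x _ => is_derive_sin x).
 by apply: continuous_subspaceT; exact: continuous_sin.
rewrite in_itv/= sin0 !subr0 => /andP[c0' cy] ->.
have cc : cos y <= cos c.
 have pi0 := @pi_gt0 R.
 have hc : c \in `[0, pi] by rewrite in_itv/=; apply/andP; split; lra.
 have hy : y \in `[0, pi] by rewrite in_itv/=; apply/andP; split; lra.
 by rewrite leNgt (ltr_cos hy hc) -leNgt.
have h1 := c4 y; have h2 := c0 y.
have h3 : 1 / 2 <= cos c * cos y.
 rewrite (le_trans (h1 _)) ?y0// expr2 ler_wpM2r// h2// y0//.
have -> : cos y * (cos c * y) + cos y * (cos c * y) = 2 * y * (cos c * cos y) by ring.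
apply: (@le_trans _ _ (2 * y * (1 / 2))); last by rewrite ler_wpM2l// mulr_ge0.
by rewrite /y; nra.
Qed.

Lemma sqr_le_sin2 (t : R) : `|t| <= 1 / 2 -> t ^+ 2 <= sin (pi * t) ^+ 2.
Proof.
move=> t1; have -> : sin (pi * t) ^+ 2 = sin (pi * `|t|) ^+ 2.
 by case: (ger0P t) => // _; rewrite mulrN sinN sqrrN.
rewrite -sqrn; have h := @sin_ge_id `|t|; rewrite t1 normr_ge0 in h.
by rewrite lerXn2r ?nnegrE ?h// (le_trans (normr_ge0 t))// h.
Qed.

Lemma sin2_natr (j : int) (t : R) : sin (pi * (t - j%:~R)) ^+ 2 = sin (pi * t) ^+ 2.
Proof.
have H (n : nat) s : sin (pi * (s + n%:R)) ^+ 2 = sin (pi * s) ^+ 2 :> R.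
 elim: n => [|n IH]; first by rewrite addr0.
 by rewrite -natr1 addrA sinDpi1 sqrrN IH.
case: j => n; first by rewrite -{2}(subrK n%:R t) H.
by rewrite NegzE mulrNz opprK H.
Qed.

(** Both kernels having mean one, the mean of sin(pi t)^2 against [pk N] is 1/(2N + 2): the second
    moment that measures the concentration. *)
Lemma sin2_pk N t : sin (pi * t) ^+ 2 * pk N t = pk N t - (2 * N + 1)%:R / (2 * N + 2)%:R * pk N.+1 t.
Proof.
rewrite sin2cos2 /pk mulnS exprD /=.
have n1 : (2 * N + 1)%:R != 0 :> R by rewrite pnatr_eq0; lia.
have n2 : (2 * N + 2)%:R != 0 :> R by rewrite pnatr_eq0; lia.
move: n1 n2; move: (2 * N + 1)%:R (2 * N + 2)%:R => p q n1 n2.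
by field; rewrite n1 n2.
Qed.

(** Both g - f and g + f are nondecreasing on the interval. This plays the part of the triangle
    inequality for integrals. *)
Lemma dv_le f f' g g' (x y : R) : dv f f' -> dv g g' -> x <= y ->
 (forall t, x <= t <= y -> `|f' t| <= g' t) -> `|f y - f x| <= g y - g x.
Proof.
move=> df dg xy h.
have H k : k = 1 \/ k = -1 -> k * (f y - f x) <= g y - g x.
 move=> k1; have dh := dvD dg (dvM (@dv_cst R (- k)) df).
 have [|c] := @MVT_segment R _ _ x y xy (fun t _ => dh t).
  by apply: continuous_subspaceT; exact: dv_continuous dh.
 rewrite in_itv/= => cxy e; have := h c cxy.
 have : 0 <= y - x by rewrite subr_ge0.
 move: e; rewrite mul0r add0r ler_norml => e y0 /andP[h1 h2].
 rewrite -subr_ge0; have -> : g y - g x - k * (f y - f x) =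
  g y + - k * f y - (g x + - k * f x) by ring.
 by rewrite e mulr_ge0//; case: k1 => ->; lra.
rewrite ler_norml; have := H 1; have := H (-1).
move=> /(_ (or_intror erefl)) h1 /(_ (or_introl erefl)) h2; apply/andP; split; lra.
Qed.

Lemma pk_sm N : sm (pk N).
Proof.
apply: smZ; elim: (2 * N)%N => [|n IH].
 by have := @sm_cst R 1; congr sm; apply/funext => t; rewrite expr0.
have := smM (@sm_cos R pi 0) IH; congr sm; apply/funext => t.
by rewrite addr0 -exprS.
Qed.

(** On the unit interval centred at an integer j one has |t - j| <= d + sin(pi t)^2 / d. Against the
    kernel, the first term contributes d by the mean, the second 1/(d (2N + 2)) by the second
    moment; 2B + 1 such intervals cover the support. *)
Lemma pk_approx f (B : nat) (K d : R) N : cs f -> out B%:R f ->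
 (forall x y, `|f x - f y| <= K * `|x - y|) -> 0 < d ->
 `|Int (fun t => f t * pk N t) - \sum_(i < (2 * B).+1) f (i%:R - B%:R)|
  <= (2 * B).+1%:R * (K * (d + (d * (2 * N + 2)%:R)^-1)).
Proof.
move=> cf oB fK d0; have [sf _] := cf.
have K0 : 0 <= K by have := fK 1 0; rewrite subr0 normr1 mulr1; apply: le_trans.
have sfp : sm (fun t => f t * pk N t) by apply: smM => //; exact: pk_sm.
have ofp : out B%:R (fun t => f t * pk N t) by move=> x xB; rewrite oB// mul0r.
have [G dG] : exists G, dv G (fun t => f t * pk N t).
 by apply: cs_antider; split => //; exists B%:R.
have [k dk k1] := pk_antider N; have [k' dk' k1'] := pk_antider N.+1.
rewrite (@Int_antider _ _ G B%:R (- B%:R - 1 / 2) (B%:R + 1 / 2))//; [|lra|lra|]; last first.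
 by have : 0 <= B%:R :> R by []; lra.
pose x (i : nat) : R := i%:R - B%:R - 1 / 2.
have -> : G (B%:R + 1 / 2) - G (- B%:R - 1 / 2) =
  \sum_(i < (2 * B).+1) (G (x i.+1) - G (x i)).
 rewrite -(big_mkord xpredT (fun i => G (x i.+1) - G (x i))) telescope_sumr//.
 congr (G _ - G _); rewrite /x; last by ring.
 by rewrite -[(2 * B).+1%:R]natr1 [(2 * B)%:R]natrM; field.
rewrite -sumrB (le_trans (ler_norm_sum _ _ _))//.
have -> : (2 * B).+1%:R * (K * (d + (d * (2 * N + 2)%:R)^-1)) =
  \sum_(i < (2 * B).+1) K * (d + (d * (2 * N + 2)%:R)^-1).
 by rewrite sumr_const card_ord mulr_natl.
apply: ler_sum => i _; set j : R := i%:R - B%:R.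
have xj : x i.+1 = x i + 1 by rewrite /x -natr1; ring.
have -> : G (x i.+1) - G (x i) - f j =
  (G (x i.+1) + - f j * k (x i.+1)) - (G (x i) + - f j * k (x i)).
 by rewrite xj k1; ring.
have d2 := dvD dG (dvM (@dv_cst R (- f j)) dk).
pose r : R := (2 * N + 1)%:R / (2 * N + 2)%:R.
have d1 := dvM (@dv_cst R K) (dvD (dvM (@dv_cst R (d + d^-1)) dk) (dvM (@dv_cst R (- d^-1 * r)) dk')).
have xx : x i <= x i.+1 by rewrite xj lerDl.
have := dv_le d2 d1 xx; rewrite xj k1 k1' => H.
apply: (le_trans (H _)); last first.
 rewrite le_eqVlt; apply/orP; left; apply/eqP.
 have n2 : (2 * N + 2)%:R = 2 * N%:R + 2 :> R by rewrite natrD natrM.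
 have n1 : (2 * N + 1)%:R = 2 * N%:R + 1 :> R by rewrite natrD natrM.
 have N0 : 0 <= N%:R :> R by [].
 rewrite /r n1 n2; field.
 by rewrite (gt_eqF d0)/= gt_eqF//; lra.
move=> t /andP[tx1 tx2]; rewrite !mul0r !add0r.
have tj : `|t - j| <= 1 / 2.
 by rewrite ler_norml; move: tx1 tx2; rewrite /x -/j; lra.
have -> : f t * pk N t + - f j * pk N t = (f t - f j) * pk N t by ring.
rewrite normrM (ger0_norm (pk_ge0 N t)).
have s2 := sqr_le_sin2 tj.
have jz : j = ((i : int) - (B : int))%:~R by rewrite /j rmorphB.
rewrite jz sin2_natr -jz in s2.
have h1 : `|t - j| <= d + d^-1 * sin (pi * t) ^+ 2.
 have : `|t - j| ^+ 2 <= sin (pi * t) ^+ 2 by rewrite sqrn.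
 move: (sin (pi * t) ^+ 2) => S h.
 have hS : d^-1 * `|t - j| ^+ 2 <= d^-1 * S by rewrite ler_wpM2l// invr_ge0 ltW.
 have h0 := normr_ge0 (t - j).
 have : `|t - j| <= d + d^-1 * `|t - j| ^+ 2.
  rewrite -subr_ge0; have -> : d + d^-1 * `|t - j| ^+ 2 - `|t - j| =
   d^-1 * ((d - `|t - j|) ^+ 2 + d * `|t - j|) by field; rewrite gt_eqF.
  rewrite mulr_ge0 ?invr_ge0 ?(ltW d0)// addr_ge0 ?sqr_ge0// mulr_ge0// ltW//.
 lra.
apply: (@le_trans _ _ (K * (d + d^-1 * sin (pi * t) ^+ 2) * pk N t)).
 rewrite ler_wpM2r ?pk_ge0// (le_trans (fK _ _))// ler_wpM2l//.
rewrite -mulrA ler_wpM2l// mulrDl -mulrA sin2_pk -/r.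
by rewrite le_eqVlt; apply/orP; left; apply/eqP; ring.
Qed.

Lemma hs_fin (T : eqType) (F : T -> R[i]) (r : seq T) : uniq r ->
 (forall t, t \notin r -> F t = 0) -> hs F (\sum_(t <- r) F t).
Proof.
move=> ur F0 eps e0; exists r => B uB rB.
rewrite (sum_split _ ur uB rB) [X in _ + X - _]big1; last by move=> t /F0.
by rewrite addr0 subrr nc0 ltW.
Qed.

Definition zr (B : nat) : seq int := [seq (n : int) - (B : int) | n <- iota 0 (2 * B).+1].
Lemma zr_uniq B : uniq (zr B).
Proof. by rewrite map_inj_uniq ?iota_uniq// => x y /=; lia. Qed.
Lemma mem_zr B (k : int) : (k \in zr B) = (`|k| <= B)%N.
Proof.
apply/mapP/idP => [[n]|kB]; first by rewrite mem_iota => + ->; lia.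
by exists (absz (k + (B : int))); rewrite ?mem_iota; lia.
Qed.
Lemma sum_zr B (V : nmodType) (F : R -> V) :
 \sum_(i < (2 * B).+1) F (i%:R - B%:R) = \sum_(k <- zr B) F k%:~R.
Proof.
rewrite big_map -[iota _ _]/(index_iota 0 (2 * B).+1) big_mkord; apply: eq_bigr => i _.
by rewrite rmorphB.
Qed.
Lemma sum_zrN B (V : nmodType) (F : int -> V) :
 \sum_(k <- zr B) F k = \sum_(k <- zr B) F (- k).
Proof.
rewrite -(big_map (fun k : int => - k) xpredT); apply: perm_big; apply: uniq_perm.
- exact: zr_uniq.
- by rewrite map_inj_uniq ?zr_uniq//; exact: oppr_inj.
- move=> k; rewrite mem_zr; apply/idP/mapP => [kB|[l]].
  by exists (- k); rewrite ?opprK// mem_zr abszN.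
 by rewrite mem_zr => lB ->; rewrite abszN.
Qed.

Lemma abs_subn (n N : nat) : (n < (2 * N).+1)%N -> (`|(n : int) - (N : int)| <= N)%N.
Proof. lia. Qed.
Lemma bin_abs (n N : nat) : (n < (2 * N).+1)%N ->
 'C(2 * N, N + `|(n : int) - (N : int)|) = 'C(2 * N, n).
Proof.
move=> nN; have [h|h] := leqP N n.
 by have -> : (N + `|(n : int) - (N : int)| = n)%N by lia.
have -> : (N + `|(n : int) - (N : int)| = 2 * N - n)%N by lia.
by rewrite bin_sub; last by lia.
Qed.

Definition ft a (w : R) : R[i] := cInt (fun t => a t * ee (- w * t)).

Lemma ft_dv a b w : cc a -> csm b -> cdv a b -> tpi w * ft a w = ft b w.
Proof.
move=> ca sb ab; have cb := cc_dv ca sb ab.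
have d := cdvM ab (cdv_ee (- w)).
have : cInt (fun x => b x * ee (- w * x) + a x * (tpi (- w) * ee (- w * x))) = 0.
 apply: cInt_dv d; first by apply: ccM => //; exact: csm_ee.
 apply: csmD; first by apply: csmM => //; exact: csm_ee.
 case: ca => sa _; apply: csmM => //; apply: csmM; [exact: csm_cst|exact: csm_ee].
have ce : cc (fun x => a x * ee (- w * x)) by apply: ccM => //; exact: csm_ee.
rewrite (_ : (fun x => _) = fun x => b x * ee (- w * x) + tpi (- w) * (a x * ee (- w * x))); last first.
 by apply/funext => x; ring.
rewrite cIntD ?cIntZ//; [|by apply: ccM => //; exact: csm_ee|exact: ccZ].
move/eqP; rewrite addr_eq0 => /eqP; rewrite /ft => ->.
rewrite -mulNr; congr (_ * _); apply/eqP.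
by rewrite eq_complex /tpi/= oppr0 mulrN opprK !eqxx.
Qed.

(** Multiplication by the frequency is differentiation of the function, by integration by parts;
    [tpi w] has modulus 2 pi |w| >= |w|. *)
Lemma ft_decay L a : cc a -> exists C, forall w, `|w| ^+ L * nc (ft a w) <= C.
Proof.
elim: L a => [|L IH] a ca.
 have [B [K [B0 K0 oB aK]]] := cc_bounded ca.
 exists (4 * (B + 1) * K) => w; rewrite expr0 mul1r; apply: cInt_bound => //.
 - by case: ca => sa _; apply: csmM => //; exact: csm_ee.
 - by move=> x xB; rewrite oB// mul0r.
 - by move=> x; rewrite ncM nc_e mulr1.
have [b sb ab] : exists2 b, csm b & cdv a b by case: ca => /csm_dv.
have cb := cc_dv ca sb ab.
have [C HC] := IH b cb; exists C => w.
rewrite (le_trans _ (HC w))// -(ft_dv w ca sb ab) ncM nc_tpi exprSr -mulrA ler_wpM2l ?exprn_ge0//.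
rewrite -[leRHS]mulrA ler_peMl ?mulr_ge0 ?nc_ge0//.
 by have := @pi_ge2 R; lra.
Qed.

Lemma pk_fourier N t : (pk N t)%:C%C =
 \sum_(n < (2 * N).+1) (cw N / 4 ^+ N * 'C(2 * N, n)%:R)%:C%C * ee ((N%:R - n%:R) * t).
Proof.
have h : ((2 * cos (pi * t))%:C)%C = ee (t / 2) + ee (- (t / 2)).
 rewrite eN /ee /expi; apply/eqP; rewrite eq_complex/= subrr eqxx andbT; apply/eqP.
 have -> : 2 * pi * (t / 2) = pi * t by field.
 by ring.
have -> : pk N t = cw N / 4 ^+ N * (2 * cos (pi * t)) ^+ (2 * N).
 have e4 : 2 ^+ (2 * N) = 4 ^+ N :> R by rewrite exprM; congr (_ ^+ _); ring.
 by rewrite /pk exprMn e4 mulrA divfK// expf_neq0// pnatr_eq0.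
have h' : ((2 * cos (pi * t)) ^+ (2 * N))%:C%C = (ee (t / 2) + ee (- (t / 2))) ^+ (2 * N).
 by rewrite -h -rmorphXn.
transitivity ((cw N / 4 ^+ N)%:C%C * (ee (t / 2) + ee (- (t / 2))) ^+ (2 * N)).
 by rewrite -h' -rmorphM.
rewrite [(_ + _) ^+ (2 * N)]exprDn mulr_sumr; apply: eq_bigr => -[n nN] _ /=.
rewrite [X in _ = X * _]rcM -[RHS]mulrA; congr (_ * _); rewrite rc_nat mulr_natl; congr (_ *+ _).
rewrite -!eMn -eD; congr ee.
by rewrite natrB -1?ltnS// natrM; field.
Qed.

(** Passing from k to k + 1 multiplies the binomial coefficient by (N - k)/(N + k + 1), which
    differs from 1 by at most (2k + 1)/N; the odd numbers add up to k^2. *)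
Lemma bin_ratio N k : (k <= N)%N -> (0 < N)%N ->
 0 <= (1 - 'C(2 * N, N + k)%:R / 'C(2 * N, N)%:R : R) <= k%:R ^+ 2 / N%:R.
Proof.
move=> kN N0; elim: k kN => [|k IH] kN.
 rewrite addn0 divff ?subrr ?lexx ?mulr_ge0 ?invr_ge0 ?sqr_ge0//.
 by rewrite pnatr_eq0 -lt0n bin_gt0; lia.
have c0 : 0 < 'C(2 * N, N)%:R :> R by rewrite ltr0n bin_gt0; lia.
have := mul_bin_left (2 * N) (N + k).
have -> : (2 * N - (N + k) = N - k)%N by lia.
move=> /(congr1 (fun n => n%:R : R)); rewrite !natrM -addnS.
set p := 'C(_, N + k.+1)%:R; set q := 'C(_, N + k)%:R => h.
have := IH (ltnW kN); rewrite -/q => /andP[h1 h2].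
have q0 : 0 <= q by rewrite ler0n.
have NR : 0 < N%:R :> R by rewrite ltr0n.
have Nk : 0 < (N + k.+1)%:R :> R by rewrite ltr0n; lia.
have -> : p = q * ((N - k)%:R / (N + k.+1)%:R).
 by rewrite mulrA [q * _]mulrC -h mulrAC divff ?mul1r// gt_eqF.
have e1 : (N - k)%:R = N%:R - k%:R :> R by rewrite natrB// ltnW.
have e2 : (N + k.+1)%:R = N%:R + k%:R + 1 :> R by rewrite natrD -natr1 addrA.
have kR : 0 <= k%:R :> R by [].
have kNR : k%:R <= N%:R :> R by rewrite ler_nat ltnW.
rewrite mulrAC; set x := q / _ in h1 h2 *.
have x0 : 0 <= x by rewrite divr_ge0// ltW.
have y0 : 0 <= (N - k)%:R / (N + k.+1)%:R :> R by rewrite divr_ge0// ltW.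
have y1 : (N - k)%:R / (N + k.+1)%:R <= 1 :> R.
 by rewrite ler_pdivrMr// mul1r e1 e2; lra.
have y2 : 1 - (N - k)%:R / (N + k.+1)%:R <= (2 * k%:R + 1) / N%:R :> R.
 have -> : 1 - (N - k)%:R / (N + k.+1)%:R = (2 * k%:R + 1) / (N + k.+1)%:R :> R.
  by rewrite e1 e2; field; rewrite gt_eqF//; lra.
 rewrite ler_wpM2l// ?addr_ge0 ?mulr_ge0// lef_pV2 ?posrE// e2; lra.
set y := _ / _ in y0 y1 y2 *.
apply/andP; split; first by nra.
have -> : k.+1%:R ^+ 2 / N%:R = k%:R ^+ 2 / N%:R + (2 * k%:R + 1) / N%:R :> R.
 by rewrite -natr1; field; rewrite gt_eqF.
by nra.
Qed.

(** Integrate [a] against [pk N] in two ways. The concentration of the kernel gives nearly the sum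
    over the integers; its binomial expansion gives the Fourier coefficients with weights C(2N, N +
    k) / C(2N, N), which tend to 1. The decay of the coefficients allows [hs_dom]. *)
Lemma poisson a (B : nat) : cc a -> out B%:R a ->
 hs (fun n : int => ft a n%:~R) (\sum_(i < (2 * B).+1) a (i%:R - B%:R)).
Proof.
move=> ca oB.
have [C0 HC0] := ft_decay 0 ca; have [C1 HC1] := ft_decay 1 ca; have [C2 HC2] := ft_decay 2 ca.
(* From (1 + x)(2 + x) = 2 + 3 x + x^2, the inverse of the weight. *)
pose C := 2 * C0 + 3 * C1 + C2.
have Cb (n : int) : nc (ft a n%:~R) <= C * wt1 n.
 rewrite /wt1 ler_pdivlMr ?mulr_gt0 ?ltr_wpDr//.
 have := HC0 n%:~R; have := HC1 n%:~R; have := HC2 n%:~R.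
 rewrite expr1 expr0 mul1r -intr_norm -abszE /C.
 set x : R := (`|n|%N)%:~R; have -> : (`|n|%N)%:R = x by [].
 set y := nc _; lra.
have Cnn : 0 <= C.
 by have := le_trans (nc_ge0 _) (Cb 0); rewrite pmulr_lge0// wt1_gt0.
have HD := hs_dom (bsZ Cnn bs_wt1) Cb.
refine (HD _ _) => eps A e0.
have [/cs_bounded[KR KR0 aKR] /cs_bounded[KI KI0 aKI]] := cc_cs ca.
have [K [K0 KRe KIm]] : exists K, [/\ 0 <= K, forall x y, `|Re (a x) - Re (a y)| <= K * `|x - y| &
  forall x y, `|Im (a x) - Im (a y)| <= K * `|x - y|].
 have [b sb [abR abI]] : exists2 b, csm b & cdv a b by case: ca => /csm_dv.
 have cb := cc_dv ca sb (conj abR abI).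
 have [B' [K [_ K0 _ bK]]] := cc_bounded cb.
 exists K; split => // x y.
  by apply: (dv_lipschitz _ _ abR) => t; rewrite (le_trans (Re_le_nc _)).
 by apply: (dv_lipschitz _ _ abI) => t; rewrite (le_trans (Im_le_nc _)).
pose M : R := (2 * B).+1%:R * K + 1.
have M0 : 0 < M by rewrite /M ltr_wpDl// mulr_ge0.
pose d := eps / (4 * M).
have d0 : 0 < d by rewrite divr_gt0// mulr_gt0.
pose mA := (\max_(n <- A) `|n|%N)%N.
(* The first term makes the error of [pk_approx] small, the second brings the binomial weights of
   the frequencies in [A] close to one. *)
pose X := (d * d)^-1 + C * mA%:R ^+ 2 / eps.
have X1 : 0 <= (d * d)^-1 by rewrite invr_ge0 mulr_ge0// ltW.
have X2 : 0 <= C * mA%:R ^+ 2 / eps.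
 by rewrite !mulr_ge0 ?invr_ge0 ?exprn_ge0 ?(ltW e0).
have [N [NX mAN N0]] : exists N : nat, [/\ X <= N%:R, (mA <= N)%N & (0 < N)%N].
 exists ((Num.truncn X).+1 + mA)%N; split; [|exact: leq_addl|by []].
 by rewrite natrD ler_wpDr// ltW// truncnS_gt.
have NN : 0 < N%:R :> R by rewrite ltr0n.
pose w (n : nat) : R := cw N / 4 ^+ N * 'C(2 * N, n)%:R.
have wE n : w n = 'C(2 * N, n)%:R / 'C(2 * N, N)%:R.
 rewrite /w -cw_bin; have c0 := cw_gt0 N.
 have b0 : 0 < 'C(2 * N, N)%:R :> R by rewrite ltr0n bin_gt0 leq_pmull.
 by field; rewrite !gt_eqF.
pose F' (k : int) : R[i] := if (`|k| <= N)%N then (w (N + `|k|)%N)%:C%C * ft a k%:~R else 0.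
exists F', (cInt (fun t => a t * (pk N t)%:C%C)); split.
- move=> k; rewrite /F'; case: ifPn => [kN|_]; last by rewrite nc0 (le_trans _ (Cb k))// nc_ge0.
 rewrite (le_trans _ (Cb k))// ncM nc_real ler_piMl ?nc_ge0//.
 have := bin_ratio kN N0; rewrite -wE => /andP[h _].
 rewrite ger0_norm; first by lra.
 by rewrite wE divr_ge0.
- move=> k kA; have kmA : (`|k| <= mA)%N by apply: (leq_bigmax_seq (F := absz)).
 have kN : (`|k| <= N)%N by exact: leq_trans mAN.
 rewrite /F' kN -[X in _ - X]mul1r -mulrBl ncM.
 have -> : (w (N + `|k|)%N)%:C%C - 1 = (w (N + `|k|)%N - 1)%:C%C by rewrite rmorphB rmorph1.
 rewrite nc_real distrC.
 have := bin_ratio kN N0; rewrite -wE => /andP[h h'].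
 rewrite ger0_norm//.
 apply: (@le_trans _ _ (mA%:R ^+ 2 / N%:R * C)).
  rewrite ler_pM ?nc_ge0//.
   rewrite (le_trans h')// ler_wpM2r ?invr_ge0 ?(ltW NN)//.
   by rewrite lerXn2r ?nnegrE// ler_nat.
  rewrite (le_trans (Cb k))// ler_piMr// /wt1 invf_le1 ?mulr_gt0 ?ltr_wpDr//.
  by rewrite -[leLHS]mul1r ler_pM// ?lerDl//; have : 0 <= (`|k|%N)%:R :> R by []; lra.
 rewrite mulrAC ler_pdivrMr//.
 have : C * mA%:R ^+ 2 / eps <= N%:R.
  by move: NX; rewrite /X; lra.
 by rewrite ler_pdivrMr// => h2; rewrite [leRHS]mulrC [leLHS]mulrC.
- have cp n : cc (fun t => (w n)%:C%C * (a t * ee ((N%:R - n%:R) * t))).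
  by apply: ccZ; apply: ccM => //; exact: csm_ee.
 have -> : cInt (fun t => a t * (pk N t)%:C%C) =
   \sum_(k <- zr N) F' k.
  have -> : (fun t => a t * (pk N t)%:C%C) =
    fun t => \sum_(n <- iota 0 (2 * N).+1) (w n)%:C%C * (a t * ee ((N%:R - n%:R) * t)).
   apply/funext => t; rewrite pk_fourier mulr_sumr -[iota 0 _]/(index_iota 0 (2 * N).+1).
   rewrite big_mkord; apply: eq_bigr => n _; rewrite -/(w n); ring.
  rewrite cInt_sum// big_map big_seq [RHS]big_seq; apply: eq_bigr => n.
  rewrite mem_iota add0n => /= nN.
  rewrite cIntZ; last by apply: ccM => //; exact: csm_ee.
  rewrite /F' abs_subn//; congr (_ * _).
   by congr (_ +i* _)%C; rewrite !wE bin_abs.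
  rewrite /ft; congr cInt; apply/funext => t; congr (_ * ee (_ * _)).
  by rewrite rmorphB/= opprB.
 apply: hs_fin; first exact: zr_uniq.
 by move=> k; rewrite mem_zr /F' => /negbTE ->.
- have cR := (cc_cs ca).1; have cI := (cc_cs ca).2.
 have oR : out B%:R (Re \o a) by move=> x xB /=; rewrite oB.
 have oI : out B%:R (Im \o a) by move=> x xB /=; rewrite oB.
 have hR := pk_approx N cR oR KRe d0; have hI := pk_approx N cI oI KIm d0.
 have bound : (2 * B).+1%:R * (K * (d + (d * (2 * N + 2)%:R)^-1)) <= eps / 2.
  apply: (@le_trans _ _ (M * (2 * d))); last first.
   by have -> : M * (2 * d) = eps / 2 by rewrite /d; field; rewrite gt_eqF.
  rewrite mulrA; apply: ler_pM.
  - by rewrite mulr_ge0.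
  - by rewrite addr_ge0 ?(ltW d0)// invr_ge0 mulr_ge0// ltW.
  - by rewrite /M lerDl.
  - have -> : 2 * d = d + d by ring.
   rewrite lerD2l invfM ler_pdivrMr; last by rewrite ltr0n addn2.
   have : (d * d)^-1 <= N%:R.
    by move: NX; rewrite /X; lra.
   rewrite invfM => h; rewrite -(ler_pM2l (_ : 0 < d^-1)) ?invr_gt0//.
   rewrite [leRHS]mulrA mulVf ?gt_eqF// mul1r (le_trans h)// ler_nat; clear -N; lia.
 rewrite (le_trans (nc_le_ReIm _))// RecD ImcD RecN ImcN ReE_sum ImE_sum /=.
 have eR : Re \o (fun t => a t * (pk N t)%:C%C) = fun t => (Re \o a) t * pk N t.
  by apply/funext => t /=; rewrite RecM /= mulr0 subr0.
 have eI : Im \o (fun t => a t * (pk N t)%:C%C) = fun t => (Im \o a) t * pk N t.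
  by apply/funext => t /=; rewrite ImcM /= mulr0 add0r.
 rewrite eR eI (splitr eps) lerD//; exact: le_trans bound.
Qed.

End poisson.

(** * The short-time Fourier transform on the line *)

Section ambiguity.
Context {R : realType}.
Implicit Types (u v a b f g : R -> R[i]) (x w t : R).

Lemma hs_tail (T : eqType) (F : T -> R[i]) S (b : T -> R) (d : R) (r s : seq T) :
 hs F S -> (forall i, nc (F i) <= b i) ->
 (forall B, uniq B -> \sum_(i <- B | i \notin r) b i <= d) ->
 uniq s -> {subset r <= s} -> nc (\sum_(i <- s) F i - S) <= d.
Proof.
move=> hF Fb Hr us rs; apply/ler_addgt0Pr => eps e0.
have [A HA] := hF _ e0.
pose B := undup (s ++ A).
have uB : uniq B by rewrite undup_uniq.
have sB : {subset s <= B} by move=> i si; rewrite mem_undup mem_cat si.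
have AB : {subset A <= B} by move=> i si; rewrite mem_undup mem_cat si orbT.
have := HA B uB AB; rewrite (sum_split F us uB sB).
set X := \sum_(i <- s) F i; set Y := \sum_(i <- B | _) F i => h.
have hY : nc Y <= d.
 apply: le_trans (nc_sum _ _ _) _; apply: le_trans (Hr B uB).
 have b0 i : 0 <= b i := le_trans (nc_ge0 _) (Fb i).
 rewrite [leLHS]big_mkcond [leRHS]big_mkcond/=; apply: ler_sum => i _.
 case: ifPn => [si|_]; last by case: ifP.
 by case: ifPn => // /negPn /rs; rewrite (negbTE si).
have -> : X - S = (X + Y - S) - Y by ring.
apply: le_trans (ncBD _ _) _; lra.
Qed.

Lemma cIntB u v : cc u -> cc v -> cInt u - cInt v = cInt (fun t => u t - v t).
Proof.
move=> cu cv; rewrite -mulN1r -cIntZ// -cIntD//; last exact: ccZ.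
by congr cInt; apply/funext => t; rewrite mulN1r.
Qed.

Lemma poisson_zr a (B : nat) t : cc a -> out B%:R (fun s => a (s + t)) ->
 hs (fun n : int => ft a n%:~R * ee (n%:~R * t)) (\sum_(j <- zr B) a (j%:~R + t)).
Proof.
move=> ca oB; have := poisson (cc_shift t ca) oB.
rewrite (sum_zr B (fun s => a (s + t))); apply: hs_ext => n.
rewrite /ft -(cInt_shift t (u := fun s => a s * ee (- n%:~R * s))); last first.
 by apply: ccM => //; exact: csm_ee.
rewrite mulrC -cIntZ; last first.
 by apply: (cc_shift t (u := fun s => a s * ee (- n%:~R * s))); apply: ccM => //; exact: csm_ee.
congr cInt; apply/funext => s.
rewrite mulrCA; congr (_ * _); rewrite -eD; congr ee; ring.
Qed.

Lemma ft_int_bound a : cc a -> exists2 C, 0 <= C & forall n : int, nc (ft a n%:~R) <= C * wt1 n.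
Proof.
move=> ca.
have [C0 HC0] := ft_decay 0 ca; have [C1 HC1] := ft_decay 1 ca; have [C2 HC2] := ft_decay 2 ca.
pose C := 2 * C0 + 3 * C1 + C2.
have Cb (n : int) : nc (ft a n%:~R) <= C * wt1 n.
 rewrite /wt1 ler_pdivlMr ?mulr_gt0 ?ltr_wpDr//.
 have := HC0 n%:~R; have := HC1 n%:~R; have := HC2 n%:~R.
 rewrite expr1 expr0 mul1r -intr_norm -abszE /C.
 set x : R := (`|n|%N)%:~R; have -> : (`|n|%N)%:R = x by [].
 set y := nc _; lra.
by exists C => //; have := le_trans (nc_ge0 _) (Cb 0); rewrite pmulr_lge0// wt1_gt0.
Qed.

Lemma cc_shiftl u (c : R) : cc u -> cc (fun t => u (c + t)).
Proof.
move=> cu; rewrite (_ : (fun t => _) = fun t => u (t + c)); first exact: cc_shift.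
by apply/funext => t; rewrite addrC.
Qed.

Lemma ft_conj b w : cc b -> ((ft b w)^*)%C = cInt (fun t => ee (w * t) * ((b t)^*)%C).
Proof.
move=> cb; rewrite /ft -cIntJ; last by apply: ccM => //; exact: csm_ee.
congr cInt; apply/funext => t.
have -> : ee (w * t) = ((ee (- w * t))^*)%C by rewrite -eN mulNr opprK.
by rewrite rmorphM mulrC.
Qed.

(** Poisson summation expands the periodisation of [a] at t, with tails small uniformly in t;
    multiply by the conjugate of [b] and integrate over the support of [b]. *)
Lemma parseval a b (A B : nat) : cc a -> cc b -> out A%:R a -> out B%:R b ->
 hs (fun n : int => ft a n%:~R * ((ft b n%:~R)^*)%C)
   (\sum_(j <- zr (A + B)) cInt (fun t => a (j%:~R + t) * ((b t)^*)%C)).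
Proof.
move=> ca cb oA oB.
have [C C0 Cb] := ft_int_bound ca.
have [B' [K [B'0 K0 oB' bK]]] := cc_bounded cb.
have oAt t : `|t| <= B%:R -> out (A + B)%:R (fun s => a (s + t)).
 move=> tB s sAB; apply: oA; have := ler_normD (s + t) (- t).
 by rewrite addrK normrN; move: sAB; rewrite natrD; lra.
have w0 (n : int) : 0 <= C * wt1 n by rewrite mulr_ge0// ltW// wt1_gt0.
move=> eps e0; pose d := eps / (4 * (B' + 1) * (K + 1)).
have K1 : 0 < K + 1 by rewrite ltr_wpDl.
have D0 : 0 < 4 * (B' + 1) * (K + 1) by rewrite !mulr_gt0// ltr_wpDl.
have d0 : 0 < d by rewrite divr_gt0.
have [r ur Hr] := bs_tail w0 (bsZ C0 bs_wt1) d0.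
exists r => s us rs.
have cA n : cc (fun t => ft a n * (ee (n * t) * ((b t)^*)%C)).
 by apply: ccZ; apply: ccMl; [exact: csm_ee|exact: cc_conj].
have cP (j : int) : cc (fun t => a (j%:~R + t) * ((b t)^*)%C).
 by apply: ccMl; [case: (cc_shiftl j%:~R ca)|exact: cc_conj].
have -> : \sum_(n <- s) ft a n%:~R * ((ft b n%:~R)^*)%C =
  cInt (fun t => \sum_(n <- s) ft a n%:~R * (ee (n%:~R * t) * ((b t)^*)%C)).
 rewrite cInt_sum//; apply: eq_bigr => n _; rewrite ft_conj// cIntZ//.
 by apply: ccMl; [exact: csm_ee|exact: cc_conj].
rewrite -cInt_sum// cIntB; [|by apply: cc_sum..].
have cs1 : cc (fun t => \sum_(n <- s) ft a n%:~R * (ee (n%:~R * t) * ((b t)^*)%C)) by exact: cc_sum.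
have cs2 : cc (fun t => \sum_(j <- zr (A + B)) a (j%:~R + t) * ((b t)^*)%C) by exact: cc_sum.
have -> : eps = 4 * (B' + 1) * (d * (K + 1)).
 by rewrite /d; field; rewrite !gt_eqF// ltr_wpDl.
apply: cInt_bound => //.
- have := ccD cs1 (ccZ (-1) cs2); rewrite (_ : (fun x => _ + _) =
  fun t => \sum_(n <- s) ft a n%:~R * (ee (n%:~R * t) * ((b t)^*)%C) -
   \sum_(j <- zr (A + B)) a (j%:~R + t) * ((b t)^*)%C) => [[]//|].
 by apply/funext => t; rewrite mulN1r.
- move=> t tB; rewrite oB'// conjc0 !big1 ?subrr// => i _; rewrite !mulr0//.
- move=> t; have [tB|tB] := leP B%:R `|t|.
  rewrite (oB _ tB) conjc0 (eq_bigr (fun=> 0)) => [|i _]; last by rewrite !mulr0.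
  rewrite big1_eq (eq_bigr (fun=> 0)) => [|i _]; last by rewrite mulr0.
  by rewrite big1_eq subrr nc0; exact: mulr_ge0 (ltW d0) (ltW K1).
 rewrite -mulr_suml.
 under eq_bigr do rewrite mulrA.
 rewrite -mulr_suml -mulrBl ncM nc_conj ler_pM ?nc_ge0//; last first.
  by rewrite (le_trans (bK _))// lerDl.
 apply: (hs_tail (poisson_zr ca (oAt t (ltW tB))) (b := fun n : int => C * wt1 n)) => //.
  by move=> i; rewrite ncM nc_e mulr1.
  exact: Hr.
 exact: rs.
Qed.

Lemma cc_out_nat u : cc u -> exists B : nat, forall A : nat, (B <= A)%N -> out A%:R u.
Proof.
move=> /cc_bounded[B [_ [B0 _ oB _]]]; exists (Num.truncn B).+1 => A BA.
by apply: out_le oB; rewrite (le_trans (ltW (truncnS_gt B)))// ler_nat.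
Qed.

(* The short-time Fourier transform [<u, pi(x, w) v>] on the real line. *)
Definition V1 u v x w := ft (fun t => u t * ((v (t - x))^*)%C) w.

Lemma cc_V1 u v x : cc u -> cc v -> cc (fun t => u t * ((v (t - x))^*)%C).
Proof. by move=> cu [sv _]; apply: ccM => //; apply: csm_conj; exact: csm_shift. Qed.
Lemma V1_out u v x w B : out B u -> out B v -> 2 * B <= `|x| -> V1 u v x w = 0.
Proof.
move=> ou ov xB; rewrite /V1 /ft -[RHS]cInt0; congr cInt; apply/funext => t.
have [tB|tB] := leP B `|t|; first by rewrite ou// !mul0r.
rewrite ov ?conjc0 ?mulr0 ?mul0r//.
have := ler_normB (t - x) t; rewrite [t - x - t]addrAC subrr add0r normrN; lra.
Qed.

(** For fixed time shift m, [parseval] turns the sum over frequencies into a sum over translations j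
    of the integrals [Q m j]. The second sum leads to the same integrals with m and j exchanged and
    negated. *)
Lemma figa1 f g f' g' : cc f -> cc g -> cc f' -> cc g' -> exists S,
 hs (fun p : int * int => V1 f g p.1%:~R p.2%:~R * ((V1 f' g' p.1%:~R p.2%:~R)^*)%C) S /\
 hs (fun p : int * int => V1 g' g p.1%:~R p.2%:~R * ((V1 f' f p.1%:~R p.2%:~R)^*)%C) S.
Proof.
move=> cf cg cf' cg'.
have [B [of_ og of' og']] : exists B : nat, [/\ out B%:R f, out B%:R g, out B%:R f' & out B%:R g'].
 have [B1 H1] := cc_out_nat cf; have [B2 H2] := cc_out_nat cg.
 have [B3 H3] := cc_out_nat cf'; have [B4 H4] := cc_out_nat cg'.
 exists (maxn (maxn B1 B2) (maxn B3 B4)); split; [apply: H1|apply: H2|apply: H3|apply: H4];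
  by rewrite !leq_max leqnn ?orbT.
have outM u v x : out B%:R u -> out B%:R (fun t => u t * ((v (t - x))^*)%C).
 by move=> ou t tB; rewrite ou// mul0r.
pose Q (m j : int) := cInt (fun t => f (j%:~R + t) * ((g (j%:~R + t - m%:~R))^*)%C *
 ((f' t * ((g' (t - m%:~R))^*)%C)^*)%C).
have zr0 u v u' v' (m n : int) : out B%:R u -> out B%:R v -> m \notin zr (2 * B) ->
  V1 u v m%:~R n%:~R * ((V1 u' v' m%:~R n%:~R)^*)%C = 0.
 move=> ou ov; rewrite mem_zr -ltnNge => mB.
 rewrite (V1_out _ ou ov) ?mul0r// -natrM -intr_norm -abszE.
 by rewrite (_ : (`|m|%N)%:~R = (`|m|%N)%:R :> R)// ler_nat ltnW.
exists (\sum_(m <- zr (2 * B)) \sum_(j <- zr (2 * B)) Q m j); split.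
 apply: hs_rows => [|m n mB|m]; [exact: zr_uniq|exact: zr0|].
 have := parseval (cc_V1 m%:~R cf cg) (cc_V1 m%:~R cf' cg') (outM _ _ _ of_) (outM _ _ _ of').
 by rewrite addnn -mul2n.
rewrite exchange_big/= sum_zrN.
apply: hs_rows => [|m n mB|m]; [exact: zr_uniq|exact: zr0|].
rewrite sum_zrN.
have := parseval (cc_V1 m%:~R cg' cg) (cc_V1 m%:~R cf' cf) (outM _ _ _ og') (outM _ _ _ of').
rewrite addnn -mul2n; congr (hs _ _); apply: eq_bigr => j _.
rewrite /Q; congr cInt; apply/funext => t; rewrite !rmorphN/= !rmorphM/= !conjcK.
have -> : - m%:~R + t - - j%:~R = j%:~R + t - m%:~R :> R by ring.
have -> : - m%:~R + t = t - m%:~R :> R by ring.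
have -> : t - - j%:~R = j%:~R + t :> R by ring.
ring.
Qed.

Lemma V1_ft_decay k u v : cc u -> cc v -> exists2 C, 0 <= C &
 forall x w, `|w| ^+ k * nc (V1 u v x w) <= C.
Proof.
elim: k u v => [|k IH] u v cu cv.
 have [B [K [B0 K0 oB uK]]] := cc_bounded cu.
 have [_ [K' [_ K'0 _ vK]]] := cc_bounded cv.
 exists (4 * (B + 1) * (K * K')); first by rewrite !mulr_ge0// addr_ge0.
 move=> x w; rewrite expr0 mul1r /V1 /ft; apply: cInt_bound => //.
 - by have [s _] := cc_V1 x cu cv; apply: csmM => //; exact: csm_ee.
 - by move=> t tB; rewrite oB// !mul0r.
 - by move=> t; rewrite !ncM nc_e mulr1 nc_conj ler_pM ?nc_ge0.
have [u' su' uu'] : exists2 u', csm u' & cdv u u' by case: cu => /csm_dv.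
have [v' sv' vv'] : exists2 v', csm v' & cdv v v' by case: cv => /csm_dv.
have cu' := cc_dv cu su' uu'; have cv' := cc_dv cv sv' vv'.
have [C C0 HC] := IH u' v cu' cv; have [C' C'0 HC'] := IH u v' cu cv'.
exists (C + C'); first exact: addr_ge0.
move=> x w.
have h : tpi w * V1 u v x w = V1 u' v x w + V1 u v' x w.
 have d := cdvM uu' (cdv_conj (cdv_shift (- x) vv')).
 have c1 := cc_V1 x cu' cv; have c2 := cc_V1 x cu cv'.
 rewrite /V1 (ft_dv _ (cc_V1 x cu cv) _ d); last by case: (ccD c1 c2).
 rewrite /ft -cIntD; [|by apply: ccM => //; exact: csm_ee..].
 by congr cInt; apply/funext => t; rewrite mulrDl.
have h2 : `|w| * nc (V1 u v x w) <= nc (V1 u' v x w) + nc (V1 u v' x w).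
 apply: le_trans (ncD _ _); rewrite -h ncM nc_tpi -[leRHS]mulrA ler_peMl ?mulr_ge0 ?nc_ge0//.
 by have := @pi_ge2 R; lra.
rewrite exprSr -mulrA (le_trans (ler_wpM2l _ h2)) ?exprn_ge0// mulrDr lerD//.
Qed.

(** Compact supports exclude large x, and integration by parts gives the decay in w. *)
Lemma V1_decay L u v : cc u -> cc v -> exists2 C, 0 <= C &
 forall x w, (1 + `|x| + `|w|) ^+ L * nc (V1 u v x w) <= C.
Proof.
move=> cu cv.
have [B ou ov] : exists2 B : nat, out B%:R u & out B%:R v.
 have [B1 H1] := cc_out_nat cu; have [B2 H2] := cc_out_nat cv.
 by exists (maxn B1 B2); [apply: H1|apply: H2]; rewrite leq_max leqnn ?orbT.
have [C0 C00 H0] := V1_ft_decay 0 cu cv; have [C C_0 HC] := V1_ft_decay L cu cv.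
pose D : R := 1 + 2 * B%:R.
have D1 : 1 <= D by rewrite lerDl.
exists (2 ^+ L * (D ^+ L * C0 + C)).
 by rewrite mulr_ge0 ?exprn_ge0// addr_ge0// mulr_ge0// exprn_ge0// (le_trans _ D1).
move=> x w; have [xB|xB] := leP (2 * B%:R) `|x|.
 rewrite (V1_out _ ou ov)// nc0 mulr0 mulr_ge0 ?exprn_ge0// addr_ge0// mulr_ge0// exprn_ge0//.
 by rewrite (le_trans _ D1).
have := H0 x w; rewrite expr0 mul1r => h0; have hC := HC x w.
have y0 := nc_ge0 (V1 u v x w); set y := nc _ in h0 hC y0 *.
have le1 : (1 + `|x| + `|w|) ^+ L <= 2 ^+ L * (D ^+ L + `|w| ^+ L).
 apply: (@le_trans _ _ ((2 * Num.max D `|w|) ^+ L)).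
  rewrite lerXn2r ?nnegrE ?addr_ge0 ?mulr_ge0 ?le_max ?(le_trans ler01 D1)//.
  have [h|h] := leP D `|w|; move: D1 xB h; rewrite /D; lra.
 rewrite exprMn ler_wpM2l ?exprn_ge0//.
 by case: (leP D `|w|) => _; rewrite ?lerDl ?lerDr exprn_ge0// (le_trans ler01 D1).
rewrite (le_trans (ler_wpM2r y0 le1))// -mulrA ler_wpM2l ?exprn_ge0// mulrDl lerD//.
by rewrite ler_wpM2l// exprn_ge0// (le_trans ler01 D1).
Qed.

Lemma cc_lipschitz u : cc u -> exists2 K, 0 <= K & forall x y, nc (u x - u y) <= K * `|x - y|.
Proof.
move=> cu; have [b sb [abR abI]] : exists2 b, csm b & cdv u b by case: cu => /csm_dv.
have [_ [K [_ K0 _ bK]]] := cc_bounded (cc_dv cu sb (conj abR abI)).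
exists (K + K) => [|x y]; first exact: addr_ge0.
rewrite (le_trans (nc_le_ReIm _))// RecD ImcD RecN ImcN mulrDl lerD//.
 by apply: (dv_lipschitz _ _ abR) => t; rewrite (le_trans (Re_le_nc _)).
by apply: (dv_lipschitz _ _ abI) => t; rewrite (le_trans (Im_le_nc _)).
Qed.

Lemma V1_lipschitz u v : cc u -> cc v -> exists2 C, 0 <= C &
 forall x w x' w', nc (V1 u v x w - V1 u v x' w') <= C * (`|x - x'| + `|w - w'|).
Proof.
move=> cu cv.
have [B [K [B0 K0 oB uK]]] := cc_bounded cu.
have [_ [K' [_ K'0 _ vK]]] := cc_bounded cv.
have [Kv Kv0 vL] := cc_lipschitz cv.
pose E := Kv + K' * (4 * pi * B).
have P0 := @pi_ge0 R.
have E0 : 0 <= K' * (4 * pi * B) by rewrite !mulr_ge0.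
exists (4 * (B + 1) * (K * E)); first by rewrite !mulr_ge0 ?addr_ge0.
move=> x w x' w'.
have c1 x1 w1 : cc (fun t => u t * ((v (t - x1))^*)%C * ee (- w1 * t)).
 by apply: ccM; [exact: cc_V1|exact: csm_ee].
rewrite /V1 /ft cIntB// -[leRHS]mulrA; apply: cInt_bound => //.
- have [+ _] := ccD (c1 x w) (ccZ (-1) (c1 x' w')).
 by under eq_fun do rewrite mulN1r.
- by move=> t tB; rewrite oB// !mul0r subrr.
- move=> t; rewrite -!mulrA -mulrBr ncM.
 have [tB|tB] := leP B `|t|; first by rewrite oB// nc0 mul0r !mulr_ge0// addr_ge0.
 rewrite ler_pM ?nc_ge0//.
 set a := ((v (t - x))^*)%C; set a' := ((v (t - x'))^*)%C.
 have -> : a * ee (- w * t) - a' * ee (- w' * t) =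
  (a - a') * ee (- w * t) + a' * (ee (- w * t) - ee (- w' * t)) by ring.
 rewrite (le_trans (ncD _ _))// !ncM nc_e mulr1 /a /a' -rmorphB !nc_conj.
 have h1 := vL (t - x) (t - x').
 have e1 : t - x - (t - x') = - (x - x') by ring.
 rewrite e1 normrN in h1.
 have h2 := nc_eB (- w * t) (- w' * t).
 have e2 : - w * t - - w' * t = - (w - w') * t by ring.
 rewrite e2 normrM normrN in h2.
 have h3 : nc (v (t - x')) * nc (ee (- w * t) - ee (- w' * t)) <= K' * (4 * pi * B) * `|w - w'|.
  rewrite -mulrA ler_pM ?nc_ge0// (le_trans h2)//.
  by rewrite -[leRHS]mulrA [B * _]mulrC ler_wpM2l ?mulr_ge0// ler_wpM2l// (ltW tB).
 rewrite /E mulrDl mulrDr mulrDr.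
 have : 0 <= Kv * `|w - w'| by rewrite mulr_ge0.
 have : 0 <= K' * (4 * pi * B) * `|x - x'| by rewrite mulr_ge0.
 lra.
Qed.

End ambiguity.

(** * Tensor products and the class of nice functions *)

Section tensors.
Context {R : realType}.

Definition ten (V : pzSemiRingType) n (u : 'I_n -> R -> V) (x : 'rV[R]_n) : V := \prod_i u i (x ord0 i).

Lemma cs_out_nat (f : R -> R) : cs f -> exists B : nat, forall A : nat, (B <= A)%N -> out A%:R f.
Proof.
move=> [_ [B oB]]; exists (Num.truncn B).+1 => A BA.
by apply: out_le oB; rewrite (le_trans (ltW (truncnS_gt B)))// ler_nat.
Qed.

Lemma cs_dv (f : R -> R) : cs f -> exists2 g, cs g & dv f g.
Proof.
move=> [sf [B oB]]; have [g sg fg] := sm_dv sf; exists g => //; split=> //.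
by exists (`|B| + 1); exact: dv_out oB fg.
Qed.

Lemma csM (f g : R -> R) : cs f -> sm g -> cs (fun x => f x * g x).
Proof.
move=> [sf [B oB]] sg; split; first exact: smM.
by exists B => x xB; rewrite oB// mul0r.
Qed.

(** Finite sums of products of one-variable functions: stable under products and partial
    derivatives, dense in L2, and with integrals that factor into one-dimensional ones. *)
Inductive rnice n : ('rV[R]_n -> R) -> Prop :=
| rn_ten c (u : 'I_n -> R -> R) : (forall i, cs (u i)) -> rnice (fun x => c * ten u x)
| rn_D f g : rnice f -> rnice g -> rnice (fun x => f x + g x).

Lemma rnZ n c (f : 'rV[R]_n -> R) : rnice f -> rnice (fun x => c * f x).
Proof.
elim=> {f} [k u cu|f g _ If _ Ig].
 by under eq_fun do rewrite mulrA; exact: rn_ten.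
by under eq_fun do rewrite mulrDr; exact: rn_D.
Qed.

Lemma cs0 : cs (fun _ : R => 0 : R).
Proof. by split; [exact: sm_cst|exists 0]. Qed.
Lemma rn0 n : rnice (fun _ : 'rV[R]_n => 0).
Proof.
have := @rn_ten n 0 (fun _ _ => 0) (fun=> cs0).
by under eq_fun do rewrite mul0r.
Qed.

Lemma rn_sum n I (r : seq I) (F : I -> 'rV[R]_n -> R) : (forall i, rnice (F i)) ->
 rnice (fun x => \sum_(i <- r) F i x).
Proof.
move=> rF; elim: r => [|i r IH]; first by under eq_fun do rewrite big_nil; exact: rn0.
by under eq_fun do rewrite big_cons; exact: rn_D.
Qed.

Lemma rnM n (f g : 'rV[R]_n -> R) : rnice f -> rnice g -> rnice (fun x => f x * g x).
Proof.
move=> + rg; elim=> {f} [k u cu|f f' _ If _ If']; last first.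
 by under eq_fun do rewrite mulrDl; exact: rn_D.
elim: rg => {g} [l v cv|g g' _ Ig _ Ig']; last first.
 by under eq_fun do rewrite mulrDr; exact: rn_D.
rewrite (_ : (fun x => _) = fun x => (k * l) * ten (fun i t => u i t * v i t) x).
 by apply: rn_ten => i; apply: csM => //; case: (cv i).
by apply/funext => x; rewrite /ten big_split/=; ring.
Qed.

Lemma rn_diff n (f : 'rV[R]_n -> R) x : rnice f -> differentiable f x.
Proof.
elim=> {f} [c u cu|f g _ If _ Ig]; last by apply: (@differentiableD _ _ _ f g).
apply: (@differentiableM _ _ (fun=> c) (ten u)); first exact: differentiable_cst.
rewrite /ten; elim: (index_enum _) => [|i r IH].
 by under eq_fun do rewrite big_nil; exact: differentiable_cst.
under eq_fun do rewrite big_cons.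
apply: (@differentiableM _ _ (fun x : 'rV[R]_n => u i (x ord0 i))) => //.
apply: (@differentiable_comp _ _ _ _ (fun x : 'rV[R]_n => x ord0 i : R) (u i)).
 exact: differentiable_coord.
have [g _ ug] := cs_dv (cu i).
by apply/derivable1_diffP; have [] := ug (x ord0 i).
Qed.

Lemma is_derive_line n (f : 'rV[R]_n -> R) (x v : 'rV[R]_n) (df : R) :
 is_derive (0 : R) (1 : R) (fun t => f (x + t *: v)) df -> is_derive x v f df.
Proof.
move=> [h1 h2].
have E : (fun h : R => h^-1 *: ((f \o shift x) (h *: v) - f x)) =
  (fun h : R => h^-1 *: (((fun t => f (x + t *: v)) \o shift (0 : R)) (h *: (1 : R)) -
   (fun t => f (x + t *: v)) (0 : R))).
 apply/funext => h /=; have e1 : h *: (1 : R) = h := mulr1 h.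
 by rewrite /shift e1 addr0 scale0r addr0 [h *: v + x]addrC.
split; first by rewrite /derivable E.
by rewrite /derive E.
Qed.

Lemma rn_partial n (f : 'rV[R]_n -> R) i : rnice f ->
 exists2 g, rnice g & forall x, is_derive x (delta_mx ord0 i : 'rV[R]_n) f (g x).
Proof.
elim=> {f} [c u cu|f f' _ [g rg Hg] _ [g' rg' Hg']]; last first.
 exists (fun x => g x + g' x) => [|x]; first exact: rn_D.
 exact: (@is_deriveD _ _ _ f f').
have [g cg ug] := cs_dv (cu i).
pose v j := if j == i then g else u j.
exists (fun x => c * ten v x) => [|x].
 by apply: rn_ten => j; rewrite /v; case: eqP.
apply: is_derive_line.
pose K := c * \prod_(j | j != i) u j (x ord0 j).
have -> : (fun t : R => c * ten u (x + t *: delta_mx ord0 i)) =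
  (fun t => K * u i (1 * t + x ord0 i)).
 apply/funext => t; rewrite /ten (bigD1 i)//= !mxE !eqxx mulr1 mul1r addrC.
 rewrite [u i _ * _]mulrC mulrA; congr (_ * _ * _); apply: eq_bigr => j /negbTE ji.
 by rewrite !mxE ji andbF mulr0 addr0.
have := dvM (dv_cst K) (dv_affine 1 (x ord0 i) ug) 0.
rewrite mul0r add0r mul1r mulr0 add0r; congr is_derive.
rewrite /ten (bigD1 i)//= {1}/v eqxx /K -mulrA; congr (_ * _); rewrite mulrC; congr (_ * _).
by apply: eq_bigr => j /negbTE ji; rewrite /v ji.
Qed.

Lemma rn_partials n (f : 'rV[R]_n -> R) s : rnice f -> rnice (partials s f).
Proof.
move=> rf; elim: s => //= i s IH; have [g rg Hg] := rn_partial i IH.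
rewrite (_ : 'D_ _ _ = g)//; apply/funext => x.
by have [_ <-] := Hg x.
Qed.

Lemma rn_smooth n (f : 'rV[R]_n -> R) : rnice f -> smooth f.
Proof. by move=> rf s x; apply: rn_diff; exact: rn_partials. Qed.
Lemma rn_bounded n (f : 'rV[R]_n -> R) : rnice f -> exists (B : nat) (K : R),
 [/\ 0 <= K, forall x, `|f x| <= K & forall x : 'rV[R]_n, (exists i, B%:R <= `|x ord0 i|) -> f x = 0].
Proof.
elim=> {f} [c u cu|f g _ [B [K [K0 fK oB]]] _ [B' [K' [K'0 gK oB']]]]; last first.
 exists (maxn B B'), (K + K'); split=> [||x [i xB]]; first exact: addr_ge0.
  by move=> x; rewrite (le_trans (ler_normD _ _))// lerD.
 rewrite oB ?oB' ?addr0//; exists i; rewrite (le_trans _ xB)// ler_nat ?leq_maxl ?leq_maxr//.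
have [B HB] := choice (fun i => cs_out_nat (cu i)).
have HK0 i : exists K, 0 <= K /\ forall x, `|u i x| <= K by have [K] := cs_bounded (cu i); exists K.
have [K HK] := choice HK0.
exists (\max_i B i)%N, (`|c| * \prod_i K i); split.
- by rewrite mulr_ge0// prodr_ge0// => i _; case: (HK i).
- move=> x; rewrite normrM ler_wpM2l// /ten normr_prod; apply: ler_prod => i _.
 by rewrite normr_ge0/=; case: (HK i).
- move=> x [i xB]; rewrite /ten (bigD1 i)//= (HB i (\max_i B i)%N) ?mul0r ?mulr0//.
 exact: leq_bigmax.
Qed.

Lemma measurable_ten n (u : 'I_n -> R -> R) : (forall i, continuous (u i)) ->
 measurable_fun [set: 'rV[R]_n] (ten u).
Proof.
move=> cu; apply: measurable_prod => i _.
apply: (measurableT_comp (f := u i) (g := rV_coord i)); first exact: continuous_measurable_fun.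
exact: measurable_rV_coord.
Qed.

Lemma ten_cons n (V : pzSemiRingType) (u : 'I_n.+1 -> R -> V) p :
 ten u (cons_rV p) = u ord0 p.1 * ten (fun i => u (lift ord0 i)) p.2.
Proof.
rewrite /ten big_ord_recl cons_rV0; congr (_ * _).
by apply: eq_bigr => i _; rewrite cons_rVS.
Qed.

(** Fubini along [cons_rV], the map through which the measure on the space of dimension n + 1 is
    built. *)
Lemma int_ten n (u : 'I_n -> R -> R) : (forall i, cs (u i)) ->
 (lebesgue_rV n).-integrable setT (EFin \o ten u) /\
 (\int[lebesgue_rV n]_x (ten u x)%:E = (\prod_i Int (u i))%:E)%E.
Proof.
elim: n u => [|n IH] u cu.
 have E x : ten u x = 1 by rewrite /ten big_ord0.
 split.
  rewrite (_ : EFin \o _ = cst 1%E); last by apply/funext => x /=; rewrite E.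
  apply/integrableP; split; first exact: measurable_cst.
  rewrite integral_cst//= normr1 mul1e diracE in_setT ltry//.
 rewrite (eq_integral (fun=> 1%:E))=> [|x _]; last by rewrite E.
 by rewrite integral_cst//= diracE in_setT mul1e big_ord0.
have [intI valI] := IH (fun i => u (lift ord0 i)) (fun i => cu _).
set T := ten (fun i => u (lift ord0 i)) in intI valI.
have cT i : continuous (u i) by apply: sm_continuous; case: (cu i).
have mT : measurable_fun setT T by exact: measurable_ten.
have mu0 : measurable_fun setT (u ord0) by exact: continuous_measurable_fun.
have i0 := cs_integrable (cu ord0).
have E : (EFin \o ten u) \o (@cons_rV R n) = fun p => (u ord0 p.1 * T p.2)%:E.
 by apply/funext => p /=; rewrite ten_cons.
have mE : measurable_fun setT (fun p : measurableTypeR R * 'rV[R]_n => (u ord0 p.1 * T p.2)%:E).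
 apply/measurable_EFinP; apply: measurable_funM.
  exact: (measurableT_comp mu0 measurable_fst).
 exact: (measurableT_comp mT measurable_snd).
have ip : (lebesgue_measure \x lebesgue_rV n)%E.-integrable setT
  (fun p : measurableTypeR R * 'rV[R]_n => (u ord0 p.1 * T p.2)%:E).
 apply/integrable12ltyP => //=.
 move/integrableP : intI => [mT' fT]; move/integrableP : i0 => [m0 f0].
 rewrite (eq_integral (fun x : measurableTypeR R => (\int[lebesgue_rV n]_y `|(T y)%:E|) * `|(u ord0 x)%:E|)%E).
  rewrite ge0_integralZl//=.
  - rewrite lte_mul_pinfty//; first exact: integral_ge0.
   by rewrite ge0_fin_numE//; exact: integral_ge0.
  - exact: (measurableT_comp (f := @abse R) (g := EFin \o u ord0)).
  - exact: integral_ge0.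
 move=> x _; rewrite muleC -ge0_integralZl//=; last exact: (measurableT_comp (f := @abse R) (g := EFin \o T)).
 by apply: eq_integral => y _; rewrite normrM EFinM.
split.
 have mt : measurable_fun setT (EFin \o ten u) by apply/measurable_EFinP; exact: measurable_ten.
 apply: (@integrable_pushforward _ _ _ _ R _ (@measurable_cons_rV R n)
  (lebesgue_measure \x lebesgue_rV n)%E setT (EFin \o ten u) mt _ measurableT).
 by rewrite preimage_setT E.
rewrite /=.
rewrite (integral_pushforward (measurable_cons_rV (n := n)))//=; last first.
- by rewrite preimage_setT E.
- by apply/measurable_EFinP; exact: measurable_ten.
under eq_integral do rewrite ten_cons.
rewrite preimage_setT -(integral12_prod_meas1 ip) /fubini_F/=.
rewrite (eq_integral (fun x : measurableTypeR R => ((\prod_i Int (u (lift ord0 i)))%:E * (u ord0 x)%:E)%E)).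
 rewrite integralZl// big_ord_recl mulrC EFinM; congr (_ * _)%E.
 rewrite /Int /Rintegral fineK//; exact: integrable_fin_num.
move=> x _; rewrite -valI muleC -integralZl//.
Qed.

Lemma rn_measurable n (f : 'rV[R]_n -> R) : rnice f -> measurable_fun setT f.
Proof.
elim=> {f} [c u cu|f g _ If _ Ig]; last exact: measurable_funD.
apply: measurable_funM; first exact: measurable_cst.
by apply: measurable_ten => i; apply: sm_continuous; case: (cu i).
Qed.

Lemma rn_integrable n (f : 'rV[R]_n -> R) : rnice f ->
 (lebesgue_rV n).-integrable setT (EFin \o f).
Proof.
elim=> {f} [c u cu|f g _ If _ Ig]; last exact: (@integrableD _ _ _ _ _ _ (EFin \o f) (EFin \o g)).
have [iu _] := int_ten cu.
exact: (@integrableZl _ _ _ _ _ _ c (EFin \o ten u)).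
Qed.

Definition RI n (f : 'rV[R]_n -> R) := Rintegral (lebesgue_rV n) setT f.

Lemma RI_ten n c (u : 'I_n -> R -> R) : (forall i, cs (u i)) ->
 RI (fun x => c * ten u x) = c * \prod_i Int (u i).
Proof.
move=> cu; have [iu vu] := int_ten cu.
by rewrite /RI RintegralZl// /Rintegral vu.
Qed.

Lemma RI_D n (f g : 'rV[R]_n -> R) : rnice f -> rnice g -> RI (fun x => f x + g x) = RI f + RI g.
Proof. by move=> rf rg; rewrite /RI RintegralD//; exact: rn_integrable. Qed.
Lemma RI_Z n c (f : 'rV[R]_n -> R) : rnice f -> RI (fun x => c * f x) = c * RI f.
Proof. by move=> rf; rewrite /RI RintegralZl//; exact: rn_integrable. Qed.
Lemma RI_sum n I (r : seq I) (F : I -> 'rV[R]_n -> R) : (forall i, rnice (F i)) ->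
 RI (fun x => \sum_(i <- r) F i x) = \sum_(i <- r) RI (F i).
Proof.
move=> rF; elim: r => [|i r IH].
 under eq_fun do rewrite big_nil; have := RI_Z 0 (rn0 n).
 by under eq_fun do rewrite mulr0; rewrite mul0r big_nil.
under eq_fun do rewrite big_cons.
by rewrite RI_D ?IH ?big_cons//; exact: rn_sum.
Qed.

Lemma RI_le n (f g : 'rV[R]_n -> R) : rnice f -> rnice g -> (forall x, f x <= g x) -> RI f <= RI g.
Proof. by move=> rf rg fg; apply: le_Rintegral => //; exact: rn_integrable. Qed.

Inductive nice n : ('rV[R]_n -> R[i]) -> Prop :=
| n_ten c (u : 'I_n -> R -> R[i]) : (forall i, cc (u i)) -> nice (fun x => c * ten u x)
| n_D f g : nice f -> nice g -> nice (fun x => f x + g x).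

Definition pick2 (V : Type) (b : bool) (x y : V) := if b then x else y.

(** Expanding a product of terms a + ib over the choices of real or imaginary part writes a complex
    tensor product as a combination of real ones. *)
Lemma prod_ReIm n (z : 'I_n -> R[i]) : \prod_i z i =
 \sum_(p : {ffun 'I_n -> bool}) (\prod_i pick2 (p i) 1 'i%C) *
  (\prod_i pick2 (p i) (Re (z i)) (Im (z i)))%:C%C.
Proof.
have E i : z i = \sum_(b : bool) pick2 b 1 'i%C * (pick2 b (Re (z i)) (Im (z i)))%:C%C.
 rewrite big_bool/= mul1r; case: (z i) => a b /=.
 by apply/eqP; rewrite eq_complex/=; apply/andP; split; apply/eqP; ring.
under eq_bigr do rewrite E.
rewrite bigA_distr_bigA; apply: eq_bigr => p _.
rewrite big_split/= rmorph_prod//.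
Qed.

Lemma Re_cr (z : R[i]) (x : R) : Re (z * x%:C%C) = Re z * x.
Proof. by rewrite RecM/= mulr0 subr0. Qed.
Lemma Im_cr (z : R[i]) (x : R) : Im (z * x%:C%C) = Im z * x.
Proof. by rewrite ImcM/= mulr0 add0r. Qed.
Definition part n (p : {ffun 'I_n -> bool}) (u : 'I_n -> R -> R[i]) (i : 'I_n) (t : R) : R :=
 pick2 (p i) (Re (u i t)) (Im (u i t)).

Lemma cs_part n p (u : 'I_n -> R -> R[i]) : (forall i, cc (u i)) -> forall i, cs (part p u i).
Proof.
move=> cu i; have [cR cI] := cc_cs (cu i); rewrite (_ : part p u i =
 if p i then Re \o u i else Im \o u i); first by case: (p i).
by apply/funext => t; rewrite /part /pick2; case: (p i).
Qed.

Lemma ten_parts n (c : R[i]) (u : 'I_n -> R -> R[i]) x : c * ten u x =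
 \sum_(p : {ffun 'I_n -> bool}) (c * \prod_i pick2 (p i) 1 'i%C) * (ten (part p u) x)%:C%C.
Proof.
rewrite /ten prod_ReIm mulr_sumr; apply: eq_bigr => p _.
by rewrite mulrA.
Qed.

Lemma nice_ReIm n (f : 'rV[R]_n -> R[i]) : nice f -> rnice (Re \o f) /\ rnice (Im \o f).
Proof.
elim=> {f} [c u cu|f g _ [If1 If2] _ [Ig1 Ig2]]; last first.
 split; [rewrite (_ : _ \o _ = fun x => Re (f x) + Re (g x))|
  rewrite (_ : _ \o _ = fun x => Im (f x) + Im (g x))]; try exact: rn_D;
  by apply/funext => x /=; rewrite ?RecD ?ImcD.
split.
 rewrite (_ : _ \o _ = fun x => \sum_(p : {ffun 'I_n -> bool})
  Re (c * \prod_i pick2 (p i) 1 'i%C) * ten (part p u) x).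
  by apply: rn_sum => p; apply: rn_ten; exact: cs_part.
 by apply/funext => x /=; rewrite ten_parts ReE_sum; apply: eq_bigr => p _; rewrite Re_cr.
rewrite (_ : _ \o _ = fun x => \sum_(p : {ffun 'I_n -> bool})
 Im (c * \prod_i pick2 (p i) 1 'i%C) * ten (part p u) x).
 by apply: rn_sum => p; apply: rn_ten; exact: cs_part.
by apply/funext => x /=; rewrite ten_parts ImE_sum; apply: eq_bigr => p _; rewrite Im_cr.
Qed.

Lemma complexRI (z : R[i]) : z = (Re z)%:C%C + 'i%C * (Im z)%:C%C.
Proof. by case: z => a b; apply/eqP; rewrite eq_complex/=; apply/andP; split; apply/eqP; ring. Qed.
Lemma RI_Re n c (u : 'I_n -> R -> R[i]) : (forall i, cc (u i)) ->
 cintegral (fun x => c * ten u x) = c * \prod_i cInt (u i).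
Proof.
move=> cu; rewrite prod_ReIm mulr_sumr.
have E (p : {ffun 'I_n -> bool}) : \prod_i pick2 (p i) (Re (cInt (u i))) (Im (cInt (u i))) = \prod_i Int (part p u i).
 by apply: eq_bigr => i _; rewrite /part /pick2 /cInt/=; case: (p i).
rewrite /cintegral.
have -> : Re \o (fun x => c * ten u x) = fun x => \sum_(p : {ffun 'I_n -> bool})
  Re (c * \prod_i pick2 (p i) 1 'i%C) * ten (part p u) x.
 by apply/funext => x /=; rewrite ten_parts ReE_sum; apply: eq_bigr => p _; rewrite Re_cr.
have -> : Im \o (fun x => c * ten u x) = fun x => \sum_(p : {ffun 'I_n -> bool})
  Im (c * \prod_i pick2 (p i) 1 'i%C) * ten (part p u) x.
 by apply/funext => x /=; rewrite ten_parts ImE_sum; apply: eq_bigr => p _; rewrite Im_cr.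
rewrite -/(RI _) -/(RI _) !RI_sum; [|by move=> p; apply: rn_ten; exact: cs_part..].
apply/eqP; rewrite eq_complex/= ReE_sum ImE_sum; apply/andP; split; apply/eqP;
 apply: eq_bigr => p _; (rewrite RI_ten; last exact: cs_part);
 by rewrite mulrA E ?Re_cr ?Im_cr.
Qed.

Lemma cintegralD n (f g : 'rV[R]_n -> R[i]) : nice f -> nice g ->
 cintegral (fun x => f x + g x) = cintegral f + cintegral g.
Proof.
move=> /nice_ReIm[fR fI] /nice_ReIm[gR gI]; rewrite /cintegral.
have -> : Re \o (fun x => f x + g x) = fun x => (Re \o f) x + (Re \o g) x.
 by apply/funext => x /=; rewrite RecD.
have -> : Im \o (fun x => f x + g x) = fun x => (Im \o f) x + (Im \o g) x.
 by apply/funext => x /=; rewrite ImcD.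
rewrite -!/(RI _) !RI_D//.
Qed.

Lemma niceZ n c (f : 'rV[R]_n -> R[i]) : nice f -> nice (fun x => c * f x).
Proof.
elim=> {f} [k u cu|f g _ If _ Ig].
 by under eq_fun do rewrite mulrA; exact: n_ten.
by under eq_fun do rewrite mulrDr; exact: n_D.
Qed.

Lemma nice0 n : nice (fun _ : 'rV[R]_n => 0).
Proof.
have := @n_ten n 0 (fun _ _ => 0) (fun=> cc0).
by under eq_fun do rewrite mul0r.
Qed.

Lemma nice_sum n I (r : seq I) (F : I -> 'rV[R]_n -> R[i]) : (forall i, nice (F i)) ->
 nice (fun x => \sum_(i <- r) F i x).
Proof.
move=> rF; elim: r => [|i r IH]; first by under eq_fun do rewrite big_nil; exact: nice0.
by under eq_fun do rewrite big_cons; exact: n_D.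
Qed.

Lemma nice_conj n (f : 'rV[R]_n -> R[i]) : nice f -> nice (fun x => ((f x)^*)%C).
Proof.
elim=> {f} [k u cu|f g _ If _ Ig]; last first.
 by under eq_fun do rewrite rmorphD; exact: n_D.
rewrite (_ : (fun x => _) = fun x => (k^*)%C * ten (fun i t => ((u i t)^*)%C) x).
 by apply: n_ten => i; exact: cc_conj.
by apply/funext => x; rewrite rmorphM/= /ten rmorph_prod.
Qed.

Lemma niceM n (f g : 'rV[R]_n -> R[i]) : nice f -> nice g -> nice (fun x => f x * g x).
Proof.
move=> + rg; elim=> {f} [k u cu|f f' _ If _ If']; last first.
 by under eq_fun do rewrite mulrDl; exact: n_D.
elim: rg => {g} [l v cv|g g' _ Ig _ Ig']; last first.
 by under eq_fun do rewrite mulrDr; exact: n_D.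
rewrite (_ : (fun x => _) = fun x => (k * l) * ten (fun i t => u i t * v i t) x).
 by apply: n_ten => i; apply: ccM => //; case: (cv i).
by apply/funext => x; rewrite /ten big_split/=; ring.
Qed.

Lemma nice_schwartz n (f : 'rV[R]_n -> R[i]) : nice f -> schwartz f.
Proof.
move=> /nice_ReIm[fR fI]; split; first by split; exact: rn_smooth.
move=> a s; have [B1 [K1 [K10 H1 O1]]] := rn_bounded (rn_partials s fR).
have [B2 [K2 [K20 H2 O2]]] := rn_bounded (rn_partials s fI).
exists ((\prod_(i < n) (maxn B1 B2)%:R ^+ a i) * (K1 + K2)) => x.
rewrite ncM nc_real.
have P0 : 0 <= \prod_(i < n) ((maxn B1 B2)%:R ^+ a i : R) by rewrite prodr_ge0// => i _; rewrite exprn_ge0.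
have [[i xi]|/forallNP nx] := pselect (exists i, (maxn B1 B2)%:R <= `|x ord0 i|).
 rewrite /cpartials O1 ?O2; last 2 first.
 - by exists i; rewrite (le_trans _ xi)// ler_nat leq_maxr.
 - by exists i; rewrite (le_trans _ xi)// ler_nat leq_maxl.
 by rewrite -[(0 +i* 0)%C]/(0 : R[i]) nc0 mulr0 mulr_ge0// addr_ge0.
rewrite ler_pM ?nc_ge0//; last by rewrite (le_trans (nc_le_ReIm _))//= lerD.
rewrite /monomial normr_prod; apply: ler_prod => i _; rewrite normrX exprn_ge0//=.
by rewrite lerXn2r ?nnegrE//; have /negP := nx i; rewrite -ltNge => /ltW.
Qed.

End tensors.

(** * Existence and stability of absolutely convergent sums *)

Section sums.
Context {R : realType}.

Lemma cjM (x y : R[i]) : ((x * y)^*)%C = (x^*)%C * (y^*)%C. Proof. exact: rmorphM. Qed.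
Lemma cjD (x y : R[i]) : ((x + y)^*)%C = (x^*)%C + (y^*)%C. Proof. exact: rmorphD. Qed.
Lemma cjK (x : R[i]) : ((x^*)^*)%C = x. Proof. exact: conjcK. Qed.
Lemma hs_ge0_ex (T : eqType) (f : T -> R) M : (forall i, 0 <= f i) -> bs f M ->
 exists S, hs (fun i => (f i)%:C%C) S%:C%C.
Proof.
move=> f0 fM; pose E := [set s | exists2 A : seq T, uniq A & s = \sum_(i <- A) f i].
have Esup : has_sup E.
 split; first by exists 0; exists [::] => //; rewrite big_nil.
 by exists M => s [A uA ->]; exact: fM.
exists (sup E) => eps e0.
have [s [A uA ->] hA] := sup_adherent e0 Esup.
exists A => B uB AB.
have h1 : \sum_(i <- A) f i <= \sum_(i <- B) f i.
 by rewrite (sum_split f uA uB AB) lerDl; apply: sumr_ge0.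
have h2 : \sum_(i <- B) f i <= sup E.
 by apply: ub_le_sup; [exact: Esup.2|exists B].
rewrite -rmorph_sum -rmorphB nc_real ler_norml; lra.
Qed.

(** Reduction to nonnegative families, where the sum is a supremum: split into real and imaginary
    parts, then each into (|h| + h)/2 and (|h| - h)/2. *)
Lemma hs_ex (T : eqType) (F : T -> R[i]) M : bs (fun i => nc (F i)) M -> exists S, hs F S.
Proof.
move=> FM.
have P (h : R[i] -> R) : (forall z, `|h z| <= nc z) -> exists S, hs (fun i => (h (F i))%:C%C) S.
 move=> hn.
 have [S1 H1] : exists S, hs (fun i => ((`|h (F i)| + h (F i)) / 2)%:C%C) S%:C%C.
  apply: (@hs_ge0_ex _ _ M) => [i|].
   by rewrite divr_ge0// -[X in X + _]opprK addrC subr_ge0; have := ler_norm (- h (F i)); rewrite normrN; lra.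
  apply: bs_le FM => i; have := hn (F i); have := ler_norm (h (F i)); lra.
 have [S2 H2] : exists S, hs (fun i => ((`|h (F i)| - h (F i)) / 2)%:C%C) S%:C%C.
  apply: (@hs_ge0_ex _ _ M) => [i|].
   by have := ler_norm (h (F i)); lra.
  apply: bs_le FM => i; have := hn (F i); have := ler_norm (- h (F i)); rewrite normrN; lra.
 exists (S1%:C%C + (-1) * S2%:C%C); apply: hs_ext (hsD H1 (hsZ (-1) H2)) => i.
 by rewrite mulN1r -rmorphB; congr (_%:C)%C; field.
have [S1 H1] := P Re (@Re_le_nc R); have [S2 H2] := P Im (@Im_le_nc R).
exists (S1 + 'i%C * S2); apply: hs_ext (hsD H1 (hsZ 'i%C H2)) => i.
by rewrite -complexRI.
Qed.

(** The finite set and the tolerance depend on the majorant alone, so the estimate is uniform over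
    all families below it; this is what the passage to the limit in the lattice uses. *)
Lemma hs_close (T : eqType) (b : T -> R) M (eps : R) : (forall i, 0 <= b i) -> bs b M -> 0 < eps ->
 exists (A : seq T) (d : R), 0 < d /\ forall F F' S S',
  (forall i, nc (F i) <= b i) -> (forall i, nc (F' i) <= b i) -> hs F S -> hs F' S' ->
  (forall i, i \in A -> nc (F i - F' i) <= d) -> nc (S - S') <= eps.
Proof.
move=> b0 bM e0; have e3 : 0 < eps / 3 by rewrite divr_gt0.
have [A uA HA] := bs_tail b0 bM e3.
exists A, (eps / 3 / (size A).+1%:R); split; first by rewrite divr_gt0.
move=> F F' S S' Fb F'b hF hF' FA.
have h1 := hs_tail hF Fb HA uA (fun x h => h).
have h2 := hs_tail hF' F'b HA uA (fun x h => h).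
have h3 : nc (\sum_(i <- A) F i - \sum_(i <- A) F' i) <= eps / 3.
 rewrite -sumrB (le_trans (nc_sum _ _ _))//.
 apply: (@le_trans _ _ (\sum_(i <- A) (eps / 3 / (size A).+1%:R))).
  by rewrite big_seq [leRHS]big_seq; apply: ler_sum => i iA; exact: FA.
 rewrite big_const_seq count_predT iter_addr_0 -[leLHS]mulr_natr; move: (ltW e3).
 by set y := eps / 3 => y0; rewrite mulrAC -mulrA ler_piMr// ler_pdivrMr// mul1r ler_nat.
have -> : S - S' = (\sum_(i <- A) F i - \sum_(i <- A) F' i) - (\sum_(i <- A) F i - S) +
 (\sum_(i <- A) F' i - S') by ring.
rewrite (le_trans (ncD _ _))//; have := ncBD (\sum_(i <- A) F i - \sum_(i <- A) F' i) (\sum_(i <- A) F i - S); lra.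
Qed.

End sums.

(** * Norms of vectors and matrices, decay along a lattice *)

Section norms.
Context {R : realType}.

Definition l1 m (z : 'rV[R]_m) : R := \sum_j `|z ord0 j|.
Definition nm m n (M : 'M[R]_(m, n)) : R := \sum_i \sum_j `|M i j|.

Lemma l1_ge0 m (z : 'rV[R]_m) : 0 <= l1 z. Proof. exact: sumr_ge0. Qed.
Lemma nm_ge0 m n (M : 'M[R]_(m, n)) : 0 <= nm M.
Proof. by apply: sumr_ge0 => i _; exact: sumr_ge0. Qed.
Lemma l1_le m (z : 'rV[R]_m) j : `|z ord0 j| <= l1 z.
Proof. by rewrite /l1 (bigD1 j)//= lerDl sumr_ge0. Qed.
Lemma l1D m (z w : 'rV[R]_m) : l1 (z + w) <= l1 z + l1 w.
Proof. by rewrite /l1 -big_split; apply: ler_sum => j _; rewrite mxE ler_normD. Qed.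
Lemma l1N m (z : 'rV[R]_m) : l1 (- z) = l1 z.
Proof. by apply: eq_bigr => j _; rewrite mxE normrN. Qed.
Lemma l1B m (z w : 'rV[R]_m) : l1 (z - w) = l1 (w - z).
Proof. by rewrite -l1N opprB. Qed.
Lemma l1Z m c (z : 'rV[R]_m) : l1 (c *: z) = `|c| * l1 z.
Proof. by rewrite /l1 mulr_sumr; apply: eq_bigr => j _; rewrite mxE normrM. Qed.
Lemma l1_0 m : l1 (0 : 'rV[R]_m) = 0.
Proof. by rewrite /l1 big1// => j _; rewrite mxE normr0. Qed.
Lemma l1_mul m n (z : 'rV[R]_m) (M : 'M[R]_(m, n)) : l1 (z *m M) <= nm M * l1 z.
Proof.
rewrite /l1 /nm exchange_big/= mulr_suml; apply: ler_sum => j _.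
rewrite mxE (le_trans (ler_norm_sum _ _ _))// mulr_suml; apply: ler_sum => i _.
by rewrite normrM mulrC ler_wpM2l//; exact: l1_le.
Qed.
Lemma nm_le m n (M : 'M[R]_(m, n)) (d : R) : (forall i j, `|M i j| <= d) -> nm M <= (m * n)%:R * d.
Proof.
move=> Md; rewrite /nm (le_trans (ler_sum _ (fun i _ => ler_sum _ (fun j _ => Md i j))))//.
by rewrite big_const_ord iter_addr_0 sumr_const card_ord -mulrnA mulr_natl mulnC.
Qed.
Lemma l1_row m n (z : 'rV[R]_m) (w : 'rV[R]_n) : l1 (row_mx z w) = l1 z + l1 w.
Proof.
rewrite /l1 big_split_ord; congr (_ + _); apply: eq_bigr => j _.
 by rewrite row_mxEl.
by rewrite row_mxEr.
Qed.
Lemma prod_ge_sum I (r : seq I) (a : I -> R) : (forall i, 0 <= a i) ->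
 1 + \sum_(i <- r) a i <= \prod_(i <- r) (1 + a i).
Proof.
move=> a0; elim: r => [|i r IH]; first by rewrite !big_nil addr0.
rewrite !big_cons; have s0 : 0 <= \sum_(j <- r) a j by exact: sumr_ge0.
have := a0 i; set S := \sum_(j <- r) _ in IH s0 *; set P := \prod_(j <- r) _ in IH *.
by move: IH; nra.
Qed.

Lemma wt_l1 m (k : 'rV[int]_m) (x : R) : (forall j, `|k ord0 j|%N%:R <= x) ->
 ((1 + x) ^+ (2 * m))^-1 <= 2 ^+ m * wt k.
Proof.
move=> kx; rewrite /wt -{2}(card_ord m) -prodr_const -big_split/=.
rewrite exprM -[X in _ ^+ X](card_ord m) -prodr_const -prodfV; apply: ler_prod => j _.
have x0 : 0 <= (`|k ord0 j|)%N%:R :> R by [].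
have xx := kx j; have x1 : 0 <= x := le_trans x0 xx.
rewrite invr_ge0 exprn_ge0 ?addr_ge0//=.
rewrite /wt1; set a := (`|k ord0 j|)%N%:R in x0 xx *.
have X0 : 0 < (1 + x) ^+ 2 by rewrite exprn_gt0// ltr_wpDr.
have Y0 : 0 < (1 + a) * (2 + a) by rewrite mulr_gt0// ltr_wpDr.
by rewrite ler_pdivlMr// mulrC ler_pdivrMr// expr2; nra.
Qed.

(** Two powers of decay per coordinate suffice to dominate by the summable weight [wt]; the lower
    bound c carries the decay from lattice points to integer coordinates. *)
Lemma bs_decay m (M : 'M[R]_m) (F : 'rV[R]_m -> R[i]) (C c : R) : 0 < c ->
 (forall k : 'rV[int]_m, c * l1 (map_mx intr k) <= l1 (map_mx intr k *m M)) ->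
 0 <= C -> (forall z, nc (F z) <= C * ((1 + l1 z) ^+ (2 * m))^-1) -> forall k : 'rV[int]_m,
 nc (F (map_mx intr k *m M)) <= C * (1 + c^-1) ^+ (2 * m) * 2 ^+ m * wt k.
Proof.
move=> c0 kM C0 FC k; rewrite (le_trans (FC _))// -!mulrA ler_wpM2l//.
have h j : `|k ord0 j|%N%:R <= l1 (map_mx intr k : 'rV[R]_m).
 by rewrite (le_trans _ (l1_le _ j))// mxE -intr_norm -abszE.
apply: (@le_trans _ _ ((1 + c^-1) ^+ (2 * m) * ((1 + l1 (map_mx intr k : 'rV[R]_m)) ^+ (2 * m))^-1)).
 have kMk := kM k; have z1 := l1_ge0 (map_mx intr k : 'rV[R]_m).
 have z2 := l1_ge0 (map_mx intr k *m M).
 have V0 : 0 < c^-1 by rewrite invr_gt0.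
 rewrite -exprVn -[X in _ <= _ * X]exprVn -exprMn lerXn2r ?nnegrE ?mulr_ge0 ?invr_ge0 ?addr_ge0 ?(ltW V0)//.
 rewrite ler_pdivlMr ?ltr_wpDr// mulrC ler_pdivrMr ?ltr_wpDr//.
 have : l1 (map_mx intr k : 'rV[R]_m) <= c^-1 * l1 (map_mx intr k *m M).
  by rewrite -[leLHS](mulKf (lt0r_neq0 c0)) ler_wpM2l// ltW.
 by nra.
by rewrite ler_wpM2l ?exprn_ge0 ?addr_ge0 ?invr_ge0 ?(ltW c0)//; exact: wt_l1.
Qed.

End norms.

(** * The short-time Fourier transform of nice functions *)

Section stft.
Context {R : realType} (d : nat).
Implicit Types (f g : 'rV[R]_d -> R[i]) (z w a b : 'rV[R]_(d + d)).

Definition V f g z : R[i] := L2inner f (tfshift z g).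

Lemma L2innerE f g : L2inner f g = cintegral (fun x => f x * ((g x)^*)%C).
Proof. by []. Qed.
Lemma tf_ten z c (u : 'I_d -> R -> R[i]) : tfshift z (fun x => c * ten u x) =
 fun t => c * ten (fun i t => ee (rsubmx z ord0 i * t) * u i (t - lsubmx z ord0 i)) t.
Proof.
apply/funext => t; rewrite /tfshift -/(ee _) /dotr e_sum mulrCA; congr (_ * _).
rewrite /ten big_split/=; congr (_ * _); apply: eq_bigr => i _.
by rewrite !mxE.
Qed.

Lemma cc_tf (u : R -> R[i]) (x w : R) : cc u -> cc (fun t => ee (w * t) * u (t - x)).
Proof. by move=> cu; apply: ccMl; [exact: csm_ee|exact: cc_shift]. Qed.
Lemma tfD z f g : tfshift z (fun x => f x + g x) = fun x => tfshift z f x + tfshift z g x.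
Proof. by apply/funext => t; rewrite /tfshift mulrDr. Qed.
Lemma tfZ z c f : tfshift z (fun x => c * f x) = fun x => c * tfshift z f x.
Proof. by apply/funext => t; rewrite /tfshift mulrCA. Qed.
Lemma tf_sum z I (r : seq I) (F : I -> 'rV[R]_d -> R[i]) :
 tfshift z (fun x => \sum_(i <- r) F i x) = fun x => \sum_(i <- r) tfshift z (F i) x.
Proof. by apply/funext => t; rewrite /tfshift mulr_sumr. Qed.
Lemma tf0 f : tfshift 0 f = f.
Proof.
apply/funext => t; rewrite /tfshift -/(ee _) /dotr big1 ?e0 ?mul1r => [|i _].
 by congr f; apply/rowP => i; rewrite !mxE subr0.
by rewrite !mxE mul0r.
Qed.

(** The cocycle of the composition of time-frequency shifts; its antisymmetrisation is the
    symplectic form, see [symp_beta]. *)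
Definition beta z w : R := dotr (lsubmx z) (rsubmx w).

Lemma tf_comp z w f : tfshift z (tfshift w f) = fun t => ee (- beta z w) * tfshift (z + w) f t.
Proof.
apply/funext => t; rewrite /tfshift -!/(ee _) !mulrA -!eD; congr (ee _ * f _).
 rewrite /beta /dotr -sumrN -!big_split/=; apply: eq_bigr => i _; rewrite !mxE; ring.
by apply/rowP => i; rewrite !mxE opprD addrA.
Qed.

Lemma nice_tf z f : nice f -> nice (tfshift z f).
Proof.
elim=> {f} [c u cu|f g _ If _ Ig]; last by rewrite tfD; exact: n_D.
by rewrite tf_ten; apply: n_ten => i; exact: cc_tf.
Qed.

Lemma L2inner_ten c c' (u v : 'I_d -> R -> R[i]) : (forall i, cc (u i)) -> (forall i, cc (v i)) ->
 L2inner (fun x => c * ten u x) (fun x => c' * ten v x) =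
 c * (c'^*)%C * \prod_i cInt (fun t => u i t * ((v i t)^*)%C).
Proof.
move=> cu cv; rewrite !L2innerE -RI_Re => [|i]; last by apply: ccM => //; apply: csm_conj; case: (cv i).
congr cintegral; apply/funext => x; rewrite cjM /ten rmorph_prod big_split/=; ring.
Qed.

Lemma L2innerDl f f' g : nice f -> nice f' -> nice g ->
 L2inner (fun x => f x + f' x) g = L2inner f g + L2inner f' g.
Proof.
move=> nf nf' ng; rewrite !L2innerE -cintegralD.
- by congr cintegral; apply/funext => x; rewrite mulrDl.
- by apply: niceM => //; exact: nice_conj.
- by apply: niceM => //; exact: nice_conj.
Qed.

Lemma L2innerDr f g g' : nice f -> nice g -> nice g' ->
 L2inner f (fun x => g x + g' x) = L2inner f g + L2inner f g'.
Proof.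
move=> nf nf' ng; rewrite !L2innerE -cintegralD.
- by congr cintegral; apply/funext => x; rewrite rmorphD mulrDr.
- by apply: niceM => //; exact: nice_conj.
- by apply: niceM => //; exact: nice_conj.
Qed.

Lemma cintegralZ n c (f : 'rV[R]_n -> R[i]) : nice f -> cintegral (fun x => c * f x) = c * cintegral f.
Proof.
elim=> {f} [k u cu|f g nf If ng Ig].
 by under eq_fun do rewrite mulrA; rewrite !RI_Re// mulrA.
under eq_fun do rewrite mulrDr.
by rewrite !cintegralD ?If ?Ig ?mulrDr//; exact: niceZ.
Qed.

Lemma L2innerZl c f g : nice f -> nice g -> L2inner (fun x => c * f x) g = c * L2inner f g.
Proof.
move=> nf ng; rewrite !L2innerE -cintegralZ; last by apply: niceM => //; exact: nice_conj.
by congr cintegral; apply/funext => x; rewrite mulrA.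
Qed.

Lemma L2innerZr c f g : nice f -> nice g -> L2inner f (fun x => c * g x) = (c^*)%C * L2inner f g.
Proof.
move=> nf ng; rewrite !L2innerE -cintegralZ; last by apply: niceM => //; exact: nice_conj.
by congr cintegral; apply/funext => x; rewrite cjM mulrCA.
Qed.

Lemma L2inner_suml I (r : seq I) (F : I -> 'rV[R]_d -> R[i]) g : (forall i, nice (F i)) -> nice g ->
 L2inner (fun x => \sum_(i <- r) F i x) g = \sum_(i <- r) L2inner (F i) g.
Proof.
move=> nF ng; elim: r => [|i r IH].
 rewrite big_nil; under eq_fun do rewrite big_nil; have := L2innerZl 0 (nice0 (R := R) d) ng.
 by under [in L2inner _ _]eq_fun do rewrite mul0r; rewrite mul0r.
under eq_fun do rewrite big_cons.
by rewrite L2innerDl ?IH ?big_cons//; exact: nice_sum.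
Qed.

Lemma cintegral_conj n (f : 'rV[R]_n -> R[i]) : nice f ->
 cintegral (fun x => ((f x)^*)%C) = ((cintegral f)^*)%C.
Proof.
move=> /nice_ReIm[rR rI]; rewrite /cintegral.
have -> : Re \o (fun x => ((f x)^*)%C) = Re \o f by apply/funext => x /=; rewrite RecJ.
have -> : Im \o (fun x => ((f x)^*)%C) = fun x => (-1) * (Im \o f) x.
 by apply/funext => x /=; rewrite ImcJ mulN1r.
by rewrite -!/(RI _) RI_Z// mulN1r.
Qed.

Lemma L2inner_conj f g : nice f -> nice g -> L2inner g f = ((L2inner f g)^*)%C.
Proof.
move=> nf ng; rewrite !L2innerE -cintegral_conj; last by apply: niceM => //; exact: nice_conj.
by congr cintegral; apply/funext => x; rewrite cjM cjK mulrC.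
Qed.

Lemma L2inner_sumr I (r : seq I) (F : I -> 'rV[R]_d -> R[i]) f : (forall i, nice (F i)) -> nice f ->
 L2inner f (fun x => \sum_(i <- r) F i x) = \sum_(i <- r) L2inner f (F i).
Proof.
move=> nF nf; have ns : nice (fun x => \sum_(i <- r) F i x) by exact: nice_sum.
rewrite (L2inner_conj ns nf) L2inner_suml// conj_sum; apply: eq_bigr => i _.
by rewrite -L2inner_conj.
Qed.

Lemma L2inner_tf1 (u v : R -> R[i]) (xa wa xb wb : R) : cc u -> cc v ->
 cInt (fun t => ee (wa * t) * u (t - xa) * ((ee (wb * t) * v (t - xb))^*)%C) =
 ee (- (xa * (wb - wa))) * V1 u v (xb - xa) (wb - wa).
Proof.
move=> cu cv; rewrite -(cInt_shift xa); last first.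
 by apply: ccM; [exact: cc_tf|apply: csm_conj; case: (cc_tf xb wb cv)].
rewrite /V1 /ft -cIntZ; last by apply: ccM; [exact: cc_V1|exact: csm_ee].
congr cInt; apply/funext => t; rewrite addrK cjM -eN.
have -> : t + xa - xb = t - (xb - xa) by ring.
have -> : - (wb * (t + xa)) = - (xa * (wb - wa)) + - (wb - wa) * t + - (wa * (t + xa)) by ring.
rewrite !eD; have := eNM (wa * (t + xa)).
move: (ee (- (wa * (t + xa)))) (ee (wa * (t + xa))) => s p h.
move: (ee (- (xa * (wb - wa)))) (ee (- (wb - wa) * t)) => q r.
transitivity (p * s * (q * (u t * ((v (t - (xb - xa)))^*)%C * r))); first by ring.
by rewrite h mul1r.
Qed.

Lemma V_ten c c' (u v : 'I_d -> R -> R[i]) z : (forall i, cc (u i)) -> (forall i, cc (v i)) ->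
 V (fun x => c * ten u x) (fun x => c' * ten v x) z =
 c * (c'^*)%C * \prod_i V1 (u i) (v i) (lsubmx z ord0 i) (rsubmx z ord0 i).
Proof.
move=> cu cv; rewrite /V tf_ten L2inner_ten//; last by move=> i; exact: cc_tf.
congr (_ * _); apply: eq_bigr => i _.
have := @L2inner_tf1 (u i) (v i) 0 0 (lsubmx z ord0 i) (rsubmx z ord0 i) (cu i) (cv i).
rewrite !subr0 mul0r oppr0 e0 mul1r => <-; congr cInt; apply/funext => t.
by rewrite mul0r e0 mul1r addr0.
Qed.

Lemma V_Dl f f' g z : nice f -> nice f' -> nice g ->
 V (fun x => f x + f' x) g z = V f g z + V f' g z.
Proof. by move=> nf nf' ng; apply: L2innerDl => //; exact: nice_tf. Qed.
Lemma V_Dr f g g' z : nice f -> nice g -> nice g' ->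
 V f (fun x => g x + g' x) z = V f g z + V f g' z.
Proof. by move=> nf ng ng'; rewrite /V tfD L2innerDr//; exact: nice_tf. Qed.
Lemma V_cov f g a b : nice f -> nice g ->
 L2inner (tfshift a f) (tfshift b g) = ee (- beta a (b - a)) * V f g (b - a).
Proof.
move=> nf ng; elim: nf => {f} [c u cu|f f' nf If nf' If']; last first.
 by rewrite tfD L2innerDl ?If ?If' ?V_Dl ?mulrDr//; exact: nice_tf.
elim: ng => {g} [c' v cv|g g' ng Ig ng' Ig']; last first.
 have nu : nice (fun x => c * ten u x) by exact: n_ten.
 by rewrite tfD L2innerDr ?Ig ?Ig' ?V_Dr ?mulrDr//; exact: nice_tf.
rewrite V_ten// !tf_ten L2inner_ten; [|by move=> i; exact: cc_tf..].
rewrite mulrCA; congr (_ * _); rewrite /beta /dotr -sumrN e_sum -big_split/=; apply: eq_bigr => i _.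
by rewrite L2inner_tf1// !mxE.
Qed.

Lemma l1_split z : l1 z = \sum_i (`|lsubmx z ord0 i| + `|rsubmx z ord0 i|).
Proof. by rewrite -[LHS]/(l1 z) -{1}(hsubmxK z) l1_row /l1 -big_split. Qed.
(** The product over i of 1 + |x_i| + |w_i| dominates 1 + l1 z, so decay in each time-frequency
    plane is enough. *)
Lemma V_decay L f g : nice f -> nice g -> exists2 C, 0 <= C &
 forall z, nc (V f g z) <= C * ((1 + l1 z) ^+ L)^-1.
Proof.
move=> nf ng; elim: nf => {f} [c u cu|f f' nf [C C0 If] nf' [C' C'0 If']]; last first.
 exists (C + C') => [|z]; first exact: addr_ge0.
 by rewrite V_Dl// (le_trans (ncD _ _))// mulrDl lerD.
elim: ng => {g} [c' v cv|g g' ng [C C0 If] ng' [C' C'0 If']]; last first.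
 have nu : nice (fun x => c * ten u x) by exact: n_ten.
 exists (C + C') => [|z]; first exact: addr_ge0.
 by rewrite V_Dr// (le_trans (ncD _ _))// mulrDl lerD.
have HC i : exists C, 0 <= C /\ forall x w : R, (1 + `|x| + `|w|) ^+ L * nc (V1 (u i) (v i) x w) <= C.
 by have [C C0 H] := V1_decay L (cu i) (cv i); exists C.
have [C CP] := choice HC.
exists (nc (c * (c'^*)%C) * \prod_i C i).
 by rewrite mulr_ge0 ?nc_ge0// prodr_ge0// => i _; case: (CP i).
move=> z; rewrite V_ten// ncM -mulrA ler_wpM2l ?nc_ge0//.
have z0 := l1_ge0 z.
rewrite ler_pdivlMr ?exprn_gt0 ?ltr_wpDr//.
apply: (@le_trans _ _ (\prod_i ((1 + `|lsubmx z ord0 i| + `|rsubmx z ord0 i|) ^+ L *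
  nc (V1 (u i) (v i) (lsubmx z ord0 i) (rsubmx z ord0 i))))); last first.
 apply: ler_prod => i _; have [_ ->] := CP i; by rewrite andbT mulr_ge0 ?nc_ge0 ?exprn_ge0 ?addr_ge0.
rewrite big_split/= nc_prod mulrC ler_wpM2r//.
 by rewrite prodr_ge0// => i _; exact: nc_ge0.
rewrite prodrXl lerXn2r ?nnegrE ?addr_ge0//.
 by rewrite prodr_ge0// => i _; rewrite addr_ge0// addr_ge0.
rewrite l1_split; under [leRHS]eq_bigr do rewrite -addrA.
by apply: prod_ge_sum => i; rewrite addr_ge0.
Qed.

Lemma V_lip f g : nice f -> nice g -> exists2 C, 0 <= C &
 forall z w, nc (V f g z - V f g w) <= C * l1 (z - w).
Proof.
move=> nf ng; elim: nf => {f} [c u cu|f f' nf [C C0 If] nf' [C' C'0 If']]; last first.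
 exists (C + C') => [|z w]; first exact: addr_ge0.
 rewrite !V_Dl// opprD addrACA (le_trans (ncD _ _))// mulrDl lerD//.
elim: ng => {g} [c' v cv|g g' ng [C C0 If] ng' [C' C'0 If']]; last first.
 have nu : nice (fun x => c * ten u x) by exact: n_ten.
 exists (C + C') => [|z w]; first exact: addr_ge0.
 by rewrite !V_Dr// opprD addrACA (le_trans (ncD _ _))// mulrDl lerD.
have HC i : exists C, 0 <= C /\ forall x w : R, nc (V1 (u i) (v i) x w) <= C.
 have [C C0 H] := V1_decay 0 (cu i) (cv i); exists C; split=> // x w.
 by have := H x w; rewrite expr0 mul1r.
have [M MP] := choice HC.
have HL i : exists C, 0 <= C /\ forall x w x' w' : R, nc (V1 (u i) (v i) x w - V1 (u i) (v i) x' w') <=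
  C * (`|x - x'| + `|w - w'|).
 by have [C C0 H] := V1_lipschitz (cu i) (cv i); exists C.
have [L LP] := choice HL.
pose M' := 1 + \sum_i M i; pose L' := \sum_i L i.
have M0 : 0 <= \sum_i M i by apply: sumr_ge0 => i _; case: (MP i).
have L0 : 0 <= L' by apply: sumr_ge0 => i _; case: (LP i).
have M'1 : 1 <= M' by rewrite lerDl.
have bM i (x w : R) : nc (V1 (u i) (v i) x w) <= M'.
 rewrite (le_trans (proj2 (MP i) x w))// /M' (bigD1 i)//= addrCA lerDl addr_ge0//.
 by apply: sumr_ge0 => j _; case: (MP j).
exists (nc (c * (c'^*)%C) * (d%:R * M' ^+ d * L')).
 by rewrite !mulr_ge0 ?nc_ge0 ?exprn_ge0 ?(le_trans ler01 M'1).
move=> z w; rewrite !V_ten//.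
rewrite -mulrBr [leLHS]ncM.
rewrite -[leRHS]mulrA.
rewrite ler_wpM2l ?nc_ge0//. rewrite -[leRHS]mulrA.
apply: nc_prodB => // i; rewrite (le_trans (proj2 (LP i) _ _ _ _))// ler_pM//.
- by case: (LP i).
- by rewrite /L' (bigD1 i)//= lerDl; apply: sumr_ge0 => j _; case: (LP j).
- rewrite l1_split (bigD1 i)//= !mxE lerDl sumr_ge0// => j _; by rewrite addr_ge0.
Qed.

End stft.

(** * Lattices in row coordinates and perturbation of matrices *)

Section matrices.
Context {R : realType}.

Lemma ee1_int (t : R) : ee t = 1 -> t \is a Num.int.
Proof.
move=> h; pose u := t - (Num.floor t)%:~R.
have hu : ee u = 1 by rewrite /u eB h e_int conjc1 mulr1.
have u0 : 0 <= u by rewrite /u subr_ge0 ge_floor.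
have u1 : u < 1 by rewrite /u ltrBlDl; have := floorD1_gt t; rewrite intrD.
have t_u : t = u + (Num.floor t)%:~R by rewrite /u subrK.
have [u00|un0] := eqVneq u 0; first by rewrite t_u u00 add0r intr_int.
have up : 0 < u by rewrite lt_neqAle eq_sym un0.
have /(congr1 (@complex.Re _)) := hu; rewrite /ee /expi/=.
have -> : 2 * pi * u = pi * u + pi * u by ring.
have P := @pi_gt0 R.
have s0 : 0 < sin (pi * u).
 by apply: sin_gt0_pi; rewrite mulr_gt0//= -[ltRHS]mulr1 ltr_pM2l.
by rewrite cosD; have := cos2Dsin2 (pi * u); rewrite !expr2; nra.
Qed.

Lemma invmx_uniq n (A B : 'M[R]_n) : A *m B = 1%:M -> invmx A = B.
Proof. by move=> AB; have [uA _] := mulmx1_unit AB; rewrite -[B]mul1mx -(mulVmx uA) -mulmxA AB mulmx1. Qed.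
Lemma invmx_mul n (A B : 'M[R]_n) : A \in unitmx -> B \in unitmx ->
 invmx (A *m B) = invmx B *m invmx A.
Proof. by move=> uA uB; apply: invmx_uniq; rewrite -mulmxA (mulmxA B) mulmxV// mul1mx mulmxV. Qed.
Lemma unitmx_opp (T : comUnitRingType) n (A : 'M[T]_n) : (- A \in unitmx) = (A \in unitmx).
Proof. by rewrite -scaleN1r unitmxZ// unitrN1. Qed.
Lemma cj_prod I (r : seq I) (P : pred I) (F : I -> R[i]) :
 ((\prod_(i <- r | P i) F i)^*)%C = \prod_(i <- r | P i) ((F i)^*)%C.
Proof. exact: rmorph_prod. Qed.
Definition lat n (N : 'M[R]_n) (k : 'rV[int]_n) : 'rV[R]_n := map_mx intr k *m N.

Lemma latD n (N : 'M[R]_n) k l : lat N (k + l) = lat N k + lat N l.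
Proof. by rewrite /lat map_mxD mulmxDl. Qed.
Lemma latN n (N : 'M[R]_n) k : lat N (- k) = - lat N k.
Proof. by rewrite /lat map_mxN mulNmx. Qed.
Lemma latB n (N : 'M[R]_n) k l : lat N (k - l) = lat N k - lat N l.
Proof. by rewrite latD latN. Qed.
Lemma lat0 n (N : 'M[R]_n) : lat N 0 = 0.
Proof. by rewrite /lat map_mx0 mul0mx. Qed.
(** One constant serves all matrices near [N]; hence sums over nearby lattices have a common
    majorant. *)
Lemma lat_lower n (N : 'M[R]_n) : N \in unitmx -> exists2 c, 0 < c & exists2 eta, 0 < eta &
 forall N' : 'M[R]_n, nm (N' - N) <= eta -> forall z, c * l1 z <= l1 (z *m N').
Proof.
move=> uN; pose K := 1 + nm (invmx N).
have K0 : 0 < K by rewrite ltr_wpDr// nm_ge0.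
exists (K^-1 / 2); first by rewrite divr_gt0 ?invr_gt0.
exists (K^-1 / 2); first by rewrite divr_gt0 ?invr_gt0.
move=> N' hN' z.
have h1 : K^-1 * l1 z <= l1 (z *m N).
 rewrite mulrC ler_pdivrMr// -{1}[z]mulmx1 -(mulmxV uN) mulmxA (le_trans (l1_mul _ _))//.
 by rewrite mulrC ler_wpM2l ?l1_ge0// /K lerDr.
have h2 : l1 (z *m N) <= l1 (z *m N') + nm (N' - N) * l1 z.
 rewrite (le_trans _ (lerD (lexx _) (l1_mul z _)))// mulmxBr l1B.
 by rewrite -{1}[z *m N](subrK (z *m N')) addrC (le_trans (l1D _ _)).
have := ler_wpM2r (l1_ge0 z) hN'.
have := l1_ge0 z; set a := l1 z in h1 h2 *; set b := K^-1 in h1 *.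
move=> _; lra.
Qed.

Lemma lower_unit n (N : 'M[R]_n) (c : R) : 0 < c -> (forall z, c * l1 z <= l1 (z *m N)) -> N \in unitmx.
Proof.
move=> c0 h; rewrite -row_free_unit -kermx_eq0; apply/eqP/row_matrixP => i.
rewrite row0; set z := row i _.
have z0 : z *m N = 0 by rewrite /z -row_mul mulmx_ker row0.
have := h z; rewrite z0 l1_0 pmulr_rle0// => l0.
apply/rowP => j; rewrite [RHS]mxE; apply/eqP; rewrite -normr_eq0.
by rewrite eq_le normr_ge0 andbT (le_trans (l1_le z j)).
Qed.

Lemma det_cont n (N : 'M[R]_n) (eps : R) : 0 < eps -> exists2 eta, 0 < eta &
 forall N' : 'M[R]_n, nm (N' - N) <= eta -> `|\det N' - \det N| <= eps.
Proof.
move=> e0; pose M := 1 + nm N; have M1 : 1 <= M by rewrite lerDl nm_ge0.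
pose K := n`!%:R * (n%:R * (M + 1) ^+ n) + 1.
have M10 : 0 <= M + 1 by rewrite addr_ge0// (le_trans ler01).
have K0 : 0 < K by rewrite ltr_wpDl// !mulr_ge0// exprn_ge0.
have eK : 0 < eps / K by rewrite divr_gt0.
exists (Num.min 1 (eps / K)); first by rewrite lt_min ltr01 eK.
move=> N' h; have [h1 h2] : nm (N' - N) <= 1 /\ nm (N' - N) <= eps / K.
 by move: h; rewrite le_min => /andP.
have ent (A : 'M[R]_n) i j : `|A i j| <= nm A.
 by rewrite /nm (bigD1 i)//= (bigD1 j)//= -addrA lerDl addr_ge0// ?sumr_ge0// => k _; exact: sumr_ge0.
rewrite -sumrB (le_trans (ler_norm_sum _ _ _))//.
apply: (@le_trans _ _ (\sum_(s : 'S_n) (n%:R * (M + 1) ^+ n * nm (N' - N)))).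
 apply: ler_sum => s _; rewrite -mulrBr normrM normrX normrN1 expr1n mul1r -nc_real rmorphB !rmorph_prod.
 apply: nc_prodB => [|i|i|i]; first by rewrite lerDr (le_trans ler01).
 - rewrite nc_real -[N' i _](subrK (N i (s i))) (le_trans (ler_normD _ _))//.
  have := ent (N' - N) i (s i); rewrite !mxE => h3; have := ent N i (s i); rewrite /M; lra.
 - rewrite nc_real (le_trans (ent _ _ _))// /M; lra.
 - by rewrite -rmorphB nc_real; have := ent (N' - N) i (s i); rewrite !mxE.
rewrite sumr_const card_Sn -[_ *+ n`!]mulr_natl mulrA.
rewrite (le_trans (ler_wpM2l _ h2)) ?mulr_ge0 ?exprn_ge0//.
rewrite mulrCA ler_piMr ?(ltW e0)// ler_pdivrMr// mul1r /K lerDl//.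
Qed.

Lemma rat_approx n (N : 'M[R]_n) (eta : R) : 0 < eta -> exists (W : 'M[int]_n) (q : nat),
 (0 < q)%N /\ nm (q%:R^-1 *: map_mx intr W - N) <= eta.
Proof.
move=> e0; pose X := (n * n)%:R / eta.
pose q := (Num.truncn X).+1; have qX : X < q%:R := truncnS_gt X.
have q0 : 0 < q%:R :> R by rewrite ltr0n.
exists (\matrix_(i, j) Num.floor (q%:R * N i j)), q; split=> //.
apply: (@le_trans _ _ ((n * n)%:R * q%:R^-1)); last first.
 by rewrite ler_pdivrMr// mulrC -ler_pdivrMr// ltW.
apply: nm_le => i j; rewrite !mxE.
have -> (x : R) : q%:R^-1 * x - N i j = q%:R^-1 * (x - q%:R * N i j) by rewrite mulrBr mulKf// gt_eqF.
rewrite normrM gtr0_norm ?invr_gt0// ler_piMr ?invr_ge0 ?(ltW q0)//.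
have := ge_floor (q%:R * N i j); have := floorD1_gt (q%:R * N i j); rewrite intrD => h1 h2.
rewrite ler_norml; apply/andP; split; lra.
Qed.

End matrices.

(** * The fundamental identity of Gabor analysis *)

Section figa.
Context {R : realType} (d : nat).
Implicit Types (f g : 'rV[R]_d -> R[i]) (z w : 'rV[R]_(d + d)) (N : 'M[R]_(d + d)).
Local Notation m := (d + d)%N.

Definition sJ : 'M[R]_m := block_mx 0 1%:M (- 1%:M) 0.
(** A basis of the adjoint lattice: its rows are dual to those of [N] for the symplectic form, see
    [symp_adj]. *)
Definition adj N : 'M[R]_m := (invmx N)^T *m sJ.

Lemma sJ_tr : sJ *m sJ^T = 1%:M.
Proof.
rewrite /sJ tr_block_mx mulmx_block !trmx0 !trmx1 linearN/= trmx1 !mulmx0 !mul0mx.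
by rewrite mulmxN mulNmx opprK !mulmx1 !addr0 !add0r -scalar_mx_block.
Qed.
Lemma sJ_trl : sJ^T *m sJ = 1%:M. Proof. exact: mulmx1C sJ_tr. Qed.
Lemma sJ_inv : invmx sJ = sJ^T. Proof. exact: invmx_uniq sJ_tr. Qed.
Lemma sJ_unit : sJ \in unitmx. Proof. by have [] := mulmx1_unit sJ_tr. Qed.
Lemma sJ_N : sJ^T = - sJ.
Proof.
by rewrite /sJ tr_block_mx !trmx0 trmx1 linearN/= trmx1 opp_block_mx !oppr0 opprK.
Qed.
Lemma det_sJ : `|\det sJ| = 1.
Proof.
have := congr1 determinant sJ_tr; rewrite det_mulmx det_tr det1 -expr2 => /eqP.
by rewrite sqrf_eq1 => /orP[] /eqP ->; rewrite ?normrN normr1.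
Qed.

Lemma sympE z w : symp z w = (z *m sJ *m w^T) ord0 ord0.
Proof.
rewrite -{2}(hsubmxK z) -{2}(hsubmxK w) /sJ mul_row_block !mulmx0 !mulmxN !mulmx1 add0r addr0.
rewrite tr_row_mx mul_row_col mxE /symp addrC; congr (_ + _).
 by rewrite !mxE; apply: eq_bigr => i _; rewrite !mxE.
by rewrite mulNmx !mxE; congr (- _); apply: eq_bigr => i _; rewrite !mxE mulrC.
Qed.
Lemma sympDl z z' w : symp (z + z') w = symp z w + symp z' w.
Proof. by rewrite !sympE !mulmxDl mxE. Qed.
Lemma sympNl z w : symp (- z) w = - symp z w.
Proof. by rewrite !sympE !mulNmx mxE. Qed.
Lemma sympZl c z w : symp (c *: z) w = c * symp z w.
Proof. by rewrite !sympE -!scalemxAl mxE. Qed.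
Lemma symp_anti z w : symp z w = - symp w z.
Proof. by rewrite /symp opprB. Qed.
Lemma sympDr z w w' : symp z (w + w') = symp z w + symp z w'.
Proof. by rewrite !(symp_anti z) sympDl opprD. Qed.
Lemma sympNr z w : symp z (- w) = - symp z w.
Proof. by rewrite !(symp_anti z) sympNl. Qed.
Lemma sympZr c z w : symp z (c *: w) = c * symp z w.
Proof. by rewrite !(symp_anti z) sympZl mulrN. Qed.
Lemma symp0l w : symp 0 w = 0. Proof. by rewrite sympE !mul0mx mxE. Qed.
Lemma symp_beta z w : symp z w = beta z w - beta w z.
Proof. by []. Qed.
Lemma symp_adj N (a b : 'rV[R]_m) : N \in unitmx -> symp (a *m N) (b *m adj N) = (a *m b^T) ord0 ord0.
Proof.
move=> uN; rewrite sympE /adj !trmx_mul trmxK -!mulmxA (mulmxA sJ) sJ_tr mul1mx.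
by rewrite (mulmxA N) mulmxV// mul1mx.
Qed.

Lemma adj_unit N : N \in unitmx -> adj N \in unitmx.
Proof. by move=> uN; rewrite unitmx_mul unitmx_tr unitmx_inv uN sJ_unit. Qed.
Lemma adj_adj N : N \in unitmx -> adj (adj N) = - N.
Proof.
move=> uN; rewrite /adj invmx_mul ?sJ_unit ?unitmx_tr ?unitmx_inv// sJ_inv -trmx_inv invmxK.
have JJ : sJ *m sJ = - 1%:M by rewrite -[X in _ *m X]opprK -sJ_N mulmxN sJ_tr.
by rewrite trmx_mul !trmxK -mulmxA JJ mulmxN mulmx1.
Qed.
Lemma det_adj N : N \in unitmx -> `|\det (adj N)| = `|\det N|^-1.
Proof. by move=> uN; rewrite det_mulmx det_tr det_inv normrM det_sJ mulr1 normfV. Qed.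
Definition HH f g f' g' z := V f g z * ((V f' g' z)^*)%C.
(** The identity for one lattice, with the determinant on the adjoint side. It is kept as a
    predicate on [N] in order to be transported along operations on [N]. *)
Definition figa N := forall f g f' g', nice f -> nice g -> nice f' -> nice g' -> exists S,
 hs (fun k => HH f g f' g' (lat N k)) S /\
 hs (fun l => HH g' g f' f (lat (adj N) l)) (`|\det N|%:C%C * S).

Lemma bs_wt2 : bs (fun p : int * int => wt1 p.1 * wt1 p.2 : R) 4.
Proof.
have -> : 4 = 2 ^+ 2 :> R by rewrite expr2 -natrM.
have inj : injective (fun p : int * int => \row_(j < 2) (if j == ord0 then p.1 else p.2)).
 move=> [a b] [a' b'] /rowP h; have := h ord0; have := h (lift ord0 ord0).
 by rewrite !mxE /= => -> ->.
have := bs_inj inj (@bs_wt R 2); apply: bs_le => p.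
by rewrite /wt !big_ord_recl big_ord0 !mxE/= mulr1.
Qed.

Lemma bs_V1 (f g f' g' : R -> R[i]) : cc f -> cc g -> cc f' -> cc g' -> exists M,
 bs (fun p : int * int => nc (V1 f g p.1%:~R p.2%:~R * ((V1 f' g' p.1%:~R p.2%:~R)^*)%C)) M.
Proof.
move=> cf cg cf' cg'.
have [C C0 HC] := V1_decay 4 cf cg; have [C' C'0 HC'] := V1_decay 0 cf' cg'.
exists (4 * C * C' * 4); apply: bs_le (bsZ _ bs_wt2); last by rewrite !mulr_ge0.
move=> [x w]; rewrite ncM nc_conj -[(x, w).1]/x -[(x, w).2]/w.
have h1 := HC x%:~R w%:~R; have := HC' x%:~R w%:~R; rewrite expr0 mul1r => h2.
rewrite /wt1 -invfM [leRHS]mulrAC; set X := (1 + _) * _; set W := (1 + _) * _ in X *.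
have X0 : 0 < X * W.
 by rewrite !mulr_gt0// ltr_wpDr.
rewrite ler_pM ?nc_ge0// ler_pdivlMr//.
apply: (@le_trans _ _ (4 * ((1 + `|x%:~R| + `|w%:~R|) ^+ 4 * nc (V1 f g x%:~R w%:~R)))); last first.
 by rewrite ler_wpM2l.
rewrite [leRHS]mulrA [leLHS]mulrC ler_wpM2r ?nc_ge0//.
rewrite /X /W -!intr_norm -!abszE.
have a0 : 0 <= (`|x|%N)%:~R :> R by []. have b0 : 0 <= (`|w|%N)%:~R :> R by [].
have -> : (`|x|%N)%:R = (`|x|%N)%:~R :> R by []. have -> : (`|w|%N)%:R = (`|w|%N)%:~R :> R by [].
set a := _%:~R in a0 *; set b := _%:~R in b0 *.
have s0 : 1 <= 1 + a + b by lra.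
have -> : 4 * (1 + a + b) ^+ 4 = (2 * (1 + a + b) ^+ 2) * (2 * (1 + a + b) ^+ 2) by ring.
rewrite ler_pM ?mulr_ge0 ?addr_ge0//; rewrite expr2; nra.
by rewrite /X !mulr_gt0// ltr_wpDr.
Qed.

(** Z^(2d) is a product of d copies of Z^2, one per time-frequency plane, so the sums are products
    of those of [figa1]; [phi] and [psi] regroup the coordinates into pairs. *)
Lemma figa_ten (c c1 c2 c3 : R[i]) (f g f' g' : 'I_d -> R -> R[i]) :
 (forall i, cc (f i)) -> (forall i, cc (g i)) -> (forall i, cc (f' i)) -> (forall i, cc (g' i)) ->
 exists S, hs (fun k => HH (fun x => c * ten f x) (fun x => c1 * ten g x)
   (fun x => c2 * ten f' x) (fun x => c3 * ten g' x) (lat 1%:M k)) S /\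
  hs (fun k => HH (fun x => c3 * ten g' x) (fun x => c1 * ten g x)
   (fun x => c2 * ten f' x) (fun x => c * ten f x) (lat 1%:M k)) S.
Proof.
move=> cf cg cf' cg'.
have [S HS] := choice (fun i => figa1 (cf i) (cg i) (cf' i) (cg' i)).
pose phi (k : 'rV[int]_m) : {ffun 'I_d -> int * int} :=
 [ffun i => (lsubmx k ord0 i, rsubmx k ord0 i)].
pose psi (p : {ffun 'I_d -> int * int}) : 'rV[int]_m := row_mx (\row_i (p i).1) (\row_i (p i).2).
have phiK : cancel phi psi.
 move=> k; rewrite /psi -[RHS](hsubmxK k); congr row_mx; apply/rowP => i; by rewrite mxE ffunE.
have psiK : cancel psi phi.
 move=> p; apply/ffunP => i; rewrite ffunE /psi row_mxKl row_mxKr !mxE; by case: (p i).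
have latl k : lsubmx (lat 1%:M k) = map_mx intr (lsubmx k) :> 'rV[R]_d.
 by rewrite /lat mulmx1 map_lsubmx.
have latr k : rsubmx (lat 1%:M k) = map_mx intr (rsubmx k) :> 'rV[R]_d.
 by rewrite /lat mulmx1 map_rsubmx.
have key (e e1 e2 e3 : R[i]) (u v u' v' : 'I_d -> R -> R[i]) T : (forall i, cc (u i)) -> (forall i, cc (v i)) ->
  (forall i, cc (u' i)) -> (forall i, cc (v' i)) ->
  (forall i, hs (fun p : int * int => V1 (u i) (v i) p.1%:~R p.2%:~R *
    ((V1 (u' i) (v' i) p.1%:~R p.2%:~R)^*)%C) (T i)) ->
  hs (fun k => HH (fun x => e * ten u x) (fun x => e1 * ten v x)
   (fun x => e2 * ten u' x) (fun x => e3 * ten v' x) (lat 1%:M k)) (e * (e1^*)%C * ((e2^*)%C * e3) * \prod_i T i).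
 move=> cu cv cu' cv' HT.
 have HM0 i : exists M, bs (fun p : int * int => nc (V1 (u i) (v i) p.1%:~R p.2%:~R *
   ((V1 (u' i) (v' i) p.1%:~R p.2%:~R)^*)%C)) M by exact: bs_V1.
 have [M HM] := choice HM0.
 have M0 i : 0 <= M i by have := HM i [::] isT; rewrite big_nil.
 have bM i : bs (fun p : int * int => nc (V1 (u i) (v i) p.1%:~R p.2%:~R *
   ((V1 (u' i) (v' i) p.1%:~R p.2%:~R)^*)%C)) (\sum_i M i).
  move=> A uA; rewrite (le_trans (HM i A uA))// (bigD1 i)//= lerDl sumr_ge0//.
 have := hsZ (e * (e1^*)%C * ((e2^*)%C * e3)) ((hs_bij _ _ phiK psiK).1 (hs_prod bM HT)).
 apply: hs_ext => k; rewrite /HH !V_ten// !cjM cjK.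
 rewrite cj_prod [RHS]mulrACA -big_split/=; congr (_ * _).
 by apply: eq_bigr => i _; rewrite ffunE latl latr !mxE.
exists (c * (c1^*)%C * ((c2^*)%C * c3) * \prod_i S i); split.
 by apply: key => // i; case: (HS i).
have -> : c * (c1^*)%C * ((c2^*)%C * c3) = c3 * (c1^*)%C * ((c2^*)%C * c) by ring.
by apply: key => // i; case: (HS i).
Qed.

Lemma figa_Z f g f' g' : nice f -> nice g -> nice f' -> nice g' -> exists S,
 hs (fun k => HH f g f' g' (lat 1%:M k)) S /\ hs (fun k => HH g' g f' f (lat 1%:M k)) S.
Proof.
move=> nf ng nf' ng'.
elim: nf => {f} [c u cu|f f1 nf [S [S1 S2]] nf1 [T [T1 T2]]]; last first.
 exists (S + T); split; [apply: hs_ext (hsD S1 T1)|apply: hs_ext (hsD S2 T2)] => k.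
  by rewrite /HH V_Dl// mulrDl.
 by rewrite /HH V_Dr// cjD mulrDr.
have nu : nice (fun x => c * ten u x) by exact: n_ten.
elim: ng => {g} [c1 v cv|f f1 nf [S [S1 S2]] nf1 [T [T1 T2]]]; last first.
 exists (S + T); split; [apply: hs_ext (hsD S1 T1)|apply: hs_ext (hsD S2 T2)] => k.
  by rewrite /HH V_Dr// mulrDl.
 by rewrite /HH V_Dr// mulrDl.
have nv : nice (fun x => c1 * ten v x) by exact: n_ten.
elim: nf' => {f'} [c2 u' cu'|f f1 nf [S [S1 S2]] nf1 [T [T1 T2]]]; last first.
 exists (S + T); split; [apply: hs_ext (hsD S1 T1)|apply: hs_ext (hsD S2 T2)] => k.
  by rewrite /HH V_Dl// cjD mulrDr.
 by rewrite /HH V_Dl// cjD mulrDr.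
have nu' : nice (fun x => c2 * ten u' x) by exact: n_ten.
elim: ng' => {g'} [c3 v' cv'|f f1 nf [S [S1 S2]] nf1 [T [T1 T2]]]; last first.
 exists (S + T); split; [apply: hs_ext (hsD S1 T1)|apply: hs_ext (hsD S2 T2)] => k.
  by rewrite /HH V_Dr// cjD mulrDr.
 by rewrite /HH V_Dl// mulrDl.
exact: figa_ten.
Qed.

Lemma lat_mul (U : 'M[int]_m) N k : lat (map_mx intr U *m N) k = lat N (k *m U).
Proof. by rewrite /lat mulmxA map_mxM. Qed.
(** The double adjoint is -N, which spans the same lattice, so the two sides of the identity
    exchange roles. *)
Lemma figa_swap N : N \in unitmx -> figa N -> figa (adj N).
Proof.
move=> uN FN f g f' g' nf ng nf' ng'; have [S [S1 S2]] := FN g' g f' f ng' ng nf' nf.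
exists (`|\det N|%:C%C * S); split => //.
rewrite det_adj// mulrA -rcM mulVf ?normr_eq0 ?mul1r; last by rewrite -unitfE -unitmxE.
have NK : cancel (fun k : 'rV[int]_m => - k) (fun k => - k) by move=> k; rewrite opprK.
apply: hs_ext ((hs_bij _ _ NK NK).1 S1) => k.
have -> : lat (adj (adj N)) k = lat N (- k) by rewrite (adj_adj uN) latN /lat mulmxN.
by [].
Qed.

Lemma figa_unimod (U : 'M[int]_m) N : U \in unitmx -> N \in unitmx -> figa N -> figa (map_mx intr U *m N).
Proof.
move=> uU uN FN f g f' g' nf ng nf' ng'; have [S [S1 S2]] := FN f g f' g' nf ng nf' ng'.
have K1 : cancel (fun k : 'rV[int]_m => k *m U) (fun k => k *m invmx U) by move=> k; rewrite mulmxK.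
have K2 : cancel (fun k : 'rV[int]_m => k *m invmx U) (fun k => k *m U) by move=> k; rewrite mulmxKV.
have uT : U^T \in unitmx by rewrite unitmx_tr.
have K3 : cancel (fun k : 'rV[int]_m => k *m invmx U^T) (fun k => k *m U^T) by move=> k; rewrite mulmxKV.
have K4 : cancel (fun k : 'rV[int]_m => k *m U^T) (fun k => k *m invmx U^T) by move=> k; rewrite mulmxK.
have UR : map_mx intr U *m map_mx intr (invmx U) = 1%:M :> 'M[R]_m.
 by rewrite -map_mxM mulmxV// map_mx1.
have [uUR _] := mulmx1_unit UR.
exists S; split.
 by apply: hs_ext ((hs_bij _ _ K1 K2).1 S1) => k; rewrite lat_mul.
have -> : `|\det (map_mx intr U *m N)| = `|\det N|.
 rewrite det_mulmx normrM det_map_mx.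
 have : \det U \is a GRing.unit by rewrite -unitmxE.
 by rewrite qualifE /= => /orP[] /eqP ->; rewrite ?rmorphN rmorph1 ?normrN normr1 mul1r.
apply: hs_ext ((hs_bij _ _ K3 K4).1 S2) => k; congr HH.
rewrite /adj invmx_mul// trmx_mul (invmx_uniq UR) -mulmxA map_trmx lat_mul; congr lat.
by rewrite -trmx_inv.
Qed.

Definition Sc (i : 'I_m) (a : R) : 'M[R]_m := diag_mx (\row_j (if j == i then a else 1)).

Lemma Sc_inv i (a : R) : a != 0 -> Sc i a *m Sc i a^-1 = 1%:M.
Proof.
move=> a0; rewrite /Sc mul_diag_mx; apply/matrixP => j k; rewrite !mxE.
case: eqP => [->|_]; case: eqP => /= _; rewrite ?mulr0n ?mulr1n ?mulr0 ?mulr1//.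
by rewrite mulfV.
Qed.

Lemma adj_Sc i (a : R) N : a != 0 -> N \in unitmx -> adj (Sc i a *m N) = Sc i a^-1 *m adj N.
Proof.
move=> a0 uN; have [uS _] := mulmx1_unit (Sc_inv i a0).
by rewrite /adj invmx_mul// (invmx_uniq (Sc_inv i a0)) trmx_mul tr_diag_mx mulmxA.
Qed.

Lemma det_Sc i (a : R) : \det (Sc i a) = a.
Proof.
rewrite det_diag (bigD1 i)//= mxE eqxx big1 ?mulr1// => j /negbTE ji.
by rewrite mxE ji.
Qed.

Lemma V_tf f g w z : nice f -> nice g ->
 V (tfshift w f) (tfshift w g) z = ee (symp z w) * V f g z.
Proof.
move=> nf ng; rewrite /V tf_comp L2innerZr ?V_cov//; try exact: nice_tf.
have -> : z + w - w = z by rewrite addrK.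
by rewrite -eN opprK mulrA -eD.
Qed.

Lemma HH_tfadj f g f' g' w z : nice f -> nice g -> nice f' -> nice g' ->
 HH (tfshift w g') g (tfshift w f') f z = HH g' g f' f (z - w).
Proof.
move=> nf ng nf' ng'; rewrite /HH /V !V_cov// cjM mulrACA -[RHS]mul1r; congr (_ * _).
by rewrite -eN opprK -eD addNr e0.
Qed.

Lemma ee_avg (a : nat) (k : int) : (0 < a)%N ->
 a%:R^-1 * (\sum_(s < a) ee (- ((s%:R : R) / a%:R * k%:~R))) = ((a %| k)%Z)%:R :> R[i].
Proof.
move=> a0; have aR : (a%:R : R) != 0 by rewrite pnatr_eq0 -lt0n.
have aC : (a%:R : R[i]) != 0 by rewrite -rc_nat eq_complex/= negb_and aR.
pose zeta : R[i] := ee (- (k%:~R / a%:R)).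
have E : \sum_(s < a) ee (- ((s%:R : R) / a%:R * k%:~R)) = \sum_(s < a) zeta ^+ s.
 by apply: eq_bigr => s _; rewrite -eMn; congr ee; rewrite mulrN; congr (- _); ring.
rewrite E; case: (boolP (_ %| _)%Z) => [/dvdzP[q kE]|ndv].
 have -> : zeta = 1.
  rewrite /zeta kE rmorphM/= -[(a : int)%:~R]/(a%:R : R) mulfK// -rmorphN; exact: e_int.
 by under eq_bigr do rewrite expr1n; rewrite sumr_const card_ord mulVf.
have za : zeta ^+ a = 1.
 rewrite /zeta -eMn mulrN mulrCA mulfV// mulr1 -rmorphN; exact: e_int.
have z1 : zeta != 1.
 apply: contra ndv => /eqP /ee1_int; rewrite rpredN => /intrP[q qE].
 apply/dvdzP; exists q; apply: (@intr_inj R); rewrite rmorphM/= -qE -[(a : int)%:~R]/(a%:R : R).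
 by rewrite mulfVK.
have := subrX1 zeta a; rewrite za subrr => /esym/eqP; rewrite mulf_eq0 subr_eq0 (negbTE z1)/= => /eqP ->.
by rewrite mulr0.
Qed.

Lemma latE N (k : 'rV[int]_m) : lat N k = (map_mx intr k : 'rV[R]_m) *m N. Proof. by []. Qed.
(** Apply the identity for [N] to a translates of f' and g', by s/a times the i-th adjoint vector.
    On the lattice side each translation multiplies by a character of k_i, and the average keeps
    exactly the k with a | k_i. On the adjoint side the translated copies together fill the finer
    lattice. *)
Lemma figa_Sc i (a : nat) N : (0 < a)%N -> N \in unitmx -> figa N -> figa (Sc i a%:R *m N).
Proof.
move=> a0 uN FN f g f' g' nf ng nf' ng'.
have aR : (a%:R : R) != 0 by rewrite pnatr_eq0 -lt0n.
have az : (a : int) != 0 by rewrite eqz_nat -lt0n.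
pose w (s : 'I_a) : 'rV[R]_m := (s%:R / a%:R *: delta_mx ord0 i) *m adj N.
have HS (s : 'I_a) : exists S, hs (fun k : 'rV[int]_m => ee (- (s%:R / a%:R * (k ord0 i)%:~R)) * HH f g f' g' (lat N k)) S /\
  hs (fun l : 'rV[int]_m => HH g' g f' f (lat (adj N) l - w s)) (`|\det N|%:C%C * S).
 have [S [S1 S2]] := FN f g (tfshift (w s) f') (tfshift (w s) g') nf ng (nice_tf _ nf') (nice_tf _ ng').
 exists S; split; [apply: hs_ext S1|apply: hs_ext S2] => k; last exact: HH_tfadj.
 rewrite /HH V_tf// cjM -eN mulrCA; congr (ee (- _) * _).
 rewrite /w latE symp_adj// linearZ/= -scalemxAr mxE; congr (_ * _).
 rewrite !mxE (bigD1 i)//= !mxE !eqxx mulr1 big1 ?addr0// => j /negbTE ji.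
 by rewrite !mxE ji andbF mulr0.
have [S SP] := choice HS.
pose up (k : 'rV[int]_m) : 'rV[int]_m := \row_j (if j == i then (a : int) * k ord0 j else k ord0 j).
pose dn (k : 'rV[int]_m) : 'rV[int]_m := \row_j (if j == i then (k ord0 j %/ a)%Z else k ord0 j).
have upK : cancel up dn.
 by move=> k; apply/rowP => j; rewrite !mxE; case: eqP => // _; rewrite mulKz.
exists (a%:R^-1 * \sum_s S s); split.
 have h1 := hsZ a%:R^-1 (hs_sum (index_enum 'I_a) (fun s => (SP s).1)).
 have h2 : hs (fun k : 'rV[int]_m => ((a %| k ord0 i)%Z)%:R * HH f g f' g' (lat N k)) (a%:R^-1 * \sum_s S s).
  apply: hs_ext h1 => k.
  by rewrite -mulr_suml mulrA ee_avg.
 have h3 := hs_inj upK _ h2.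
 apply: hs_ext (h3 _) => [k|k].
  rewrite !mxE eqxx dvdz_mulr ?dvdzz// mul1r; congr HH.
  rewrite !latE mulmxA; congr (_ *m _); apply/rowP => j; rewrite mul_mx_diag !mxE.
  by case: eqP => _; rewrite ?mulr1// rmorphM mulrC.
 move=> ne; case: (boolP (_ %| _)%Z) => [dv|_]; last by rewrite mul0r.
 case/negP: ne; apply/eqP/rowP => j; rewrite !mxE; case: eqP => // ->.
 by rewrite mulrC divzK.
have -> : `|\det (Sc i a%:R *m N)|%:C%C * (a%:R^-1 * \sum_s S s) = \sum_s `|\det N|%:C%C * S s.
 rewrite -mulr_sumr det_mulmx det_Sc normrM rcM normr_nat rc_nat mulrA; congr (_ * _).
 by rewrite mulrAC mulfV ?mul1r// -rc_nat eq_complex/= negb_and aR.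
pose F (p : 'I_a * 'rV[int]_m) := HH g' g f' f (lat (adj N) p.2 - w p.1).
have hF : hs F (\sum_s `|\det N|%:C%C * S s).
 apply: (hs_rows (r := index_enum 'I_a)); first exact: index_enum_uniq.
  by move=> t u; rewrite mem_index_enum.
 by move=> s; case: (SP s).
have a1 : a.-1.+1 = a by rewrite prednK.
pose sm (x : int) : 'I_a := cast_ord a1 (inord `|(x %% a)%Z|%N).
have smE x : (sm x : int) = (x %% a)%Z.
 rewrite /= inordK ?a1; first by rewrite gez0_abs// modz_ge0.
 by rewrite -ltz_nat gez0_abs ?modz_ge0// ltz_pmod.
(* Division of -l_i by a, so that l_i = a q - s with 0 <= s < a: the remainder names the translate,
   the quotient the point in it. *)
pose phi (l : 'rV[int]_m) : 'I_a * 'rV[int]_m :=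
 (sm (- l ord0 i), \row_j (if j == i then - ((- l ord0 j) %/ a)%Z else l ord0 j)).
pose psi (p : 'I_a * 'rV[int]_m) : 'rV[int]_m :=
 \row_j (if j == i then (a : int) * p.2 ord0 j - (p.1 : int) else p.2 ord0 j).
have phiK : cancel phi psi.
 move=> l; apply/rowP => j; rewrite !mxE; case: eqP => // ->; rewrite [(phi l).1 : int]smE.
 by apply: oppr_inj; rewrite [RHS](divz_eq (- l ord0 i) a); ring.
have psiK : cancel psi phi.
 move=> [s n]; rewrite /phi /psi; congr pair.
  apply/ord_inj/eqP; rewrite -eqz_nat smE; apply/eqP; rewrite !mxE eqxx opprB addrC -mulrN mulrC modzMDl modz_small//=.
  by rewrite ltz_nat ltn_ord.
 apply/rowP => j; rewrite !mxE; case: eqP => // ->.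
 by rewrite /= opprB -mulrN mulrC divzDr ?dvdz_mull// mulzK// divz_small ?add0r ?opprK//= ltz_nat ltn_ord.
apply: hs_ext ((hs_bij _ _ phiK psiK).1 hF) => l.
suff E : lat (adj (Sc i a%:R *m N)) l = lat (adj N) (phi l).2 - w (phi l).1 by rewrite E.
rewrite (adj_Sc i aR uN); symmetry.
rewrite /w !latE -mulmxBl mulmxA; congr (_ *m _); apply/rowP => j.
rewrite mul_mx_diag !mxE; case: eqP => [->|_]; last by rewrite andbF mulr0 subr0 mulr1.
rewrite !eqxx mulr1.
have -> : ((phi l).1 : nat)%:R = ((- l ord0 i) %% a)%Z%:~R :> R by rewrite -[RHS]/(_%:~R) -smE.
have := divz_eq (- l ord0 i) a; set q := (_ %/ _)%Z; set r := (_ %% _)%Z => h.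
have hR : (l ord0 i)%:~R = - (q%:~R * a%:R + r%:~R) :> R.
 by rewrite -[l ord0 i]opprK h mulrNz intrD -[a%:R]/((a : int)%:~R) -intrM.
by rewrite mulrNz hR; field.
Qed.

Definition scalable (al : R) := al != 0 /\ forall i N, N \in unitmx -> figa N -> figa (Sc i al *m N).

Lemma scalable_nat (a : nat) : (0 < a)%N -> scalable a%:R.
Proof. by move=> a0; split; [rewrite pnatr_eq0 -lt0n|move=> i N; exact: figa_Sc]. Qed.
Lemma figa_N N : N \in unitmx -> figa N -> figa (- N).
Proof.
move=> uN FN; have := figa_unimod (U := - 1%:M) _ uN FN.
by rewrite map_mxN map_mx1 mulNmx mul1mx; apply; rewrite unitmx_opp unitmx1.
Qed.

Lemma Sc_unit i (al : R) : al != 0 -> Sc i al \in unitmx.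
Proof. by move=> a0; have [] := mulmx1_unit (Sc_inv i a0). Qed.
(** Scaling a basis vector by al^-1 scales the dual vector by al; so adjoin, scale, and adjoin back,
    up to a sign. *)
Lemma scalable_inv (al : R) : scalable al -> scalable al^-1.
Proof.
move=> [a0 Pa]; split; first by rewrite invr_eq0.
move=> i N uN FN; have uS := Sc_unit i (invr_neq0 a0).
have uSN : Sc i al^-1 *m N \in unitmx by rewrite unitmx_mul uS.
have := Pa i _ (adj_unit uN) (figa_swap uN FN).
rewrite -{1}[al]invrK -adj_Sc ?invr_neq0// => F1.
have := figa_swap (adj_unit uSN) F1; rewrite adj_adj// => F2.
by rewrite -[_ *m N]opprK; apply: figa_N => //; rewrite unitmx_opp.
Qed.

Lemma figa_diag (al : 'I_m -> R) (r : seq 'I_m) N : (forall i, scalable (al i)) -> uniq r ->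
 N \in unitmx -> figa N -> let D := diag_mx (\row_j (if j \in r then al j else 1)) in
 D *m N \in unitmx /\ figa (D *m N).
Proof.
move=> sa + uN FN; elim: r => [_|i r IH /andP[ir ur]] /=.
 rewrite (_ : diag_mx _ = 1%:M) ?mul1mx//; apply/matrixP => j k; by rewrite !mxE.
have [u1 F1] := IH ur.
have -> : diag_mx (\row_j (if j \in i :: r then al j else 1)) =
  Sc i (al i) *m diag_mx (\row_j (if j \in r then al j else 1)).
 rewrite /Sc mul_diag_mx; apply/matrixP => j k; rewrite !mxE in_cons.
 case: eqP => [->|_] /=; last by rewrite mul1r.
 by rewrite (negbTE ir) mulrnAr mulr1.
rewrite -mulmxA; have [a0 Pa] := sa i.
by split; [rewrite unitmx_mul Sc_unit|exact: Pa].
Qed.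

Lemma figa_diagT (al : 'I_m -> R) N : (forall i, scalable (al i)) -> N \in unitmx -> figa N ->
 diag_mx (\row_j al j) *m N \in unitmx /\ figa (diag_mx (\row_j al j) *m N).
Proof.
move=> sa uN FN; have [u1 F1] := figa_diag sa (index_enum_uniq 'I_m) uN FN.
rewrite (_ : \row_j al j = \row_j (if j \in index_enum 'I_m then al j else 1))//.
by apply/rowP => j; rewrite !mxE mem_index_enum.
Qed.

(** The adjoint of the identity is the matrix of the symplectic form, which is unimodular: Z^(2d) is
    its own adjoint lattice. *)
Lemma figa_1 : figa 1%:M.
Proof.
move=> f g f' g' nf ng nf' ng'; have [S [S1 S2]] := figa_Z nf ng nf' ng'.
exists S; split=> //; rewrite det1 normr1 mul1r.
have adj1 : adj 1%:M = sJ.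
 by rewrite /adj (invmx_uniq (mulmx1 _)) trmx1 mul1mx.
pose Ji : 'M[int]_m := block_mx 0 1%:M (- 1%:M) 0.
have JiR : map_mx intr Ji = sJ by rewrite map_block_mx !map_mx0 map_mxN map_mx1.
have JJ : Ji *m Ji = - 1%:M.
 rewrite /Ji mulmx_block !mulmx0 !mul0mx !mulmxN !mulNmx !mulmx1 !addr0 !add0r.
 by rewrite (@scalar_mx_block _ d d) opp_block_mx oppr0.
have K1 : cancel (fun k : 'rV[int]_m => k *m Ji) (fun k => - (k *m Ji)).
 by move=> k; rewrite -mulmxA JJ mulmxN mulmx1 opprK.
have K2 : cancel (fun k : 'rV[int]_m => - (k *m Ji)) (fun k => k *m Ji).
 by move=> k; rewrite mulNmx -mulmxA JJ mulmxN mulmx1 opprK.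
apply: hs_ext ((hs_bij _ _ K1 K2).1 S2) => k.
have -> : lat (adj 1%:M) k = lat 1%:M (k *m Ji) by rewrite -lat_mul JiR mulmx1 adj1.
by [].
Qed.

(** Smith normal form reduces an integral matrix to unimodular factors and positive scalings of
    single vectors; the common denominator is an inverse scaling. *)
Lemma figa_rat (W : 'M[int]_m) (q : nat) : (0 < q)%N -> \det W != 0 ->
 figa (q%:R^-1 *: map_mx intr W).
Proof.
move=> q0 dW.
have [L uL [Q uQ [s _ WE]]] := int_Smith_normal_form W.
have dN0 : \prod_(i < m) s`_i != 0.
 apply: contra dW => /eqP p0; rewrite WE !det_mulmx.
 rewrite (_ : \matrix_(i, j) _ = diag_mx (\row_(j < m) s`_j)).
  by rewrite det_diag; under eq_bigr do rewrite mxE; rewrite p0 mulr0 mul0r.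
 by apply/matrixP => i j; rewrite !mxE.
have s0 i : s`_(i : 'I_m) != 0.
 by apply: contra dN0 => /eqP si; rewrite (bigD1 i)//= si mul0r.
(* The signs of the elementary divisors form a unimodular matrix, leaving positive integers to
   [scalable_nat]. *)
pose D1 : 'M[int]_m := diag_mx (\row_j sgz s`_j).
pose al (i : 'I_m) : R := (absz s`_i)%:R.
have WR : map_mx intr W = map_mx intr L *m (map_mx intr D1 *m (diag_mx (\row_j al j) *m (map_mx intr Q *m 1%:M))) :> 'M[R]_m.
 rewrite mulmx1 (mulmxA (map_mx intr D1)) (mulmxA (map_mx intr L)) {1}WE !map_mxM; congr (_ *m _ *m _).
 rewrite /D1 map_diag_mx mul_diag_mx; apply/matrixP => i j; rewrite !mxE.
 have -> : (nat_of_ord i == j) = (i == j) by [].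
 case: eqP => [->|_]; last by rewrite !mulr0n mulr0 rmorph0.
 rewrite !mulr1n /al -[_%:R]/((absz s`_j : int)%:~R) -rmorphM/=; congr (_%:~R).
 exact: intEsg.
have uD1 : D1 \in unitmx.
 rewrite unitmxE det_diag; under eq_bigr do rewrite mxE.
 rewrite rpred_prod// => i _; have := s0 i; case: sgzP => //.
have sal i : scalable (al i) by apply: scalable_nat; rewrite absz_gt0.
have uI : (1%:M : 'M[R]_m) \in unitmx by rewrite unitmx1.
have uim (U : 'M[int]_m) : U \in unitmx -> (map_mx intr U : 'M[R]_m) \in unitmx.
 by move=> uU; rewrite unitmxE det_map_mx rmorph_unit// -unitmxE.
have F1 := figa_unimod uQ uI figa_1.
have u1 : (map_mx intr Q *m 1%:M : 'M[R]_m) \in unitmx by rewrite mulmx1 uim.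
have [u2 F2] := figa_diagT sal u1 F1.
have F3 := figa_unimod uD1 u2 F2.
have u3 : (map_mx intr D1 *m (diag_mx (\row_j al j) *m (map_mx intr Q *m 1%:M)) : 'M[R]_m) \in unitmx.
 by rewrite unitmx_mul uim.
have F4 := figa_unimod uL u3 F3; rewrite -WR in F4.
have uW : (map_mx intr W : 'M[R]_m) \in unitmx.
 by rewrite unitmxE det_map_mx unitfE intr_eq0.
have [_] := figa_diagT (fun=> scalable_inv (scalable_nat q0)) uW F4.
rewrite (_ : diag_mx _ = q%:R^-1%:M) ?mul_scalar_mx//.
by apply/matrixP => i j; rewrite !mxE.
Qed.

Lemma HH_bound f g f' g' : nice f -> nice g -> nice f' -> nice g' -> exists2 C, 0 <= C &
 forall z, nc (HH f g f' g' z) <= C * ((1 + l1 z) ^+ (2 * m))^-1.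
Proof.
move=> nf ng nf' ng'; have [C C0 HC] := V_decay (2 * m) nf ng; have [C' C'0 HC'] := V_decay 0 nf' ng'.
exists (C * C') => [|z]; first exact: mulr_ge0.
rewrite /HH ncM nc_conj mulrAC ler_pM ?nc_ge0//.
by have := HC' z; rewrite expr0 invr1 mulr1.
Qed.

Lemma HH_lip f g f' g' : nice f -> nice g -> nice f' -> nice g' -> exists2 C, 0 <= C &
 forall z w, nc (HH f g f' g' z - HH f g f' g' w) <= C * l1 (z - w).
Proof.
move=> nf ng nf' ng'; have [C C0 HC] := V_decay 0 nf ng; have [C' C'0 HC'] := V_decay 0 nf' ng'.
have [L L0 HL] := V_lip nf ng; have [L' L'0 HL'] := V_lip nf' ng'.
exists (L * C' + C * L') => [|z w]; first by rewrite addr_ge0// mulr_ge0.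
have e1 : nc (V f g w) <= C by have := HC w; rewrite expr0 invr1 mulr1.
have e2 : nc (V f' g' z) <= C' by have := HC' z; rewrite expr0 invr1 mulr1.
have := HL z w; have := HL' z w; rewrite /HH.
move: (V f g z) (V f g w) (V f' g' z) (V f' g' w) e1 e2 => x x' y y' e1 e2 h' h.
have -> : x * (y^*)%C - x' * (y'^*)%C = (x - x') * (y^*)%C + x' * ((y - y')^*)%C.
 rewrite (_ : ((y - y')^*)%C = (y^*)%C - (y'^*)%C); first by ring.
 exact: rmorphB.
rewrite (le_trans (ncD _ _))// (ncM (x - x')) (ncM x') !nc_conj mulrDl lerD//.
 by rewrite mulrAC ler_pM ?nc_ge0.
by rewrite -mulrA ler_pM ?nc_ge0.
Qed.

Lemma nm_tr N : nm N^T = nm N.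
Proof. by rewrite /nm exchange_big/=; apply: eq_bigr => i _; apply: eq_bigr => j _; rewrite mxE. Qed.
Lemma nm_sub N N' : nm N' <= nm N + nm (N' - N).
Proof.
rewrite /nm -big_split; apply: ler_sum => i _; rewrite -big_split; apply: ler_sum => j _ /=.
by rewrite !mxE -{1}[N' i j](subrK (N i j)) (le_trans (ler_normD _ _))// addrC.
Qed.

Lemma nmB N N' : nm (N - N') = nm (N' - N).
Proof. by apply: eq_bigr => i _; apply: eq_bigr => j _; rewrite !mxE distrC. Qed.
(** The resolvent identity adj N' - adj N = adj N' J^T (N - N')^T adj N; a small perturbation then
    lets l1 (z adj N') be bounded by twice l1 (z adj N). *)
Lemma adj_close N : N \in unitmx -> exists2 eta, 0 < eta & exists2 K, 0 < K &
 forall N', N' \in unitmx -> nm (N' - N) <= eta ->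
  (forall z, K^-1 * l1 z <= l1 (z *m adj N')) /\
  (forall z, l1 (z *m adj N' - z *m adj N) <= K * nm (N' - N) * l1 (z *m adj N)).
Proof.
move=> uN; pose J1 := nm (sJ^T); pose A1 := nm (adj N).
have J0 : 0 <= J1 := nm_ge0 _. have A0 : 0 <= A1 := nm_ge0 _.
pose kap := A1 * J1; have kap0 : 0 <= kap by exact: mulr_ge0.
pose K := (nm N + 1) * J1 + 2 * kap + 1.
have K1 : 1 <= K by rewrite lerDr addr_ge0 ?mulr_ge0 ?addr_ge0 ?nm_ge0.
have K0 : 0 < K := lt_le_trans ltr01 K1.
exists (Num.min 1 (2 * (kap + 1))^-1).
 by rewrite lt_min ltr01 invr_gt0 mulr_gt0// ltr_wpDl.
exists K => // N' uN' h; have [h1 h2] : nm (N' - N) <= 1 /\ nm (N' - N) <= (2 * (kap + 1))^-1.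
 by move: h; rewrite le_min => /andP.
have inv M : M \in unitmx -> adj M *m (sJ^T *m M^T) = 1%:M.
 by move=> uM; rewrite /adj mulmxA -(mulmxA _ sJ) sJ_tr mulmx1 -trmx_mul mulmxV// trmx1.
have low z M : M \in unitmx -> l1 z <= nm M * (J1 * l1 (z *m adj M)).
 move=> uM; rewrite -{1}[z]mulmx1 -(inv M uM) !mulmxA -nm_tr (le_trans (l1_mul _ _))//.
 by rewrite ler_wpM2l ?nm_ge0// l1_mul.
split=> z.
 rewrite mulrC ler_pdivrMr// (le_trans (low z N' uN'))// mulrA mulrC ler_wpM2l ?l1_ge0//.
 have : nm N' * J1 <= (nm N + 1) * J1.
  by rewrite ler_wpM2r// (le_trans (nm_sub N N'))// lerD2l.
 by rewrite /K; lra.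
have E : z *m adj N' - z *m adj N = z *m adj N' *m (sJ^T *m (N - N')^T) *m adj N.
 have inv2 : sJ^T *m N^T *m adj N = 1%:M by apply: mulmx1C; exact: inv.
 rewrite linearB/= (mulmxBr sJ^T) (mulmxBr (z *m adj N')) mulmxBl.
 by rewrite -(mulmxA (z *m adj N') _ (adj N)) inv2 mulmx1 -(mulmxA z (adj N')) inv// mulmx1.
set X := l1 (z *m adj N').
have hd : l1 (z *m adj N' - z *m adj N) <= kap * nm (N' - N) * X.
 rewrite E (le_trans (l1_mul _ _))// /kap -!mulrA ler_wpM2l// mulmxA (le_trans (l1_mul _ _))//.
 rewrite nm_tr nmB.
 by rewrite mulrCA ler_wpM2l ?nm_ge0// l1_mul.
have hX : X <= l1 (z *m adj N) + l1 (z *m adj N' - z *m adj N).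
 by rewrite /X -{1}(subrK (z *m adj N) (z *m adj N')) addrC l1D.
have X0 : 0 <= X := l1_ge0 _.
have k2 : kap * nm (N' - N) <= 2^-1.
 rewrite (le_trans (ler_wpM2l kap0 h2))// ler_pdivrMr ?mulr_gt0 ?ltr_wpDl//; lra.
have hX2 : X <= 2 * l1 (z *m adj N).
 have := le_trans hd (ler_wpM2r X0 k2); lra.
rewrite (le_trans hd)//.
rewrite (le_trans (ler_wpM2l (mulr_ge0 kap0 (nm_ge0 _)) hX2))// mulrA ler_wpM2r ?l1_ge0//.
rewrite mulrAC ler_wpM2r ?nm_ge0// /K mulrC.
have : 0 <= (nm N + 1) * J1 by rewrite mulr_ge0// addr_ge0// nm_ge0.
lra.
Qed.

(** Nonsingular rational matrices approximate [N]. Both sides of the identity are dominated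
    uniformly near [N], and the determinant is continuous, so the identity passes to the limit. *)
Theorem figa_all N : N \in unitmx -> figa N.
Proof.
move=> uN f g f' g' nf ng nf' ng'.
have [C C0 HC] := HH_bound nf ng nf' ng'; have [C' C'0 HC'] := HH_bound ng' ng nf' nf.
have [L L0 HL] := HH_lip nf ng nf' ng'; have [L' L'0 HL'] := HH_lip ng' ng nf' nf.
have [c c0 [eta eta0 low]] := lat_lower uN.
have [eta' eta'0 [K K0 adjc]] := adj_close uN.
have nm00 : nm (N - N) = 0 by rewrite subrr /nm big1// => i _; rewrite big1// => j _; rewrite mxE normr0.
(* [b1] and [b2] dominate the two sides for every matrix close enough to [N], not only for [N]. *)
pose b1 (k : 'rV[int]_m) := C * (1 + c^-1) ^+ (2 * m) * 2 ^+ m * wt k.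
pose b2 (k : 'rV[int]_m) := C' * (1 + K) ^+ (2 * m) * 2 ^+ m * wt k.
have b1P N' : nm (N' - N) <= eta -> forall k, nc (HH f g f' g' (lat N' k)) <= b1 k.
 by move=> h k; apply: (bs_decay (F := HH f g f' g')) => // l; exact: low.
have b2P N' : N' \in unitmx -> nm (N' - N) <= eta' -> forall k, nc (HH g' g f' f (lat (adj N') k)) <= b2 k.
 move=> uN' h k; rewrite /b2 -[K]invrK; apply: (bs_decay (F := HH g' g f' f)) => // [|l].
  by rewrite invr_gt0.
 by have [h1 _] := adjc N' uN' h; exact: h1.
have V0 : 0 <= 1 + c^-1 by rewrite addr_ge0// invr_ge0 ltW.
have V1 : 0 <= 1 + K by rewrite addr_ge0// ltW.
have c1 : 0 <= C * (1 + c^-1) ^+ (2 * m) * 2 ^+ m by rewrite !mulr_ge0// ?exprn_ge0.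
have c2 : 0 <= C' * (1 + K) ^+ (2 * m) * 2 ^+ m by rewrite !mulr_ge0// ?exprn_ge0.
have B1 := bsZ c1 (@bs_wt R m); have B2 := bsZ c2 (@bs_wt R m).
have p1 k : 0 <= b1 k by rewrite mulr_ge0// ltW// wt_gt0.
have p2 k : 0 <= b2 k by rewrite mulr_ge0// ltW// wt_gt0.
have hN0 : nm (N - N) <= eta by rewrite nm00 ltW.
have hN0' : nm (N - N) <= eta' by rewrite nm00 ltW.
have [S HS] := hs_ex (bs_le (b1P N hN0) B1).
have [T HT] := hs_ex (bs_le (b2P N uN hN0') B2).
exists S; split=> //; suff <- : T = `|\det N|%:C%C * S by [].
apply/eqP; rewrite -subr_eq0 -nc_eq0 eq_le nc_ge0 andbT; apply/ler_addgt0Pr => eps e0; rewrite add0r.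
pose dt := `|\det N| + 1 + nc S + 1.
have dt1 : 1 <= dt by rewrite lerDr !addr_ge0 ?nc_ge0.
have dt0 : 0 < dt := lt_le_trans ltr01 dt1.
pose e := Num.min 1 (eps / (2 * dt)).
have ee0 : 0 < e by rewrite lt_min ltr01 divr_gt0// mulr_gt0.
have [e1 e2] : e <= 1 /\ e <= eps / (2 * dt) by apply/andP; rewrite -le_min.
have [A1 [d1 [d10 cl1]]] := hs_close p1 B1 ee0.
have [A2 [d2 [d20 cl2]]] := hs_close p2 B2 ee0.
have [eta3 eta30 dcont] := det_cont N ee0.
pose s1 : R := \sum_(k <- A1) l1 (map_mx intr k : 'rV[R]_m) + 1.
pose s2 : R := \sum_(k <- A2) l1 (lat (adj N) k) + 1.
have s10 : 0 < s1 by rewrite ltr_wpDl// sumr_ge0// => k _; exact: l1_ge0.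
have s20 : 0 < s2 by rewrite ltr_wpDl// sumr_ge0// => k _; exact: l1_ge0.
pose h0 := Num.min (Num.min eta eta') (Num.min eta3 (Num.min (d1 / ((L + 1) * s1)) (d2 / ((L' + 1) * (K * s2))))).
have L1 : 0 < L + 1 by rewrite ltr_wpDl.
have L1' : 0 < L' + 1 by rewrite ltr_wpDl.
have h00 : 0 < h0 by rewrite !lt_min eta0 eta'0 eta30 !divr_gt0// ?mulr_gt0.
have [W [q [q0 hW]]] := rat_approx N h00.
set N' := _ *: _ in hW.
move: hW; rewrite /h0 !le_min => /andP[/andP[he he'] /and3P[he3 hd1 hd2]].
have uN' : N' \in unitmx by apply: lower_unit c0 _ => z; exact: low.
have dW : \det W != 0.
 move: uN'; rewrite unitmxE /N' detZ det_map_mx unitfE mulf_eq0 negb_or => /andP[_].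
 by rewrite intr_eq0.
have [S' [HS' HT']] := figa_rat q0 dW nf ng nf' ng'.
rewrite -/N' in HS' HT'.
have r1 : nc (S - S') <= e.
 apply: cl1 HS HS' _ => [k|k|k kA]; [exact: b1P|exact: b1P|].
 rewrite (le_trans (HL _ _))// /lat -mulmxBr (le_trans (ler_wpM2l L0 (l1_mul _ _)))// nmB.
 move: hd1; rewrite ler_pdivlMr ?mulr_gt0//; apply: le_trans.
 rewrite mulrCA ler_wpM2l ?nm_ge0// ler_pM ?l1_ge0// ?lerDl//.
 by rewrite /s1 (big_rem k kA)/= -addrA lerDl addr_ge0// sumr_ge0// => l _; exact: l1_ge0.
have r2 : nc (T - `|\det N'|%:C%C * S') <= e.
 apply: cl2 HT HT' _ => [k|k|k kA]; [exact: b2P|exact: b2P|].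
 have [_ hd] := adjc N' uN' he'.
 rewrite (le_trans (HL' _ _))// l1B (le_trans (ler_wpM2l L'0 (hd _)))//.
 move: hd2; rewrite ler_pdivlMr ?mulr_gt0//; apply: le_trans.
 rewrite [K * _]mulrC -!mulrA mulrCA ler_wpM2l ?nm_ge0// ler_pM ?mulr_ge0 ?(ltW K0) ?l1_ge0// ?lerDl//.
 rewrite ler_wpM2l ?(ltW K0)//.
 by rewrite /s2 (big_rem k kA)/= -addrA lerDl addr_ge0// sumr_ge0// => l _; exact: l1_ge0.
have r3 : `| `|\det N'| - `|\det N| | <= e by rewrite (le_trans (ler_dist_dist _ _))// dcont.
move: r1 r2 r3; set D := `|\det N|; set D' := `|\det N'| => r1 r2 r3.
have -> : T - D%:C%C * S = (T - D'%:C%C * S') + D'%:C%C * (S' - S) + (D' - D)%:C%C * S.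
 by rewrite rmorphB/=; ring.
have DD : D' <= D + 1 by move: r3; rewrite ler_norml => /andP[_]; lra.
rewrite (le_trans (ncD _ _))// (le_trans (lerD (ncD _ _) (lexx _)))//.
rewrite (ncM D'%:C%C) (ncM (D' - D)%:C%C) !nc_real (ncB S') (ger0_norm (normr_ge0 _)).
apply: (@le_trans _ _ (e * dt)); last first.
 by rewrite (le_trans (ler_wpM2r (ltW dt0) e2))// invfM mulrA mulfVK ?gt_eqF//; lra.
have h1 : D' * nc (S - S') <= (D + 1) * e by rewrite ler_pM ?nc_ge0// normr_ge0.
have h2 : `|D' - D| * nc S <= e * nc S by rewrite ler_wpM2r ?nc_ge0.
rewrite /dt -/D -/D'; clear -r2 h1 h2.
by move: (nc (T - _)) (D' * _) (`|D' - D| * _) r2 h1 h2 => x y z *; lra.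
Qed.

End figa.

(** * Density of real tensor sums in L2 *)

Section density.
Context {R : realType} (n : nat).
Local Notation X := 'rV[R]_n.
Local Notation mu := (@lebesgue_rV R n).
Implicit Types (u v g : X -> R).

Definition N2 u : \bar R := (\int[mu]_x (u x ^+ 2)%:E)%E.

Lemma msq u : measurable_fun setT u -> measurable_fun setT (fun x => (u x ^+ 2)%:E).
Proof. by move=> mu; apply/measurable_EFinP; exact: measurable_funX. Qed.
Lemma N2_le u v : measurable_fun setT u -> measurable_fun setT v -> (forall x, `|u x| <= `|v x|) ->
 (N2 u <= N2 v)%E.
Proof.
move=> mu mv uv; apply: ge0_le_integral => //.
- by move=> x _; rewrite lee_fin sqr_ge0.
- exact: msq.
- exact: msq.
- by move=> x _; rewrite lee_fin -[u x ^+ 2]sqrn -[v x ^+ 2]sqrn lerXn2r ?nnegrE.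
Qed.

Lemma N2Z c u : measurable_fun setT u -> N2 (fun x => c * u x) = ((c ^+ 2)%:E * N2 u)%E.
Proof.
move=> mu; rewrite /N2; under eq_integral do rewrite exprMn EFinM.
rewrite ge0_integralZl//; [exact: msq|by move=> x _; rewrite lee_fin sqr_ge0|by rewrite lee_fin sqr_ge0].
Qed.

Lemma N2D u v : measurable_fun setT u -> measurable_fun setT v ->
 (N2 (fun x => (u x + v x)%R) <= 2%:E * N2 u + 2%:E * N2 v)%E.
Proof.
move=> mu mv; rewrite /N2 -!ge0_integralZl//; last first.
- by move=> x _; rewrite lee_fin sqr_ge0.
- exact: msq.
- by move=> x _; rewrite lee_fin sqr_ge0.
- exact: msq.
rewrite -ge0_integralD//; last 4 first.
- by move=> x _; rewrite mule_ge0// lee_fin sqr_ge0.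
- by apply: measurable_funeM; exact: msq.
- by move=> x _; rewrite mule_ge0// lee_fin sqr_ge0.
- by apply: measurable_funeM; exact: msq.
apply: ge0_le_integral => //.
- by move=> x _; rewrite lee_fin sqr_ge0.
- by apply: msq; exact: measurable_funD.
- by apply: emeasurable_funD; apply: measurable_funeM; exact: msq.
- move=> x _; rewrite -!EFinM -EFinD lee_fin.
 have : 0 <= (u x - v x) ^+ 2 by rewrite sqr_ge0.
 by rewrite !expr2; lra.
Qed.

Definition Ap u := measurable_fun setT u /\ forall eps, 0 < eps ->
 exists2 h, rnice h & (N2 (fun x => (u x - h x)%R) <= eps%:E)%E.

Lemma Ap_rn h : rnice h -> Ap h.
Proof.
move=> rh; split=> [|eps e0]; first exact: rn_measurable.
exists h => //; rewrite /N2; under eq_integral do rewrite subrr expr2 mulr0.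
by rewrite integral0 lee_fin ltW.
Qed.

Lemma ApD u v : Ap u -> Ap v -> Ap (fun x => u x + v x).
Proof.
move=> [mu Hu] [mv Hv]; split=> [|eps e0]; first exact: measurable_funD.
have e4 : 0 < eps / 4 by rewrite divr_gt0.
have [h rh Hh] := Hu _ e4; have [k rk Hk] := Hv _ e4.
exists (fun x => h x + k x); first exact: rn_D.
have -> : (fun x => u x + v x - (h x + k x)) = fun x => (u x - h x) + (v x - k x).
 by apply/funext => x; ring.
have m1 : measurable_fun setT (fun x => u x - h x) by apply: measurable_funB => //; exact: rn_measurable.
have m2 : measurable_fun setT (fun x => v x - k x) by apply: measurable_funB => //; exact: rn_measurable.
apply: (le_trans (N2D m1 m2)).
have -> : eps%:E = (2%:E * (eps / 4)%:E + 2%:E * (eps / 4)%:E)%E.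
 by rewrite -EFinM -EFinD; congr EFin; field.
by apply: leeD; rewrite lee_wpmul2l// lee_fin.
Qed.

Lemma ApZ c u : Ap u -> Ap (fun x => c * u x).
Proof.
move=> [mu Hu]; split=> [|eps e0]; first by apply: measurable_funM => //; exact: measurable_cst.
have c1 : 0 < c ^+ 2 + 1 by rewrite ltr_wpDl// sqr_ge0.
have [h rh Hh] := Hu (eps / (c ^+ 2 + 1)) (divr_gt0 e0 c1).
exists (fun x => c * h x); first exact: rnZ.
under eq_fun do rewrite -mulrBr.
rewrite N2Z; last by apply: measurable_funB => //; exact: rn_measurable.
apply: (@le_trans _ _ ((c ^+ 2)%:E * (eps / (c ^+ 2 + 1))%:E)%E).
 by rewrite lee_wpmul2l// lee_fin sqr_ge0.
by rewrite -EFinM lee_fin mulrCA ler_piMr ?(ltW e0)// ler_pdivrMr// mul1r lerDl.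
Qed.

Lemma Ap_sum I (r : seq I) (F : I -> X -> R) : (forall i, Ap (F i)) -> Ap (fun x => \sum_(i <- r) F i x).
Proof.
move=> HF; elim: r => [|i r IH].
 by under eq_fun do rewrite big_nil; apply: Ap_rn; exact: rn0.
by under eq_fun do rewrite big_cons; exact: ApD.
Qed.

(** Dominated convergence with majorant 4 g^2. It serves three times: smooth steps to boxes, finite
    to countable disjoint unions, simple functions to their limit. *)
Lemma Ap_dom (F : nat -> X -> R) u g : (forall j, Ap (F j)) -> measurable_fun setT g -> (N2 g < +oo)%E ->
 (forall x, 0 <= g x) -> (forall j x, `|F j x| <= g x) ->
 (forall x, F ^~ x @ \oo --> u x) -> Ap u.
Proof.
move=> HF mg g2 g0 Fg Fu.
have ug x : `|u x| <= g x.
 have c1 : `|F j x| @[j --> \oo] --> `|u x| by apply: cvg_norm; exact: Fu.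
 rewrite -(cvg_lim (@Rhausdorff R) c1); apply: limr_le; first by apply/cvg_ex; exists `|u x|.
 by apply: nearW => j; exact: Fg.
have mu_ : measurable_fun setT u.
 by apply: (measurable_fun_cvg (h := F)) => [j|x _]; [case: (HF j)|exact: Fu].
split=> // eps e0.
have mFu j : measurable_fun setT (fun x => u x - F j x).
 by apply: measurable_funB => //; case: (HF j).
have ig : mu.-integrable setT (fun x => (4 * g x ^+ 2)%:E).
 under eq_fun do rewrite EFinM.
 apply: integrableZl => //; apply/integrableP; split; first exact: msq.
 rewrite (eq_integral (fun x => (g x ^+ 2)%:E))// => x _.
 by rewrite gee0_abs// lee_fin sqr_ge0.
have h1 : {ae mu, forall x, setT x -> (fun j => ((u x - F j x) ^+ 2)%:E) @ \oo --> (0 : R)%:E}.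
 apply: aeW => x _ /=; apply: cvg_EFin; first by apply: nearW => j.
 have c1 : (u x - F j x) @[j --> \oo] --> u x - u x.
  by apply: cvgB; [exact: cvg_cst|exact: Fu].
 rewrite subrr in c1; have c2 := cvgM c1 c1; rewrite mulr0 in c2; exact: c2.
have h2 : {ae mu, forall x j, setT x -> (`|((u x - F j x) ^+ 2)%:E| <= (4 * g x ^+ 2)%:E)%E}.
 apply: aeW => x j _ /=; rewrite lee_fin ger0_norm ?sqr_ge0// -sqrn.
 have h : `|u x - F j x| <= 2 * g x.
  by rewrite (le_trans (ler_normB _ _))// mulr_natl mulr2n lerD.
 have -> : 4 * g x ^+ 2 = (2 * g x) ^+ 2 by ring.
 by rewrite lerXn2r ?nnegrE// mulr_ge0.
have [_ _] := @dominated_convergence _ X R mu setT measurableT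
 (fun j x => ((u x - F j x) ^+ 2)%:E) (fun=> 0%E) (fun x => (4 * g x ^+ 2)%:E)
 (fun j => msq (mFu j)) (measurable_cst _) h1 ig h2.
rewrite integral0 => /fine_cvgP[fin /cvgrPdist_le /(_ _ (divr_gt0 e0 (ltr0n R 4))) ce].
near \oo => j.
have finj : (\int[mu]_x ((u x - F j x) ^+ 2)%:E)%E \is a fin_num by near: j; exact: fin.
have : `|0 - fine (\int[mu]_x ((u x - F j x) ^+ 2)%:E)%E| <= eps / 4 by near: j; exact: ce.
rewrite sub0r normrN => hj.
have [h rh Hh] := (HF j).2 (eps / 4) (divr_gt0 e0 (ltr0n R 4)).
exists h => //.
have -> : (fun x => u x - h x) = fun x => (u x - F j x) + (F j x - h x).
 by apply/funext => x; ring.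
have m2 : measurable_fun setT (fun x => F j x - h x).
 by apply: measurable_funB; [case: (HF j)|exact: rn_measurable].
apply: (le_trans (N2D (mFu j) m2)).
have -> : eps%:E = (2%:E * (eps / 4)%:E + 2%:E * (eps / 4)%:E)%E.
 by rewrite -EFinM -EFinD; congr EFin; field.
apply: leeD; rewrite lee_wpmul2l// ?lee_fin// /N2 -(fineK finj) lee_fin.
exact: le_trans (ler_norm _) hj.
Unshelve. all: by end_near. Qed.

Definition cube (K : R) : set X := [set x | forall i, (`]-K, K]%classic : set R) (x ord0 i)].

Lemma measurable_cube K : measurable (cube K).
Proof.
rewrite (_ : cube K = \bigcap_(i in [set: 'I_n]) (@rV_coord _ R n i @^-1` `]-K, K]%classic)).
 apply: fin_bigcap_measurable => // i _.
 by rewrite -[X in measurable X]setTI; apply: measurable_rV_coord => //; exact: measurable_itv.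
by apply/seteqP; split => v /= Hv i; [move=> _|]; exact: Hv.
Qed.

Lemma cube_fin K : (N2 (\1_(cube K) : X -> R) < +oo)%E.
Proof.
rewrite /N2 (eq_integral (fun x => (\1_(cube K) x)%:E)); last first.
 by move=> x _; rewrite indicE; case: (x \in _); rewrite expr2 ?mulr1 ?mulr0.
rewrite integral_indic ?setIT//; last exact: measurable_cube.
rewrite -[X in (X < _)%E]/(lebesgue_rV n (cube K)).
pose I0 : set R := `]-K, K]%classic.
have -> : lebesgue_rV n (cube K) = (\prod_(i < n) lebesgue_measure I0)%E.
 by apply: lebesgue_rV_box => i; exact: measurable_itv.
suff : ((0 <= \prod_(i < n) lebesgue_measure I0) &&
  (\prod_(i < n) lebesgue_measure I0 < +oo))%E by case/andP.
elim/big_ind: _ => //.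
- by rewrite lee_fin ler01 ltry.
- move=> x y /andP[x0 xo] /andP[y0 yo]; rewrite mule_ge0//=.
 by rewrite lte_mul_pinfty// ge0_fin_numE.
- move=> i _; rewrite measure_ge0/= /I0 lebesgue_measure_itv/=; case: ifP => _; by rewrite ?ltry.
Qed.

(** A rising step just after a times a falling one just after k, each of width 1/(j + 1). Placing
    the transitions to the right makes the limit exactly the indicator of the half-open interval
    from a to k, endpoints included in the statement [sstep_lim]. *)
Definition sstep (j : nat) (a k t : R) : R :=
 step (j.+1%:R * t + - (j.+1%:R * a)) * (1 + (-1) * step (j.+1%:R * t + - (j.+1%:R * k))).

Lemma sstep_out j a k t : `|a| + `|k| + 1 <= `|t| -> sstep j a k t = 0.
Proof.
move=> h; have J : 1 <= j.+1%:R :> R by rewrite ler1n.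
have a1 := ler_norm (- a); rewrite normrN in a1; have k1 := ler_norm k.
have a0 := normr_ge0 a; have k0 := normr_ge0 k.
rewrite /sstep -!mulrBr; have [t0|t0] := lerP 0 t.
 rewrite (ger0_norm t0) in h; have tk : 1 <= t - k by lra.
 by rewrite (step1 (_ : 1 <= j.+1%:R * (t - k))) ?mulr1 ?addrN ?mulr0//; nra.
rewrite (ltr0_norm t0) in h; rewrite step0 ?mul0r//.
have ta : t - a <= 0 by lra.
by nra.
Qed.

Lemma sstep_cs j a k : cs (sstep j a k).
Proof.
split; last by exists (`|a| + `|k| + 1) => t; exact: sstep_out.
apply: smM; first exact: sm_step.
by apply: smD; [exact: sm_cst|apply: smZ; exact: sm_step].
Qed.

Lemma sstep_01 j a k t : 0 <= sstep j a k t <= 1.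
Proof.
rewrite /sstep; have := @step_01 R (j.+1%:R * t + - (j.+1%:R * a)).
have := @step_01 R (j.+1%:R * t + - (j.+1%:R * k)).
by move: (step _) (step _) => x y /andP[x0 x1] /andP[y0 y1]; apply/andP; split; nra.
Qed.

Lemma sstep_lim a k t : exists J : nat, forall j, (J <= j)%N ->
 sstep j a k t = ((a < t) && (t <= k))%:R.
Proof.
have big (x : R) : 0 < x -> exists J : nat, forall j, (J <= j)%N -> 1 <= j.+1%:R * x.
 move=> x0; exists (Num.truncn x^-1) => j hj.
 rewrite -ler_pdivrMr// mul1r (le_trans (ltW (truncnS_gt _)))// ler_nat ltnS//.
have [ta|ta] := leP t a.
 exists 0%N => j _; rewrite /sstep -!mulrBr step0 ?mul0r//.
 by have : 0 < j.+1%:R :> R by []; nra.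
have [J1 H1] := big (t - a) ltac:(by rewrite subr_gt0).
have [tk|tk] := leP t k.
 exists J1 => j hj; rewrite /sstep -!mulrBr (step1 (H1 j hj)) step0 ?mulr0 ?addr0 ?mulr1//.
 by have : 0 < j.+1%:R :> R by []; nra.
have [J2 H2] := big (t - k) ltac:(by rewrite subr_gt0).
by exists J2 => j hj; rewrite /sstep -!mulrBr (step1 (H2 j hj)) mulr1 subrr mulr0.
Qed.

Lemma Ap_box (a : 'I_n -> R) (k : R) :
 Ap (\1_[set x : X | forall i, (a i < x ord0 i) && (x ord0 i <= k)] : X -> R).
Proof.
pose K := \sum_i `|a i| + `|k| + 1.
have aK i : `|a i| + `|k| + 1 <= K.
 by rewrite !lerD2r (bigD1 i)//= lerDl sumr_ge0.
apply: (@Ap_dom (fun j => ten (fun i => sstep j (a i) k)) _ (\1_(cube K))).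
- move=> j; apply: Ap_rn.
 have := @rn_ten R n 1 (fun i => sstep j (a i) k) (fun i => sstep_cs _ _ _).
 by under eq_fun do rewrite mul1r.
- by apply: measurable_indic; exact: measurable_cube.
- exact: cube_fin.
- by move=> x; rewrite indicE.
- move=> j x; rewrite indicE; case: (boolP (x \in cube K)) => [_|/negP xK].
  have -> : true%:R = \prod_(i < n) 1 :> R by rewrite big1.
  rewrite normr_prod; apply: ler_prod => i _.
  by have /andP[h0 h1] := sstep_01 j (a i) k (x ord0 i); rewrite ger0_norm// h0 h1.
 have [i hi] : exists i, ~ (`]-K, K]%classic : set R) (x ord0 i).
  by apply/existsNP => h; apply: xK; rewrite inE.
 rewrite /ten (bigD1 i)//= sstep_out ?mul0r ?normr0// (le_trans (aK i))//.
 rewrite leNgt; apply/negP => xi; apply: hi; rewrite /= in_itv/=.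
 by move: xi; rewrite ltr_norml => /andP[-> /ltW].
- move=> x; have [J HJ] := choice (fun i => sstep_lim (a i) k (x ord0 i)).
 apply: cvg_near_cst; exists (\max_i J i)%N => // j /= hj.
 rewrite /ten indicE; case: (boolP (x \in _)) => [/set_mem xB|/negP xB].
  rewrite big1// => i _; rewrite HJ ?xB//.
  by rewrite (leq_trans _ hj)//; exact: leq_bigmax.
 have [i hi] : exists i, ~ ((a i < x ord0 i) && (x ord0 i <= k)).
  by apply/existsNP => h; apply: xB; rewrite inE.
 rewrite (bigD1 i)//= HJ ?(leq_trans _ hj) ?leq_bigmax//.
 by rewrite (negbTE (introN idP hi)) mul0r.
Qed.

Definition rays : set (set X) := [set E | exists a : 'I_n -> R, E = [set x : X | forall i, a i < x ord0 i]].

Lemma rays_measurable : @measurable _ X = <<s rays >>.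
Proof.
apply/seteqP; split => [A mA|].
 pose T := g_sigma_algebraType rays.
 have mid : measurable_fun (setT : set T) (fun x : T => (x : X)).
  apply: measurable_fun_rV => i.
  apply: (measurability _ (RGenOInfty.measurableE R)) => // _ [_ [b ->] <-].
  rewrite setTI (_ : _ @^-1` _ = \bigcup_(k : nat) [set x : X | forall j, (if j == i then b else - k%:R) < x ord0 j]).
   apply: bigcupT_measurable => k; apply: sub_sigma_algebra.
   by exists (fun j => if j == i then b else - k%:R).
  apply/seteqP; split => x /=.
   rewrite in_itv/= andbT => bx.
   pose S := \sum_j `|x ord0 j|.
   exists (Num.truncn S).+1 => //= j; case: eqP => [->//|_].
   have h1 : S < (Num.truncn S).+1%:R := truncnS_gt _.
   have h2 : `|x ord0 j| <= S by rewrite /S (bigD1 j)//= lerDl sumr_ge0.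
   have := ler_norm (- x ord0 j); rewrite normrN; lra.
  by move=> [k _ /(_ i)]; rewrite eqxx in_itv/= andbT.
 by have := mid measurableT A mA; rewrite setTI.
apply: smallest_sub; first exact: sigma_algebra_measurable.
move=> _ [a ->].
rewrite (_ : [set _ | _] = \bigcap_(i in [set: 'I_n]) (@rV_coord _ R n i @^-1` `]a i, +oo[%classic)).
 apply: fin_bigcap_measurable => // i _.
 by rewrite -[X in measurable X]setTI; apply: measurable_rV_coord => //; exact: measurable_itv.
apply/seteqP; split => v /= Hv i; first by move=> _; rewrite /= in_itv/= andbT; exact: Hv.
by have := Hv i I; rewrite /= in_itv/= andbT.
Qed.

(** Dynkin's theorem on the open orthants, which are stable under intersection. Cutting by a cube
    keeps the majorant square integrable and turns an orthant into a half-open box. *)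
Lemma Ap_indic E (K : R) : measurable E -> Ap (\1_(E `&` cube K) : X -> R).
Proof.
rewrite rays_measurable; move: E.
have cubeE (a : 'I_n -> R) : [set x : X | forall i, a i < x ord0 i] `&` cube K =
  [set x : X | forall i, (Num.max (a i) (- K) < x ord0 i) && (x ord0 i <= K)].
 apply/seteqP; split => x /=.
  by move=> [h1 h2] i; have := h2 i; rewrite /= in_itv/= gt_max h1/=.
 move=> h; split=> i; have /andP[] := h i; rewrite gt_max => /andP[? ?] ? //.
 by rewrite /= in_itv/=; apply/andP; split.
have cubeT : Ap (\1_(cube K) : X -> R).
 have := Ap_box (fun=> - K) K; congr Ap; congr (\1_ _); apply/seteqP; split => x /= h i; have := h i;
  by rewrite /= in_itv.
apply: (dynkin_induction rays_measurable).
- move=> _ _ [a ->] [b ->]; exists (fun i => Num.max (a i) (b i)).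
 apply/seteqP; split => x /=; first by move=> [h1 h2] i; rewrite gt_max h1 h2.
 by move=> h; split=> i; have := h i; rewrite gt_max => /andP[].
- by rewrite setTI.
- by move=> _ [a ->]; rewrite cubeE; exact: Ap_box.
- move=> E mE AE; have := ApD cubeT (ApZ (-1) AE); congr Ap.
 apply/funext => x; rewrite !indicE !in_setI in_setC.
 by case: (x \in E); case: (x \in cube K) => /=; rewrite ?mulr1 ?mulr0 ?addr0 ?subrr.
move=> F mF tF AF.
apply: (@Ap_dom (fun j x => \sum_(i < j) \1_(F i `&` cube K) x) _ (\1_(cube K))).
- by move=> j; exact: Ap_sum.
- by apply: measurable_indic; exact: measurable_cube.
- exact: cube_fin.
- by move=> x; rewrite indicE.
- move=> j x; rewrite indicE; case: (boolP (x \in cube K)) => xK; last first.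
  by rewrite big1 ?normr0// => i _; rewrite indicE in_setI (negbTE xK) andbF.
 have [[i0 Fi0]|nF] := pselect (exists i, F i x); last first.
  rewrite big1 ?normr0// => i _; rewrite indicE in_setI memNset//= => Fi.
  by apply: nF; exists i.
 rewrite (eq_bigr (fun i : 'I_j => (i == i0 :> nat)%:R)) => [|i _]; last first.
  rewrite indicE in_setI xK andbT; case: eqP => [->|ii]; first by rewrite mem_set.
  rewrite memNset// => Fi; have /trivIsetP/(_ i i0 I I) := tF.
  move/eqP : ii => ii /(_ ii) /seteqP[+ _] => /(_ x); exact.
 have [ij|ji] := ltnP i0 j.
  rewrite (bigD1 (Ordinal ij))//= eqxx big1 ?addr0 ?normr1// => i ii.
  by case: eqP => // ii0; case/eqP: ii; exact/val_inj.
 rewrite big1 ?normr0// => i _; case: eqP => // ii; move: (ltn_ord i); rewrite ii ltnNge ji//.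
- move=> x; apply: cvg_near_cst.
 have [[i0 Fi0]|nF] := pselect (exists i, F i x); last first.
  exists 0%N => // j _ /=; rewrite big1 => [|i _].
   by rewrite indicE in_setI memNset//= => -[i _ Fi]; apply: nF; exists i.
  by rewrite indicE in_setI memNset//= => Fi; apply: nF; exists i.
 exists i0.+1 => // j /= hj.
 rewrite (bigD1 (Ordinal hj))//= big1 ?addr0 => [|i ii].
  by rewrite !indicE !in_setI (mem_set Fi0) (mem_set (_ : (\bigcup_k F k) x))//; exists i0.
 rewrite indicE in_setI memNset//= => Fi; have /trivIsetP/(_ i i0 I I) := tF.
 have ii0 : (i : nat) != i0 by apply: contra ii => /eqP ii0; apply/eqP/val_inj.
 by move=> /(_ ii0) /seteqP[+ _] => /(_ x); exact.
Qed.

Import HBNNSimple.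

(** Increasing simple functions, truncated to growing cubes so that only indicators of bounded sets
    occur. *)
Lemma N2_max u : measurable_fun setT u -> (N2 u < +oo)%E -> (forall x, 0 <= u x) -> Ap u.
Proof.
move=> mu_ u2 u0.
have meu : measurable_fun setT (EFin \o u) by exact/measurable_EFinP.
have [f [ndf fu]] := approximation measurableT meu (fun x _ => u0 x : (0 <= (EFin \o u) x)%E).
have fx x : f j x @[j --> \oo] --> u x.
 by have := fu x Logic.I; move/fine_cvgP => [_].
have fle j x : f j x <= u x.
 have ndx : nondecreasing_seq (fun j => f j x) by move=> p q pq; have /lefP := ndf p q pq; exact.
 have cf : cvgn (fun j => f j x) by apply: (cvgP (u x)); exact: fx.
 have := nondecreasing_cvgn_le ndx cf j.
 by rewrite (cvg_lim (@Rhausdorff R) (fx x)).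
apply: (@Ap_dom (fun j x => f j x * \1_(cube j%:R) x) _ u) => //.
- move=> j.
 have -> : (fun x => f j x * \1_(cube j%:R) x) = fun x => \sum_(i < #|`fset_set (f j @` setT)|)
   (fset_set (f j @` setT))`_i * \1_(f j @^-1` [set (fset_set (f j @` setT))`_i] `&` cube j%:R) x.
  apply/funext => x; rewrite {1}(fimfunEord (f j) x) mulr_suml; apply: eq_bigr => i _.
  by rewrite indicI mulrA.
 by apply: Ap_sum => i; apply: ApZ; apply: Ap_indic; exact: measurable_sfunP.
- move=> j x; rewrite indicE normrM; have f0 : 0 <= f j x by exact: fun_ge0.
 by rewrite ger0_norm//; case: (x \in _); rewrite ?normr1 ?normr0 ?mulr1 ?mulr0.
- move=> x; rewrite -[u x]mulr1; apply: cvgM; first exact: fx.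
 apply: cvg_near_cst; pose S := \sum_j `|x ord0 j|.
 exists (Num.truncn S).+1 => // j /= hj; rewrite indicE mem_set// => i; rewrite /= in_itv/=.
 have h1 : S < (Num.truncn S).+1%:R := truncnS_gt _.
 have h3 : (Num.truncn S).+1%:R <= j%:R :> R by rewrite ler_nat.
 have h2 : `|x ord0 i| <= S by rewrite /S (bigD1 i)//= lerDl sumr_ge0.
 have := ler_norm (x ord0 i); have := ler_norm (- x ord0 i); rewrite normrN => h4 h5.
 by apply/andP; split; lra.
Qed.

Lemma density u eps : measurable_fun setT u -> (N2 u < +oo)%E -> 0 < eps ->
 exists2 h, rnice h & (N2 (fun x => (u x - h x)%R) <= eps%:E)%E.
Proof.
move=> mu_ u2 e0.
have P v : measurable_fun setT v -> (forall x, `|v x| <= `|u x|) -> (forall x, 0 <= v x) -> Ap v.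
 move=> mv vu v0; apply: N2_max => //; apply: le_lt_trans u2; exact: N2_le.
have A1 : Ap (fun x => Num.max (u x) 0).
 apply: P => [|x|x]; [by apply: measurable_maxr|..]; last by rewrite le_max lexx orbT.
 by case: (leP (u x) 0) => h; rewrite ?normr0.
have A2 : Ap (fun x => Num.max (- u x) 0).
 apply: P => [|x|x]; [by apply: measurable_maxr => //; exact: measurable_funN|..]; last by rewrite le_max lexx orbT.
 by case: (leP (- u x) 0) => h; rewrite ?normr0 ?normrN.
have [_ /(_ _ e0)[h rh Hh]] := ApD A1 (ApZ (-1) A2).
exists h => //; apply: le_trans Hh; rewrite (_ : (fun x => u x - h x) =
 fun x => Num.max (u x) 0 + -1 * Num.max (- u x) 0 - h x)//.
apply/funext => x; congr (_ - _); rewrite mulN1r.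
by case: (leP (u x) 0) => h1; case: (leP (- u x) 0) => h2; lra.
Qed.

End density.

(** * Square integrable functions and their inner products *)

Section L2.
Context {R : realType} (d : nat).
Local Notation X := 'rV[R]_d.
Local Notation mu := (@lebesgue_rV R d).
Implicit Types (f g h : X -> R[i]).

Definition nf f : R := fine (L2norm2 f).

Lemma sqm f : L2fun f -> measurable_fun setT (fun x => nc (f x) ^+ 2).
Proof.
move=> [mR mI _]; under eq_fun do rewrite nc_sqr.
by apply: measurable_funD; apply: measurable_funX.
Qed.

Lemma L2_int f : L2fun f -> mu.-integrable setT (fun x => (nc (f x) ^+ 2)%:E).
Proof.
move=> Lf; have ms := sqm Lf; case: Lf => _ _ foo.
apply/integrableP; split; first exact/measurable_EFinP.
rewrite (eq_integral (fun x => (nc (f x) ^+ 2)%:E))// => x _.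
by rewrite gee0_abs// lee_fin sqr_ge0.
Qed.

Lemma L2norm2_ge0 f : (0 <= L2norm2 f)%E.
Proof. by apply: integral_ge0 => x _; rewrite lee_fin sqr_ge0. Qed.
Lemma nf_ge0 f : 0 <= nf f. Proof. by rewrite fine_ge0// L2norm2_ge0. Qed.
Lemma L2norm2E f : L2fun f -> L2norm2 f = (nf f)%:E.
Proof. by move=> [_ _ foo]; rewrite /nf fineK// ge0_fin_numE// L2norm2_ge0. Qed.
Lemma nice_L2 f : nice f -> L2fun f.
Proof.
move=> /nice_ReIm[rR rI]; split; [exact: rn_measurable|exact: rn_measurable|].
have rn : rnice (fun x => nc (f x) ^+ 2).
 under eq_fun do rewrite nc_sqr !expr2.
 by apply: rn_D; apply: rnM.
exact: integrable_lty (rn_integrable rn).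
Qed.

Lemma L2_of f : measurable_fun setT (Re \o f) -> measurable_fun setT (Im \o f) ->
 forall F : X -> R, mu.-integrable setT (EFin \o F) -> (forall x, nc (f x) ^+ 2 <= F x) -> L2fun f.
Proof.
move=> mR mI F iF fF; split=> //.
have F0 x : 0 <= F x by rewrite (le_trans _ (fF x))// sqr_ge0.
apply: le_lt_trans; last exact: integrable_lty iF.
apply: ge0_le_integral => //.
- by move=> x _; rewrite lee_fin sqr_ge0.
- apply/measurable_EFinP; under eq_fun do rewrite nc_sqr.
 by apply: measurable_funD; apply: measurable_funX.
- by have /integrableP[] := iF.
- by move=> x _; rewrite lee_fin.
Qed.

Lemma L2_D f g : L2fun f -> L2fun g -> L2fun (fun x => f x + g x).
Proof.
move=> Lf Lg; have iF := L2_int Lf; have iG := L2_int Lg.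
apply: (L2_of _ _ (F := fun x => 2 * nc (f x) ^+ 2 + 2 * nc (g x) ^+ 2)).
- case: Lf Lg => mf _ _ [mg _ _]; rewrite (_ : _ \o _ = (Re \o f) \+ (Re \o g)).
  exact: measurable_funD.
 by apply/funext => x /=; rewrite RecD.
- case: Lf Lg => _ mf _ [_ mg _]; rewrite (_ : _ \o _ = (Im \o f) \+ (Im \o g)).
  exact: measurable_funD.
 by apply/funext => x /=; rewrite ImcD.
- have := integrableD measurableT (integrableZl measurableT 2 iF) (integrableZl measurableT 2 iG).
 by congr integrable.
- move=> x; have h : nc (f x + g x) <= nc (f x) + nc (g x) := ncD _ _.
 apply: (@le_trans _ _ ((nc (f x) + nc (g x)) ^+ 2)).
  by rewrite lerXn2r ?nnegrE ?addr_ge0 ?nc_ge0.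
 have : 0 <= (nc (f x) - nc (g x)) ^+ 2 by rewrite sqr_ge0.
 by rewrite !expr2; lra.
Qed.

Lemma L2_N f : L2fun f -> L2fun (fun x => - f x).
Proof.
move=> Lf; apply: (L2_of _ _ (L2_int Lf)).
- case: Lf => mf _ _; rewrite (_ : _ \o _ = \- (Re \o f)); first exact: measurable_funN.
 by apply/funext => x /=; rewrite RecN.
- case: Lf => _ mf _; rewrite (_ : _ \o _ = \- (Im \o f)); first exact: measurable_funN.
 by apply/funext => x /=; rewrite ImcN.
- by move=> x; rewrite ncN.
Qed.

Definition ci (F : X -> R[i]) := mu.-integrable setT (EFin \o (Re \o F)) /\
 mu.-integrable setT (EFin \o (Im \o F)).

Lemma L2_ci f g : L2fun f -> L2fun g -> ci (fun x => f x * ((g x)^*)%C).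
Proof.
move=> Lf Lg; have iF := L2_int Lf; have iG := L2_int Lg.
have iS := integrableD measurableT iF iG.
have P (h : R[i] -> R) : (forall z, `|h z| <= nc z) ->
  measurable_fun setT (fun x => h (f x * ((g x)^*)%C)) ->
  mu.-integrable setT (EFin \o (fun x => h (f x * ((g x)^*)%C))).
 move=> hn mh; apply: le_integrable iS => //; first exact/measurable_EFinP.
 move=> x _ /=; rewrite lee_fin [leRHS]ger0_norm ?addr_ge0 ?sqr_ge0//.
 rewrite (le_trans (hn _))// ncM nc_conj.
 have : 0 <= (nc (f x) - nc (g x)) ^+ 2 by rewrite sqr_ge0.
 have := sqr_ge0 (nc (f x) + nc (g x)); rewrite !expr2; lra.
case: Lf Lg => mf1 mf2 _ [mg1 mg2 _]; split.
 apply: (P Re); first exact: Re_le_nc.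
 under eq_fun do rewrite RecM RecJ ImcJ mulrN opprK.
 by apply: measurable_funD; apply: measurable_funM.
apply: (P Im); first exact: Im_le_nc.
under eq_fun do rewrite ImcM RecJ ImcJ mulrN addrC.
by apply: measurable_funB; apply: measurable_funM.
Qed.

Lemma ciD (F G : X -> R[i]) : ci F -> ci G ->
 ci (fun x => F x + G x) /\ cintegral (fun x => F x + G x) = cintegral F + cintegral G.
Proof.
move=> [F1 F2] [G1 G2].
have eR : Re \o (fun x => F x + G x) = (Re \o F) \+ (Re \o G) by apply/funext => x /=; rewrite RecD.
have eI : Im \o (fun x => F x + G x) = (Im \o F) \+ (Im \o G) by apply/funext => x /=; rewrite ImcD.
split.
 by split; [rewrite eR|rewrite eI]; [exact: (integrableD measurableT F1 G1)|exact: (integrableD measurableT F2 G2)].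
by rewrite /cintegral eR eI !RintegralD.
Qed.

Lemma ciZ c (F : X -> R[i]) : ci F ->
 ci (fun x => c * F x) /\ cintegral (fun x => c * F x) = c * cintegral F.
Proof.
move=> [F1 F2].
have eR : Re \o (fun x => c * F x) = fun x => Re c * (Re \o F) x - Im c * (Im \o F) x.
 by apply/funext => x /=; rewrite RecM.
have eI : Im \o (fun x => c * F x) = fun x => Re c * (Im \o F) x + Im c * (Re \o F) x.
 by apply/funext => x /=; rewrite ImcM.
have Z k (u : X -> R) : mu.-integrable setT (EFin \o u) -> mu.-integrable setT (EFin \o (fun x => k * u x)).
 by move=> iu; exact: (integrableZl measurableT k iu).
split.
 split; [rewrite eR|rewrite eI].
  exact: (integrableB measurableT (Z (Re c) _ F1) (Z (Im c) _ F2)).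
 exact: (integrableD measurableT (Z (Re c) _ F2) (Z (Im c) _ F1)).
rewrite /cintegral eR eI RintegralB ?RintegralD ?RintegralZl//; try exact: Z.
by apply/eqP; rewrite eq_complex RecM ImcM/= !eqxx.
Qed.

Lemma ci0 : ci (fun=> 0) /\ cintegral (fun _ : X => 0) = 0.
Proof.
have := ciZ 0 (L2_ci (nice_L2 (nice0 d)) (nice_L2 (nice0 d))).
by under eq_fun do rewrite mul0r; rewrite mul0r.
Qed.

Lemma L2inner_sumr_gen I (r : seq I) f (c : I -> R[i]) (G : I -> X -> R[i]) : L2fun f -> (forall i, L2fun (G i)) ->
 L2inner f (fun x => \sum_(i <- r) c i * G i x) = \sum_(i <- r) ((c i)^*)%C * L2inner f (G i).
Proof.
move=> Lf LG; rewrite L2innerE.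
suff : ci (fun x => f x * ((\sum_(i <- r) c i * G i x)^*)%C) /\
  cintegral (fun x => f x * ((\sum_(i <- r) c i * G i x)^*)%C) = \sum_(i <- r) ((c i)^*)%C * L2inner f (G i) by case.
elim: r => [|i r [IH1 IH2]].
 by under eq_fun do rewrite big_nil conjc0 mulr0; rewrite big_nil; exact: ci0.
under eq_fun do rewrite big_cons cjD cjM mulrDr mulrCA.
have [c1 e1] := ciZ ((c i)^*)%C (L2_ci Lf (LG i)).
have [c2 e2] := ciD c1 IH1; split=> //.
by rewrite big_cons e2 e1 IH2.
Qed.

Lemma L2inner_sub f h g : L2fun f -> L2fun h -> L2fun g ->
 L2inner f g = L2inner (fun x => f x - h x) g + L2inner h g.
Proof.
move=> Lf Lh Lg; rewrite !L2innerE.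
have Lfh : L2fun (fun x => f x - h x) by apply: L2_D => //; exact: L2_N.
have [_ <-] := ciD (L2_ci Lfh Lg) (L2_ci Lh Lg).
by congr cintegral; apply/funext => x; ring.
Qed.

Lemma L2inner_self f : L2fun f -> L2inner f f = (nf f)%:C%C.
Proof.
move=> Lf; rewrite L2innerE /cintegral; congr (_ +i* _)%C.
 rewrite /nf /L2norm2 /Rintegral; congr fine; apply: eq_integral => x _ /=.
 by rewrite mul_conj.
rewrite /Rintegral (eq_integral (fun=> 0%E)) ?integral0// => x _ /=.
by rewrite mul_conj.
Qed.

(** A pointwise substitute for the Cauchy-Schwarz inequality; the weight [s] is tuned at each
    use. *)
Lemma amgm f g (s : R) : L2fun f -> L2fun g -> 0 < s ->
 2 * Re (L2inner f g) <= s * nf f + s^-1 * nf g.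
Proof.
move=> Lf Lg s0; have iF := L2_int Lf; have iG := L2_int Lg.
have nfE (h : X -> R[i]) : nf h = Rintegral mu setT (fun x => nc (h x) ^+ 2) by [].
have Z k (u : X -> R) : mu.-integrable setT (EFin \o u) -> mu.-integrable setT (EFin \o (fun x => k * u x)).
 by move=> iu; exact: (integrableZl measurableT k iu).
rewrite !nfE L2innerE /cintegral/=; have [cR _] := L2_ci Lf Lg.
rewrite -!RintegralZl// -RintegralD//; [|exact: Z|exact: Z].
apply: le_Rintegral => //; first exact: Z.
 exact: (integrableD measurableT (Z s _ iF) (Z s^-1 _ iG)).
move=> x _ /=; apply: (@le_trans _ _ (2 * (nc (f x) * nc (g x)))).
 by rewrite ler_wpM2l// -[nc (g x)]nc_conj -ncM (le_trans (ler_norm _))// Re_le_nc.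
have : 0 <= s * (nc (f x) - s^-1 * nc (g x)) ^+ 2 by rewrite mulr_ge0 ?sqr_ge0// ltW.
have -> : s * (nc (f x) - s^-1 * nc (g x)) ^+ 2 =
 s * nc (f x) ^+ 2 - 2 * (s * s^-1) * (nc (f x) * nc (g x)) + (s * s^-1) * s^-1 * nc (g x) ^+ 2 by ring.
by rewrite mulfV ?gt_eqF// mulr1 mul1r; lra.
Qed.

Lemma rn_nice (u : X -> R) : rnice u -> nice (fun x => (u x)%:C%C).
Proof.
elim=> {u} [c u cu|u v _ Iu _ Iv]; last by under eq_fun do rewrite rmorphD; exact: n_D.
rewrite (_ : (fun x => _) = fun x => c%:C%C * ten (fun i t => (u i t)%:C%C) x).
 apply: n_ten => i; case: (cu i) => su [B oB]; split; first exact: csm_real.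
 by exists B => t tB; rewrite oB.
by apply/funext => x; rewrite rcM /ten rmorph_prod.
Qed.

Lemma L2_dense f (eps : R) : L2fun f -> 0 < eps -> exists2 h, nice h & nf (fun x => f x - h x) <= eps.
Proof.
move=> Lf e0; have e2 : 0 < eps / 2 by rewrite divr_gt0.
have part (p : R[i] -> R) : (forall z, `|p z| <= nc z) -> measurable_fun setT (p \o f) ->
  exists2 u, rnice u & (N2 (fun x => ((p \o f) x - u x)%R) <= (eps / 2)%:E)%E.
 move=> pn mp; apply: density => //; have [_ _ Lo] := Lf; apply: le_lt_trans Lo.
 apply: ge0_le_integral => //.
 - by move=> x _; rewrite lee_fin sqr_ge0.
 - exact: msq.
 - by apply/measurable_EFinP; apply: sqm.
 - by move=> x _; rewrite lee_fin /= -[leLHS]sqrn lerXn2r ?nnegrE ?nc_ge0.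
have [mR mI _] := Lf.
have [u ru hu] := part Re (@Re_le_nc R) mR; have [v rv hv] := part Im (@Im_le_nc R) mI.
exists (fun x => (u x)%:C%C + 'i%C * (v x)%:C%C).
 by apply: n_D; [exact: rn_nice|apply: niceZ; exact: rn_nice].
have mRu : measurable_fun setT (fun x => (Re \o f) x - u x).
 by apply: measurable_funB => //; exact: rn_measurable.
have mIv : measurable_fun setT (fun x => (Im \o f) x - v x).
 by apply: measurable_funB => //; exact: rn_measurable.
have E : (L2norm2 (fun x => (f x - ((u x)%:C%C + 'i%C * (v x)%:C%C))%R) =
  N2 (fun x => ((Re \o f) x - u x)%R) + N2 (fun x => ((Im \o f) x - v x)%R))%E.
 rewrite /N2 -ge0_integralD//.
 - apply: eq_integral => x _; rewrite -EFinD; congr EFin; rewrite nc_sqr.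
  rewrite RecD ImcD RecN ImcN RecD ImcD RecM ImcM /=; ring.
 - by move=> x _; rewrite lee_fin sqr_ge0.
 - exact: msq.
 - by move=> x _; rewrite lee_fin sqr_ge0.
 - exact: msq.
have h : (L2norm2 (fun x => (f x - ((u x)%:C%C + 'i%C * (v x)%:C%C))%R) <= eps%:E)%E.
 rewrite E (splitr eps) EFinD; exact: leeD.
by rewrite -lee_fin /nf fineK// ge0_fin_numE ?L2norm2_ge0// (le_lt_trans h)// ltry.
Qed.

Lemma nf_D f g : L2fun f -> L2fun g -> nf (fun x => f x + g x) <= 2 * nf f + 2 * nf g.
Proof.
move=> Lf Lg; have iF := L2_int Lf; have iG := L2_int Lg; have iFG := L2_int (L2_D Lf Lg).
have Z k (u : X -> R) : mu.-integrable setT (EFin \o u) -> mu.-integrable setT (EFin \o (fun x => k * u x)).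
 by move=> iu; exact: (integrableZl measurableT k iu).
have nfE (h : X -> R[i]) : nf h = Rintegral mu setT (fun x => nc (h x) ^+ 2) by [].
rewrite !nfE -!RintegralZl// -RintegralD//; [|exact: Z|exact: Z].
apply: le_Rintegral => //.
 exact: (integrableD measurableT (Z 2 _ iF) (Z 2 _ iG)).
move=> x _ /=; have h : nc (f x + g x) <= nc (f x) + nc (g x) := ncD _ _.
apply: (@le_trans _ _ ((nc (f x) + nc (g x)) ^+ 2)).
 by rewrite lerXn2r ?nnegrE ?addr_ge0 ?nc_ge0.
have : 0 <= (nc (f x) - nc (g x)) ^+ 2 by rewrite sqr_ge0.
by rewrite !expr2; lra.
Qed.

Lemma nf_nice f : nice f -> nf f = Re (L2inner f f).
Proof. by move=> nf'; rewrite L2inner_self//; exact: nice_L2. Qed.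

End L2.

(** * Bessel bounds, Riesz sequences and duality *)

Section synthesis.
Context {R : realType} (d : nat).
Implicit Types (f g h : 'rV[R]_d -> R[i]) (N : 'M[R]_(d + d)).
Local Notation m := (d + d)%N.

Definition syn N (s : seq 'rV[int]_m) (c : 'rV[int]_m -> R[i]) g : 'rV[R]_d -> R[i] :=
 fun x => \sum_(k <- s) c k * tfshift (lat N k) g x.

Lemma nice_syn N s c g : nice g -> nice (syn N s c g).
Proof. by move=> ng; apply: nice_sum => k; apply: niceZ; exact: nice_tf. Qed.
Lemma L2inner_syn N s c s' c' f g : nice f -> nice g -> L2inner (syn N s c f) (syn N s' c' g) =
 \sum_(k <- s) \sum_(l <- s') c k * ((c' l)^*)%C * L2inner (tfshift (lat N k) f) (tfshift (lat N l) g).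
Proof.
move=> nf ng; rewrite /syn L2inner_suml.
- apply: eq_bigr => k _; rewrite L2inner_sumr.
 + apply: eq_bigr => l _; rewrite L2innerZl ?L2innerZr ?mulrA//; try exact: nice_tf.
  by apply: niceZ; exact: nice_tf.
 + by move=> l; apply: niceZ; exact: nice_tf.
 + by apply: niceZ; exact: nice_tf.
- by move=> k; apply: niceZ; exact: nice_tf.
- by apply: nice_sum => k; apply: niceZ; exact: nice_tf.
Qed.

(** Schur's test: split c_k c'_l by the arithmetic-geometric inequality; the row and the column sums
    of the convolution kernel are both at most [M]. *)
Lemma schur (T : zmodType) (a : T -> R) M (s : seq T) (c c' : T -> R) :
 (forall k, 0 <= a k) -> bs a M -> uniq s -> (forall k, 0 <= c k) -> (forall k, 0 <= c' k) ->
 \sum_(k <- s) \sum_(l <- s) c k * c' l * a (l - k) <=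
 M / 2 * (\sum_(k <- s) c k ^+ 2) + M / 2 * (\sum_(k <- s) c' k ^+ 2).
Proof.
move=> a0 aM us c0 c'0.
apply: (@le_trans _ _ (\sum_(k <- s) \sum_(l <- s) (c k ^+ 2 / 2 * a (l - k) + c' l ^+ 2 / 2 * a (l - k)))).
 apply: ler_sum => k _; apply: ler_sum => l _; rewrite -mulrDl ler_wpM2r//.
 have : 0 <= (c k - c' l) ^+ 2 by rewrite sqr_ge0.
 by rewrite !expr2; lra.
have aM1 k : \sum_(l <- s) a (l - k) <= M.
 by have := bs_inj (f := fun l => l - k) (addIr (- k)) aM us.
have aM2 l : \sum_(k <- s) a (l - k) <= M.
 by have := bs_inj (f := fun k => l - k) (fun (x y : T) e => oppr_inj (@addrI _ l _ _ e)) aM us.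
under eq_bigr do rewrite big_split/=; rewrite big_split/=; apply: lerD.
 rewrite mulr_sumr; apply: ler_sum => k _; rewrite -mulr_sumr.
 have -> : M / 2 * c k ^+ 2 = c k ^+ 2 / 2 * M by ring.
 by rewrite ler_wpM2l ?divr_ge0 ?sqr_ge0.
rewrite exchange_big/= mulr_sumr; apply: ler_sum => l _; rewrite -mulr_sumr.
have -> : M / 2 * c' l ^+ 2 = c' l ^+ 2 / 2 * M by ring.
by rewrite ler_wpM2l ?divr_ge0 ?sqr_ge0.
Qed.

Lemma nc_gram N f g k l : nice f -> nice g ->
 nc (L2inner (tfshift (lat N k) f) (tfshift (lat N l) g)) = nc (V f g (lat N (l - k))).
Proof. by move=> nf ng; rewrite V_cov// ncM nc_e mul1r -latB. Qed.
Lemma nc3 (x y z : R[i]) : nc (x * (y^*)%C * z) = nc x * nc y * nc z.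
Proof. by rewrite ncM ncM nc_conj. Qed.
Lemma gram_bound N f g M s c c' : nice f -> nice g -> bs (fun k => nc (V f g (lat N k))) M -> uniq s ->
 nc (L2inner (syn N s c f) (syn N s c' g)) <=
 M / 2 * (\sum_(k <- s) nc (c k) ^+ 2) + M / 2 * (\sum_(k <- s) nc (c' k) ^+ 2).
Proof.
move=> nf ng bM us; apply: le_trans (schur (fun k => nc_ge0 _) bM us (fun k => nc_ge0 (c k)) (fun k => nc_ge0 (c' k))).
rewrite L2inner_syn// (le_trans (nc_sum _ _ _))//; apply: ler_sum => k _.
rewrite (le_trans (nc_sum _ _ _))//; apply: ler_sum => l _.
move: (nc_gram N k l nf ng); move: (L2inner (tfshift (lat N k) f) _) (V f g _) => z w E.
by rewrite nc3 E.
Qed.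

Lemma bessel_syn N g M s c : nice g -> bs (fun k => nc (V g g (lat N k))) M -> uniq s ->
 nf (syn N s c g) <= M * (\sum_(k <- s) nc (c k) ^+ 2).
Proof.
move=> ng bM us; rewrite nf_nice; last exact: nice_syn.
rewrite (le_trans (ler_norm _))// (le_trans (Re_le_nc _))// (le_trans (gram_bound c c ng ng bM us))//.
by rewrite -mulrDl; set x := \sum_(k <- s) _; lra.
Qed.

Lemma bs_V N f g : N \in unitmx -> nice f -> nice g -> exists2 M, 0 < M & bs (fun k => nc (V f g (lat N k))) M.
Proof.
move=> uN nf ng; have [C C0 HC] := V_decay (2 * m) nf ng.
have [c c0 [eta eta0 low]] := lat_lower uN.
have nm00 : nm (N - N) <= eta.
 by rewrite subrr /nm big1 ?ltW// => i _; rewrite big1// => j _; rewrite mxE normr0.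
exists (C * (1 + c^-1) ^+ (2 * m) * 2 ^+ m * 2 ^+ m + 1).
 by rewrite ltr_wpDl// !mulr_ge0// ?exprn_ge0 ?addr_ge0 ?invr_ge0 ?(ltW c0).
have c1 : 0 <= C * (1 + c^-1) ^+ (2 * m) * 2 ^+ m.
 by rewrite !mulr_ge0// ?exprn_ge0 ?addr_ge0 ?invr_ge0 ?(ltW c0).
move=> s us; apply: le_trans (_ : C * (1 + c^-1) ^+ (2 * m) * 2 ^+ m * 2 ^+ m <= _); last by rewrite lerDl.
apply: (bs_le _ (bsZ c1 (@bs_wt R m)) us) => k.
by apply: (bs_decay (F := V f g)) => // l; exact: low.
Qed.

(** Test [f] against the synthesis of its own coefficients c. With weight M, twice the sum of |c|^2
    is at most M nf f plus 1/M times the squared norm of the synthesis, and the latter term is at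
    most the sum itself. *)
Lemma bessel N g : N \in unitmx -> nice g -> exists2 B, 0 < B & forall f, L2fun f -> forall s, uniq s ->
 \sum_(k <- s) nc (L2inner f (tfshift (lat N k) g)) ^+ 2 <= B * nf f.
Proof.
move=> uN ng; have [M M0 bM] := bs_V uN ng ng.
exists M => // f Lf s us.
pose c k := L2inner f (tfshift (lat N k) g).
have h1 := bessel_syn c ng bM us.
have := amgm Lf (nice_L2 (nice_syn N s c ng)) M0.
rewrite /syn L2inner_sumr_gen//; last by move=> k; apply: nice_L2; exact: nice_tf.
have -> : \sum_(i <- s) ((c i)^*)%C * L2inner f (tfshift (lat N i) g) = (\sum_(k <- s) nc (c k) ^+ 2)%:C%C.
 by rewrite rmorph_sum; apply: eq_bigr => k _; rewrite mulrC mul_conj.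
rewrite -/(syn N s c g) /=; rewrite -/(c _).
have h2 : M^-1 * nf (syn N s c g) <= \sum_(k <- s) nc (c k) ^+ 2.
 by rewrite mulrC ler_pdivrMr// mulrC.
rewrite -[\sum_(k <- s) nc (L2inner _ _) ^+ 2]/(\sum_(k <- s) nc (c k) ^+ 2).
by move: h2; set x := \sum_(k <- s) _; lra.
Qed.

(** The lower Riesz inequality only; for nice [g] and invertible [N] the upper one comes from
    [bessel_syn]. *)
Definition riesz N g := exists2 A, 0 < A & forall s c, uniq s ->
 A * (\sum_(k <- s) nc (c k) ^+ 2) <= nf (syn N s c g).

Definition bx n (L : nat) : seq 'rV[int]_n := [seq \row_j (p : {ffun 'I_n -> int}) j | p <- boxf n (zr L)].

Lemma bx_uniq n L : uniq (bx n L).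
Proof.
rewrite map_inj_uniq ?boxf_uniq// => p p' /rowP hh; apply/ffunP => j.
by have := hh j; rewrite !mxE.
Qed.
Lemma mem_bx n L (k : 'rV[int]_n) : (k \in bx n L) = [forall j, (`|k ord0 j| <= L)%N].
Proof.
apply/mapP/forallP => [[p + ->] j|H].
 by rewrite mem_boxf => /forallP/(_ j); rewrite mem_zr mxE.
exists [ffun j => k ord0 j]; last by apply/rowP => j; rewrite mxE ffunE.
by rewrite mem_boxf; apply/forallP => j; rewrite ffunE mem_zr.
Qed.
Lemma size_bx n L : size (bx n L) = ((2 * L).+1 ^ n)%N.
Proof.
by rewrite size_map /boxf size_image card_ffun card_ord card_seq_sub ?zr_uniq// size_map size_iota.
Qed.

Lemma bernoulli_sub n (x : R) : 0 <= x <= 1 -> 1 - n%:R * x <= (1 - x) ^+ n.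
Proof.
move=> /andP[x0 x1]; elim: n => [|n IH]; first by rewrite mul0r subr0 expr0.
have n0 : 0 <= n%:R :> R by [].
rewrite exprS -natr1; apply: (@le_trans _ _ ((1 - x) * (1 - n%:R * x))); first by nra.
by rewrite ler_wpM2l// subr_ge0.
Qed.

Lemma V_self_conj f g z : HH f g f g z = (nc (V f g z) ^+ 2)%:C%C.
Proof. by rewrite /HH mul_conj. Qed.
Lemma folner_num (rho t nt eps K : R) : 0 <= rho <= 1 -> - t <= nt -> 0 < eps ->
 (1 - rho) * (K + nt + 1) <= eps / 2 -> rho * (t + eps / 2) + (1 - rho) * K <= t + eps.
Proof.
move=> /andP[r0 r1] tn e0 h.
have h1 : 0 <= (1 - rho) * (t + nt) by rewrite mulr_ge0//; lra.
have h2 : 0 <= (1 - rho) * (eps / 2) by rewrite mulr_ge0//; lra.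
lra.
Qed.

Section folner.
Variables (n : nat) (H : 'rV[int]_n -> R[i]) (M : R) (T : R[i]) (Q : R).
Hypotheses (M0 : 0 <= M) (hM : bs (fun k => nc (H k)) M) (hT : hs H T).
Hypothesis hQ : forall L, Q * (size (bx n L))%:R <=
 Re (\sum_(k <- bx n L) \sum_(l <- bx n L) H (l - k)).

(* The double sum over a large box is nearly [size * T]: every row indexed by an
  interior point is a partial sum of [H] over a set containing a fixed box. *)
Lemma folner : Q <= Re T.
Proof.
have n1 (p q : nat) : (2 * q <= (2 * (p + q)).+1)%N by clear; lia.
have n2 (p q : nat) : ((2 * (p + q)).+1 - 2 * q = (2 * p).+1)%N by clear; lia.
have n3 (p q : nat) : (2 * q * p <= q * (2 * (p + q)).+1)%N by clear; nia.
apply/ler_addgt0Pr => eps e0; have e2 : 0 < eps / 2 by rewrite divr_gt0.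
have [A HA] := hT e2.
pose r := (\max_(k <- A) \max_j `|k ord0 j|)%N.
have Ar k : k \in A -> k \in bx n r.
 move=> kA; rewrite mem_bx; apply/forallP => j.
 apply: (leq_trans (leq_bigmax j : (`|k ord0 j| <= \max_j `|k ord0 j|)%N)).
 by rewrite /r (big_rem k kA)/= leq_maxl.
pose Y := M + `|Re T| + 1; have Y0 : 0 < Y by rewrite ltr_wpDl// addr_ge0.
(* The boundary layer of width r occupies at most the proportion n r / L of the large box, by
   Bernoulli's inequality. *)
pose L := (Num.truncn (2 * n%:R * r%:R * Y / eps)).+1.
pose a : R := (size (bx n (L + r)))%:R; pose b : R := (size (bx n L))%:R.
have sub : {subset bx n L <= bx n (L + r)}.
 move=> k; rewrite !mem_bx => /forallP hk; apply/forallP => j.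
 by rewrite (leq_trans (hk j))// leq_addr.
have uL := bx_uniq n L; have uLr := bx_uniq n (L + r).
have int_row k : k \in bx n L -> Re (\sum_(l <- bx n (L + r)) H (l - k)) <= Re T + eps / 2.
 move=> kL; rewrite -lerBlDl -RecN -RecD (le_trans (ler_norm _))// (le_trans (Re_le_nc _))//.
 rewrite -(big_map (fun l => l - k) xpredT H); apply: HA.
  by rewrite map_inj_uniq//; exact: addIr.
 move=> l /Ar; rewrite mem_bx => /forallP lr; apply/mapP; exists (l + k); rewrite ?addrK//.
 move: kL; rewrite !mem_bx => /forallP kL; apply/forallP => j; rewrite mxE.
 have tri (x y : int) : (`|x| <= r)%N -> (`|y| <= L)%N -> (`|(x + y)%R| <= L + r)%N by lia.
 exact: tri (lr j) (kL j).
have any_row k : Re (\sum_(l <- bx n (L + r)) H (l - k)) <= M.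
 rewrite (le_trans (ler_norm _))// (le_trans (Re_le_nc _))// (le_trans (nc_sum _ _ _))//.
 exact: (bs_inj (f := fun l => l - k) (addIr (- k)) hM uLr).
have main : Q * a <= b * (Re T + eps / 2) + (a - b) * M.
 apply: (le_trans (hQ (L + r))); rewrite ReE_sum (sum_split _ uL uLr sub) lerD//.
  rewrite [leRHS]mulr_natl -[leRHS]/((Re T + eps / 2) *+ size (bx n L)).
  rewrite -iter_addr_0 -[size _]count_predT -big_const_seq big_seq [leRHS]big_seq.
  by apply: ler_sum => k kL; exact: int_row.
 apply: (@le_trans _ _ (\sum_(k <- bx n (L + r) | k \notin bx n L) M)).
  by apply: ler_sum => k _; exact: any_row.
 have S1 (s : seq 'rV[int]_n) : \sum_(i <- s) (1 : R) = (size s)%:R.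
  by rewrite big_const_seq count_predT iter_addr_0.
 have : a = b + \sum_(k <- bx n (L + r) | k \notin bx n L) 1.
  have := sum_split (fun=> (1 : R)) uL uLr sub.
  by rewrite !S1.
 move=> ->; rewrite [b + _ - b]addrAC subrr add0r mulr_suml; apply: ler_sum => k _; by rewrite mul1r.
have aE : a = (2 * (L + r)).+1%:R ^+ n by rewrite /a size_bx natrX.
have bE : b = (2 * L).+1%:R ^+ n by rewrite /b size_bx natrX.
have a0 : 0 < a by rewrite aE exprn_gt0.
pose x : R := (2 * r)%:R / (2 * (L + r)).+1%:R.
have q0 : 0 < (2 * (L + r)).+1%:R :> R by [].
have x0 : 0 <= x by rewrite divr_ge0.
have x1 : x <= 1 by rewrite ler_pdivrMr// mul1r ler_nat.
have ba : b = a * (1 - x) ^+ n.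
 rewrite aE bE -exprMn; congr (_ ^+ _); rewrite mulrBr mulr1 mulrC divfK ?gt_eqF//.
 by rewrite -natrB// n2.
have hx := bernoulli_sub n (_ : 0 <= x <= 1); rewrite x0 x1 in hx; have {}hx := hx isT.
have L0 : 2 * n%:R * r%:R * Y / eps < L%:R by exact: truncnS_gt.
have nxY : n%:R * x * Y <= eps / 2.
 have h1 : x <= r%:R / L%:R.
  rewrite ler_pdivrMr// mulrAC ler_pdivlMr; last by rewrite ltr0n.
  by rewrite -!natrM ler_nat.
 rewrite mulrAC (le_trans (ler_wpM2l _ h1)) ?mulr_ge0 ?(ltW Y0)//.
 rewrite mulrA ler_pdivrMr ?ltr0n//; move: L0; rewrite ltr_pdivrMr// => L0.
 by have := ltW L0; lra.
have bound : (1 - (1 - x) ^+ n) * Y <= eps / 2.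
 by apply: le_trans nxY; rewrite ler_wpM2r ?(ltW Y0)//; lra.
have rho1 : (1 - x) ^+ n <= 1 by rewrite exprn_ile1//; lra.
rewrite -(ler_pM2r a0) (le_trans main)// ba -[X in _ <= X]mulrC -mulrA -[X in _ + (X - _) * _]mulr1 -mulrBr -mulrA -mulrDr ler_wpM2l ?(ltW a0)//.
have ht := ler_norm (- Re T); rewrite normrN in ht; have t0 := normr_ge0 (Re T).
have rho0 : 0 <= (1 - x) ^+ n by rewrite exprn_ge0// subr_ge0.
exact: (@folner_num _ _ `|Re T| eps M (introT andP (conj rho0 rho1)) ht e0 bound).
Qed.

End folner.

Lemma beta0r (z : 'rV[R]_m) : beta z 0 = 0.
Proof. by rewrite /beta /dotr big1// => i _; rewrite [X in _ * X]mxE [X in _ * X]mxE mulr0. Qed.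
(** Use, at each point x, the Riesz inequality with the conjugates of the values at x of the shifts
    of [f] by a box of the adjoint lattice, and integrate in x. The left side becomes A times the
    size of the box times nf f, the right side a double sum of [H (l - k)]. Averaging over growing
    boxes leaves the sum of [H], which the fundamental identity converts into the sum of |V f g|^2
    over the lattice of [N]. *)
Lemma riesz_lower N f g A : N \in unitmx -> nice f -> nice g -> 0 <= A ->
 (forall s c, uniq s -> A * (\sum_(k <- s) nc (c k) ^+ 2) <= nf (syn (adj N) s c g)) ->
 exists S, hs (fun k => (nc (V f g (lat N k)) ^+ 2)%:C%C) S /\ A * nf f <= `|\det N| * Re S.
Proof.
move=> uN nf' ng A0 HA.
have [S [S1 S2]] := figa_all uN nf' ng nf' ng.
exists S; split; first by apply: hs_ext S1 => k; rewrite V_self_conj.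
pose H (l : 'rV[int]_m) := HH g g f f (lat (adj N) l).
have [C C0 HC] := HH_bound ng ng nf' nf'.
have uA := adj_unit uN.
have [M1 M10 bM1] := bs_V uA ng ng.
have [C' C'0 HC'] := V_decay 0 nf' nf'.
have bH : bs (fun k => nc (H k)) (C' * M1).
 apply: bs_le (bsZ C'0 bM1) => k; rewrite /H /HH ncM nc_conj mulrC ler_wpM2r ?nc_ge0//.
 by have := HC' (lat (adj N) k); rewrite expr0 invr1 mulr1.
have -> : `|\det N| * Re S = Re (`|\det N|%:C%C * S) by rewrite RecM/= mul0r subr0.
apply: (@folner _ H (C' * M1)) => //; first by rewrite mulr_ge0// ltW.
move=> L; set s := bx m L; have us : uniq s := bx_uniq m L.
pose w l := tfshift (lat (adj N) l) f.
have nw l : nice (w l) by exact: nice_tf.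
pose gr k l := L2inner (tfshift (lat (adj N) k) g) (tfshift (lat (adj N) l) g).
pose E x := A%:C%C * \sum_(k <- s) w k x * ((w k x)^*)%C.
pose F x := \sum_(k <- s) \sum_(l <- s) gr k l * (w l x * ((w k x)^*)%C).
have nww k l : nice (fun x => w l x * ((w k x)^*)%C) by apply: niceM => //; exact: nice_conj.
have nE : nice E by apply: niceZ; apply: nice_sum => k.
have nFk k : nice (fun x => \sum_(l <- s) gr k l * (w l x * ((w k x)^*)%C)).
 by apply: nice_sum => l; exact: niceZ.
have nF : nice F by exact: nice_sum.
(* The pointwise inequality, before integration. *)
have EF x : Re (E x) <= Re (F x).
 have := HA s (fun l => ((w l x)^*)%C) us; rewrite nf_nice; last exact: nice_syn.
 rewrite L2inner_syn//.
 have -> : Re (E x) = A * \sum_(k <- s) nc ((w k x)^*)%C ^+ 2.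
  rewrite /E RecM/= mul0r subr0 ReE_sum; congr (_ * _); apply: eq_bigr => k _.
  by rewrite mul_conj/= nc_conj.
 move/le_trans; apply; rewrite le_eqVlt; apply/orP; left; apply/eqP; congr (Re _).
 apply: eq_bigr => k _; apply: eq_bigr => l _; rewrite cjK mulrC; congr (_ * _).
 exact: mulrC.
have cE : cintegral E = (A * (size s)%:R * nf f)%:C%C.
 rewrite /E cintegralZ; last exact: nice_sum.
 have -> : cintegral (fun x => \sum_(k <- s) w k x * ((w k x)^*)%C) = \sum_(k <- s) L2inner (w k) (w k).
  elim: (s) => [|k r IH].
   by rewrite big_nil; under eq_fun do rewrite big_nil; have [_] := @ci0 R d.
  rewrite big_cons; under eq_fun do rewrite big_cons.
  by rewrite cintegralD ?IH//; exact: nice_sum.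
 rewrite (eq_bigr (fun=> (nf f)%:C%C)) => [|k _]; last first.
  rewrite /w V_cov// subrr /V tf0 L2inner_self; last exact: nice_L2.
  by rewrite beta0r oppr0 e0 mul1r.
 by rewrite big_const_seq count_predT iter_addr_0 -mulrA mulr_natl !rcM rmorphMn.
have cF : cintegral F = \sum_(k <- s) \sum_(l <- s) H (l - k).
 have cs (I : eqType) (r : seq I) (G : I -> 'rV[R]_d -> R[i]) : (forall i, nice (G i)) ->
   cintegral (fun x => \sum_(i <- r) G i x) = \sum_(i <- r) cintegral (G i).
  move=> nG; elim: r => [|k r IH].
   by rewrite big_nil; under eq_fun do rewrite big_nil; have [_] := @ci0 R d.
  rewrite big_cons; under eq_fun do rewrite big_cons.
  by rewrite cintegralD ?IH//; exact: nice_sum.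
 rewrite /F cs//; apply: eq_bigr => k _; rewrite cs; last by move=> l; exact: niceZ.
 apply: eq_bigr => l _; rewrite (cintegralZ _ (nww k l)) /H /HH /gr latB.
 have -> : cintegral (fun x => w l x * ((w k x)^*)%C) = ((L2inner (w k) (w l))^*)%C.
  by rewrite -L2inner_conj.
 rewrite /w (V_cov _ _ nf' nf') (V_cov _ _ ng ng) cjM mulrACA -eN opprK -eD addNr e0 mul1r//.
have h : RI (Re \o E) <= RI (Re \o F).
 have [r1 _] := nice_ReIm nE; have [r2 _] := nice_ReIm nF.
 by apply: RI_le.
have eE : RI (Re \o E) = Re (cintegral E) by [].
have eF : RI (Re \o F) = Re (cintegral F) by [].
by move: h; rewrite eE eF cE cF/= mulrAC.
Qed.

Lemma lat_inj N : N \in unitmx -> injective (lat N).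
Proof.
move=> uN k l /(congr1 (mulmx^~ (invmx N))); rewrite /lat !mulmxK// => /rowP h.
by apply/rowP => j; have := h j; rewrite !mxE => /intr_inj.
Qed.

Lemma duality_num (P D W a b c Bq : R) : 0 <= P -> P <= 2 * a + 2 * b -> a <= D * (2 * W + 2 * Bq + c) ->
 b <= P / 8 -> D * Bq <= P / 16 -> D * c = P / 16 -> P <= W * (16 * D).
Proof. lra. Qed.

(** [riesz_lower] is the lower frame bound for nice functions; the Bessel bound for the remainder
    extends it to all of L2 by density. *)
Theorem duality N g : N \in unitmx -> nice g -> riesz (adj N) g ->
 gabor_frame (lattice_of N^T) g.
Proof.
move=> uN ng [A A0 HA].
have [B B0 HB] := bessel uN ng.
pose D := `|\det N| + 1; have D0 : 0 < D by rewrite ltr_wpDl.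
have latE : lattice_of N^T = lat N @` setT.
 by apply/seteqP; split => x [k _ <-]; exists k => //; rewrite /lat trmxK.
exists (A / (16 * D)), B; split=> //; first by rewrite divr_gt0// mulr_gt0.
move=> f Lf.
pose F k := nc (L2inner f (tfshift (lat N k) g)) ^+ 2.
have eE : (\esum_(z in lattice_of N^T) (nc (L2inner f (tfshift z g)) ^+ 2)%:E)%E =
  (\esum_(k in [set: 'rV[int]_m]) (F k)%:E)%E.
 rewrite latE (esum_image setT (lat N)) //; first by move=> k l _ _; exact: lat_inj.
rewrite eE (L2norm2E Lf) -!EFinM.
have fsb s : uniq s -> (\sum_(k \in [set` s]) (F k)%:E)%E = (\sum_(k <- s) F k)%:E.
 by move=> us; rewrite -fsbig_seq// sumEFin.
apply/andP; split; last first.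
 apply: ge_ereal_sup => _ [Y [finY _] <-].
 have [s sE] := (finite_seqP Y).1 finY.
 have -> : Y = [set` undup s] by rewrite sE; apply/seteqP; split => x /=; rewrite mem_undup.
 by rewrite fsb ?undup_uniq// lee_fin; apply: HB => //; exact: undup_uniq.
have [f0|f0] := eqVneq (nf f) 0.
 rewrite f0 mulr0; apply: esum_ge0 => k _; by rewrite lee_fin sqr_ge0.
have nf0 : 0 < nf f by rewrite lt_neqAle eq_sym f0 nf_ge0.
(* The first bound keeps a fixed part of the norm of [f] in [h]; the second makes the coefficients
   of f - h, measured by the Bessel bound [B], absorbable. *)
pose eta := Num.min (nf f / 8) (A * nf f / (16 * D * B)).
have eta0 : 0 < eta by rewrite lt_min !divr_gt0 ?mulr_gt0.
have [h nh fh] := L2_dense Lf eta0.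
have [fh1 fh2] : nf (fun x => f x - h x) <= nf f / 8 /\ nf (fun x => f x - h x) <= A * nf f / (16 * D * B).
 by move: fh; rewrite le_min => /andP.
have Lh := nice_L2 nh.
have Lfh : L2fun (fun x => f x - h x) by apply: L2_D => //; exact: L2_N.
have hf : nf f <= 2 * nf h + 2 * nf (fun x => f x - h x).
 have -> : nf f = nf (fun x => h x + (f x - h x)).
  by congr nf; apply/funext => x; rewrite addrC subrK.
 exact: nf_D.
have [S [hS AS]] := riesz_lower uN nh ng (ltW A0) HA.
have e0 : 0 < A * nf f / (16 * D) by rewrite divr_gt0 ?mulr_gt0.
have [s0 Hs] := hS _ e0.
pose s := undup s0; have us : uniq s by exact: undup_uniq.
have ss : {subset s0 <= s} by move=> k ks; rewrite mem_undup.
have {}Hs := Hs s us ss.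
apply: esum_ge; exists [set` s].
 by split => //; apply/finite_seqP; exists s.
rewrite fsb// lee_fin.
set W := \sum_(k <- s) F k; pose q := nf (fun x => f x - h x).
pose Z := \sum_(k <- s) nc (V h g (lat N k)) ^+ 2.
have ZW : Z <= 2 * W + 2 * (B * q).
 apply: (@le_trans _ _ (2 * W + 2 * \sum_(k <- s) nc (L2inner (fun x => f x - h x) (tfshift (lat N k) g)) ^+ 2)).
  rewrite /Z /W !mulr_sumr -big_split; apply: ler_sum => k _.
  rewrite -[leRHS]/(2 * F k + 2 * nc (L2inner (fun x => f x - h x) (tfshift (lat N k) g)) ^+ 2) /F /V.
  have Lg := nice_L2 (nice_tf (lat N k) ng).
  have := L2inner_sub Lf Lh Lg.
  set G := tfshift (lat N k) g.
  move: (L2inner f G) (L2inner h G) (L2inner (fun x => f x - h x) G) => x y z ->.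
  have h1 : nc y <= nc (z + y) + nc z by have := ncBD (z + y) z; rewrite addrC addKr.
  apply: (@le_trans _ _ ((nc (z + y) + nc z) ^+ 2)).
   by rewrite lerXn2r ?nnegrE ?addr_ge0 ?nc_ge0.
  have : 0 <= (nc (z + y) - nc z) ^+ 2 by rewrite sqr_ge0.
  by rewrite !expr2; lra.
 by rewrite lerD2l ler_wpM2l//; exact: HB.
have SZ : Re S <= Z + A * nf f / (16 * D).
 have := le_trans (Re_le_nc _) Hs; rewrite RecD RecN -rmorph_sum/= -/Z ler_norml => /andP[+ _]; lra.
have Z0 : 0 <= Z by apply: sumr_ge0 => k _; rewrite sqr_ge0.
have DZ : A * nf h <= D * (2 * W + 2 * (B * q) + A * nf f / (16 * D)).
 apply: (le_trans AS); apply: (@le_trans _ _ (`|\det N| * (Z + A * nf f / (16 * D)))).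
  by rewrite ler_wpM2l.
 by apply: ler_pM => //; rewrite ?addr_ge0 ?(ltW e0)// ?lerDl// lerD2r.
have -> : A / (16 * D) * nf f = (A * nf f) / (16 * D) by ring.
rewrite ler_pdivrMr ?mulr_gt0//.
have q1 : A * q <= A * nf f / 8.
 by rewrite -mulrA ler_wpM2l// ltW.
have q2 : D * (B * q) <= A * nf f / 16.
 apply: (@le_trans _ _ (D * (B * (A * nf f / (16 * D * B))))).
  by rewrite !ler_wpM2l// ltW.
 by have -> : D * (B * (A * nf f / (16 * D * B))) = A * nf f / 16 by field; rewrite !gt_eqF.
have q3 : D * (A * nf f / (16 * D)) = A * nf f / 16 by field; rewrite gt_eqF.
have hA : A * nf f <= 2 * (A * nf h) + 2 * (A * q).
 by have := ler_wpM2l (ltW A0) hf; rewrite -/q; lra.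
exact: duality_num (mulr_ge0 (ltW A0) (nf_ge0 f)) hA DZ q1 q2 q3.
Qed.

End synthesis.

(** * Approximation by rationals and nearly biorthogonal systems *)

Section packing.
Context {R : realType}.

(** The bound [L] does not depend on the sequence: it counts the cells of a grid on the torus.
    [near_central] relies on this, since it needs the difference of the two indices to divide L
    factorial before the sequence is chosen. *)
Lemma pigeon (I : finType) (eps : R) : 0 < eps -> exists L : nat, forall z : nat -> I -> R,
 exists (j1 j2 : nat) (w : I -> int), [/\ (j1 < j2)%N, (j2 <= L)%N & forall i, `|z j2 i - z j1 i - (w i)%:~R| <= eps].
Proof.
move=> eps0; pose K := (Num.truncn eps^-1).+1.
have KR : eps^-1 < K%:R by exact: truncnS_gt.
have K0 : 0 < K%:R :> R by rewrite ltr0n.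
pose fr (y : R) := y - (Num.floor y)%:~R.
have fr0 y : 0 <= fr y by rewrite subr_ge0 ge_floor.
have fr1 y : fr y < 1 by rewrite /fr ltrBlDl; have := floorD1_gt y; rewrite intrD.
have cell_lt y : (Num.truncn (K%:R * fr y) < K)%N.
 have /andP[h _] := truncn_itv (mulr_ge0 (ltW K0) (fr0 y)).
 by rewrite -(ltr_nat R) (le_lt_trans h)// -[ltRHS]mulr1 ltr_pM2l.
exists (K ^ #|I|)%N => z.
pose f (j : 'I_(K ^ #|I|).+1) : {ffun I -> 'I_K} := [ffun i => Ordinal (cell_lt (z j i))].
have : ~~ injectiveb f.
 apply/negP => /injectiveP/leq_card; rewrite card_ffun !card_ord ltnn//.
move=> /injectivePn[j1 [j2 j12 fj]].
wlog lt12 : j1 j2 j12 fj / (j1 < j2)%N.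
 move=> W; have [h|h|h] := ltngtP j1 j2; [exact: (W j1 j2)|by apply: (W j2 j1) => //; rewrite eq_sym|].
 by case/eqP: j12; exact/val_inj.
exists j1, j2, (fun i => Num.floor (z j2 i) - Num.floor (z j1 i)); split=> //; first by rewrite -ltnS.
move=> i; have := congr1 (fun g : {ffun I -> 'I_K} => val (g i)) fj; rewrite !ffunE/= => h.
have -> : z j2 i - z j1 i - (Num.floor (z j2 i) - Num.floor (z j1 i))%:~R = fr (z j2 i) - fr (z j1 i).
 by rewrite intrB /fr; ring.
have b1 := fr0 (z j1 i); have b2 := fr0 (z j2 i).
have c1 := truncn_itv (mulr_ge0 (ltW K0) b1); have c2 := truncn_itv (mulr_ge0 (ltW K0) b2).
rewrite -h in c2; move: c1 c2 => /andP[c1 c1'] /andP[c2 c2'].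
rewrite -(ler_pM2l K0) -[K%:R * `|_|](_ : `|K%:R * (fr (z j2 i) - fr (z j1 i))| = _); last first.
 by rewrite normrM gtr0_norm.
apply: (@le_trans _ _ 1); last first.
 by rewrite mulrC -ler_pdivrMl// mulr1 ltW.
rewrite mulrBr ler_norml; move: c1 c1' c2 c2'; rewrite -natr1; set u := (Num.truncn _)%:R; lra.
Qed.

Lemma dirichlet (I : finType) (x : I -> R) (eps : R) : 0 < eps -> exists (q : nat) (w : I -> int),
 (0 < q)%N /\ forall i, `|q%:R * x i - (w i)%:~R| <= eps.
Proof.
move=> /(pigeon I)[L /(_ (fun j i => j%:R * x i))[j1 [j2 [w [j12 _ H]]]]].
by exists (j2 - j1)%N, w; rewrite subn_gt0; split=> // i; rewrite natrB ?(ltnW j12)// mulrBl.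
Qed.

Section base.
Variables a h : R.
Hypotheses (a0 : 0 < a) (h0 : 0 < h) (ha : a^-1 + 2 * h = a).
Let hi0 : 0 < h^-1. Proof. by rewrite invr_gt0. Qed.
Let ai0 : 0 < a^-1. Proof. by rewrite invr_gt0. Qed.
Definition sg (b t : R) : R := step (h^-1 * t + - (h^-1 * b)).
Lemma sg0 b t : t <= b -> sg b t = 0.
Proof. by move=> tb; rewrite /sg step0// -mulrBr; rewrite pmulr_rle0 ?hi0// subr_le0. Qed.
Lemma sg1 b t : b + h <= t -> sg b t = 1.
Proof.
move=> tb; rewrite /sg step1// -mulrBr -(mulVf (lt0r_neq0 h0)) ler_pM2l ?hi0// lerBrDl; exact: tb.
Qed.

(** A ramp of width h minus its translate by 1/a: the integral is 1/a and the support lies in (0,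
    1/a + h). Its companion [eta1] equals 1 there and lives in (-h, a). The relation 1/a + 2h = a
    separates their supports after translation by nonzero multiples of a. *)
Definition eta0 (t : R) : R := sg 0 t + -1 * sg a^-1 t.
Definition eta1 (t : R) : R := sg (- h) t + -1 * sg (a^-1 + h) t.

Lemma sm_sg b : sm (sg b). Proof. exact: sm_step. Qed.
Lemma eta0_out t : ~ (0 < t < a^-1 + h) -> eta0 t = 0.
Proof.
move=> H; rewrite /eta0; have [t0|t0] := leP t 0; first by rewrite !sg0 ?mulr0 ?addr0// (le_trans t0)// ltW.
have [t1|t1] := leP (a^-1 + h) t; last by case: H; rewrite t0.
by rewrite !sg1 ?mulr1 ?addrN// add0r (le_trans _ t1)// lerDr ltW.
Qed.
Lemma eta1_out t : ~ (- h < t < a) -> eta1 t = 0.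
Proof.
move=> H; rewrite /eta1; have [t0|t0] := leP t (- h).
 by rewrite !sg0 ?mulr0 ?addr0//; have := ai0; have := h0; lra.
have [t1|t1] := leP a t; last by case: H; rewrite t0.
by rewrite !sg1 ?mulr1 ?addrN//; have := ha; have := ai0; have := h0; lra.
Qed.
Lemma eta1_1 t : 0 < t < a^-1 + h -> eta1 t = 1.
Proof.
by move=> /andP[t0 t1]; rewrite /eta1 sg1 ?sg0 ?mulr0 ?addr0// ?addNr ltW.
Qed.

Lemma eta0_cs : cs eta0.
Proof.
split; first by apply: smD; [exact: sm_sg|apply: smZ; exact: sm_sg].
exists (a^-1 + h) => t tb; apply: eta0_out => /andP[t0 t1].
by move: tb; rewrite gtr0_norm// leNgt t1.
Qed.
Lemma eta1_cs : cs eta1.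
Proof.
split; first by apply: smD; [exact: sm_sg|apply: smZ; exact: sm_sg].
exists (a + h) => t tb; apply: eta1_out => /andP[t0 t1].
by move: tb; rewrite leNgt ltr_norml; apply/negP; rewrite negbK; apply/andP; split; have := h0; have := a0; lra.
Qed.

Lemma eta_shift (k : int) t : k != 0 -> eta0 t * eta1 (t - a * k%:~R) = 0.
Proof.
move=> k0; have [/andP[t0 t1]|H] := pselect (0 < t < a^-1 + h); last by rewrite eta0_out ?mul0r.
rewrite eta1_out ?mulr0// => /andP[u0 u1].
have [k1|k1] : (1 <= k \/ k <= -1)%R by lia.
 have : 1 <= k%:~R :> R by rewrite -[1]/(1%:~R) ler_int.
 by have := ha; have := h0; have := a0; nra.
have : k%:~R <= -1 :> R by rewrite -[-1]/((-1)%:~R) ler_int.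
by have := ha; have := h0; have := a0; nra.
Qed.
Lemma eta_self t : eta0 t * eta1 t = eta0 t.
Proof.
have [H|H] := pselect (0 < t < a^-1 + h); first by rewrite eta1_1 ?mulr1.
by rewrite eta0_out ?mul0r.
Qed.

Lemma Int_eta0 : Int eta0 = a^-1.
Proof.
have [F dF F0] := antiderivative (f := sg 0) (sm_continuous (sm_sg 0)) (@sg0 0).
have dG : dv (fun t => F t + -1 * F (1 * t + - a^-1)) (fun t => sg 0 t + -1 * (1 * sg 0 (1 * t + - a^-1))).
 apply: dvD => //; have := dvM (dv_cst (-1)) (dv_affine 1 (- a^-1) dF).
 by under [X in dv _ X -> _]eq_fun do rewrite mul0r add0r.
have eE : (fun t => sg 0 t + -1 * (1 * sg 0 (1 * t + - a^-1))) = eta0.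
 apply/funext => t; rewrite /eta0 !mul1r; congr (_ + -1 * _).
 by rewrite /sg mulr0 subr0 mulrBr.
rewrite eE in dG.
have ob : out (a^-1 + h) eta0.
 move=> t tb; apply: eta0_out => /andP[t0 t1].
 by move: tb; rewrite gtr0_norm// leNgt t1.
have B0 : 0 < a^-1 + h by rewrite addr_gt0.
rewrite (Int_antider (a := - (a^-1 + h)) (b := a^-1 + h) (eta0_cs).1 ob dG)//; last first.
 by rewrite (@lt_trans _ _ 0)// oppr_lt0.
rewrite (F0 (- (a^-1 + h))) ?(F0 (1 * - _ + _)); last 2 first.
- by rewrite mul1r; have := ai0; have := h0; lra.
- by rewrite oppr_le0 ltW.
rewrite mulr0 addr0 subr0.
have did : dv (fun t : R => t) (fun=> 1) by move=> t; exact: is_derive_id.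
have dH := dvD dF (dvM (dv_cst (-1)) did).
have := @dv_le R _ _ _ _ h (a^-1 + h) dH (dv_cst 0) _ _.
rewrite subrr => H; have {}H : F (a^-1 + h) + -1 * (a^-1 + h) - (F h + -1 * h) = 0.
 apply/eqP; rewrite -normr_le0; apply: H => [|t /andP[ht _]]; first by rewrite lerDr ltW.
 by rewrite sg1 ?add0r// mul0r add0r mulr1 addrN normr0.
have -> : 1 * (a^-1 + h) + - a^-1 = h by ring.
lra.
Qed.

Lemma ft_shift (u : R -> R[i]) (c w : R) : cc u -> ft (fun t => u (t + c)) w = ee (w * c) * ft u w.
Proof.
move=> cu; rewrite /ft -(cInt_shift c (u := fun t => u t * ee (- w * t))); last first.
 by apply: ccM => //; exact: csm_ee.
rewrite -cIntZ; last first.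
 by apply: (cc_shift c (u := fun t => u t * ee (- w * t))); apply: ccM => //; exact: csm_ee.
congr cInt; apply/funext => t; rewrite mulrCA -eD; congr (_ * ee _); ring.
Qed.

(** Biorthogonality along the square lattice a Z^2. For k nonzero the supports are disjoint. For k =
    0 the function is [eta0], whose derivative is a bump minus its translate by 1/a, so its Fourier
    transform vanishes at the nonzero multiples of a. *)
Lemma V1_eta (k l : int) : V1 (fun t => (a * eta0 t)%:C%C) (fun t => (eta1 t)%:C%C) (a * k%:~R) (a * l%:~R) =
 ((k == 0) && (l == 0))%:R.
Proof.
have ce : cc (fun t => (a * eta0 t)%:C%C).
 have [s0 [B oB]] := eta0_cs; split; first by apply: csm_real; exact: smZ.
 by exists B => t tB; rewrite oB// mulr0.
rewrite /V1; have [->|k0] := eqVneq k 0; last first.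
 rewrite -[RHS]cInt0 /ft; congr cInt; apply/funext => t.
 have -> : (a * eta0 t)%:C%C * (((eta1 (t - a * k%:~R))%:C%C)^*)%C = (a * (eta0 t * eta1 (t - a * k%:~R)))%:C%C.
  by rewrite conjc_real -rcM mulrA.
 by rewrite eta_shift// mulr0 mul0r.
have -> : (fun t => (a * eta0 t)%:C%C * (((eta1 (t - a * 0%:~R))%:C%C)^*)%C) = fun t => (a * eta0 t)%:C%C.
 by apply/funext => t; rewrite conjc_real -rcM mulr0 subr0 -mulrA eta_self.
have [->|l0] := eqVneq l 0.
 rewrite /ft mulr0 oppr0 /cInt.
 have -> : Re \o (fun t : R => (a * eta0 t)%:C%C * ee (0 * t)) = fun t => a * eta0 t.
  by apply/funext => t; rewrite /comp mul0r e0 mulr1.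
 have -> : Im \o (fun t : R => (a * eta0 t)%:C%C * ee (0 * t)) = fun t => 0 * eta0 t.
  by apply/funext => t; rewrite /comp mul0r e0 mulr1 mul0r.
 by rewrite !IntZ ?Int_eta0 ?mulfV ?gt_eqF ?mul0r//; exact: eta0_cs.
have [K dstep K0] := @stepP R.
pose s t := h^-1 * (K * (bumpf 0 (h^-1 * t + 0) * bumpf 0 (-1 * (h^-1 * t + 0) + 1))).
have ds : dv (sg 0) s.
 by have := dv_affine h^-1 (- (h^-1 * 0)) dstep; rewrite /s /sg mulr0 oppr0.
have cs_s : cc (fun t => (s t)%:C%C).
 split.
  apply: csm_real; apply: smZ; apply: smZ; apply: smM; first exact: sm_bump.
  have := @sm_bump R 0 (- h^-1) 1; congr sm; apply/funext => t; congr bumpf; ring.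
 exists h => t; rewrite /s addr0; have [t0|t0] := leP t 0.
  by rewrite [bumpf 0 (h^-1 * t)]/bumpf ltNge pmulr_rle0// t0/= mul0r !mulr0.
 rewrite gtr0_norm// => ht; rewrite [bumpf 0 (-1 * _ + 1)]/bumpf ltNge mulN1r addrC subr_le0.
 by rewrite -(mulVf (lt0r_neq0 h0)) ler_pM2l ?hi0// ht !mulr0.
pose b t := a%:C%C * ((s t)%:C%C + -1 * (s (t + - a^-1))%:C%C).
have cs2 : cc (fun t => (s (t + - a^-1))%:C%C) by exact: (cc_shift (- a^-1) cs_s).
have cb : cc b by apply: ccZ; apply: ccD => //; exact: ccZ.
have db : cdv (fun t => (a * eta0 t)%:C%C) b.
 have Im0 : Im \o b = fun=> 0.
  by apply/funext => t; rewrite /b /=; ring.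
 split; last first.
  by rewrite Im0 (_ : Im \o _ = fun=> 0)//; exact: dv_cst.
 rewrite (_ : Re \o b = fun t => 0 * eta0 t + a * (s t + (0 * sg 0 (1 * t + - a^-1) + -1 * (1 * s (1 * t + - a^-1))))); last first.
  apply/funext => t; rewrite /b /= !mul1r; ring.
 have -> : Re \o (fun t => (a * eta0 t)%:C%C) = fun t => a * eta0 t by [].
 apply: dvM; first exact: dv_cst.
 have -> : eta0 = fun t => sg 0 t + -1 * sg 0 (1 * t + - a^-1).
  apply/funext => t; rewrite /eta0; congr (_ + -1 * _); rewrite /sg mul1r mulr0 subr0 mulrBr//.
 by apply: dvD => //; apply: dvM; [exact: dv_cst|exact: dv_affine].
have := ft_dv (a * l%:~R) ce cb.1 db.
have -> : ft b (a * l%:~R) = 0.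
 rewrite /ft /b.
 have -> : (fun t => a%:C%C * ((s t)%:C%C + -1 * (s (t + - a^-1))%:C%C) * ee (- (a * l%:~R) * t)) =
   fun t => a%:C%C * ((s t)%:C%C * ee (- (a * l%:~R) * t) + -1 * ((s (t + - a^-1))%:C%C * ee (- (a * l%:~R) * t))).
  by apply/funext => t; ring.
 have c1 : cc (fun t => (s t)%:C%C * ee (- (a * l%:~R) * t)) by apply: ccM => //; exact: csm_ee.
 have c2 : cc (fun t => (s (t + - a^-1))%:C%C * ee (- (a * l%:~R) * t)) by apply: ccM => //; exact: csm_ee.
 rewrite cIntZ; last by apply: ccD => //; exact: ccZ.
 rewrite cIntD//; last exact: ccZ.
 rewrite cIntZ// -![cInt _]/(ft _ _) (ft_shift (u := fun t => (s t)%:C%C))//.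
 rewrite mulrN mulrAC mulfV ?gt_eqF// mul1r -mulrNz e_int mul1r mulN1r subrr mulr0//.
move/eqP; rewrite mulf_eq0 => /orP[|/eqP ->//].
by rewrite -nc_eq0 nc_tpi !mulf_eq0 normr_eq0 mulf_eq0 intr_eq0 (negbTE l0) !gt_eqF ?pi_gt0.
Qed.

End base.

Lemma base_pair d (a : R) : 1 < a -> exists phi phi' : 'rV[R]_d -> R[i], [/\ nice phi, nice phi' &
 forall k : 'rV[int]_(d + d), V phi phi' (a *: map_mx intr k) = (k == 0)%:R].
Proof.
move=> a1; have a0 : 0 < a := lt_trans ltr01 a1.
pose h := (a - a^-1) / 2.
have ai1 : a^-1 < 1 by rewrite invf_lt1.
have h0 : 0 < h by rewrite divr_gt0// subr_gt0 (lt_trans ai1).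
have ha : a^-1 + 2 * h = a by rewrite /h; field; rewrite gt_eqF.
have ccr (u : R -> R) : cs u -> cc (fun t => (u t)%:C%C).
 by move=> [su [B oB]]; split; [exact: csm_real|exists B => t tB; rewrite oB].
have c0 : cc (fun t => (a * eta0 a h t)%:C%C).
 apply: ccr; have [su [B oB]] := eta0_cs a0 h0; split; first exact: smZ.
 by exists B => t tB; rewrite oB// mulr0.
have c1 : cc (fun t => (eta1 a h t)%:C%C) by apply: ccr; exact: eta1_cs.
exists (fun x => 1 * ten (fun _ t => (a * eta0 a h t)%:C%C) x), (fun x => 1 * ten (fun _ t => (eta1 a h t)%:C%C) x).
split; [by apply: n_ten|by apply: n_ten|].
move=> k; rewrite V_ten// conjc1 !mul1r.
rewrite (eq_bigr (fun i => ((lsubmx k ord0 i == 0) && (rsubmx k ord0 i == 0))%:R)) => [|i _]; last first.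
 by rewrite -(V1_eta a0 h0 ha) !mxE.
have [->|k0] := eqVneq k 0; first by rewrite big1// => i _; rewrite !mxE !eqxx.
have [i ki] : exists i, k ord0 i != 0.
 apply/existsP; apply: contraR k0 => /existsPn H; apply/eqP/rowP => i; rewrite mxE.
 by apply/eqP; rewrite -[_ == _]negbK; exact: H.
have [j|j] := split_ordP i => ij; rewrite (bigD1 j)//= !mxE -ij (negbTE ki) ?andbF mul0r//.
Qed.

Lemma small_multiple (u v : nat) (c t : int) : (u : int) - (v : int) = t * c ->
 (u < `|c|)%N -> (v < `|c|)%N -> u = v.
Proof.
have [->|t0] := eqVneq t 0; first by rewrite mul0r; lia.
move=> E uc vc; have : (absz c <= absz (t * c)%R)%N by rewrite abszM leq_pmull// absz_gt0.
by rewrite -E; lia.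
Qed.

(** Smith normal form counts the cosets of Z^n W and lists representatives. *)
Lemma lattice_reps n (W : 'M[int]_n) : \det W != 0 -> exists x : 'I_(`|\det W|%N) -> 'rV[int]_n,
 (forall i j k, x i - x j = k *m W -> i = j) /\
 (forall i j, 0 <= ((map_mx intr (x i) : 'rV[R]_n) *m invmx (map_mx intr W)) ord0 j <= 1) /\
 (forall z, exists i k, z = x i + k *m W).
Proof.
move=> dW.
have [L uL [Q uQ [s _ WE]]] := int_Smith_normal_form W.
set Dg := \matrix_(i, j) _ in WE.
have DgE : Dg = diag_mx (\row_(j < n) s`_j) by apply/matrixP => i j; rewrite !mxE.
have dDg : \det Dg = \prod_(i < n) s`_i by rewrite DgE det_diag; apply: eq_bigr => i _; rewrite mxE.
have unit1 (U : 'M[int]_n) : U \in unitmx -> `|\det U|%N = 1%N.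
 by rewrite unitmxE qualifE /= => /orP[] /eqP ->.
have dWE : `|\det W|%N = (\prod_(i < n) absz (s`_i)%R)%N.
 rewrite WE !det_mulmx !abszM (unit1 L)// (unit1 Q)// mul1n muln1 dDg.
 by elim/big_rec2: _ => // i y x _ <-; rewrite abszM.
have s0 i : s`_(i : 'I_n) != 0.
 have := dW; rewrite WE !det_mulmx dDg !mulf_eq0 !negb_or => /andP[/andP[_ +] _].
 by apply: contra => /eqP si; rewrite (bigD1 i)//= si mul0r.
pose T : finType := {dffun forall i : 'I_n, 'I_(absz (s`_i)%R)}.
have cT : #|T| = `|\det W|%N.
 rewrite dWE card_dep_ffun foldrE big_map big_enum/=; apply: eq_bigr => i _; exact: card_ord.
have uWR : (map_mx intr W : 'M[R]_n) \in unitmx by rewrite unitmxE det_map_mx unitfE intr_eq0.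
pose raw (f : T) : 'rV[int]_n := (\row_i ((f i : nat) : int)) *m Q.
pose fl (z : 'rV[int]_n) : 'rV[int]_n := \row_j Num.floor (((map_mx intr z : 'rV[R]_n) *m invmx (map_mx intr W)) ord0 j).
(* Moves the representative into the unit cell of [W], which bounds its coordinates independently of
   [W]. *)
pose y f := raw f - fl (raw f) *m W.
exists (fun i => y (enum_val (cast_ord (esym cT) i))); split; last split; last first.
 move=> z; have [z' zE] : exists z', z = z' *m Q by exists (z *m invmx Q); rewrite mulmxKV.
 have mlt c : (absz (z' ord0 c %% (s`_c)%R)%Z < absz (s`_(c : 'I_n))%R)%N.
  by have := modz_ge0 (z' ord0 c) (s0 c); have := ltz_mod (z' ord0 c) (s0 c); clear; lia.
 pose f : T := [ffun c => Ordinal (mlt c)].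
 pose k' : 'rV[int]_n := \row_c (z' ord0 c %/ (s`_c)%R)%Z.
 exists (cast_ord cT (enum_rank f)), (fl (raw f) + k' *m invmx L).
 rewrite cast_ordK enum_rankK /y mulmxDl addrA subrK WE -!mulmxA mulKmx// mulmxA -mulmxDl.
 rewrite zE; congr (_ *m Q).
 apply/rowP => c; rewrite DgE mul_mx_diag !mxE ffunE /= gez0_abs ?modz_ge0// [RHS]addrC; exact: divz_eq.
 move=> i j; set f := enum_val _; rewrite /y map_mxB mulmxBl (map_mxM _ (fl _)) (mulmxK uWR) !mxE.
 set r := \sum_(_ < _) _; rewrite subr_ge0 ge_floor/= lerBlDl.
 by have := floorD1_gt r; rewrite intrD => /ltW.
move=> i j k; set f := enum_val _; set g := enum_val _ => H.
suff fg : f = g by apply: (@cast_ord_inj _ _ (esym cT)); exact: enum_val_inj.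
have [k' k'E] : exists k' : 'rV[int]_n, raw f - raw g = k' *m W.
 exists (k + fl (raw f) - fl (raw g)); rewrite mulmxBl mulmxDl -H /y.
 move: (raw f) (raw g) (fl (raw f) *m W) (fl (raw g) *m W) => A B C D.
 by apply/rowP => c; rewrite !mxE; ring.
have E : (\row_i ((f i : nat) : int)) - (\row_i ((g i : nat) : int)) = k' *m L *m Dg.
 apply: (can_inj (mulmxK uQ)); rewrite mulmxBl -[LHS]/(raw f - raw g) k'E WE !mulmxA//.
apply/ffunP => c; apply/val_inj => /=.
have := congr1 (fun z : 'rV[int]_n => z ord0 c) E; rewrite DgE mul_mx_diag !mxE.
set t := \sum_(_ < _) _ => Ec.
have lf := ltn_ord (f c); have lg := ltn_ord (g c).
by apply: small_multiple Ec lf lg.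
Qed.

(** Approximate [N] by W/q with [W] integral, take a slightly above 1 and p = a q. For
    representatives x_j of Z^(2d) modulo [W], the points a x_j + p N k are close to distinct points
    of a Z^(2d), along which [base_pair] is biorthogonal. Their number |det W| is about q^(2d) |det
    N|, above tau p^(2d) when tau a^(2d) < |det N|. *)
Theorem packing d (N : 'M[R]_(d + d)) (tau : R) : N \in unitmx -> 0 < tau -> tau < `|\det N| ->
 exists (p t : nat) (psi psi' : 'I_t -> 'rV[R]_d -> R[i]),
  [/\ (0 < p)%N, tau * p%:R ^+ (d + d) < t%:R, forall j, nice (psi j), forall j, nice (psi' j) &
   forall j, bs (fun x : 'I_t * 'rV[int]_(d + d) =>
    nc (L2inner (psi j) (tfshift (lat (p%:R *: N) x.2) (psi' x.1)) - ((j == x.1) && (x.2 == 0))%:R)) (1 / 2)].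
Proof.
move=> uN tau0 tauN; set m := (d + d)%N in N uN tauN *.
have [c c0 [eta1 eta10 low]] := lat_lower uN.
pose D := `|\det N|.
(* a = 1 + 1/A has numerator A + 1, so a q is an integer as soon as A divides q. The expansion (1 +
   x)^k <= 1 + (2^k - 1) x for x <= 1 fixes how large A must be. *)
have [A [A0 aD]] : exists A : nat, (0 < A)%N /\ tau * (1 + A%:R^-1) ^+ m < D.
 pose x0 := (D - tau) / (tau * 2 ^+ m).
 have x00 : 0 < x0 by rewrite divr_gt0 ?subr_gt0 ?mulr_gt0 ?exprn_gt0.
 exists (Num.truncn x0^-1).+1; split=> //; set x := _^-1.
 have xx : x < x0 by rewrite /x invf_plt ?posrE//; exact: truncnS_gt.
 have x1 : x <= 1 by rewrite /x invf_le1// ler1n.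
 have xp : 0 < x by rewrite invr_gt0.
 have pw k : (1 + x) ^+ k <= 1 + (2 ^+ k - 1) * x.
  elim: k => [|k IH]; first by rewrite !expr0 subrr mul0r addr0.
  have t1 : 1 <= 2 ^+ k :> R by rewrite exprn_ege1// ler1n.
  rewrite exprS (le_trans (ler_wpM2l _ IH)) ?addr_ge0 ?(ltW xp)// exprS.
  set y := 2 ^+ k in t1 *; have : 0 <= (y - 1) * (x * (1 - x)) by rewrite !mulr_ge0 ?subr_ge0// ltW.
  by nra.
 apply: (@le_lt_trans _ _ (tau * (1 + 2 ^+ m * x))).
  rewrite ler_wpM2l ?(ltW tau0)// (le_trans (pw m))// lerD2l ler_wpM2r ?(ltW xp)//; lra.
 have h1 : tau * 2 ^+ m * x < D - tau.
  by rewrite mulrC -ltr_pdivlMr// mulr_gt0// exprn_gt0.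
 by rewrite mulrDr mulr1 mulrA; lra.
pose a : R := 1 + A%:R^-1.
have AR : 0 < A%:R :> R by rewrite ltr0n.
have a1 : 1 < a by rewrite ltrDl invr_gt0.
have a0 : 0 < a := lt_trans ltr01 a1.
have [phi [phi' [nphi nphi' Vphi]]] := base_pair d a1.
have [C C0 HC] := V_decay (2 * m) nphi nphi'; have [Lp Lp0 HL] := V_lip nphi nphi'.
pose b (n : 'rV[int]_m) := C * (1 + (a / 2)^-1) ^+ (2 * m) * 2 ^+ m * wt n.
have a2 : 0 < a / 2 by rewrite divr_gt0.
have cb : 0 <= C * (1 + (a / 2)^-1) ^+ (2 * m) * 2 ^+ m.
 by rewrite !mulr_ge0 ?exprn_ge0 ?addr_ge0 ?invr_ge0 ?(ltW a2).
have b0 n : 0 <= b n by rewrite mulr_ge0// ltW// wt_gt0.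
have q4 : 0 < 1 / 4 :> R by rewrite divr_gt0.
have [B uB HB] := bs_tail b0 (bsZ cb (@bs_wt R m)) q4.
pose sB : R := \sum_(n <- B) l1 (map_mx intr n : 'rV[R]_m).
have sB0 : 0 <= sB by apply: sumr_ge0 => n _; exact: l1_ge0.
pose th := Num.min (1 / 2) (1 / (4 * (Lp * (a * sB) + 1))).
have th0 : 0 < th by rewrite lt_min !divr_gt0 ?mulr_gt0 ?ltr_wpDl ?mulr_ge0 ?(ltW a0).
have De0 : 0 < D - tau * a ^+ m by rewrite subr_gt0.
have [eta2 eta20 dc] := det_cont N (divr_gt0 De0 (ltr0n R 2)).
pose cm := c^-1 + m%:R.
have cm0 : 0 < cm by rewrite ltr_wpDr// invr_gt0.
pose ep := Num.min (Num.min eta1 eta2) (th / cm).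
have ep0 : 0 < ep by rewrite !lt_min eta10 eta20 divr_gt0.
have e1 : 0 < ep / ((m * m)%:R + 1) by rewrite divr_gt0// ltr_wpDl.
(* Applied to A N, so that the denominator q = A q' is a multiple of A. *)
have [q' [w [q'0 Hw]]] := dirichlet (fun x : 'I_m * 'I_m => A%:R * N x.1 x.2 : R) e1.
pose W : 'M[int]_m := \matrix_(i, j) w (i, j).
pose q := (A * q')%N.
have q0 : (0 < q)%N by rewrite muln_gt0 A0.
have qR : 0 < q%:R :> R by rewrite ltr0n.
have q1 : 1 <= q%:R :> R by rewrite ler1n.
have qW : nm (q%:R *: N - map_mx intr W) <= ep.
 apply: (@le_trans _ _ ((m * m)%:R * (ep / ((m * m)%:R + 1)))).
  apply: nm_le => i j; rewrite !mxE (_ : q%:R * N i j = q'%:R * (A%:R * N i j)); last by rewrite /q [_%:R]natrM mulrCA mulrA.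
  exact: (Hw (i, j)).
 by rewrite mulrA [_ * ep]mulrC -mulrA ler_piMr ?(ltW ep0)// ler_pdivrMr ?ltr_wpDl// mul1r lerDl.
pose N' := q%:R^-1 *: map_mx intr W : 'M[R]_m.
have nmN' : nm (N' - N) <= ep.
 have -> : N' - N = - (q%:R^-1 *: (q%:R *: N - map_mx intr W)).
  by rewrite scalerBr scalerA mulVf ?gt_eqF// scale1r opprB.
 apply: le_trans qW; rewrite /nm; apply: ler_sum => i _; apply: ler_sum => j _.
 move: (q%:R *: N - _) => X.
 by rewrite !mxE normrN normrM ler_piMl// normfV gtr0_norm// invf_le1.
move: nmN'; rewrite !le_min => /andP[/andP[he1 he2] _].
have [epc epth] : ep <= Num.min eta1 eta2 /\ ep <= th / cm by apply/andP; rewrite -le_min.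
have lowN' := low N' he1.
have uN' : N' \in unitmx by apply: lower_unit c0 lowN'.
have dN'W : \det N' = (q%:R^-1) ^+ m * (\det W)%:~R by rewrite /N' detZ det_map_mx.
have dW : \det W != 0.
 by move: uN'; rewrite unitmxE dN'W unitfE mulf_eq0 negb_or intr_eq0 => /andP[].
have uW : (map_mx intr W : 'M[R]_m) \in unitmx by rewrite unitmxE det_map_mx unitfE intr_eq0.
have [x [xinj [xbox _]]] := lattice_reps dW.
pose p := (A.+1 * q')%N.
have pE : p%:R = a * q%:R :> R.
 by rewrite /p /q /a !natrM -natr1; field; rewrite gt_eqF.
pose u j : 'rV[R]_m := a *: map_mx intr (x j).
exists p, `|\det W|%N, (fun j => tfshift (u j) phi), (fun j => tfshift (u j) phi'); split.
- by rewrite muln_gt0.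
- have h1 : D - (D - tau * a ^+ m) / 2 <= `|\det N'|.
  have := dc N' he2; have := ler_dist_dist (\det N) (\det N'); rewrite distrC -/D ler_norml.
  by move=> /andP[h2 h3] h4; move: h3 h4; lra.
 have h2 : `|\det N'| * q%:R ^+ m = (absz (\det W))%:R.
  rewrite dN'W normrM normrX ger0_norm ?invr_ge0 ?(ltW qR)// mulrAC -exprMn mulVf ?gt_eqF// expr1n mul1r.
  by rewrite -intr_norm -abszE.
 rewrite -h2 pE exprMn mulrA ltr_pM2r ?exprn_gt0//.
 by apply: lt_le_trans h1; move: De0; clear; set y := tau * _; lra.
- by move=> j; exact: nice_tf.
- by move=> j; exact: nice_tf.
(* The integral vector whose multiple by a approximates the displacement between the two shifted
   windows; it vanishes only on the diagonal term. *)
move=> j; pose nn (y : 'I_(absz (\det W)) * 'rV[int]_m) := y.2 *m W + x y.1 - x j.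
have nn_inj : injective nn.
 move=> [j1 k1] [j2 k2]; rewrite /nn/= => /addIr E.
 have j12 : j1 = j2.
  apply: (xinj _ _ (k2 - k1)); rewrite mulmxBl.
  by apply/eqP; rewrite subr_eq addrAC -E [k1 *m W + _]addrC addrK.
 rewrite j12 in E *; congr pair; move/addIr: E => E.
 have := congr1 (map_mx intr : _ -> 'rV[R]_m) E; rewrite !map_mxM => /(can_inj (mulmxK uW)).
 by move/rowP => h; apply/rowP => i; have := h i; rewrite !mxE => /intr_inj.
pose X n : R := Lp * (th * (a * l1 (map_mx intr n : 'rV[R]_m))).
have X0 n : 0 <= X n by rewrite !mulr_ge0 ?l1_ge0// ?(ltW th0) ?(ltW a0).
pose G (y : 'I_(absz (\det W)) * 'rV[int]_m) := nc (L2inner (tfshift (u j) phi)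
 (tfshift (lat (p%:R *: N) y.2) (tfshift (u y.1) phi')) - ((j == y.1) && (y.2 == 0))%:R).
have key y : G y <= if nn y \in B then X (nn y) else b (nn y).
 case: y => j' k; rewrite /G/=; set n := nn (j', k).
 have [/andP[/eqP jj /eqP k0]|ne] := boolP ((j == j') && (k == 0)).
  rewrite -jj k0 lat0 tf0 V_cov// subrr beta0r oppr0 e0 mul1r.
  have -> : (0 : 'rV[R]_m) = a *: map_mx intr (0 : 'rV[int]_m) by rewrite map_mx0 scaler0.
  by rewrite Vphi eqxx subrr nc0; case: ifP.
 have n0 : n != 0.
  apply: contra ne => /eqP nE.
  have jj : j = j' by apply: (xinj _ _ k); move: nE => /eqP; rewrite subr_eq add0r -/(nn _) => /eqP <-; rewrite /= addrK.
  rewrite jj eqxx/=; move: nE; rewrite /n /nn/= jj addrK => /(congr1 (map_mx intr : _ -> 'rV[R]_m)).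
  rewrite map_mxM map_mx0 => /(congr1 (mulmx^~ (invmx (map_mx intr W)))); rewrite mulmxK// mul0mx => /rowP h.
  by apply/eqP/rowP => i; have := h i; rewrite !mxE => /eqP; rewrite intr_eq0 => /eqP.
 have n1 : 1 <= l1 (map_mx intr n : 'rV[R]_m).
  have /rV0Pn[i ni] := n0.
  rewrite (le_trans _ (l1_le _ i))// mxE -intr_norm -[1]/(1%:~R) ler_int.
  have : n ord0 i != 0 := ni.
  by move: (n ord0 i); clear; move=> v; lia.
 pose z := lat (p%:R *: N) k + u j' - u j.
 have Gz : nc (L2inner (tfshift (u j) phi) (tfshift (lat (p%:R *: N) k) (tfshift (u j') phi')) - 0) = nc (V phi phi' z).
  rewrite subr0 tf_comp L2innerZr ?V_cov//; try exact: nice_tf.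
  by rewrite -eN !ncM !nc_e !mul1r.
 rewrite Gz.
 (* The error is relative to n: since k W differs from n by two representatives in the unit cell of
    [W] and n is at least 1, the norm of k is at most [cm] times that of n. *)
 have dz : l1 (z - a *: map_mx intr n) <= th * (a * l1 (map_mx intr n : 'rV[R]_m)).
  have -> : z - a *: map_mx intr n = a *: (map_mx intr k *m (q%:R *: N - map_mx intr W)).
   rewrite /z /n /nn /u /lat !map_mxB !map_mxD map_mxM !scalerBr !scalerDr mulmxBr scalerBr.
   rewrite pE -!scalemxAr scalerA.
   move: (_ *: (map_mx intr k *m N)) (a *: (_ *m _)) (a *: map_mx intr (x j')) (a *: map_mx intr (x j)).
   by move=> v1 v2 v3 v4; apply/rowP => i; rewrite !mxE; ring.
  rewrite l1Z gtr0_norm// mulrCA ler_wpM2l ?(ltW a0)// (le_trans (l1_mul _ _))//.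
  have lk : l1 (map_mx intr k : 'rV[R]_m) <= cm * l1 (map_mx intr n : 'rV[R]_m).
   pose Wi := invmx (map_mx intr W : 'M[R]_m).
   have kE : map_mx intr k = map_mx intr n *m Wi + (map_mx intr (x j) *m Wi - map_mx intr (x j') *m Wi).
    rewrite /n /nn !map_mxB map_mxD map_mxM !mulmxBl mulmxDl mulmxK//.
    move: (_ *m Wi) (_ *m Wi) => v1 v2.
    by apply/rowP => i; rewrite !mxE; ring.
   rewrite kE (le_trans (l1D _ _))// mulrDl lerD//.
    have := lowN' (map_mx intr n *m Wi).
    rewrite /N' -scalemxAr -mulmxA mulVmx// mulmx1 l1Z gtr0_norm ?invr_gt0// => h.
    rewrite mulrC ler_pdivlMr// mulrC (le_trans h)// ler_piMl ?l1_ge0// invf_le1//.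
   rewrite (le_trans _ (ler_wpM2l _ n1))// mulr1 /l1 -[leRHS](_ : \sum_(i < m) 1 = _); last first.
    by rewrite sumr_const card_ord.
   apply: ler_sum => i _; have := xbox j i; have := xbox j' i; rewrite -/Wi.
   move: (_ *m Wi) (_ *m Wi) => X2 X1; rewrite [(X2 - X1) _ _]mxE [(- X1) _ _]mxE => /andP[b1 b2] /andP[b3 b4].
   by rewrite ler_norml; move: b1 b2 b3 b4; clear; move: (X1 _ _) (X2 _ _) => y1 y2 *; apply/andP; split; lra.
  rewrite (le_trans (ler_pM (nm_ge0 _) (l1_ge0 _) qW lk))// mulrA ler_wpM2r ?l1_ge0//.
  by move: epth; rewrite ler_pdivlMr.
 case: ifP => nB.
  have -> : V phi phi' z = V phi phi' z - V phi phi' (a *: map_mx intr n).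
   by rewrite Vphi (negbTE n0) subr0.
  by rewrite (le_trans (HL _ _))// /X ler_wpM2l.
 pose F (z' : 'rV[R]_m) : R[i] := (C * ((1 + l1 z') ^+ (2 * m))^-1)%:C%C.
 have F0 z' : 0 <= C * ((1 + l1 z') ^+ (2 * m))^-1.
  by rewrite mulr_ge0// invr_ge0 exprn_ge0// addr_ge0// l1_ge0.
 have := @bs_decay R m (a / 2)%:M F C (a / 2) a2 _ C0 _ n.
 have low2 (k' : 'rV[int]_m) : a / 2 * l1 (map_mx intr k' : 'rV[R]_m) <= l1 (map_mx intr k' *m (a / 2)%:M).
  by rewrite mul_mx_scalar l1Z gtr0_norm.
 move=> /(_ low2) H; have {H} := H (fun z' => _ : nc (F z') <= C * ((1 + l1 z') ^+ (2 * m))^-1).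
 move=> H; apply: le_trans (H _); last by move=> z'; rewrite nc_real ger0_norm.
 rewrite (le_trans (HC z))// /F nc_real ger0_norm// ler_wpM2l//.
 have th2 : th <= 1 / 2 by rewrite /th ge_min lexx.
 have lz : l1 (map_mx intr n *m (a / 2)%:M) <= l1 z.
  rewrite mul_mx_scalar l1Z gtr0_norm//.
  have := l1D (z) (a *: map_mx intr n - z); rewrite addrC subrK (l1B (_ *: _) z) l1Z gtr0_norm//.
  have := ler_wpM2r (mulr_ge0 (ltW a0) (l1_ge0 (map_mx intr n : 'rV[R]_m))) th2.
  by move: dz; clear; rewrite !mulrA; move: (l1 _) (l1 _) (l1 _) => y1 y2 y3; lra.
 rewrite lef_pV2 ?posrE ?exprn_gt0 ?ltr_wpDr ?l1_ge0// lerXn2r ?nnegrE ?addr_ge0 ?l1_ge0//.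
 by rewrite lerD2l.
move=> s us; apply: (@le_trans _ _ (\sum_(y <- s) (if nn y \in B then X (nn y) else b (nn y)))).
 by apply: ler_sum => y _; exact: key.
rewrite -(big_map nn xpredT (fun n => if n \in B then X n else b n)).
set sn := map nn s; have usn : uniq sn by rewrite map_inj_uniq.
rewrite (bigID (fun n => n \in B))/= (_ : 1 / 2 = 1 / 4 + 1 / 4); last by field.
apply: lerD; last first.
 rewrite (eq_bigr b) => [|n /negbTE ->//]; exact: HB.
rewrite (eq_bigr X) => [|n ->//]; rewrite -big_filter.
have uf : uniq [seq n <- sn | n \in B] by rewrite filter_uniq.
have sf : {subset [seq n <- sn | n \in B] <= B} by move=> n; rewrite mem_filter => /andP[].
apply: (@le_trans _ _ (\sum_(n <- B) X n)).
 by rewrite (sum_split X uf uB sf) lerDl; apply: sumr_ge0.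
rewrite /X -!mulr_sumr -/sB.
have : th <= 1 / (4 * (Lp * (a * sB) + 1)) by rewrite /th ge_min lexx orbT.
have y0 : 0 <= Lp * (a * sB) by rewrite !mulr_ge0// ltW.
rewrite ler_pdivlMr ?mulr_gt0 ?ltr_wpDl// (mulrCA Lp th); move: y0 th0; set y := Lp * _; clearbody y th; clear.
by move=> y0 v0 h; lra.
Qed.

End packing.

(** * Elementary operations on summable families *)

Section l1sums.
Context {R : realType}.

Lemma bs_D (T : eqType) (b b' : T -> R) M M' : bs b M -> bs b' M' -> bs (fun i => b i + b' i) (M + M').
Proof. by move=> H H' s us; rewrite big_split lerD//; [exact: H|exact: H']. Qed.
Lemma bs_sum (T : eqType) I (r : seq I) (P : pred I) (b : I -> T -> R) (M : I -> R) : (forall i, P i -> bs (b i) (M i)) ->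
 bs (fun t => \sum_(i <- r | P i) b i t) (\sum_(i <- r | P i) M i).
Proof. by move=> H s us; rewrite exchange_big/=; apply: ler_sum => i Pi; exact: H. Qed.
Lemma bs_mono (T : eqType) (b : T -> R) M M' : M <= M' -> bs b M -> bs b M'.
Proof. by move=> MM H s us; exact: le_trans (H s us) MM. Qed.
Lemma big_pairs (W : nmodType) (I : finType) (T : Type) (F : seq T) (h : I * T -> W) :
 \sum_(j : I) \sum_(k <- F) h (j, k) = \sum_(x <- [seq (j, k) | j <- enum I, k <- F]) h x.
Proof. by rewrite big_allpairs big_enum. Qed.

End l1sums.

(** * From approximate duals to Riesz sequences, and improvement of duals *)

Section neumann.
Context {R : realType} (d : nat).
Local Notation m := (d + d)%N.
Local Notation X := 'rV[R]_d.
Implicit Types (N : 'M[R]_m).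

(** By Schur's test the inner product of the two syntheses is at least K/2 times the sum of |c|^2;
    the weighted inequality [amgm] and the Bessel bound of g' then transfer this to the norm of the
    synthesis of g. *)
Lemma riesz_of_dual N g g' (K : R) : N \in unitmx -> nice g -> nice g' -> 0 < K ->
 bs (fun k => nc (V g g' (lat N k) - (K * (k == 0)%:R)%:C%C)) (K / 2) -> riesz N g.
Proof.
move=> uN ng ng' K0 bK; have [M M0 bM] := bs_V uN ng' ng'.
exists (K ^+ 2 / (4 * M)); first by rewrite divr_gt0 ?exprn_gt0 ?mulr_gt0.
move=> s c us; set S := \sum_(k <- s) _.
have nS := nice_syn N s c ng; have nS' := nice_syn N s c ng'.
have S0 : 0 <= S by apply: sumr_ge0 => k _; rewrite exprn_ge0 ?nc_ge0.
have main : nc (L2inner (syn N s c g) (syn N s c g') - (K * S)%:C%C) <= K / 2 * S.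
 pose a k := nc (V g g' (lat N k) - (K * (k == 0)%:R)%:C%C).
 apply: (@le_trans _ _ (\sum_(k <- s) \sum_(l <- s) nc (c k) * nc (c l) * a (l - k))); last first.
  apply: le_trans (schur (fun k => nc_ge0 _) bK us (fun k => nc_ge0 (c k)) (fun k => nc_ge0 (c k))) _.
  by rewrite -/S; lra.
 have -> : (K * S)%:C%C = \sum_(k <- s) \sum_(l <- s) c k * ((c l)^*)%C * (ee (- beta (lat N k) (lat N (l - k))) * (K * (l - k == 0)%:R)%:C%C).
  rewrite /S mulr_sumr rmorph_sum/=; apply: eq_big_seq => k ks.
  rewrite (bigD1_seq k)//= big1 ?addr0 => [|l lk].
   by rewrite subrr eqxx lat0 beta0r oppr0 e0 mul1r mulr1 mul_conj -rcM mulrC.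
  by rewrite subr_eq0 (negbTE lk) mulr0 /= mulr0 mulr0.
 rewrite L2inner_syn// -sumrB (le_trans (nc_sum _ _ _))//; apply: ler_sum => k _.
 rewrite -sumrB (le_trans (nc_sum _ _ _))//; apply: ler_sum => l _.
 rewrite (V_cov (lat N k) (lat N l) ng ng') -latB -mulrBr -mulrBr ncM (ncM (ee _)) nc_e mul1r.
 by rewrite ncM nc_conj.
have h1 : K / 2 * S <= Re (L2inner (syn N s c g) (syn N s c g')).
 move: main; move: (L2inner _ _) => z; move/(le_trans (Re_le_nc _)).
 have -> : Re (z - (K * S)%:C%C) = Re z - K * S by case: z.
 by rewrite ler_norml => /andP[h _]; lra.
have x0 : 0 < 2 * M / K by rewrite divr_gt0 ?mulr_gt0.
have h2 := amgm (nice_L2 nS) (nice_L2 nS') x0.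
have h3 := bessel_syn c ng' bM us.
have h4 : (2 * M / K)^-1 * nf (syn N s c g') <= K / 2 * S.
 rewrite invf_div (le_trans (ler_wpM2l _ h3)) ?divr_ge0 ?(ltW K0) ?mulr_ge0 ?(ltW M0)//.
 by rewrite -/S mulrA ler_wpM2r// (_ : K / (2 * M) * M = K / 2)//; field; rewrite gt_eqF.
have : K / 2 * S <= 2 * M / K * nf (syn N s c g) by lra.
move=> h5; rewrite -(ler_pM2l x0) (le_trans _ h5)// mulrA; apply: ler_wpM2r => //.
rewrite (_ : _ * (K ^+ 2 / (4 * M)) = K / 2)//; by field; rewrite !gt_eqF.
Qed.

Variables (N : 'M[R]_m) (p t : nat) (psi psi' : 'I_t -> X -> R[i]).
Hypotheses (np : forall j, nice (psi j)) (np' : forall j, nice (psi' j)).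
Local Notation Np := (p%:R *: N).

Lemma lat_scale (l : 'rV[int]_m) : lat Np l = lat N (l *+ p).
Proof.
rewrite /lat -scalemxAr scalemxAl; congr (_ *m _); apply/rowP => i.
by rewrite !mxE mulmxnE rmorphMn/= mulr_natl.
Qed.

Definition err (f : 'I_t -> X -> R[i]) j (x : 'I_t * 'rV[int]_m) : R[i] :=
 V (psi j) (f x.1) (lat Np x.2) - ((j == x.1) && (x.2 == 0))%:R.

Definition pert (f : X -> R[i]) (s : seq ('I_t * 'rV[int]_m)) (c : 'I_t * 'rV[int]_m -> R[i]) : X -> R[i] :=
 fun x => f x + \sum_(y <- s) c y * tfshift (lat Np y.2) (psi' y.1) x.

Lemma nice_pert f s c : nice f -> nice (pert f s c).
Proof. by move=> nf0; apply: n_D => //; apply: nice_sum => y; apply: niceZ; exact: nice_tf. Qed.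
Lemma V_pert x f s c z : nice x -> nice f -> V x (pert f s c) z =
 V x f z + \sum_(y <- s) ((c y)^*)%C * (ee (beta z (lat Np y.2)) * V x (psi' y.1) (z + lat Np y.2)).
Proof.
move=> nx nf0; rewrite /V /pert tfD L2innerDr//; last 2 first.
- exact: nice_tf.
- by apply: nice_tf; apply: nice_sum => y; apply: niceZ; exact: nice_tf.
rewrite tf_sum L2inner_sumr//; last by move=> y; apply: nice_tf; apply: niceZ; exact: nice_tf.
congr (_ + _); apply: eq_bigr => y _; rewrite tfZ L2innerZr//; last by do 2 apply: nice_tf.
rewrite tf_comp L2innerZr//; last exact: nice_tf.
by rewrite eN cjK.
Qed.

(** The last clause transfers l^1 bounds from psi' to the improved duals. Its factor [K] is tracked
    because it has to stay bounded while [e] tends to 0. *)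
Definition improved (e K : R) := exists f : 'I_t -> X -> R[i],
 [/\ forall j, nice (f j), forall j, bs (fun x => nc (err f j x)) e &
  forall x w M, nice x -> (forall j, bs (fun k => nc (V x (psi' j) (lat N k + w))) M) ->
   forall j, bs (fun k => nc (V x (f j) (lat N k + w))) (K * M)].

(** One step of a Neumann series: subtract the shifts of psi' weighted by the current error.
    Subtracting all of them would leave a composition of the error with that of psi', at most e/2.
    Only finitely many are subtracted, so that the functions remain nice, and the tail costs e/4. *)
Lemma improve_step e K : (forall j, bs (fun x => nc (err psi' j x)) (1 / 2)) -> 0 < e ->
 improved e K -> improved (3 / 4 * e) (K + t%:R * e).
Proof.
move=> E0 e_gt0 [f [nf0 Ef Kf]].
have e4 : 0 < e / 4 by rewrite divr_gt0.
have tl j : {A : seq ('I_t * 'rV[int]_m) | forall B, uniq B -> \sum_(x <- B | x \notin A) nc (err f j x) <= e / 4}.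
 apply: cid; have [A _ HA] := bs_tail (fun x => nc_ge0 _) (Ef j) e4; by exists A.
(* Indices are negated: the correction by the shift k acts on the error at -k. *)
pose F : seq 'rV[int]_m := undup (flatten [seq [seq - x.2 | x <- sval (tl j)] | j <- enum 'I_t]).
pose s : seq ('I_t * 'rV[int]_m) := [seq (j, k) | j <- enum 'I_t, k <- F].
pose D (y : 'I_t * 'rV[int]_m) j' : R[i] := ee (beta (lat Np y.2) (lat Np y.2)) * err f y.1 (j', - y.2).
pose c j' y : R[i] := - ((D y j')^*)%C.
pose f2 j' := pert (f j') s (c j').
have cs j' y : ((c j' y)^*)%C = - D y j' by rewrite /c; case: (D y j') => a b; rewrite /= !opprK.
have ncDE y j' : nc (D y j') = nc (err f y.1 (j', - y.2)) by rewrite /D ncM nc_e mul1r.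
have sumD (h : 'I_t * 'rV[int]_m -> R[i]) : \sum_(y <- s) h y = \sum_(j : 'I_t) \sum_(k <- F) h (j, k).
 by rewrite /s big_allpairs big_enum.
have sumDR (h : 'I_t * 'rV[int]_m -> R) : \sum_(y <- s) h y = \sum_(j : 'I_t) \sum_(k <- F) h (j, k).
 by rewrite /s big_allpairs big_enum.
have uF : uniq F by exact: undup_uniq.
have rowF j (j' : 'I_t) : \sum_(k <- F) nc (err f j (j', - k)) <= e.
 rewrite -(big_map (fun k => (j', - k)) xpredT (fun x => nc (err f j x))); apply: Ef.
 by rewrite map_inj_uniq// => k k' [] /oppr_inj.
have rowFJ j : \sum_(j' : 'I_t) \sum_(k <- F) nc (err f j (j', - k)) <= e.
 rewrite (big_pairs F (fun x => nc (err f j (x.1, - x.2)))).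
 rewrite -(big_map (fun x : 'I_t * 'rV[int]_m => (x.1, - x.2)) xpredT (fun x => nc (err f j x))); apply: Ef.
 rewrite map_inj_uniq => [|[j1 k1] [j2 k2] /= [-> /oppr_inj ->]//].
 by rewrite allpairs_uniq ?enum_uniq// => -[? ?] [? ?].
exists f2; split; first by move=> j; exact: nice_pert.
- move=> j s0 us0.
 pose G (x : 'I_t * 'rV[int]_m) := \sum_(y <- s) nc (D y x.1) * nc (err psi' j (y.1, x.2 + y.2)).
 have bnd x : nc (err f2 j x) <= (if x \in sval (tl j) then 0 else nc (err f j x)) + G x.
  case: x => j' l.
  (* The Kronecker part of the pairing with psi' cancels the selected entry of the old error; what
     is left is the tail and the product of the two errors. *)
  have key : err f2 j (j', l) = (err f j (j', l) - (if - l \in F then err f j (j', l) else 0)) -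
    \sum_(y <- s) D y j' * ee (beta (lat Np l) (lat Np y.2)) * err psi' j (y.1, l + y.2).
   rewrite /err /= V_pert// -!addrA; congr (_ + _); rewrite addrC; congr (_ + _).
   rewrite (eq_bigr (fun y => - (D y j' * ee (beta (lat Np l) (lat Np y.2)) * ((j == y.1) && (l + y.2 == 0))%:R)
     - D y j' * ee (beta (lat Np l) (lat Np y.2)) * err psi' j (y.1, l + y.2))); last first.
    move=> y _; rewrite cs /err /= latD.
    set z1 := V _ _ _; set z2 := ee _; set z3 := D _ _; set z4 := _%:R; clearbody z1 z2 z3 z4; ring.
   rewrite sumrB; congr (_ - _); rewrite sumrN; congr (- _).
   rewrite sumD (bigD1 j)//= [X in _ + X]big1 ?addr0 => [|j1 j1j]; last first.
    by rewrite big1// => k _; rewrite eq_sym (negbTE j1j) mulr0.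
   have [lF|lF] := boolP (- l \in F); last first.
    rewrite big1_seq// => k /andP[_ kF]; rewrite eqxx/= addr_eq0.
    case: eqP => [lk|_]; last by rewrite mulr0.
    by move: lF; rewrite lk opprK kF.
   rewrite (bigD1_seq (- l))//= [X in _ + X]big1 ?addr0 => [|k kl]; last first.
    by rewrite addrC addr_eq0 (negbTE kl) andbF mulr0.
   rewrite eqxx addrN eqxx mulr1 /D/= opprK mulrAC -eD latN.
   have -> : beta (- lat Np l) (- lat Np l) + beta (lat Np l) (- lat Np l) = 0.
    by rewrite /beta !linearN/= /dotr -big_split/= big1// => i _; rewrite !mxE; ring.
   by rewrite e0 mul1r.
  rewrite key (le_trans (ncBD _ _))//; apply: lerD; last first.
   rewrite (le_trans (nc_sum _ _ _))// /G; apply: ler_sum => y _.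
   by rewrite ncM (ncM (D _ _)) nc_e mulr1.
  case: ifP => [lF|lF]; first by rewrite subrr nc0; case: ifP => // _; exact: nc_ge0.
  rewrite subr0; case: ifP => // xA; move: lF; rewrite mem_undup => /negP[].
  by apply/flatten_mapP; exists j; [rewrite mem_enum|apply/mapP; exists (j', l)].
 apply: (le_trans (ler_sum _ (fun x _ => bnd x))); rewrite big_split/=.
 have -> : 3 / 4 * e = e / 4 + 1 / 2 * e by field.
 apply: lerD.
  rewrite (bigID (fun x => x \in sval (tl j)))/= big1 ?add0r => [|x ->//].
  rewrite (eq_bigr (fun x => nc (err f j x))) => [|x /negbTE ->//]; exact: (svalP (tl j)).
 pose L := undup [seq x.2 | x <- s0].
 pose L' := undup [seq l + k | l <- L, k <- F].
 pose Sj j2 := \sum_(l <- L') nc (err psi' j (j2, l)).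
 have Sj0 j2 : 0 <= Sj j2 by apply: sumr_ge0 => l _; exact: nc_ge0.
 have uL : uniq L by exact: undup_uniq. have uL' : uniq L' by exact: undup_uniq.
 apply: (@le_trans _ _ (\sum_(j' : 'I_t) \sum_(l <- L) G (j', l))).
  rewrite (big_pairs L G).
  have ua : uniq [seq (j', l) | j' <- enum 'I_t, l <- L] by rewrite allpairs_uniq ?enum_uniq// => -[? ?] [? ?].
  rewrite (@sum_split _ _ G _ _ us0 ua).
   rewrite lerDl; apply: sumr_ge0 => x _; apply: sumr_ge0 => y _; rewrite mulr_ge0 ?nc_ge0//.
  move=> x xs; apply/allpairsP; exists x; split; rewrite ?mem_enum//; last by case: x xs.
  by rewrite mem_undup; apply: map_f.
 apply: (@le_trans _ _ (\sum_(j2 : 'I_t) (\sum_(j' : 'I_t) \sum_(k <- F) nc (err f j2 (j', - k))) * Sj j2)).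
  under eq_bigr do rewrite exchange_big/=.
  rewrite exchange_big/= sumDR; apply: ler_sum => j2 _; rewrite mulr_suml [leRHS](eq_bigr
   (fun j' => \sum_(k <- F) nc (err f j2 (j', - k)) * Sj j2)) => [|j' _]; last by rewrite mulr_suml.
  rewrite [leRHS]exchange_big/= big_seq [leRHS]big_seq; apply: ler_sum => k kF.
  apply: ler_sum => j' _; rewrite -mulr_sumr (ncDE (j2, k) j'); apply: ler_wpM2l; first exact: nc_ge0.
  rewrite /Sj -(big_map (fun l => l + k) xpredT (fun l => nc (err psi' j (j2, l)))).
  have um : uniq [seq l + k | l <- L] by rewrite map_inj_uniq//; exact: addIr.
  rewrite (@sum_split _ _ (fun l => nc (err psi' j (j2, l))) _ _ um uL').
   by rewrite lerDl; apply: sumr_ge0 => x _; exact: nc_ge0.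
  move=> _ /mapP[l lL ->]; rewrite mem_undup; apply/allpairsP; exists (l, k); split=> //.
 apply: (@le_trans _ _ (\sum_(j2 : 'I_t) e * Sj j2)).
  by apply: ler_sum => j2 _; rewrite ler_wpM2r.
 rewrite -mulr_sumr mulrC ler_wpM2r ?(ltW e_gt0)// /Sj (big_pairs L' (fun x => nc (err psi' j x))).
 apply: E0.
 by rewrite allpairs_uniq ?enum_uniq// => -[? ?] [? ?].
move=> x w M nx HM j s0 us0.
have H1 := Kf x w M nx HM j s0 us0.
have bnd k : nc (V x (f2 j) (lat N k + w)) <= nc (V x (f j) (lat N k + w)) +
  \sum_(y <- s) nc (D y j) * nc (V x (psi' y.1) (lat N (k + y.2 *+ p) + w)).
 rewrite V_pert// (le_trans (ncD _ _))// lerD2l (le_trans (nc_sum _ _ _))//; apply: ler_sum => y _.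
 rewrite cs ncM ncN (ncM (ee _)) nc_e mul1r lat_scale latD.
 by rewrite -!addrA [w + _]addrC.
rewrite (le_trans (ler_sum _ (fun k _ => bnd k)))// big_split/= mulrDl lerD// exchange_big/=.
have M0 : 0 <= M by have := HM j [::] isT; rewrite big_nil.
apply: (@le_trans _ _ (\sum_(y <- s) nc (D y j) * M)).
 apply: ler_sum => y _; rewrite -mulr_sumr ler_wpM2l ?nc_ge0//.
 exact: (bs_inj (f := fun k => k + y.2 *+ p) (addIr _) (HM y.1)).
rewrite -mulr_suml ler_wpM2r// sumDR.
apply: (@le_trans _ _ (\sum_(j2 : 'I_t) e)); last by rewrite sumr_const card_ord -[leLHS]mulr_natl lexx.
apply: ler_sum => j2 _; rewrite (eq_bigr (fun k => nc (err f j2 (j, - k)))) => [|k _]; [exact: rowF|exact: ncDE].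
Qed.

(** After n steps the error is (3/4)^n / 2 and the factors added so far are t times a geometric sum,
    at most 2t in total. *)
Lemma neumann eps : (forall j, bs (fun x => nc (err psi' j x)) (1 / 2)) -> 0 < eps ->
 exists e, e <= eps /\ improved e (1 + 2 * t%:R).
Proof.
move=> E0 eps0.
have P n : improved ((3 / 4) ^+ n / 2) (1 + 2 * t%:R * (1 - (3 / 4) ^+ n)).
 elim: n => [|n IH].
  rewrite expr0 subrr mulr0 addr0; exists psi'; split=> // x w M nx H j; rewrite mul1r; exact: H.
 have q0 : 0 < (3 / 4) ^+ n / 2 :> R by rewrite divr_gt0// exprn_gt0// divr_gt0.
 have := improve_step E0 q0 IH; rewrite exprS; set q := _ ^+ n.
 have -> : 3 / 4 * (q / 2) = 3 / 4 * q / 2 by rewrite mulrA.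
 have -> : 1 + 2 * t%:R * (1 - q) + t%:R * (q / 2) = 1 + 2 * t%:R * (1 - 3 / 4 * q) by field.
 exact.
have /cvgrPdist_le : (fun n : nat => (3 / 4 : R) ^+ n) @ \oo --> (0 : R).
 by apply: cvg_expr; rewrite ger0_norm ?divr_ge0// ltr_pdivrMr// mul1r ltr_nat.
move=> /(_ _ eps0)[n _ /(_ n (leqnn n))]; rewrite sub0r normrN => hn.
have q0 : 0 <= (3 / 4) ^+ n :> R by rewrite exprn_ge0// divr_ge0.
exists ((3 / 4) ^+ n / 2); split; first by move: hn; rewrite ger0_norm//; lra.
have [f [nf0 Ef Kf]] := P n; exists f; split=> // x w M nx HM j.
apply: bs_mono (Kf x w M nx HM j).
have M0 : 0 <= M by have := HM j [::] isT; rewrite big_nil.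
rewrite ler_wpM2r// lerD2l ler_piMr ?mulr_ge0//; lra.
Qed.

End neumann.

(** * Diophantine approximation for nearly central elements *)

Section arithmetic.
Context {R : realType}.

Lemma irrational_dense (al : R) : (forall (q : nat) (w : int), (0 < q)%N -> q%:R * al <> w%:~R) ->
 forall c delta : R, 0 < delta -> exists b w : int, `|b%:~R * al - c - w%:~R| <= delta.
Proof.
move=> irr c delta d0; have [q [w [q0 Hw]]] := dirichlet (fun _ : 'I_1 => al) d0.
move: (Hw ord0) => {}Hw; set e := q%:R * al - (w ord0)%:~R in Hw.
have e_neq : e != 0 by rewrite subr_eq0; apply/eqP; exact: irr.
pose n := Num.floor (c / e).
exists (n * q), (n * w ord0).
have -> : (n * q)%:~R * al - c - (n * w ord0)%:~R = (n%:~R - c / e) * e.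
 by rewrite mulrBl mulfVK// !intrM /e -[(q : int)%:~R]/(q%:R); ring.
rewrite normrM (le_trans _ Hw)// ler_piMl// distrC ger0_norm ?subr_ge0 ?ge_floor//.
by rewrite lerBlDl; have := floorD1_gt (c / e); rewrite intrD => /ltW.
Qed.

(** The multiplier b is a difference of two terms of a sequence b_j with b_j al close to j e1 modulo
    1, selected by the pigeonhole so that b y_s is almost integral. The index difference g <= L
    divides L factorial, so a = a0 L! / g brings a b al back to a0 L! e1 = gam, whatever g is; a is
    a multiple of a0 and keeps a x_s almost integral. *)
Lemma near_central (I : finType) (x y : I -> R) (al eta gam : R) :
 (forall (q : nat) (w : int), (0 < q)%N -> q%:R * al <> w%:~R) -> 0 < eta -> exists a b : int,
 [/\ forall s, exists w : int, `|a%:~R * x s - w%:~R| <= eta,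
   forall s, exists w : int, `|b%:~R * y s - w%:~R| <= eta &
   exists w : int, `|(a * b)%:~R * al - gam - w%:~R| <= eta].
Proof.
move=> irr e0; have [L HL] := pigeon I e0.
have f0 : 0 < (L`!)%:R :> R by rewrite ltr0n fact_gt0.
have [a0 [wx [a00 Hx]]] := dirichlet x (divr_gt0 e0 f0).
have aR : 0 < a0%:R :> R by rewrite ltr0n.
have af0 : 0 < a0%:R * (L`!)%:R :> R by rewrite mulr_gt0.
pose e1 := gam / (a0%:R * (L`!)%:R).
have d0 : 0 < eta / (2 * (a0%:R * (L`!)%:R)) by rewrite divr_gt0// mulr_gt0.
have bj (j : nat) : {b : int | exists w : int, `|b%:~R * al - j%:R * e1 - w%:~R| <= eta / (2 * (a0%:R * (L`!)%:R))}.
 by apply: cid; have [b [w H]] := irrational_dense irr (j%:R * e1) d0; exists b, w.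
have [j1 [j2 [wy [j12 j2L Hy]]]] := HL (fun j i => (sval (bj j))%:~R * y i).
have [w1 H1] := svalP (bj j1); have [w2 H2] := svalP (bj j2).
pose g := (j2 - j1)%N.
have g0 : (0 < g)%N by rewrite subn_gt0.
have gL : (g <= L)%N by rewrite (leq_trans (leq_subr _ _)).
have gf : (L`! = g * (L`! %/ g))%N by rewrite mulnC divnK// dvdn_fact// g0.
pose v := (L`! %/ g)%N.
have v0 : (0 < v)%N by rewrite divn_gt0// dvdn_leq ?fact_gt0 ?dvdn_fact ?g0.
have gR : 0 < g%:R :> R by rewrite ltr0n.
have fE : (L`!)%:R = g%:R * v%:R :> R by rewrite -natrM -gf.
exists (a0 * v)%N, (sval (bj j2) - sval (bj j1)); split.
- move=> s; exists (wx s * v); rewrite intrM -[((a0 * v)%N : int)%:~R]/((a0 * v)%:R) natrM.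
 have -> : a0%:R * v%:R * x s - (wx s)%:~R * (v : int)%:~R = v%:R * (a0%:R * x s - (wx s)%:~R).
  by rewrite -[(v : int)%:~R]/(v%:R); ring.
 rewrite normrM ger0_norm// (le_trans (ler_wpM2l _ (Hx s)))// fE mulrC -mulrA ler_piMr ?(ltW e0)//.
 by rewrite invfM mulfVK ?gt_eqF ?ltr0n// invf_le1// ler1n.
- by move=> s; exists (wy s); rewrite intrB mulrBl.
exists (Posz (a0 * v) * (w2 - w1)).
have gE : g%:R = j2%:R - j1%:R :> R by rewrite natrB// ltnW.
have gamE : gam = (a0 * v)%:R * ((j2%:R - j1%:R) * e1).
 by rewrite -gE /e1 natrM fE; field; rewrite !gt_eqF ?ltr0n.
rewrite !intrM !intrB -[((a0 * v)%N : int)%:~R]/((a0 * v)%:R : R).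
have -> : (a0 * v)%:R * ((sval (bj j2))%:~R - (sval (bj j1))%:~R) * al - gam - (a0 * v)%:R * (w2%:~R - w1%:~R) =
  (a0 * v)%:R * ((sval (bj j2))%:~R * al - j2%:R * e1 - w2%:~R - ((sval (bj j1))%:~R * al - j1%:R * e1 - w1%:~R)).
 by rewrite {1}gamE; ring.
have avf : (a0 * v)%:R <= a0%:R * (L`!)%:R :> R.
 by rewrite natrM ler_wpM2l// fE ler_peMl// ler1n.
rewrite normrM ger0_norm// (le_trans (ler_pM _ _ avf (le_trans (ler_normB _ _) (lerD H2 H1))))//.
by rewrite le_eqVlt; apply/orP; left; apply/eqP; field; rewrite gt_eqF ?ltr0n ?fact_gt0// gt_eqF.
Qed.

End arithmetic.

(** * Trigonometric kernels as polynomials *)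

Section kernel.
Context {R : realType}.
Implicit Types (p q : {poly R[i]}).

(** The Wiener norm: it bounds the effect of p when the powers of X are replaced by time-frequency
    shifts. *)
Definition pn p : R := \sum_(n < size p) nc p`_n.

Lemma pn_wide p N : (size p <= N)%N -> pn p = \sum_(n < N) nc p`_n.
Proof.
move=> sN; rewrite /pn (big_ord_widen N (fun n => nc p`_n) sN) [RHS](bigID (fun n : 'I_N => (n < size p)%N))/=.
by rewrite [X in _ = _ + X]big1 ?addr0// => n; rewrite -leqNgt => h; rewrite nth_default ?nc0.
Qed.

Lemma pn_ge0 p : 0 <= pn p. Proof. by apply: sumr_ge0 => n _; exact: nc_ge0. Qed.
Lemma pn0 : pn 0 = 0. Proof. by rewrite /pn size_poly0 big_ord0. Qed.
Lemma pnD p q : pn (p + q) <= pn p + pn q.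
Proof.
pose N := maxn (size p) (size q).
rewrite (@pn_wide (p + q) N) ?size_polyD// (@pn_wide p N) ?leq_maxl// (@pn_wide q N) ?leq_maxr//.
by rewrite -big_split; apply: ler_sum => n _; rewrite coefD ncD.
Qed.

Lemma pn_sum I (r : seq I) (P : pred I) (F : I -> {poly R[i]}) :
 pn (\sum_(i <- r | P i) F i) <= \sum_(i <- r | P i) pn (F i).
Proof.
elim/big_rec2: _ => [|i x y _ IH]; first by rewrite pn0.
by rewrite (le_trans (pnD _ _))// lerD2l.
Qed.

Lemma pnZ c p : pn (c *: p) = nc c * pn p.
Proof.
rewrite (@pn_wide (c *: p) (size p)) ?size_scale_leq// /pn mulr_sumr.
by apply: eq_bigr => n _; rewrite coefZ ncM.
Qed.

Lemma pnN p : pn (- p) = pn p.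
Proof. by rewrite -scaleN1r pnZ ncN nc1 mul1r. Qed.
Lemma pnXnM n p : pn ('X^n * p) <= pn p.
Proof.
have s : (size ('X^n * p)%R <= n + size p)%N.
 by rewrite (leq_trans (size_polyMleq _ _))// size_polyXn.
rewrite (pn_wide s) big_split_ord/= big1 ?add0r => [|i _]; last by rewrite coefXnM ltn_ord nc0.
by apply: ler_sum => i _; rewrite coefXnM ltnNge leq_addr/= addKn.
Qed.

Lemma pnM p q : pn (p * q) <= pn p * pn q.
Proof.
rewrite -{1}[p]coefK poly_def mulr_suml (le_trans (pn_sum _ _ _))// [pn p]/pn mulr_suml; apply: ler_sum => n _.
by rewrite -scalerAl pnZ ler_wpM2l ?nc_ge0// pnXnM.
Qed.

Lemma pn1 : pn 1 = 1.
Proof. by rewrite /pn size_poly1 big_ord1 coef1 nc1. Qed.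
Lemma pnX p n : pn (p ^+ n) <= pn p ^+ n.
Proof.
elim: n => [|n IH]; first by rewrite !expr0 pn1.
by rewrite !exprS (le_trans (pnM _ _))// ler_wpM2l ?pn_ge0.
Qed.

Lemma central_bin N : (4 ^ N <= (2 * N).+1 * 'C(2 * N, N))%N.
Proof.
elim: N => [|N IH]; first by rewrite bin0.
have E1 := mul_bin_diag (2 * N).+2 N; have E2 := mul_bin_diag (2 * N).+1 N.
have E3 : 'C((2 * N).+1, N) = 'C((2 * N).+1, N.+1).
 by rewrite -(@bin_sub (2 * N).+1 N); [congr 'C(_, _); lia|lia].
rewrite mulnS add2n; rewrite [(2 * N).+2.-1]/= [(2 * N).+1.-1]/= in E1 E2.
rewrite E3 in E1; rewrite expnS.
move: E1 E2 IH; set x := 'C((2 * N).+2, _); set y := 'C(_, N.+1); set z := 'C(_, N); set f := (4 ^ N)%N.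
clearbody x y z f; move=> E1 E2 IH; nia.
Qed.

Lemma nc_1e (u th : R) : 0 <= th <= 1 / 2 -> th <= `|u| -> `|u| <= 1 - th -> nc (1 + ee u) <= 2 * cos (pi * th).
Proof.
move=> /andP[th0 th2] u1 u2.
have E : 1 + ee u = ee (u / 2) * (2 * cos (pi * u))%:C%C.
 have -> : (2 * cos (pi * u))%:C%C = ee (u / 2) + ee (- (u / 2)).
  rewrite eN /ee /expi (_ : 2 * pi * (u / 2) = pi * u); last by field.
  by apply/eqP; rewrite eq_complex /= addrN eqxx andbT; apply/eqP; ring.
 by rewrite mulrDr -eD -eD addrN e0 [RHS]addrC; congr (_ + ee _); field.
rewrite E ncM nc_e mul1r nc_real normrM ger0_norm// ler_wpM2l//.
have -> : cos (pi * u) = cos (pi * `|u|).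
 have [u0|u0] := leP 0 u; first by rewrite ger0_norm.
 by rewrite ltr0_norm// mulrN cosN.
have pp : 0 < pi :> R := pi_gt0 R.
have i1 : pi * th \in `[0, pi] by rewrite in_itv/= mulr_ge0 ?(ltW pp)//= ler_piMr ?(ltW pp)//; lra.
have i2 : pi * `|u| \in `[0, pi] by rewrite in_itv/= mulr_ge0 ?(ltW pp)//= ler_piMr ?(ltW pp)//; lra.
have i3 : pi - pi * th \in `[0, pi].
 by move: i1; rewrite !in_itv/= => /andP[h1 h2]; apply/andP; split; lra.
have cd (a b : R) : a \in `[0, pi] -> b \in `[0, pi] -> a <= b -> cos b <= cos a.
 by move=> ia ib; rewrite le_eqVlt => /predU1P[->//|ab]; apply/ltW; rewrite ltr_cos.
rewrite ler_norml cd ?ler_pM2l// andbT.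
have -> : - cos (pi * th) = cos (pi - pi * th) by rewrite addrC cosDpi cosN.
by apply: cd => //; rewrite -[X in X - _]mulr1 -mulrBr ler_pM2l.
Qed.

Lemma binomX (a : R[i]) M : (1 + a *: 'X) ^+ M = \poly_(i < M.+1) (a ^+ i *+ 'C(M, i)).
Proof.
rewrite exprDn poly_def; apply: eq_bigr => i _.
by rewrite expr1n mul1r exprZn scalerMnl.
Qed.

(** At X = e(s) this is X^N times a normalised (2 cos pi(s - y/D))^(2N): the periodic kernel with
    peak at y/D, made into a polynomial by the factor X^N. *)
Definition kp (N D : nat) (y : int) : {poly R[i]} :=
 (((('C(2 * N, N) * D)%:R)^-1 : R)%:C%C * ee (N%:R * (y%:~R / D%:R))) *: (1 + ee (- (y%:~R / D%:R)) *: 'X) ^+ (2 * N).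

Lemma size_kp N D y : (size (kp N D y) <= (2 * N).+1)%N.
Proof. by rewrite (leq_trans (size_scale_leq _ _))// binomX size_poly. Qed.
Lemma kp_comp N D y (dl : int) :
 kp N D y \Po (ee (dl%:~R / D%:R) *: 'X) = ee (N%:R * (dl%:~R / D%:R)) *: kp N D (y - dl).
Proof.
rewrite /kp comp_polyZ rmorphXn/= rmorphD/= rmorph1 linearZ/= comp_polyX !scalerA; congr (_ *: (1 + _) ^+ _).
 by rewrite [RHS]mulrCA -eD; congr (_ * ee _); rewrite intrB; ring.
by rewrite -eD; congr (ee _ *: _); rewrite intrB; ring.
Qed.

(** A partition of unity up to X^N: the sum over residues y annihilates every frequency except
    multiples of D, and only the central coefficient survives since N < D. *)
Lemma kp_sum N D (y0 : int) : (N < D)%N -> \sum_(s < D) kp N D (y0 + (s : nat)) = 'X^N.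
Proof.
move=> ND; have D0 : (0 < D)%N by case: D ND.
have DR : D%:R != 0 :> R by rewrite pnatr_eq0 -lt0n.
apply/polyP => n; rewrite coef_sum coefXn.
under eq_bigr do rewrite coefZ binomX coef_poly.
have [nN|nN] := ltnP; last first.
 rewrite big1 => [|s _]; last by rewrite mulr0.
 by rewrite (_ : (n == N) = false)//; apply/negbTE; rewrite neq_ltn orbC (leq_trans _ nN)// ltnS leq_pmull.
pose k : int := (n : int) - (N : int).
have gen (x u v A B A' B' : R[i]) (q : nat) : x = u * v -> A * B = A' * B' -> x * A * (B *+ q) = (u * A' *+ q) * (v * B').
 by move=> -> E; rewrite mulrnAr mulrnAl; congr (_ *+ _); rewrite -mulrA E mulrACA mulrA.
have cE (s : 'I_D) : ((('C(2 * N, N) * D)%:R)^-1 : R)%:C%C * ee (N%:R * ((y0 + (s : nat))%:~R / D%:R)) *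
  (ee (- ((y0 + (s : nat))%:~R / D%:R)) ^+ n *+ 'C(2 * N, n)) =
  ((('C(2 * N, N))%:R^-1 : R)%:C%C * ee (- (y0%:~R / D%:R * k%:~R)) *+ 'C(2 * N, n)) *
  (((D%:R)^-1 : R)%:C%C * ee (- ((s%:R : R) / D%:R * k%:~R))).
 apply: gen; first by rewrite natrM invfM rcM.
 rewrite -eMn -!eD; congr ee.
 by rewrite /k intrB intrD -[((s : nat) : int)%:~R]/(s%:R) -[((n : nat) : int)%:~R]/(n%:R) -[((N : nat) : int)%:~R]/(N%:R); ring.
have vE : ((D%:R)^-1 : R)%:C%C = (D%:R)^-1 by rewrite fmorphV/= rc_nat.
rewrite (eq_bigr _ (fun s _ => cE s)) -mulr_sumr -mulr_sumr vE (ee_avg k D0).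
have [nE|nn] := eqVneq n N.
 have -> : k = 0 by rewrite /k nE subrr.
 rewrite nE dvdz0 mulr1 mulr0 oppr0 e0 mulr1 -mulr_natr -rc_nat -rcM mulVf ?pnatr_eq0 -?lt0n ?bin_gt0//.
 by rewrite mul2n -addnn leq_addr.
case: (boolP (_ %| _)%Z) => [/dvdzP[q kE]|_]; last by rewrite mulr0.
exfalso; have k0 : k != 0 by rewrite subr_eq0; apply: contra nn => /eqP[->].
have : (absz k < D)%N by rewrite /k; lia.
by rewrite kE abszM; move: k0; rewrite kE mulf_eq0 negb_or -absz_gt0 => /andP[q0 _]; rewrite ltnNge leq_pmull.
Qed.

(** For distant peaks the quadratic (1 + aX)(1 + bX) has middle coefficient of modulus at most 2c,
    hence norm at most 2 + 2c instead of 4. The 2N-th power is compared with the normalisation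
    through 4^N <= (2N + 1) C(2N, N). *)
Lemma pn_kpM N (y y' : int) (c : R) : 0 <= c -> nc (1 + ee ((y - y')%:~R / N.+1%:R)) <= 2 * c ->
 pn (kp N N.+1 y * kp N N.+1 y') <= 4 * ((1 + c) / 2) ^+ (2 * N).
Proof.
move=> c0 hc; rewrite /kp; set a := ee (- (y%:~R / _)); set b := ee (- (y'%:~R / _)).
set k := ((_ : R)%:C)%C.
set c1 := k * ee _; set c2 := k * ee _.
have -> : c1 *: (1 + a *: 'X) ^+ (2 * N) * (c2 *: (1 + b *: 'X) ^+ (2 * N)) =
  (c1 * c2) *: ((1 + a *: 'X) * (1 + b *: 'X)) ^+ (2 * N).
 by rewrite exprMn -scalerAl -scalerAr scalerA.
rewrite pnZ {}/c1 {}/c2.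
have -> : nc (k * ee (N%:R * (y%:~R / N.+1%:R)) * (k * ee (N%:R * (y'%:~R / N.+1%:R)))) = ((('C(2 * N, N) * N.+1)%:R)^-1) ^+ 2.
 rewrite ncM (ncM k) (ncM k) !nc_e !mulr1 /k nc_real ger0_norm ?invr_ge0//.
have ab : nc (a + b) <= 2 * c.
 rewrite (_ : a + b = a * (1 + ee ((y - y')%:~R / N.+1%:R))) ?ncM ?nc_e ?mul1r//.
 by rewrite mulrDr mulr1 -eD intrB; congr (_ + ee _); ring.
have q2 : pn ((1 + a *: 'X) * (1 + b *: 'X)) <= 2 + 2 * c.
 have -> : (1 + a *: 'X) * (1 + b *: 'X) = 1 + ((a + b) *: 'X^1 + (a * b) *: 'X^2).
  rewrite mulrDl mul1r mulrDr mulr1 -scalerAl -scalerAr scalerA -expr2 scalerDl expr1 -!addrA; congr (_ + _).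
  by rewrite addrCA.
 have pX n : pn 'X^n <= 1.
  by have := pnXnM n 1; rewrite mulr1 pn1.
 rewrite (le_trans (pnD _ _))// pn1 (_ : 2 + 2 * c = 1 + (2 * c + 1)); last by ring.
 rewrite lerD2l (le_trans (pnD _ _))//; apply: lerD.
  by rewrite pnZ -[leRHS]mulr1 ler_pM ?nc_ge0 ?pn_ge0.
 by rewrite pnZ /a /b ncM !nc_e !mul1r.
rewrite (le_trans (ler_wpM2l _ (pnX _ _)))// ?exprn_ge0 ?invr_ge0//.
rewrite (le_trans (ler_wpM2l _ (_ : _ <= (2 + 2 * c) ^+ (2 * N))))// ?exprn_ge0 ?invr_ge0//.
 by rewrite lerXn2r ?nnegrE ?pn_ge0// addr_ge0// mulr_ge0.
have -> : (2 + 2 * c) ^+ (2 * N) = (4 ^+ N) ^+ 2 * ((1 + c) / 2) ^+ (2 * N).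
 by rewrite -exprM [(N * 2)%N]mulnC -exprMn; congr (_ ^+ _); field.
rewrite mulrA ler_wpM2r ?exprn_ge0 ?divr_ge0 ?addr_ge0//.
rewrite -exprMn (_ : 4 = 2 ^+ 2); last by ring.
rewrite lerXn2r ?nnegrE ?mulr_ge0 ?invr_ge0 ?exprn_ge0//.
have b0 : (0 < 'C(2 * N, N) * N.+1)%N by rewrite muln_gt0 bin_gt0 andbT mul2n -addnn leq_addr.
rewrite mulrC ler_pdivrMr ?ltr0n// (_ : 2 ^+ 2 ^+ N = (4 ^ N)%:R); last by rewrite natrX; congr (_ ^+ _); ring.
rewrite -natrM ler_nat; have := central_bin N; move: (4 ^ N)%N 'C(_, _); clear; move=> x y; nia.
Qed.

Lemma npow_small (rho eps : R) : 0 <= rho -> rho < 1 -> 0 < eps -> exists n0 : nat, forall n : nat, (n0 <= n)%N -> n.+1%:R * rho ^+ n <= eps.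
Proof.
move=> r0 r1 e0; pose s := Num.sqrt rho.
have s0 : 0 <= s by exact: sqrtr_ge0.
have sE : s ^+ 2 = rho by rewrite sqr_sqrtr.
have s1 : s < 1 by rewrite -(ltr_pXn2r (n := 2))// ?nnegrE// expr1n sE.
have c1 : 1 - s > 0 by rewrite subr_gt0.
have bern n : n.+1%:R * s ^+ n * (1 - s) <= 1.
 have -> : n.+1%:R * s ^+ n * (1 - s) = \sum_(i < n.+1) (1 - s) * s ^+ n.
  by rewrite sumr_const card_ord -mulr_natl; ring.
 apply: (@le_trans _ _ (\sum_(i < n.+1) (1 - s) * s ^+ i)).
  by apply: ler_sum => i _; rewrite ler_wpM2l ?(ltW c1)// ler_wiXn2l ?(ltW s1)// -ltnS ltn_ord.
 rewrite -mulr_sumr (_ : (1 - s) * _ = 1 - s ^+ n.+1).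
  by rewrite lerBlDr lerDl exprn_ge0.
 by have := subrX1 s n.+1; rewrite -(opprB s 1) mulNr => <-; rewrite opprB.
have /cvgrPdist_le : (fun n : nat => s ^+ n) @ \oo --> (0 : R).
 by apply: cvg_expr; rewrite ger0_norm.
move=> /(_ (eps * (1 - s)) (mulr_gt0 e0 c1))[n0 _ H]; exists n0 => n nn.
have := H n nn; rewrite sub0r normrN ger0_norm ?exprn_ge0// => h.
have -> : rho ^+ n = s ^+ n * s ^+ n by rewrite -sE -exprM mulnC exprM expr2.
rewrite -(ler_pM2r c1) mulrA (_ : _ * _ * _ * (1 - s) = (n.+1%:R * s ^+ n * (1 - s)) * s ^+ n); last by ring.
by rewrite (le_trans _ h)// ler_piMl// exprn_ge0.
Qed.

Lemma sum_blocks (W : nmodType) (f : nat -> W) t w :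
 \sum_(j < t) \sum_(s < w) f (j * w + s)%N = \sum_(y < t * w) f y.
Proof.
elim: t => [|t IH]; first by rewrite !big_ord0.
by rewrite big_ord_recr/= IH mulSnr big_split_ord.
Qed.

(** The residues modulo D are cut into t arcs of length w. [F j] sums the kernels with peak in arc
    j, [H j] those in the arc widened by h on both sides; thus F j H j is close to F j X^N, and the
    products add up to X^(2N). The substitution moves the arc of [H j'] onto the widened arc j
    displaced by B i - B i'. The k widened arcs fit side by side on the circle because k < t, so the
    products with distinct i are negligible. *)
Lemma kernel_polys (k t : nat) (eps : R) : (0 < k)%N -> (k < t)%N -> 0 < eps ->
 exists (D N : nat) (F H : 'I_t -> {poly R[i]}) (A : 'I_t -> int) (B : 'I_k -> int),
 [/\ (0 < D)%N, forall j, (size (F j) <= (2 * N).+1)%N, forall j, (size (H j) <= (2 * N).+1)%N,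
  forall i i' j j', i != i' ->
   pn (F j * (H j' \Po (ee ((A j' + B i' - A j - B i)%:~R / D%:R) *: 'X))) <= eps &
  pn (\sum_j F j * H j - 'X^(2 * N)) <= eps].
Proof.
move=> k0 kt e0; pose th : R := (2 * (k * t)%:R)^-1.
have kt0 : 1 <= (k * t)%:R :> R by rewrite ler1n muln_gt0 k0 (leq_trans _ kt).
have th0 : 0 < th by rewrite invr_gt0; lra.
have th2 : th <= 1 / 2 by rewrite /th div1r lef_pV2 ?posrE//; lra.
have pp : 0 < pi :> R := pi_gt0 R.
pose c : R := cos (pi * th).
have pth : 0 < pi * th by rewrite mulr_gt0.
have pth2 : pi * th <= pi / 2 by rewrite ler_pM2l//; lra.
have c0 : 0 <= c by apply: cos_ge0_pihalf; apply/andP; split; lra.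
have c1 : c < 1 by rewrite -cos0 ltr_cos// in_itv/=; apply/andP; split; lra.
have r0 : 0 <= (1 + c) / 2 by lra.
have r1 : (1 + c) / 2 < 1 by lra.
pose e1 := Num.min 1 (eps / 4).
have e10 : 0 < e1 by rewrite lt_min ltr01 divr_gt0.
have [n0 Hn] := npow_small r0 r1 e10.
(* With w = 2kh one has k (w + 2h) = (k + 1) w, at most t w = D as k < t. The margin h is the
   fraction 1/(2kt) of the circle whatever n0, so N = D - 1, the largest exponent allowed by
   [kp_sum], can grow with a fixed contraction ratio. *)
pose h := n0.+1; pose w := (2 * k * h)%N; pose D := (t * w)%N; pose N := D.-1.
have w0 : (0 < w)%N by rewrite !muln_gt0 k0.
have D0 : (0 < D)%N by rewrite muln_gt0 w0 (leq_trans _ kt).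
have DN : N.+1 = D by rewrite prednK.
have wD : (k * (w + 2 * h) <= D)%N.
 have E : (k * (2 * h) = w)%N by rewrite /w mulnA [(k * 2)%N]mulnC.
 by rewrite mulnDr E -mulSnr /D leq_mul2r kt orbT.
have hw : (2 * h <= w)%N by rewrite /w -mulnA leq_mul2l/= leq_pmull.
have n0N : (n0 <= N)%N.
 rewrite -ltnS DN; have : (w <= D)%N by rewrite leq_pmull// (leq_trans _ kt).
 by move: hw; rewrite /h; clear; lia.
pose q : R := 4 * ((1 + c) / 2) ^+ (2 * N).
have q0 : 0 <= q by rewrite mulr_ge0// exprn_ge0.
have Dq : (D * D)%:R * q <= eps.
 have e1l : e1 <= 1 by rewrite ge_min lexx.
 have e1r : e1 <= eps / 4 by rewrite ge_min lexx orbT.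
 have hN := Hn N n0N; rewrite DN in hN.
 have -> : (D * D)%:R * q = 4 * (D%:R * ((1 + c) / 2) ^+ N) ^+ 2.
  by rewrite /q natrM [(2 * N)%N]mulnC exprM; ring.
 have x0 : 0 <= D%:R * ((1 + c) / 2) ^+ N by rewrite mulr_ge0// exprn_ge0.
 move: (D%:R * _) hN x0 => x hN x0.
 have : x ^+ 2 <= e1 by rewrite expr2 -[leRHS]mulr1 ler_pM// (le_trans hN).
 lra.
have pairP (y y' : int) : (h <= absz (y - y'))%N -> (absz (y - y') <= D - h)%N ->
  pn (kp N D y * kp N D y') <= q.
 move=> h1 h2; rewrite -DN; apply: pn_kpM => //; rewrite DN.
 have DR : 0 < D%:R :> R by rewrite ltr0n.
 have thE : th = h%:R / D%:R.
  rewrite /th /D /w !natrM; field; rewrite !pnatr_eq0 -!lt0n.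
  by rewrite k0 (leq_trans _ kt).
 have nE : `|(y - y')%:~R / D%:R| = (absz (y - y'))%:R / D%:R :> R.
  by rewrite normrM (@ger0_norm _ D%:R^-1) ?invr_ge0 ?(ltW DR)// -intr_norm -abszE.
 apply: nc_1e; first by rewrite ltW//=.
  by rewrite nE thE ler_pM2r ?invr_gt0// ler_nat.
 have hD : (h <= D)%N by rewrite (leq_trans _ wD)// (leq_trans _ (leq_pmull _ k0))//; move: hw; clear; lia.
 have -> : 1 - th = (D - h)%:R / D%:R by rewrite thE natrB// mulrBl mulfV// gt_eqF.
 by rewrite nE ler_pM2r ?invr_gt0// ler_nat.
pose F (j : 'I_t) := \sum_(s < w) kp N D ((j * w + s)%N : int).
pose H (j : 'I_t) := \sum_(s < w + 2 * h) kp N D (((j * w)%N : int) - (h : int) + ((s : nat) : int)).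
have bnd (n1 n2 : nat) (P : pred 'I_n2) (u : 'I_n1 -> int) (v : 'I_n2 -> int) :
  (forall a b, P b -> (h <= absz (u a - v b)%R)%N /\ (absz (u a - v b)%R <= D - h)%N) ->
  pn ((\sum_a kp N D (u a)) * (\sum_(b | P b) kp N D (v b))) <= (n1 * n2)%:R * q.
 move=> uv; rewrite mulr_suml (le_trans (pn_sum _ _ _))//.
 have -> : (n1 * n2)%:R * q = \sum_(a < n1) \sum_(b < n2) q.
  under eq_bigr do rewrite sumr_const card_ord.
  by rewrite sumr_const card_ord -mulrnA mulnC -[RHS]mulr_natl.
 apply: ler_sum => a _; rewrite mulr_sumr (le_trans (pn_sum _ _ _))//.
 rewrite [leRHS](bigID P)/= -[leLHS]addr0 lerD//; last by apply: sumr_ge0.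
 by apply: ler_sum => b Pb; have [] := uv a b Pb; exact: pairP.
exists D, N, F, H, (fun j => ((j * w)%N : int)), (fun i => ((i * (w + 2 * h))%N : int)); split=> //.
- by move=> j; rewrite (leq_trans (size_sum _ _ _))//; apply/bigmax_leqP => s _; exact: size_kp.
- by move=> j; rewrite (leq_trans (size_sum _ _ _))//; apply/bigmax_leqP => s _; exact: size_kp.
- move=> i i' j j' ii'; set dl : int := _ + _ - _ - _.
 have HE : H j' \Po (ee (dl%:~R / D%:R) *: 'X) = ee (N%:R * (dl%:~R / D%:R)) *:
   \sum_(s < w + 2 * h) kp N D (((j' * w)%N : int) - (h : int) + ((s : nat) : int) - dl).
  rewrite /H linear_sum/= scaler_sumr; apply: eq_bigr => s _; exact: kp_comp.
 rewrite HE -scalerAr pnZ nc_e mul1r; apply: le_trans (bnd _ _ xpredT _ _ _) _; last first.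
  rewrite (le_trans _ Dq)// ler_wpM2r// ler_nat leq_mul//.
   by rewrite leq_pmull// (leq_trans _ kt).
  by rewrite (leq_trans _ wD)// leq_pmull.
 move=> s s' _; rewrite /dl.
 have ls := ltn_ord s; have ls' := ltn_ord s'.
 have bk (a : 'I_k) : (a * (w + 2 * h) + (w + 2 * h) <= k * (w + 2 * h))%N.
  by rewrite -mulSnr leq_mul2r ltn_ord orbT.
 have b1 := bk i; have b2 := bk i'.
 have [b3|b3] : (i * (w + 2 * h) + (w + 2 * h) <= i' * (w + 2 * h))%N \/ (i' * (w + 2 * h) + (w + 2 * h) <= i * (w + 2 * h))%N.
  move: ii'; rewrite neq_ltn => /orP[lt1|lt1]; [left|right]; by rewrite -mulSnr leq_mul2r lt1 orbT.
  move: ls ls' b1 b2 b3 wD hw; clear.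
  move: (i * _)%N (i' * _)%N (k * _)%N (j * w)%N (j' * w)%N => x x' kx y y'.
  move: (s : nat) (s' : nat) => a b ? ? ? ? ? ? ?; split; lia.
 move: ls ls' b1 b2 b3 wD hw; clear.
 move: (i * _)%N (i' * _)%N (k * _)%N (j * w)%N (j' * w)%N => x x' kx y y'.
 move: (s : nat) (s' : nat) => a b ? ? ? ? ? ? ?; split; lia.
have ND : (N < D)%N by rewrite -DN.
have sF : \sum_j F j = 'X^N.
 rewrite -(kp_sum 0 ND) /F (sum_blocks (fun y => kp N D (y : int))).
 by apply: eq_bigr => s _; rewrite add0r.
have wle : (w + 2 * h <= D)%N by rewrite (leq_trans _ wD)// leq_pmull.
(* The kernels missing from [H j]: their peaks are at distance at least h from arc j, so their
   products with [F j] are small. *)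
pose rest (j : 'I_t) := \sum_(s < D | (w + 2 * h <= s)%N) kp N D (((j * w)%N : int) - (h : int) + ((s : nat) : int)).
have HR j : H j = 'X^N - rest j.
 apply/eqP; rewrite eq_sym subr_eq -(kp_sum (((j * w)%N : int) - (h : int)) ND) (bigID (fun s : 'I_D => (s < w + 2 * h)%N))/=.
 apply/eqP; congr (_ + _); last by apply: eq_bigl => s; rewrite -leqNgt.
 by rewrite /H (big_ord_widen D (fun s => kp N D (((j * w)%N : int) - (h : int) + (s : int))) wle).
have -> : \sum_j F j * H j - 'X^(2 * N) = - \sum_j F j * rest j.
 under eq_bigr do rewrite HR mulrBr; rewrite sumrB -mulr_suml sF -exprD addnn -mul2n addrAC subrr add0r//.
rewrite pnN (le_trans (pn_sum _ _ _))// (le_trans _ Dq)//.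
apply: (@le_trans _ _ (\sum_(j < t) (w * D)%:R * q)); last first.
 by rewrite sumr_const card_ord -[leLHS]mulr_natl mulrA -natrM mulnA lexx.
apply: ler_sum => j _; apply: bnd => s s' hs'.
have ls := ltn_ord s; have ls' := ltn_ord s'.
move: ls ls' hs' wle; clear; move: (j * w)%N (s : nat) (s' : nat) => y a b ? ? ? ?; split; lia.
Qed.

End kernel.

(** * Symmetric time-frequency shifts and their relations *)

Section weyl.
Context {R : realType} (d : nat).
Local Notation m := (d + d)%N.
Local Notation X := 'rV[R]_d.
Implicit Types (N : 'M[R]_m) (z w : 'rV[R]_m).

Lemma dotrE (x y : 'rV[R]_d) : dotr x y = (x *m y^T) ord0 ord0.
Proof. by rewrite mxE; apply: eq_bigr => i _; rewrite mxE. Qed.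
Lemma betaDl z z' w : beta (z + z') w = beta z w + beta z' w.
Proof. by rewrite /beta !dotrE linearD/= mulmxDl mxE. Qed.
Lemma betaDr z w w' : beta z (w + w') = beta z w + beta z w'.
Proof. by rewrite /beta /dotr -big_split/=; apply: eq_bigr => i _; rewrite !mxE mulrDr. Qed.
(** The symmetrised shift: the phase makes the composition cocycle e(-symp/2), depending on the
    symplectic form alone. *)
Definition rho z (f : X -> R[i]) : X -> R[i] := fun x => ee (- (beta z z / 2)) * tfshift z f x.

Lemma nice_rho z f : nice f -> nice (rho z f).
Proof. by move=> nf0; apply: niceZ; exact: nice_tf. Qed.
Definition Vr f g z : R[i] := L2inner f (rho z g).

Lemma VrE f g z : nice f -> nice g -> Vr f g z = ee (beta z z / 2) * V f g z.
Proof. by move=> nf0 ng; rewrite /Vr /rho L2innerZr ?eN ?cjK//; exact: nice_tf. Qed.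
Lemma nc_Vr f g z : nice f -> nice g -> nc (Vr f g z) = nc (V f g z).
Proof. by move=> nf0 ng; rewrite VrE// ncM nc_e mul1r. Qed.
Lemma rho_comp z w f : rho z (rho w f) = fun x => ee (- (symp z w / 2)) * rho (z + w) f x.
Proof.
rewrite /rho tfZ tf_comp; apply/funext => x; rewrite !mulrA -!eD; congr (ee _ * _).
by rewrite symp_beta !betaDl !betaDr; field.
Qed.

Lemma Vr_cov f g a b : nice f -> nice g ->
 L2inner (rho a f) (rho b g) = ee (- (symp a (b - a) / 2)) * Vr f g (b - a).
Proof.
move=> nf0 ng; have -> : L2inner (rho a f) (rho b g) =
  ee (- (beta a a / 2)) * (ee (beta b b / 2) * L2inner (tfshift a f) (tfshift b g)).
 rewrite /rho L2innerZl; [|exact: nice_tf|exact: nice_rho].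
 by rewrite L2innerZr ?eN ?cjK//; exact: nice_tf.
rewrite V_cov// VrE// !mulrA -!eD; congr (ee _ * _).
rewrite -{1 2}[b](subrK a) symp_beta; move: (b - a) => x.
by rewrite !betaDl !betaDr; field.
Qed.

Lemma rho_pair f g (a b a' : 'rV[R]_m) : nice f -> nice g ->
 L2inner (rho a f) (rho b (rho a' g)) =
 ee (symp b a' / 2 - symp a (b + a' - a) / 2) * Vr f g (b + a' - a).
Proof.
move=> nf0 ng; rewrite rho_comp L2innerZr; [|exact: nice_rho|exact: nice_rho].
by rewrite Vr_cov// eN cjK mulrA -eD.
Qed.

(** The prefactors turn the shift by n nu + k mu into the ordered product of the shifts by n nu and
    k mu. The outcome is organised by the net displacement xi, so that for xi in a finite set the
    second phase can be made almost trivial. *)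
Lemma weyl_pair f g (nu mu l : 'rV[R]_m) (n k n' k' : R) : nice f -> nice g ->
 let th := symp nu mu in let a := n *: nu + k *: mu in let a' := n' *: nu + k' *: mu in
 let xi := l + a' - a in
 ee (- (th * n * k / 2)) * ((ee (- (th * n' * k' / 2)))^*)%C * L2inner (rho a f) (rho l (rho a' g)) =
 ee (th * (n + n') * (k' - k) / 2) * ee (symp xi (a + a') / 2) * Vr f g xi.
Proof.
move=> nf0 ng th a a' xi; rewrite rho_pair// -/xi -eN opprK !mulrA -!eD; congr (ee _ * _).
have -> : l = xi + a - a' by rewrite /xi subrK addrK.
have s0 u : symp u u = 0 :> R by rewrite symp_beta subrr.
have -> : symp (xi + a - a') a' = symp xi a' + symp a a'.
 by rewrite sympDl sympNl s0 subr0 sympDl.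
rewrite (symp_anti a xi) (sympDr xi a a').
have -> : symp a a' = th * (n * k' - k * n').
 rewrite /a /a' !sympDl !sympDr !sympZl !sympZr !s0 (symp_anti mu nu) -/th; ring.
by field.
Qed.

Lemma Vr_conj f g z w : nice f -> nice g -> Vr (rho w f) (rho w g) z = ee (symp z w) * Vr f g z.
Proof.
move=> nf0 ng; rewrite /Vr (rho_pair _ _ _ nf0 ng).
have -> : z + w - w = z by rewrite addrK.
by congr (ee _ * _); rewrite (symp_anti w z); field.
Qed.

Lemma nc_Vr2 f g z a b : nice f -> nice g -> nc (Vr (rho a f) (rho b g) z) = nc (V f g (z + (b - a))).
Proof.
by move=> nf0 ng; rewrite /Vr (rho_pair _ _ _ nf0 ng) ncM nc_e mul1r (nc_Vr _ nf0 ng) addrA.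
Qed.

(* The averaged characters of the points (1/p) u, u in {0..p-1}^n, detect the sublattice p Z^n. *)
Lemma char_sum n (p : nat) (l : 'rV[int]_n) : (0 < p)%N ->
 \sum_(u : {ffun 'I_n -> 'I_p}) ee (\sum_s - ((u s : nat)%:R / p%:R * (l ord0 s)%:~R)) =
 (p ^ n)%:R * [forall s, (p %| l ord0 s)%Z]%:R :> R[i].
Proof.
move=> p0; have pC : (p%:R : R[i]) != 0 by rewrite pnatr_eq0 -lt0n.
under eq_bigr do rewrite e_sum.
rewrite -(bigA_distr_bigA (fun s (u : 'I_p) => ee (- ((u : nat)%:R / p%:R * (l ord0 s)%:~R) : R))).
have E s : \sum_(u < p) ee (- ((u : nat)%:R / p%:R * (l ord0 s)%:~R) : R) = p%:R * ((p %| l ord0 s)%Z)%:R.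
 by rewrite -(ee_avg (R := R) (l ord0 s) p0) mulVKf.
under eq_bigr do rewrite E.
rewrite big_split/= prodr_const card_ord -natrX; congr (_ * _).
case: (boolP [forall s, _]) => [/forallP H|]; first by rewrite big1// => s _; rewrite H.
by rewrite negb_forall => /existsP[s H]; rewrite (bigD1 s)//= (negbTE H) mul0r.
Qed.

(** When the kernel depends on n - n' only, a double sum with the coefficients of q reversed is a
    single sum over the coefficients of the product p q; bilinearity reduces this to monomials. *)
Lemma poly_pair (p q : {poly R[i]}) (L : nat) (Phi : int -> R[i]) :
 (size p <= L.+1)%N -> (size q <= L.+1)%N ->
 \sum_(n < L.+1) \sum_(n' < L.+1) p`_n * q`_(L - n') * Phi ((n : nat)%:Z - (n' : nat)%:Z) =
 \sum_(s < (2 * L).+1) (p * q)`_s * Phi ((s : nat)%:Z - L%:Z).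
Proof.
move=> sp sq.
pose Lam (f : {poly R[i]}) := \sum_(s < (2 * L).+1) f`_s * Phi ((s : nat)%:Z - L%:Z).
have LamZ c f : Lam (c *: f) = c * Lam f.
 by rewrite /Lam mulr_sumr; apply: eq_bigr => s _; rewrite coefZ mulrA.
have LamS I (r : seq I) (G : I -> {poly R[i]}) : Lam (\sum_(i <- r) G i) = \sum_(i <- r) Lam (G i).
 rewrite /Lam exchange_big/=; apply: eq_bigr => s _; rewrite coef_sum mulr_suml//.
have wide (f : {poly R[i]}) : (size f <= L.+1)%N -> f = \sum_(n < L.+1) f`_n *: 'X^n.
 move=> sf; rewrite -poly_def; apply/polyP => i; rewrite coef_poly; case: ltnP => // h.
 by rewrite nth_default// (leq_trans sf).
rewrite -/(Lam (p * q)) {2}(wide p sp) mulr_suml LamS; apply: eq_bigr => n _.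
rewrite -scalerAl LamZ {2}(wide q sq) [X in Lam X]mulr_sumr LamS mulr_sumr (reindex_inj rev_ord_inj)/=.
apply: eq_bigr => n' _; rewrite subSS (subKn (ltn_ord n' : (n' <= L)%N)) -mulrA; congr (_ * _).
rewrite -scalerAr LamZ -exprD; congr (_ * _).
have lt : (n + n' < (2 * L).+1)%N by have := ltn_ord n; have := ltn_ord n'; clear; lia.
rewrite /Lam (bigD1 (Ordinal lt))//= coefXn eqxx mul1r big1 ?addr0 => [|s sn]; last first.
 by rewrite coefXn -[_ == _]/(s == Ordinal lt) (negbTE sn) mul0r.
congr Phi; have := ltn_ord n'; clear; lia.
Qed.

Lemma comp_scaleX (p : {poly R[i]}) c s : (p \Po (c *: 'X))`_s = p`_s * c ^+ s.
Proof.
have -> : p \Po (c *: 'X) = \poly_(n < size p) (p`_n * c ^+ n).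
 by rewrite comp_polyE poly_def; apply: eq_bigr => n _; rewrite exprZn scalerA.
by rewrite coef_poly; case: ltnP => // h; rewrite nth_default// mul0r.
Qed.

Lemma rho_sum w I (r : seq I) (c : I -> R[i]) (G : I -> X -> R[i]) :
 rho w (fun x => \sum_(i <- r) c i * G i x) = fun x => \sum_(i <- r) c i * rho w (G i) x.
Proof.
rewrite /rho tf_sum; apply/funext => x; rewrite mulr_sumr; apply: eq_bigr => i _.
by rewrite tfZ mulrCA.
Qed.

Lemma L2inner_sums I J (r : seq I) (s : seq J) (c : I -> R[i]) (c' : J -> R[i]) (f : I -> X -> R[i]) (g : J -> X -> R[i]) :
 (forall i, nice (f i)) -> (forall j, nice (g j)) ->
 L2inner (fun x => \sum_(i <- r) c i * f i x) (fun x => \sum_(j <- s) c' j * g j x) =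
 \sum_(i <- r) \sum_(j <- s) c i * ((c' j)^*)%C * L2inner (f i) (g j).
Proof.
move=> nf0 ng; rewrite L2inner_suml; last 2 first.
- by move=> i; apply: niceZ.
- by apply: nice_sum => j; apply: niceZ.
apply: eq_bigr => i _; rewrite L2inner_sumr; last 2 first.
- by move=> j; apply: niceZ.
- exact: niceZ.
apply: eq_bigr => j _; rewrite (L2innerZl _ (nf0 i) (niceZ _ (ng j))) (L2innerZr _ (nf0 i) (ng j)).
by rewrite mulrA.
Qed.

Lemma nc_VrB f g N (l : 'rV[int]_m) c : nice f -> nice g ->
 nc (V f g (lat N l) - c * (l == 0)%:R) = nc (Vr f g (lat N l) - c * (l == 0)%:R).
Proof.
move=> nf0 ng; have [->|l0] := eqVneq l 0; last by rewrite !mulr0 !subr0 (nc_Vr _ nf0 ng).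
by rewrite (VrE _ nf0 ng) lat0 beta0r mul0r e0 mul1r.
Qed.

End weyl.

(** * The irrational case *)

Section irrational.
Context {R : realType} (d : nat).
Local Notation m := (d + d)%N.
Local Notation X := 'rV[R]_d.

(** Points of 1/p times the adjoint lattice of [N]: paired with the lattice of [N] they give all
    characters of Z^(2d) modulo p, so that [diag_sum] can average them out. *)
Definition zpt (N : 'M[R]_m) (p : nat) (u : {ffun 'I_m -> 'I_p}) : 'rV[R]_m :=
 - (p%:R^-1 *: ((\row_s (u s : nat)%:R) *m adj N)).

Lemma diag_sum (N : 'M[R]_m) (p : nat) f g l : N \in unitmx -> (0 < p)%N -> nice f -> nice g ->
 \sum_u Vr (rho (@zpt N p u) f) (rho (zpt N u) g) (lat N l) =
 (p ^ m)%:R * [forall s, (p %| l ord0 s)%Z]%:R * Vr f g (lat N l).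
Proof.
move=> uN p0 nf0 ng; rewrite -(char_sum (R := R) l p0) mulr_suml; apply: eq_bigr => u _.
rewrite (Vr_conj _ _ nf0 ng); congr (ee _ * _).
rewrite /zpt sympNr sympZr latE symp_adj// mxE sumrN mulr_sumr; congr (- _).
by apply: eq_bigr => s _; rewrite !mxE; ring.
Qed.

Lemma nc_ee_near (x y e : R) (w : int) : `|x - y - w%:~R| <= e -> nc (ee x - ee y) <= 4 * pi * e.
Proof.
move=> h; have -> : ee y = ee (y + w%:~R) by rewrite eD e_int mulr1.
by rewrite (le_trans (nc_eB _ _))// ler_wpM2l ?mulr_ge0 ?pi_ge0// opprD addrA.
Qed.

Lemma symp_near (N : 'M[R]_m) (v : 'rV[R]_m) (eta : R) (l : 'rV[int]_m) : 0 <= eta ->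
 (forall s, exists w : int, `|symp (row s N) v - w%:~R| <= eta) ->
 exists w : int, `|symp (lat N l) v - w%:~R| <= l1 (map_mx intr l : 'rV[R]_m) * eta.
Proof.
move=> e0 H; have H' s : {w : int | `|symp (row s N) v - w%:~R| <= eta} by apply: cid; exact: H.
exists (\sum_s l ord0 s * sval (H' s)).
have -> : symp (lat N l) v = \sum_s (l ord0 s)%:~R * symp (row s N) v.
 rewrite sympE /lat -!mulmxA mxE; apply: eq_bigr => s _; rewrite !mxE sympE; congr (_ * _).
 by rewrite -mulmxA [RHS]mxE; apply: eq_bigr => j _; rewrite [row s N _ _]mxE.
rewrite rmorph_sum/= -sumrB (le_trans (ler_norm_sum _ _ _))// /l1 mulr_suml; apply: ler_sum => s _.
rewrite intrM -mulrBr normrM mxE ler_wpM2l//; exact: (svalP (H' s)).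
Qed.

(** Let U and V be the shifts by the lattice vectors of [kn] and [km]. They commute up to nearly a
    primitive D-th root of unity, and almost commute with any prescribed finite set of lattice
    shifts. Hence F_j(U) localises the spectrum of U on an arc, powers of V rotate the arcs, and
    these act as approximate matrix units, placing the vectors rho(z_i) psi_j in nearly orthogonal
    positions inside one [g]; [g'] is built likewise from H and the dual vectors. Summing over the k
    = p^(2d) points z_i leaves k times the Kronecker symbol, and packing supplies t > k vectors, the
    room required by [kernel_polys]. *)
Theorem irrational_riesz (N : 'M[R]_m) (ix iy : 'I_m) : N \in unitmx -> 1 < `|\det N| ->
 (forall (q : nat) (w : int), (0 < q)%N -> q%:R * (4 * symp (row iy N) (row ix N)) <> w%:~R) ->
 exists2 g : X -> R[i], nice g & riesz N g.
Proof.
move=> uN dN irr.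
have [p [t [psi [psi' [p0 pt np np' E0]]]]] := packing uN ltr01 dN.
pose I : finType := {ffun 'I_m -> 'I_p}.
pose k := #|I|; have kE : k = (p ^ m)%N by rewrite /k card_ffun !card_ord.
have kt : (k < t)%N by move: pt; rewrite mul1r -natrX ltr_nat kE.
have k0 : (0 < k)%N by rewrite kE expn_gt0 p0.
have kR : 1 <= k%:R :> R by rewrite ler1n.
pose z (i : I) := zpt N i.
have Mex (y : I * I * ('I_t * 'I_t)) : {M : R | 0 < M /\
  bs (fun l => nc (V (psi y.2.1) (psi' y.2.2) (lat N l + (z y.1.2 - z y.1.1)))) M}.
 apply: cid; have [M M0 bM] := bs_V uN (np y.2.1) (nice_tf (z y.1.2 - z y.1.1) (np' y.2.2)).
 exists M; split=> //; apply: bs_le bM => l; rewrite /V tf_comp L2innerZr; last 2 first.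
 - exact: np.
 - by apply: nice_tf.
 by rewrite ncM nc_conj nc_e mul1r.
pose M : R := \sum_y sval (Mex y).
have M0 y : sval (Mex y) <= M.
 rewrite /M (bigD1 y)//= lerDl; apply: sumr_ge0 => y' _; apply: ltW; exact: (svalP (Mex y')).1.
have Mpos : 0 <= M by apply: sumr_ge0 => y _; apply: ltW; exact: (svalP (Mex y)).1.
pose M1 := (1 + 2 * t%:R) * M.
have M10 : 0 <= M1 by rewrite mulr_ge0// addr_ge0// mulr_ge0.
pose nq : R := #|{: (I * 'I_t) * (I * 'I_t)}|%:R.
have nq0 : 0 <= nq by exact: ler0n.
(* Calibrated so that off-diagonal terms and kernel error together stay below 1/8; it depends on
   [M1] only. *)
pose ek := 1 / (8 * (nq * M1 + k%:R + 1)).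
have ek0 : 0 < ek by rewrite divr_gt0// mulr_gt0// ltr_wpDl// addr_ge0// mulr_ge0.
have [D [L0 [F [H [A [B [D0 sF sH off diagK]]]]]]] := kernel_polys k0 kt ek0.
pose L := (2 * L0)%N.
pose mm (q : I * 'I_t) : int := A q.2 + B (enum_rank q.1).
pose dl (q q' : I * 'I_t) : int := A q'.2 + B (enum_rank q'.1) - A q.2 - B (enum_rank q.1).
have dlE q q' : dl q q' = mm q' - mm q by rewrite /dl /mm opprD addrA.
pose Gp j j' (x : int) := F j * (H j' \Po (ee (x%:~R / D%:R) *: 'X)).
pose Pd : R := \sum_j \sum_j' pn (Gp j j' (A j' - A j)).
have Pd0 : 0 <= Pd by apply: sumr_ge0 => j _; apply: sumr_ge0 => j' _; exact: pn_ge0.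
have en0 : 0 < 1 / (8 * (k%:R * Pd + 1)) by rewrite divr_gt0// mulr_gt0// ltr_wpDl// mulr_ge0.
(* The order of choices matters: [M1] bounds all pairings whatever the accuracy, as the factor 1 +
   2t of [neumann] is independent of it. The polynomials can thus be fixed first and the accuracy of
   the duals chosen after their norms [Pd]. *)
have [e [e_le [psi2 [np2 E2 K2]]]] := neumann np np' E0 en0.
pose Bf (q q' : I * 'I_t) (l : 'rV[int]_m) := Vr (rho (z q.1) (psi q.2)) (rho (z q'.1) (psi2 q'.2)) (lat N l).
have bsB q q' : bs (fun l => nc (Bf q q' l)) M1.
 apply: bs_le (K2 (psi q.2) (z q'.1 - z q.1) M (np q.2) _ q'.2) => [l|j].
  by rewrite /Bf (nc_Vr2 _ _ _ (np _) (np2 _)).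
 exact: bs_mono (M0 (q.1, q'.1, (q.2, j))) (svalP (Mex (q.1, q'.1, (q.2, j)))).2.
pose Sm : R := \sum_(q : I * 'I_t) \sum_(q' : I * 'I_t) \sum_(n < L.+1) \sum_(n' < L.+1) nc (F q.2)`_n * nc (H q'.2)`_(L - n').
have Sm0 : 0 <= Sm by do 4 (apply: sumr_ge0 => ? _); rewrite mulr_ge0 ?nc_ge0.
pose e2 := 1 / (8 * (Sm + 1)).
have e20 : 0 < e2 by rewrite divr_gt0// mulr_gt0// ltr_wpDl.
have e24 : 0 < e2 / 4 by rewrite divr_gt0.
have tl (y : (I * 'I_t) * (I * 'I_t)) : {s : seq 'rV[int]_m | forall s', uniq s' -> \sum_(l <- s' | l \notin s) nc (Bf y.1 y.2 l) <= e2 / 4}.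
 by apply: cid; have [s _ Hs] := bs_tail (fun l => nc_ge0 _) (bsB y.1 y.2) e24; exists s.
(* The finitely many displacements that carry almost all of the pairings; only for them does the
   almost commutation have to hold. *)
pose Xi : seq 'rV[int]_m := flatten [seq sval (tl y) | y <- enum {: (I * 'I_t) * (I * 'I_t)}].
pose SX : R := \sum_(l <- Xi) l1 (map_mx intr l : 'rV[R]_m).
have SXl l : l \in Xi -> l1 (map_mx intr l : 'rV[R]_m) <= SX.
 move=> lX; rewrite /SX (big_rem l lX)/= lerDl; apply: sumr_ge0 => x _; exact: l1_ge0.
have SX0 : 0 <= SX by apply: sumr_ge0 => x _; exact: l1_ge0.
pose SM : R := \sum_(q : I * 'I_t) `|(mm q)%:~R|.
have SMl q : `|(mm q)%:~R| <= SM by rewrite /SM (bigD1 q)//= lerDl; apply: sumr_ge0.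
have SM0 : 0 <= SM by apply: sumr_ge0.
pose Qb : R := L%:R * (2 * SM) + (2 * L%:R + 2 * SM) * SX.
have Qb0 : 0 <= Qb by rewrite addr_ge0// ?mulr_ge0// addr_ge0// mulr_ge0.
pose e1 := e2 / (2 * (M1 + 1)).
have e10 : 0 < e1 by rewrite divr_gt0// mulr_gt0// ltr_wpDl.
pose eta := e1 / (4 * pi * (Qb + 1)).
have pp : 0 < pi :> R := pi_gt0 R.
have eta0 : 0 < eta by rewrite divr_gt0// !mulr_gt0// ltr_wpDl.
have [a [b [Ha Hb [w3 H3]]]] := near_central (fun s => symp (row s N) (row ix N)) (fun s => symp (row s N) (row iy N)) (- D%:R^-1) irr eta0.
pose mu0 := a%:~R *: row ix N; pose nu0 := b%:~R *: row iy N.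
(* Doubling compensates the halves in the phases e(symp/2): it is [mu0] and [nu0] that pair almost
   integrally with the lattice. It is also the origin of the factor 4 in the irrationality
   hypothesis. *)
pose km : 'rV[int]_m := (2 * a) *: delta_mx ord0 ix; pose kn : 'rV[int]_m := (2 * b) *: delta_mx ord0 iy.
have latd (c : int) s : lat N (c *: delta_mx ord0 s) = c%:~R *: row s N.
 rewrite /lat (_ : map_mx intr _ = c%:~R *: delta_mx ord0 s :> 'rV[R]_m).
  by rewrite -scalemxAl -rowE.
 by apply/rowP => j; rewrite !mxE intrM; case: (_ && _).
have latZ (c : int) (l : 'rV[int]_m) : lat N (c *: l) = c%:~R *: lat N l.
 rewrite /lat scalemxAl; congr (_ *m _); apply/rowP => j; rewrite !mxE intrM//.
have lkm : lat N km = 2 *: mu0 by rewrite /km latd intrM scalerA.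
have lkn : lat N kn = 2 *: nu0 by rewrite /kn latd intrM scalerA.
pose th := symp (lat N kn) (lat N km).
have thE : th = (a * b)%:~R * (4 * symp (row iy N) (row ix N)).
 by rewrite /th lkm lkn /mu0 /nu0 !sympZl !sympZr intrM; ring.
have near_mu l : exists w : int, `|symp (lat N l) mu0 - w%:~R| <= l1 (map_mx intr l : 'rV[R]_m) * eta.
 by apply: symp_near (ltW eta0) _ => s; rewrite /mu0 sympZr; exact: Ha.
have near_nu l : exists w : int, `|symp (lat N l) nu0 - w%:~R| <= l1 (map_mx intr l : 'rV[R]_m) * eta.
 by apply: symp_near (ltW eta0) _ => s; rewrite /nu0 sympZr; exact: Hb.
pose av (q : I * 'I_t) (n : nat) : 'rV[int]_m := (n%:Z) *: kn + mm q *: km.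
pose ph q q' (n n' : nat) (l : 'rV[int]_m) := ee (th * (n%:R + n'%:R) * ((mm q')%:~R - (mm q)%:~R) / 2) *
 ee (symp (lat N l) (lat N (av q n) + lat N (av q' n')) / 2).
(* Split th (n + n')/2 as th n' + th (n - n')/2. The first part is replaced by -n'/D, which will be
   absorbed in the variable of H; the second depends on n - n' only, as [poly_pair] asks. *)
pose ph0 q q' (n n' : nat) := ee (- (n'%:R * (dl q q')%:~R / D%:R)) * ee (th * (n%:Z - n'%:Z)%:~R * (dl q q')%:~R / 2).
have latav q n : lat N (av q n) = n%:R *: lat N kn + (mm q)%:~R *: lat N km.
 by rewrite /av latD !latZ.
have phase q q' (n n' : nat) l : l \in Xi -> (n <= L)%N -> (n' <= L)%N -> nc (ph q q' n n' l - ph0 q q' n n') <= e1.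
 move=> lX nL nL'; rewrite /ph /ph0 -!eD.
 have [w1 h1] := near_nu l; have [w2 h2] := near_mu l.
 rewrite -thE opprK in H3.
 have lS := SXl l lX; have l0 := l1_ge0 (map_mx intr l : 'rV[R]_m).
 set S := l1 _ in h1 h2 lS l0.
 have nR : n%:R <= L%:R :> R by rewrite ler_nat. have nR' : n'%:R <= L%:R :> R by rewrite ler_nat.
 pose dw : int := (n'%:Z * dl q q') * w3 + ((n + n')%:Z * w1 + (mm q + mm q') * w2).
 have -> : e1 = 4 * pi * (eta * (Qb + 1)).
  have nz : 4 * pi * (Qb + 1) != 0 by rewrite gt_eqF// !mulr_gt0// ltr_wpDl.
  by rewrite -[LHS](divfK nz) -/eta; ring.
 apply: (nc_ee_near (w := dw)).
 have -> : symp (lat N l) (lat N (av q n) + lat N (av q' n')) =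
   2 * ((n%:R + n'%:R) * symp (lat N l) nu0 + ((mm q)%:~R + (mm q')%:~R) * symp (lat N l) mu0).
  rewrite !latav lkn lkm !sympDr !sympZr; ring.
 move: h1 h2 H3; set s1 := symp _ _; set s2 := symp _ _ => h1 h2 h3.
 have -> : th * (n%:R + n'%:R) * ((mm q')%:~R - (mm q)%:~R) / 2 +
   2 * ((n%:R + n'%:R) * s1 + ((mm q)%:~R + (mm q')%:~R) * s2) / 2 -
   (- (n'%:R * (dl q q')%:~R / D%:R) + th * (n%:Z - n'%:Z)%:~R * (dl q q')%:~R / 2) - dw%:~R =
   n'%:R * (dl q q')%:~R * (th + D%:R^-1 - w3%:~R) + ((n%:R + n'%:R) * (s1 - w1%:~R) + ((mm q)%:~R + (mm q')%:~R) * (s2 - w2%:~R)).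
  have -> : dw%:~R = n'%:R * (dl q q')%:~R * w3%:~R + ((n%:R + n'%:R) * w1%:~R + ((mm q)%:~R + (mm q')%:~R) * w2%:~R) :> R.
   have gen (x u y1 y2 y3 a1 a2 a3 : int) : (x * y1 * a3 + (u * a1 + (y2 + y3) * a2))%:~R =
     x%:~R * y1%:~R * a3%:~R + (u%:~R * a1%:~R + (y2%:~R + y3%:~R) * a2%:~R) :> R.
    by rewrite !(intrD, intrM).
   by rewrite /dw gen -[(n'%:Z)%:~R]/(n'%:R : R) -[((n + n')%:Z)%:~R]/((n + n')%:R : R) natrD.
  rewrite [(n%:Z - n'%:Z)%:~R]intrB -[(n%:Z)%:~R]/(n%:R : R) -[(n'%:Z)%:~R]/(n'%:R : R).
  have -> : (dl q q')%:~R = (mm q')%:~R - (mm q)%:~R :> R by rewrite dlE intrB.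
  move: (mm q)%:~R (mm q')%:~R w1%:~R w2%:~R w3%:~R (n%:R : R) (n'%:R : R) => *.
  by field; rewrite pnatr_eq0 -lt0n.
 have dS : `|(dl q q')%:~R| <= 2 * SM.
  rewrite dlE intrB (le_trans (ler_normB _ _))// mulr2n mulrDl !mul1r lerD//.
 have mS : `|(mm q)%:~R + (mm q')%:~R| <= 2 * SM.
  by rewrite (le_trans (ler_normD _ _))// mulr2n mulrDl !mul1r lerD.
 have h1' : `|s1 - w1%:~R| <= SX * eta by rewrite (le_trans h1)// ler_wpM2r// ltW.
 have h2' : `|s2 - w2%:~R| <= SX * eta by rewrite (le_trans h2)// ler_wpM2r// ltW.
 rewrite (le_trans (ler_normD _ _))//.
 apply: (@le_trans _ _ (L%:R * (2 * SM) * eta + (2 * L%:R * (SX * eta) + 2 * SM * (SX * eta)))); last first.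
  rewrite /Qb; move: (ltW eta0); clear; move=> e0.
  rewrite mulrDr mulr1 (_ : eta * _ = L%:R * (2 * SM) * eta + (2 * L%:R * (SX * eta) + 2 * SM * (SX * eta))); last by ring.
  by rewrite lerDl.
 apply: lerD.
  rewrite normrM normrM; apply: ler_pM; rewrite ?mulr_ge0//.
  by apply: ler_pM; rewrite ?normr_ge0// ger0_norm.
 rewrite (le_trans (ler_normD _ _))//; apply: lerD; rewrite normrM; apply: ler_pM; rewrite ?normr_ge0//.
 by rewrite ger0_norm ?addr_ge0// mulr2n mulrDl !mul1r lerD.
have ncph q q' n n' l : nc (ph q q' n n' l) = 1 by rewrite /ph ncM !nc_e mulr1.
have ncph0 q q' n n' : nc (ph0 q q' n n') = 1 by rewrite /ph0 ncM !nc_e mulr1.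
(* The phase that makes the shift by [av q n] an ordered product of a power of U and a power of
   V. *)
pose cf q (n : nat) := ee (- (th * n%:R * (mm q)%:~R / 2)).
pose Q : finType := (I * 'I_t * 'I_L.+1)%type.
pose g := fun x : X => \sum_(y : Q) (F y.1.2)`_(y.2 : nat) * cf y.1 y.2 * rho (lat N (av y.1 y.2)) (rho (z y.1.1) (psi y.1.2)) x.
pose g' := fun x : X => \sum_(y : Q) (((H y.1.2)`_(L - y.2))^*)%C * cf y.1 y.2 * rho (lat N (av y.1 y.2)) (rho (z y.1.1) (psi2 y.1.2)) x.
have nt (y : Q) : nice (rho (lat N (av y.1 y.2)) (rho (z y.1.1) (psi y.1.2))).
 by apply: nice_rho; apply: nice_rho.
have nt' (y : Q) : nice (rho (lat N (av y.1 y.2)) (rho (z y.1.1) (psi2 y.1.2))).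
 by apply: nice_rho; apply: nice_rho.
have ng : nice g by apply: nice_sum => y; apply: niceZ.
have ng' : nice g' by apply: nice_sum => y; apply: niceZ.
pose xi q q' (n n' : nat) l : 'rV[int]_m := l + (av q' n' - av q n).
pose T l := Vr g g' (lat N l).
have TE l : T l = \sum_q \sum_q' \sum_(n < L.+1) \sum_(n' < L.+1)
  (F q.2)`_n * (H q'.2)`_(L - n') * (ph q q' n n' (xi q q' n n' l) * Bf q q' (xi q q' n n' l)).
 rewrite /T /Vr /g' rho_sum /g L2inner_sums//; last by move=> y; apply: nice_rho.
 rewrite (eq_bigr (fun y : Q => \sum_(y' : Q) (F y.1.2)`_(y.2 : nat) * (H y'.1.2)`_(L - y'.2) *
  (ph y.1 y'.1 y.2 y'.2 (xi y.1 y'.1 y.2 y'.2 l) * Bf y.1 y'.1 (xi y.1 y'.1 y.2 y'.2 l)))); last first.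
  move=> y _; apply: eq_bigr => y' _.
  have := weyl_pair (lat N kn) (lat N km) (lat N l) (y.2 : nat)%:R (mm y.1)%:~R (y'.2 : nat)%:R (mm y'.1)%:~R
   (nice_rho (z y.1.1) (np y.1.2)) (nice_rho (z y'.1.1) (np2 y'.1.2)).
  cbv zeta; rewrite -!latav -/th -(addrA (lat N l)) -latB -latD -/(xi y.1 y'.1 y.2 y'.2 l) => W.
  rewrite /ph /Bf -W cjM cjK.
  move: (L2inner _ _) (F _)`_ _ (H _)`_ _ => x1 x2 x3.
  rewrite -/(cf y.1 y.2) -/(cf y'.1 y'.2); move: (cf _ _) ((cf _ _)^*)%C => x4 x5; ring.
 rewrite -(pair_bigA _ (fun q (n : 'I_L.+1) => \sum_(y' : Q) (F q.2)`_n * (H y'.1.2)`_(L - y'.2) *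
  (ph q y'.1 n y'.2 (xi q y'.1 n y'.2 l) * Bf q y'.1 (xi q y'.1 n y'.2 l))))/=.
 apply: eq_bigr => q _.
 rewrite (eq_bigr (fun n : 'I_L.+1 => \sum_q' \sum_(n' < L.+1) (F q.2)`_n * (H q'.2)`_(L - n') *
  (ph q q' n n' (xi q q' n n' l) * Bf q q' (xi q q' n n' l)))); last first.
  move=> n _; rewrite -(pair_bigA _ (fun q' (n' : 'I_L.+1) => (F q.2)`_n * (H q'.2)`_(L - n') *
   (ph q q' n n' (xi q q' n n' l) * Bf q q' (xi q q' n n' l))))//=.
 by rewrite exchange_big.
pose T0 l := \sum_q \sum_q' \sum_(n < L.+1) \sum_(n' < L.+1)
  (F q.2)`_n * (H q'.2)`_(L - n') * (ph0 q q' n n' * Bf q q' (xi q q' n n' l)).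
(* Cost of idealising the phases: at most [e1] on [Xi], and at most 2 times a tail outside. *)
have bsA : bs (fun l => nc (T l - T0 l)) (1 / 8).
 pose bb q q' n n' l := nc (ph q q' n n' l - ph0 q q' n n') * nc (Bf q q' l).
 have bsbb q q' (n n' : 'I_L.+1) : bs (bb q q' n n') e2.
  move=> s us; rewrite (bigID (fun l => l \in Xi))/= (_ : e2 = e1 * M1 + (e1 + 2 * (e2 / 4))); last first.
   by rewrite /e1; field; rewrite gt_eqF// ltr_wpDl.
  apply: lerD.
   apply: (@le_trans _ _ (\sum_(l <- s | l \in Xi) e1 * nc (Bf q q' l))).
    by apply: ler_sum => l lX; rewrite ler_wpM2r ?nc_ge0// phase// -ltnS ltn_ord.
   rewrite -mulr_sumr ler_wpM2l ?(ltW e10)// -big_filter; apply: bsB; exact: filter_uniq.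
  rewrite -[leLHS]add0r lerD ?(ltW e10)//.
  apply: (@le_trans _ _ (\sum_(l <- s | l \notin sval (tl (q, q'))) 2 * nc (Bf q q' l))); last first.
   by rewrite -mulr_sumr ler_wpM2l//; exact: (svalP (tl (q, q'))).
  apply: (@le_trans _ _ (\sum_(l <- s | l \notin Xi) 2 * nc (Bf q q' l))).
   apply: ler_sum => l _; rewrite ler_wpM2r ?nc_ge0// (le_trans (ncBD _ _))// ncph ncph0//.
  rewrite [leLHS]big_mkcond [leRHS]big_mkcond; apply: ler_sum => l _.
  case: (boolP (l \in Xi)) => [lX|lX]/=; first by case: ifP => // _; rewrite mulr_ge0 ?nc_ge0.
  rewrite ifT//; apply: contra lX => lt; apply/flatten_mapP; exists (q, q') => //; rewrite mem_enum//.
 have : bs (fun l => \sum_(q : I * 'I_t) \sum_(q' : I * 'I_t) \sum_(n < L.+1) \sum_(n' < L.+1)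
   nc (F q.2)`_n * nc (H q'.2)`_(L - n') * bb q q' n n' (xi q q' n n' l)) (Sm * e2).
  rewrite /Sm mulr_suml; apply: bs_sum => q _; rewrite mulr_suml; apply: bs_sum => q' _.
  rewrite mulr_suml; apply: bs_sum => n _; rewrite mulr_suml; apply: bs_sum => n' _.
  apply: bsZ; first by rewrite mulr_ge0 ?nc_ge0.
  exact: (bs_inj (f := fun l => xi q q' n n' l) (addIr _) (bsbb q q' n n')).
 have SE : Sm * e2 <= 1 / 8.
  rewrite /e2 mulrA mulr1 ler_pdivrMr ?mulr_gt0 ?ltr_wpDl//; move: Sm0; clear; lra.
 move=> /(bs_mono SE); apply: bs_le => l; rewrite TE /T0.
 rewrite -sumrB (le_trans (nc_sum _ _ _))//; apply: ler_sum => q _.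
 rewrite -sumrB (le_trans (nc_sum _ _ _))//; apply: ler_sum => q' _.
 rewrite -sumrB (le_trans (nc_sum _ _ _))//; apply: ler_sum => n _.
 rewrite -sumrB (le_trans (nc_sum _ _ _))//; apply: ler_sum => n' _.
 by rewrite -mulrBr -mulrBl ncM (ncM (F _)`_ _) (ncM (_ - _)).
pose sh (x s : int) l : 'rV[int]_m := l + (- s *: kn + x *: km).
pose U q q' l := ee (- (L%:R * ((dl q q')%:~R / D%:R))) * \sum_(s < (2 * L).+1) (Gp q.2 q'.2 (dl q q'))`_s *
  (ee (th * ((s : nat)%:Z - L%:Z)%:~R * (dl q q')%:~R / 2) * Bf q q' (sh (dl q q') ((s : nat)%:Z - L%:Z) l)).
have sHc j' (c : R[i]) : (size (H j' \Po (c *: 'X)) <= L.+1)%N.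
 apply/leq_sizeP => s sL; rewrite comp_scaleX nth_default ?mul0r// (leq_trans (sH j'))//.
(* With ideal phases the double sum over n and n' collapses to the coefficients of F_j(X)
   H_j'(e(dl/D) X), the products estimated in [kernel_polys]. *)
have T0E l : T0 l = \sum_q \sum_q' U q q' l.
 rewrite /T0; apply: eq_bigr => q _; apply: eq_bigr => q' _; rewrite /U /Gp.
 rewrite -(poly_pair (fun r => ee (th * r%:~R * (dl q q')%:~R / 2) * Bf q q' (sh (dl q q') r l)) (sF q.2) (sHc _ _)).
 rewrite mulr_sumr; apply: eq_bigr => n _; rewrite mulr_sumr; apply: eq_bigr => n' _.
 have -> : xi q q' n n' l = sh (dl q q') (n%:Z - n'%:Z) l.
  rewrite /xi /sh /av dlE; congr (_ + _); rewrite opprB !scalerBl.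
  move: (_ *: kn) (_ *: kn) (_ *: km) (_ *: km) => v1 v2 v3 v4.
  by apply/rowP => i; rewrite !mxE; ring.
 rewrite comp_scaleX -eMn /ph0.
 have -> : ee (- (n'%:R * (dl q q')%:~R / D%:R)) = ee (- (L%:R * ((dl q q')%:~R / D%:R))) * ee ((L - n')%:R * ((dl q q')%:~R / D%:R)) :> R[i].
  have -> : (L - n')%:R = L%:R - n'%:R :> R by apply: natrB; rewrite -ltnS; exact: ltn_ord.
  by rewrite -eD; congr ee; move: (dl q q')%:~R (L%:R : R) (n'%:R : R) (D%:R^-1 : R); clear => *; ring.
 set x1 := ee _; set x2 := ee _; set x3 := ee _; move: (Bf _ _ _) (F _)`_ _ (H _)`_ _ => x4 x5 x6.
 by clearbody x1 x2 x3; ring.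
have sGp j j' x : (size (Gp j j' x) <= (2 * L).+1)%N.
 rewrite (leq_trans (size_polyMleq _ _))//; have := sF j; have := sHc j' (ee (x%:~R / D%:R)).
 by rewrite -/L; move: (size _) (size _) => x1 x2; clear; lia.
have bsU q q' : q.1 != q'.1 -> bs (fun l => nc (U q q' l)) (ek * M1).
 move=> qq; have oq := off (enum_rank q.1) (enum_rank q'.1) q.2 q'.2 (contra_neq (@enum_rank_inj _ _ _) qq).
 have : bs (fun l => \sum_(s < (2 * L).+1) nc (Gp q.2 q'.2 (dl q q'))`_s * nc (Bf q q' (sh (dl q q') ((s : nat)%:Z - L%:Z) l)))
   (pn (Gp q.2 q'.2 (dl q q')) * M1).
  rewrite (pn_wide (sGp _ _ _)) mulr_suml; apply: bs_sum => s _; apply: bsZ; first exact: nc_ge0.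
  exact: (bs_inj (f := fun l => sh (dl q q') ((s : nat)%:Z - L%:Z) l) (addIr _) (bsB q q')).
 move=> /(bs_mono (ler_wpM2r M10 oq)); apply: bs_le => l.
 rewrite /U ncM nc_e mul1r (le_trans (nc_sum _ _ _))//; apply: ler_sum => s _.
 by rewrite ncM (ncM (ee _)) nc_e mul1r.
pose Dd j j' l := \sum_(i : I) Bf (i, j) (i, j') l - k%:R * ((j == j') && (l == 0))%:R.
(* The sum over the points z_i keeps only the sublattice of multiples of p, where the improved duals
   are biorthogonal up to [e]. *)
have bsD j j' : bs (fun l => nc (Dd j j' l)) (k%:R * e).
 pose dvp (l : 'rV[int]_m) : 'rV[int]_m := \row_s (l ord0 s %/ p)%Z.
 pose div l := [forall s, (p %| (l : 'rV[int]_m) ord0 s)%Z].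
 have dvpK l : div l -> dvp l *+ p = l.
  move=> /forallP h; apply/rowP => s; rewrite mulmxnE mxE -mulr_natr.
  by rewrite natz; exact: divzK (h s).
 have dvp0 l : div l -> (dvp l == 0) = (l == 0).
  move=> dl0; apply/eqP/eqP => [h|->]; first by rewrite -(dvpK l dl0) h mul0rn.
  by apply/rowP => s; rewrite !mxE div0z.
 have DE l : nc (Dd j j' l) = if div l then k%:R * nc (err N p psi psi2 j (j', dvp l)) else 0.
  rewrite /Dd /Bf/= (diag_sum l uN p0 (np j) (np2 j')) -/(div l).
  case: ifP => dvl; last first.
   have -> : (l == 0) = false.
    apply/negbTE; apply: contraFneq dvl => ->; apply/forallP => s; rewrite mxE dvdz0//.
   by rewrite andbF !mulr0 mul0r subrr nc0.
  rewrite mulr1 kE -mulrBr ncM nc_nat; congr (_ * _).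
  rewrite /err/= lat_scale (dvpK l dvl) (dvp0 l dvl).
  have := nc_VrB N l (j == j')%:R (np j) (np2 j'); rewrite -natrM mulnb => ->//.
 move=> s us; under eq_bigr do rewrite DE; rewrite -big_mkcond/= -mulr_sumr ler_wpM2l// -big_filter.
 rewrite -(big_map (fun l => (j', dvp l)) xpredT (fun x => nc (err N p psi psi2 j x))); apply: E2.
 rewrite map_inj_in_uniq ?filter_uniq// => l1' l2'; rewrite !mem_filter => /andP[d1 _] /andP[d2 _] [h].
 by rewrite -(dvpK _ d1) -(dvpK _ d2) h.
pose ind s l : R[i] := ((sh 0 s l) == 0)%:R.
pose Rp := \sum_j F j * H j - 'X^L.
have sRp : (size Rp <= (2 * L).+1)%N.
 rewrite (leq_trans (size_polyD _ _))// geq_max size_polyN size_polyXn; apply/andP; split; last by clear; lia.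
 rewrite (leq_trans (size_sum _ _ _))//; apply/bigmax_leqP => j _.
 have := sGp j j 0; rewrite /Gp mul0r e0 scale1r comp_polyXr//.
(* Three errors: distinct points z_i, killed by the kernels; equal points with imperfect
   biorthogonality; and the defect of the sum of F_j H_j from X^L, whose middle coefficient produces
   k times the Kronecker symbol. *)
have T0D l : T0 l - k%:R * (l == 0)%:R = \sum_q \sum_(q' | q.1 != q'.1) U q q' l +
  (\sum_j \sum_j' ee (- (L%:R * ((A j' - A j)%:~R / D%:R))) * \sum_(s < (2 * L).+1) (Gp j j' (A j' - A j))`_s *
   (ee (th * ((s : nat)%:Z - L%:Z)%:~R * (A j' - A j)%:~R / 2) * Dd j j' (sh (A j' - A j) ((s : nat)%:Z - L%:Z) l)) +
  k%:R * \sum_(s < (2 * L).+1) Rp`_s * ind ((s : nat)%:Z - L%:Z) l).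
 have sD (I0 : finType) (f1 f2 : I0 -> R[i]) : \sum_i f1 i + \sum_i f2 i = \sum_i (f1 i + f2 i) by rewrite big_split.
 have UE j j' : \sum_(i : I) U (i, j) (i, j') l = ee (- (L%:R * ((A j' - A j)%:~R / D%:R))) *
   (\sum_(s < (2 * L).+1) (Gp j j' (A j' - A j))`_s *
   (ee (th * ((s : nat)%:Z - L%:Z)%:~R * (A j' - A j)%:~R / 2) * \sum_(i : I) Bf (i, j) (i, j') (sh (A j' - A j) ((s : nat)%:Z - L%:Z) l))).
  have dA i : dl (i, j) (i, j') = A j' - A j by rewrite /dl/=; move: (A j) (A j') (B _); clear => *; ring.
  rewrite /U (eq_bigr (fun i => ee (- (L%:R * ((A j' - A j)%:~R / D%:R))) * \sum_(s < (2 * L).+1) (Gp j j' (A j' - A j))`_s *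
   (ee (th * ((s : nat)%:Z - L%:Z)%:~R * (A j' - A j)%:~R / 2) * Bf (i, j) (i, j') (sh (A j' - A j) ((s : nat)%:Z - L%:Z) l)))); last first.
   by move=> i _; rewrite dA.
  rewrite -mulr_sumr exchange_big; congr (_ * _); apply: eq_bigr => s _.
  by rewrite -mulr_sumr -mulr_sumr.
 have diagE : \sum_q \sum_(q' | ~~ (q.1 != q'.1)) U q q' l = \sum_j \sum_j' \sum_(i : I) U (i, j) (i, j') l.
  rewrite -(pair_bigA _ (fun (i : I) (j : 'I_t) => \sum_(q' : I * 'I_t | ~~ (i != q'.1)) U (i, j) q' l))/= exchange_big.
  apply: eq_bigr => j _; rewrite [RHS]exchange_big; apply: eq_bigr => i _.
  rewrite big_mkcond -(pair_bigA _ (fun (i' : I) (j' : 'I_t) => if ~~ (i != i') then U (i, j) (i', j') l else 0))/=.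
  rewrite (bigD1 i)//= [X in _ + X]big1 ?addr0 => [|i' ii']; first by apply: eq_bigr => j' _; rewrite eqxx.
  by rewrite big1// => j' _; rewrite eq_sym ii'.
 rewrite T0E (eq_bigr (fun q => \sum_(q' | q.1 != q'.1) U q q' l + \sum_(q' | ~~ (q.1 != q'.1)) U q q' l)); last first.
  by move=> q _; rewrite (bigID (fun q' : I * 'I_t => q.1 != q'.1)).
 rewrite big_split/= diagE -addrA; congr (_ + _).
 pose W j j' := ee (- (L%:R * ((A j' - A j)%:~R / D%:R))) * \sum_(s < (2 * L).+1) (Gp j j' (A j' - A j))`_s *
   (ee (th * ((s : nat)%:Z - L%:Z)%:~R * (A j' - A j)%:~R / 2) * (k%:R * ((j == j') && (sh (A j' - A j) ((s : nat)%:Z - L%:Z) l == 0))%:R)).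
 rewrite (eq_bigr (fun j => \sum_j' ee (- (L%:R * ((A j' - A j)%:~R / D%:R))) * \sum_(s < (2 * L).+1) (Gp j j' (A j' - A j))`_s *
   (ee (th * ((s : nat)%:Z - L%:Z)%:~R * (A j' - A j)%:~R / 2) * Dd j j' (sh (A j' - A j) ((s : nat)%:Z - L%:Z) l)) + \sum_j' W j j')); last first.
  move=> j _; rewrite sD; apply: eq_bigr => j' _.
  rewrite UE /W -mulrDr sD; congr (_ * _); apply: eq_bigr => s _.
  by rewrite -mulrDr -mulrDr /Dd subrK.
 rewrite big_split/= -addrA; congr (_ + _).
 have WE j : \sum_j' W j j' = k%:R * \sum_(s < (2 * L).+1) (F j * H j)`_s * ind ((s : nat)%:Z - L%:Z) l.
  rewrite (bigD1 j)//= [X in _ + X]big1 ?addr0 => [|j' jj']; last first.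
   by rewrite /W big1 ?mulr0// => s _; rewrite eq_sym (negbTE jj') !mulr0.
  have z0 : (0%:~R : R) / D%:R = 0 by rewrite mul0r.
  rewrite /W subrr /Gp z0 mulr0 oppr0 e0 mul1r scale1r comp_polyXr mulr_sumr; apply: eq_bigr => s _.
  by rewrite mulr0 mul0r e0 mul1r eqxx /= mulrCA.
 rewrite (eq_bigr _ (fun j _ => WE j)) -mulr_sumr -mulrBr; congr (_ * _).
 have -> : \sum_(s < (2 * L).+1) Rp`_s * ind ((s : nat)%:Z - L%:Z) l =
   \sum_(s < (2 * L).+1) \sum_j (F j * H j)`_s * ind ((s : nat)%:Z - L%:Z) l - \sum_(s < (2 * L).+1) ('X^L)`_s * ind ((s : nat)%:Z - L%:Z) l.
  rewrite -sumrB; apply: eq_bigr => s _; rewrite /Rp coefB coef_sum mulrBl mulr_suml//.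
 rewrite exchange_big; congr (_ - _).
 have lt : (L < (2 * L).+1)%N by clear; lia.
 rewrite (bigD1 (Ordinal lt))//= coefXn eqxx mul1r big1 ?addr0 => [|s sn]; last first.
  by rewrite coefXn -[_ == _]/(s == Ordinal lt) (negbTE sn) mul0r.
 by rewrite /ind /sh subrr oppr0 !scale0r !addr0.
exists g => //; apply: (riesz_of_dual uN ng ng' (lt_le_trans ltr01 kR)).
have bnd l : nc (V g g' (lat N l) - (k%:R * (l == 0)%:R)%:C%C) <= nc (T l - T0 l) + ((\sum_q \sum_(q' | q.1 != q'.1) nc (U q q' l)) +
  ((\sum_j \sum_j' \sum_(s < (2 * L).+1) nc (Gp j j' (A j' - A j))`_s * nc (Dd j j' (sh (A j' - A j) ((s : nat)%:Z - L%:Z) l))) +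
  k%:R * \sum_(s < (2 * L).+1) nc Rp`_s * (sh 0 ((s : nat)%:Z - L%:Z) l == 0)%:R)).
 rewrite rcM !rc_nat (nc_VrB N l _ ng ng') -/(T l).
 have -> : T l - k%:R * (l == 0)%:R = (T l - T0 l) + (T0 l - k%:R * (l == 0)%:R) by rewrite addrA subrK.
 apply: (le_trans (ncD _ _)); apply: lerD; first exact: lexx.
 rewrite T0D.
 rewrite (le_trans (ncD _ _))// lerD//.
  by rewrite (le_trans (nc_sum _ _ _))//; apply: ler_sum => q _; exact: nc_sum.
 rewrite (le_trans (ncD _ _))// lerD//.
  rewrite (le_trans (nc_sum _ _ _))//; apply: ler_sum => j _; rewrite (le_trans (nc_sum _ _ _))//; apply: ler_sum => j' _.
  rewrite ncM nc_e mul1r (le_trans (nc_sum _ _ _))//; apply: ler_sum => s _.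
  by rewrite ncM (ncM (ee _)) nc_e mul1r.
 rewrite ncM nc_nat ler_wpM2l// (le_trans (nc_sum _ _ _))//; apply: ler_sum => s _.
 by rewrite ncM /ind nc_nat.
apply: (bs_le bnd).
(* The errors total at most 3/8, below the k/2 required by [riesz_of_dual], since k >= 1. *)
apply: (@bs_mono _ _ _ (1 / 8 + (nq * (ek * M1) + (Pd * (k%:R * e) + k%:R * ek)))).
 have b1 : nq * (ek * M1) + k%:R * ek <= 1 / 8.
  rewrite (_ : _ + _ = (nq * M1 + k%:R) * ek); last by ring.
  have x0 : 0 <= nq * M1 + k%:R by rewrite addr_ge0// mulr_ge0.
  rewrite /ek mulrA mulr1 ler_pdivrMr ?mulr_gt0 ?ltr_wpDl//; move: x0; clear; lra.
 have b2 : Pd * (k%:R * e) <= 1 / 8.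
  have x0 : 0 <= k%:R * Pd by rewrite mulr_ge0.
  rewrite mulrA [Pd * _]mulrC (le_trans (ler_wpM2l x0 e_le))// mulrA mulr1 ler_pdivrMr ?mulr_gt0 ?ltr_wpDl//.
  by move: x0; clear; lra.
 by move: b1 b2 kR; clear; lra.
apply: bs_D => //; apply: bs_D.
 have : bs (fun l => \sum_q \sum_(q' | q.1 != q'.1) nc (U q q' l)) (\sum_(q : I * 'I_t) \sum_(q' : I * 'I_t | q.1 != q'.1) ek * M1).
  by apply: bs_sum => q _; apply: bs_sum => q' qq; exact: bsU.
 apply: bs_mono; have x0 : 0 <= ek * M1 by rewrite mulr_ge0// ltW.
 apply: (@le_trans _ _ (\sum_(q : I * 'I_t) \sum_(q' : I * 'I_t) ek * M1)).
  apply: ler_sum => q _; rewrite [leRHS](bigID (fun q' : I * 'I_t => q.1 != q'.1))/= lerDl; exact: sumr_ge0.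
 by rewrite pair_bigA/= sumr_const -[leLHS]mulr_natl.
apply: bs_D.
 rewrite /Pd mulr_suml; apply: bs_sum => j _; rewrite mulr_suml; apply: bs_sum => j' _.
 rewrite (pn_wide (sGp _ _ _)) mulr_suml; apply: bs_sum => s _; apply: bsZ; first exact: nc_ge0.
 exact: (bs_inj (f := fun l => sh (A j' - A j) ((s : nat)%:Z - L%:Z) l) (addIr _) (bsD j j')).
apply: bsZ => //; apply: (bs_mono diagK); rewrite (pn_wide sRp) -[X in bs _ X]mulr1 mulr_suml; apply: bs_sum => s _.
apply: bsZ; first exact: nc_ge0.
apply: (bs_inj (f := fun l => sh 0 ((s : nat)%:Z - L%:Z) l) (b := fun l => (l == 0)%:R) (addIr _)).
move=> r ur; have [r0|r0] := boolP (0 \in r).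
 by rewrite (bigD1_seq 0)//= eqxx big1 ?addr0// => x /negbTE ->.
by rewrite big1_seq// => x /andP[_ xr]; case: eqP r0 => // <-; rewrite xr.
Qed.

End irrational.

(** * Avoiding all degenerate parameters by counting *)

Section generic.
Context {R : realType}.

Lemma rowsub_inj_free (F : fieldType) p q n (M : 'M[F]_(p, q)) (h : 'I_n -> 'I_p) :
 injective h -> row_free M -> row_free (rowsub h M).
Proof.
move=> hi /row_freeP[M' MM']; apply/row_freeP; exists (M' *m (rowsub h 1%:M)^T).
rewrite mulmxA [rowsub h M]rowsubE -(mulmxA _ M) MM' mulmx1 -rowsubE.
by apply/matrixP => i j; rewrite !mxE (inj_eq hi) eq_sym.
Qed.

Lemma rank_minor (F : fieldType) p q n (M : 'M[F]_(p, q)) : (n <= \rank M)%N ->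
 exists (s : 'I_n -> 'I_p) (t : 'I_n -> 'I_q), \det (\matrix_(i, j) M (s i) (t j)) != 0.
Proof.
move=> nM; pose s (i : 'I_n) := maxrankfun M (widen_ord nM i).
have si : injective s by move=> i j /maxrankfun_inj /(congr1 val)/= /val_inj.
have f1 : row_free (rowsub s M).
 have -> : rowsub s M = rowsub (widen_ord nM) (rowsub (maxrankfun M) M) by apply/matrixP => i j; rewrite !mxE.
 apply: rowsub_inj_free (maxrowsub_free M) => i j /(congr1 val)/= /val_inj//.
have f2 : row_full (rowsub s M)^T by rewrite /row_full mxrank_tr.
exists s, (fullrankfun f2); have := mxrank_fullrowsub f2.
set M2 := rowsub _ _ => r2; have : M2 \in unitmx by rewrite -row_free_unit /row_free r2.
rewrite unitmxE unitfE -det_tr; suff -> : M2^T = \matrix_(i, j) M (s i) (fullrankfun f2 j) by [].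
by apply/matrixP => i j; rewrite !mxE.
Qed.

Lemma nc_sign n : nc ((-1) ^+ n : R[i]) = 1.
Proof. by rewrite ncX ncN nc1 expr1n. Qed.
Lemma det_bound n (M : 'M[R[i]]_n) K : 0 <= K -> (forall i j, nc (M i j) <= K) -> nc (\det M) <= n`!%:R * K ^+ n.
Proof.
move=> K0 MK; rewrite /determinant (le_trans (nc_sum _ _ _))//.
have -> : n`!%:R * K ^+ n = \sum_(s : 'S_n) K ^+ n.
 by rewrite sumr_const card_Sn -[RHS]mulr_natl.
apply: ler_sum => s _; rewrite ncM nc_sign mul1r nc_prod -[X in K ^+ X]card_ord -prodr_const.
by apply: ler_prod => i _; rewrite nc_ge0 MK.
Qed.

Lemma det_lip n (M M' : 'M[R[i]]_n) K e : 1 <= K -> (forall i j, nc (M i j) <= K) -> (forall i j, nc (M' i j) <= K) ->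
 (forall i j, nc (M i j - M' i j) <= e) -> nc (\det M - \det M') <= n`!%:R * (n%:R * K ^+ n) * e.
Proof.
move=> K1 MK MK' MM; rewrite /determinant -sumrB (le_trans (nc_sum _ _ _))//.
have -> : n`!%:R * (n%:R * K ^+ n) * e = \sum_(s : 'S_n) n%:R * K ^+ n * e.
 by rewrite sumr_const card_Sn -[RHS]mulr_natl !mulrA.
apply: ler_sum => s _; rewrite -mulrBr ncM nc_sign mul1r.
exact: nc_prodB.
Qed.

(** Cramer's rule, with each cofactor bounded entrywise. *)
Lemma solve_bound n (M : 'M[R[i]]_n) (K d1 : R) (x : 'rV[R[i]]_n) r : 0 <= K -> (forall i j, nc (M i j) <= K) ->
 0 < d1 -> d1 <= nc (\det M) -> (forall i, nc ((x *m M) ord0 i) <= r) ->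
 forall j, nc (x ord0 j) <= n%:R * (n.-1`!%:R * K ^+ n.-1) / d1 * r.
Proof.
move=> K0 MK d10 dM xM j.
have r0 : 0 <= r by exact: le_trans (nc_ge0 _) (xM j).
have E : \det M * x ord0 j = \sum_i (x *m M) ord0 i * (\adj M) i j.
 have := congr1 (fun y : 'rV[R[i]]_n => y ord0 j) (mulmxA x M (\adj M)).
 by rewrite mul_mx_adj mul_mx_scalar [LHS]mxE => ->; rewrite mxE.
have h : nc (\det M) * nc (x ord0 j) <= n%:R * (n.-1`!%:R * K ^+ n.-1) * r.
 rewrite -ncM E (le_trans (nc_sum _ _ _))//.
 have -> : n%:R * (n.-1`!%:R * K ^+ n.-1) * r = \sum_(i < n) r * (n.-1`!%:R * K ^+ n.-1).
  by rewrite sumr_const card_ord -[RHS]mulr_natl; ring.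
 apply: ler_sum => i _; rewrite ncM ler_pM ?nc_ge0// mxE /cofactor ncM nc_sign mul1r.
 by apply: det_bound => // a b; rewrite !mxE.
rewrite mulrAC ler_pdivlMr// (le_trans _ h)// mulrC ler_wpM2r ?nc_ge0//.
Qed.

Lemma l1_lip_continuous e (f : 'rV[R]_e -> R) C : 0 <= C -> (forall x y, `|f x - f y| <= C * l1 (x - y)) -> continuous f.
Proof.
move=> C0 H x; have FF : Filter (nbhs x) by exact: nbhs_filter.
apply/(@cvgrPdist_le _ _ _ (nbhs x) FF) => eps e0.
have C1 : 0 < eps / (C * e%:R + 1) by rewrite divr_gt0// ltr_wpDl// mulr_ge0.
have nr i : \forall y \near x, `|x ord0 i - (y : 'rV[R]_e) ord0 i| <= eps / (C * e%:R + 1).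
 by have /cvgrPdist_le := @coord_continuous R 1 e ord0 i x; apply.
have : \forall y \near x, forall i, `|x ord0 i - (y : 'rV[R]_e) ord0 i| <= eps / (C * e%:R + 1).
 exact: (@filter_forall _ _ _ _ FF nr).
apply: filterS => y hy; rewrite (le_trans (H x y))//.
apply: (@le_trans _ _ (C * (e%:R * (eps / (C * e%:R + 1))))).
 rewrite ler_wpM2l// /l1 (le_trans (ler_sum _ (_ : forall i, _ -> _ <= eps / (C * e%:R + 1))))//.
  by move=> i _; rewrite !mxE.
 by rewrite sumr_const card_ord -[leLHS]mulr_natl.
rewrite (_ : C * _ = C * e%:R / (C * e%:R + 1) * eps); last by ring.
rewrite ler_piMl ?(ltW e0)// ler_pdivrMr ?mul1r ?lerDl//.
by rewrite ltr_wpDl// mulr_ge0.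
Qed.

(** The sum of the moduli of all n by n minors is continuous and positive, hence bounded below on
    the compact box; the largest minor is at least the average. *)
Lemma minors_lower e n nw nb (A : finType) (Rm : A -> 'rV[R]_e -> 'M[R[i]]_(nw, nb)) (K : R) : 1 <= K ->
 (forall a x w b, nc (Rm a x w b) <= K) ->
 (forall a x y w b, nc (Rm a x w b - Rm a y w b) <= K * l1 (x - y)) ->
 (forall a x, (n <= \rank (Rm a x))%N) ->
 exists2 d1 : R, 0 < d1 & forall a (x : 'rV[R]_e), (forall i, `|x ord0 i| <= 1) ->
  exists (s : 'I_n -> 'I_nw) (t : 'I_n -> 'I_nb), d1 <= nc (\det (\matrix_(i, j) Rm a x (s i) (t j))).
Proof.
move=> K1 bR lR rR; have K0 : 0 <= K := le_trans ler01 K1.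
pose S := ({ffun 'I_n -> 'I_nw} * {ffun 'I_n -> 'I_nb})%type.
pose mn a x (st : S) := nc (\det (\matrix_(i, j) Rm a x (st.1 i) (st.2 j))).
pose f a x := \sum_(st : S) mn a x st.
have f0 a x : 0 < f a x.
 have [s [t st]] := rank_minor (rR a x).
 rewrite /f (bigD1 ([ffun i => s i], [ffun i => t i]))//= ltr_pwDl//; last by apply: sumr_ge0 => ? _; exact: nc_ge0.
 rewrite /mn nc_gt0; suff -> : \matrix_(i, j) Rm a x ([ffun i => s i] i) ([ffun i => t i] j) = \matrix_(i, j) Rm a x (s i) (t j) by [].
 by apply/matrixP => i j; rewrite !mxE !ffunE.
pose C := #|{: S}|%:R * (n`!%:R * (n%:R * K ^+ n) * K).
have C0 : 0 <= C by rewrite !mulr_ge0// exprn_ge0.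
have cf a : continuous (f a).
 apply: (@l1_lip_continuous _ _ C) => // x y; rewrite /f -sumrB (le_trans (ler_norm_sum _ _ _))//.
 have -> : C * l1 (x - y) = \sum_(st : S) n`!%:R * (n%:R * K ^+ n) * (K * l1 (x - y)).
  by rewrite sumr_const -[RHS]mulr_natl /C; ring.
 apply: ler_sum => st _; rewrite /mn; set M1 := \matrix_(i, j) _; set M2 := \matrix_(i, j) _.
 apply: (@le_trans _ _ (nc (\det M1 - \det M2))).
  rewrite ler_norml; apply/andP; split; last exact: nc_sub.
  by rewrite lerNl opprB ncB; exact: nc_sub.
 by apply: det_lip => // i j; rewrite !mxE.
have box_c : compact [set x : 'rV[R]_e | forall i, `[-1, 1]%classic (x ord0 i)].
 exact: (@rV_compact R e (fun=> `[-1, 1]%classic) (fun i => @segment_compact R (-1) 1)).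
have box0 : [set x : 'rV[R]_e | forall i, `[-1, 1]%classic (x ord0 i)] !=set0.
 by exists 0 => i; rewrite /= mxE in_itv/=; apply/andP; split; lra.
have mina a : {da : R | 0 < da /\ forall x : 'rV[R]_e, (forall i, `|x ord0 i| <= 1) -> da <= f a x}.
 apply: cid; have [c _ Hc] := EVT_min_rV box0 box_c (continuous_subspaceT (cf a)).
 exists (f a c); split; first exact: f0.
 by move=> x hx; apply: Hc; rewrite inE/= => i; rewrite in_itv/= -ler_norml.
have [dm dm0 Hdm] : exists2 dm : R, 0 < dm & forall a, dm <= sval (mina a).
 exists (\big[Num.min/1]_(a : A) sval (mina a)).
  by elim/big_ind: _ => // [x y x0 y0|a _]; [rewrite lt_min x0|exact: (svalP (mina a)).1].
 by move=> a; rewrite (bigD1 a)//= ge_min lexx.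
have S1 : 0 < #|{: S}|%:R + 1 :> R by rewrite ltr_wpDl.
exists (dm / (#|{: S}|%:R + 1)); first by rewrite divr_gt0.
move=> a x hx; apply: contrapT => H.
have : f a x <= \sum_(st : S) dm / (#|{: S}|%:R + 1).
 apply: ler_sum => st _; rewrite leNgt; apply/negP => h; apply: H.
 by exists st.1, st.2; exact: ltW.
rewrite sumr_const -[leRHS]mulr_natl mulrCA; have := le_trans (Hdm a) ((svalP (mina a)).2 x hx).
move=> h1 h2; have := le_trans h1 h2; rewrite leNgt => /negP; apply.
by rewrite gtr_pMr// ltr_pdivrMr// mul1r ltrDl.
Qed.

(** Take coefficients on a grid with [Kn] values for each real and imaginary part. At one parameter,
    the coefficients giving only small combinations form at most a fraction (C/Kn)^(2n) of the grid,
    as an invertible minor determines n of them up to C grid steps. A net of parameters has about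
    Kn^e points, and e < 2n leaves a coefficient vector good for all of them; the Lipschitz bound
    extends this from the net to the box. *)
Theorem generic e n nw nb (A : finType) (Rm : A -> 'rV[R]_e -> 'M[R[i]]_(nw, nb)) (K : R) : (e < 2 * n)%N -> 1 <= K ->
 (forall a x w b, nc (Rm a x w b) <= K) ->
 (forall a x y w b, nc (Rm a x w b - Rm a y w b) <= K * l1 (x - y)) ->
 (forall a x, (n <= \rank (Rm a x))%N) ->
 exists (c : 'I_nw -> R[i]) (dl : R), 0 < dl /\ forall a (x : 'rV[R]_e), (forall i, `|x ord0 i| <= 1) ->
  exists b, dl <= nc (\sum_w c w * Rm a x w b).
Proof.
move=> en K1 bR lR rR; have K0 : 0 <= K := le_trans ler01 K1.
have [d1 d10 Hd] := minors_lower K1 bR lR rR.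
(* The first term, divided by [Kn], is the variation of a combination between a parameter and its
   grid point; the extra 1 is the margin that remains as final lower bound 1/Kn. *)
pose ro : R := 2 * nw%:R * K * e%:R + 1.
have ro0 : 0 <= ro by rewrite addr_ge0// !mulr_ge0.
pose Cc : R := n%:R * (n.-1`!%:R * K ^+ n.-1) / d1 * (2 * ro).
have Cc0 : 0 <= Cc by rewrite !mulr_ge0 ?invr_ge0 ?(ltW d10)// exprn_ge0.
pose C := (Num.truncn Cc).+1.
have CC : Cc < C%:R by exact: truncnS_gt.
(* Just above #|A| 3^e C^(2n), so that the bad vectors, counted over all grid points, cannot exhaust
   the grid; 3^e comes from 2 Kn + 1 <= 3 Kn. *)
pose Kn := (#|A| * 3 ^ e * C ^ (2 * n)).+1.
have KnR : 0 < Kn%:R :> R by rewrite ltr0n.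
pose W := ('I_nw * bool)%type.
pose cc (f : {ffun W -> 'I_Kn}) (w : 'I_nw) : R[i] := ((f (w, false) : nat)%:R / Kn%:R +i* ((f (w, true) : nat)%:R / Kn%:R))%C.
pose xx (k : {ffun 'I_e -> 'I_(2 * Kn).+1}) : 'rV[R]_e := \row_i (((k i : nat)%:R - Kn%:R) / Kn%:R).
pose bad a k : pred {ffun W -> 'I_Kn} := [pred f | [forall b, nc (\sum_w cc f w * Rm a (xx k) w b) <= ro / Kn%:R]].
have xx1 k i : `|xx k ord0 i| <= 1.
 rewrite mxE normrM (@ger0_norm _ Kn%:R^-1) ?invr_ge0 ?(ltW KnR)// ler_pdivrMr// mul1r.
 rewrite ler_norml; apply/andP; split; first by rewrite lerBrDr addNr.
 by rewrite lerBlDr -natrD ler_nat addnn -mul2n -ltnS.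
have card_bad a k : (#|bad a k| * Kn ^ (2 * n) <= Kn ^ (2 * nw) * C ^ (2 * n))%N.
 have [s [t st]] := Hd a (xx k) (xx1 k).
 have si : injective s.
  move=> i j sij; apply/eqP; case: (boolP (i == j)) => // ij.
  have d0 : \det (\matrix_(i, j) Rm a (xx k) (s i) (t j)) = 0.
   by apply: (determinant_alternate ij) => l; rewrite !mxE sij.
  by move: st; rewrite d0 nc0 leNgt d10.
 pose sI := finset.imset s (mem 'I_n).
 have csI : #|sI| = n by rewrite card_imset// card_ord.
 pose D : pred W := [pred x | x.1 \notin sI].
 have cD : (#|D| + 2 * n = 2 * nw)%N.
  have -> : #|D| = #|[predX [predC sI] & predT : pred bool]| by apply: eq_card => -[w b]; rewrite !inE andbT.
  have := cardC (mem sI); rewrite card_ord csI.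
  have -> : #|[predC (mem sI)]| = #|[predC sI]| by apply: eq_card.
  by rewrite cardX card_bool; move: #|[predC _]|; clear; lia.
 (* Keep the coefficients off the rows of the minor and record the others modulo C. Two bad vectors
    with the same code differ by fewer than C steps in each remaining coordinate, hence agree. *)
 pose enc (f : {ffun W -> 'I_Kn}) : {ffun W -> 'I_Kn} * {ffun 'I_n * bool -> 'I_C} :=
  ([ffun x => if x.1 \in sI then ord0 else f x], [ffun x => inord (f (s x.1, x.2) %% C)]).
 have enc_inj : {in bad a k &, injective enc}.
  move=> f f'; rewrite !inE => /forallP hf /forallP hf' [/ffunP E1 /ffunP E2].
  pose x : 'rV[R[i]]_n := \row_j (cc f (s j) - cc f' (s j)).
  have bx0 j : nc (x ord0 j) <= Cc / Kn%:R.
   have := @solve_bound n (\matrix_(i, j) Rm a (xx k) (s i) (t j)) K d1 x (2 * (ro / Kn%:R)) K0 _ d10 st.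
   have -> : Cc / Kn%:R = n%:R * (n.-1`!%:R * K ^+ n.-1) / d1 * (2 * (ro / Kn%:R)) by rewrite /Cc; ring.
   move=> H; apply: H.
    by move=> i j'; rewrite mxE.
   move=> i; rewrite mxE.
   have -> : \sum_j0 x ord0 j0 * (\matrix_(i0, j1) Rm a (xx k) (s i0) (t j1)) j0 i =
     \sum_w cc f w * Rm a (xx k) w (t i) - \sum_w cc f' w * Rm a (xx k) w (t i).
    rewrite -sumrB [RHS](bigID (fun w => w \in sI))/= [X in _ = _ + X]big1 ?addr0 => [|w wn]; last first.
     suff -> : cc f w = cc f' w by rewrite subrr.
     by have := E1 (w, false); have := E1 (w, true); rewrite !ffunE/= (negbTE wn) /cc => -> ->.
    rewrite big_imset/=; last by move=> ? ? _ _; exact: si.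
    by apply: eq_bigr => j0 _; rewrite !mxE mulrBl.
   rewrite (le_trans (ncBD _ _))// mulr2n mulrDl !mul1r lerD//.
  have near (u v : nat) j : `|u%:R / Kn%:R - v%:R / Kn%:R| <= nc (x ord0 j) -> (u %% C = v %% C)%N -> u = v.
   move=> h E; have h1 : `|u%:R - v%:R| < C%:R :> R.
    apply: le_lt_trans CC; rewrite -(ler_pM2r (_ : 0 < Kn%:R^-1)) ?invr_gt0// (le_trans _ (bx0 j))// (le_trans _ h)//.
    by rewrite -mulrBl normrM (@ger0_norm _ Kn%:R^-1) ?invr_ge0 ?(ltW KnR).
   have sym (u' v' : nat) : `|u'%:R - v'%:R| < C%:R :> R -> (u' %% C = v' %% C)%N -> (u' <= v')%N -> u' = v'.
    move=> h2 E' le; apply/eqP; rewrite eqn_leq le/= -subn_eq0 -leqn0 leqNgt; apply/negP => pos.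
    have : (C %| v' - u')%N by rewrite -eqn_mod_dvd//; apply/eqP.
    move=> /(dvdn_leq pos); rewrite leqNgt -(ltr_nat R) natrB//; apply/negP; rewrite negbK.
    by apply: le_lt_trans h2; rewrite distrC ler_norm.
   have [le|/ltnW le] := leqP u v; first exact: sym.
   by apply/esym; apply: sym => //; rewrite distrC.
  apply/ffunP => -[w b]; have [wS|wS] := boolP (w \in sI); last first.
   by have := E1 (w, b); rewrite !ffunE/= (negbTE wS).
  have /imsetP[j _ ->] := wS; apply/val_inj; apply: (near _ _ j).
   rewrite mxE /cc; case: b; [apply: le_trans (Im_le_nc _)|apply: le_trans (Re_le_nc _)]; exact: lexx.
  have := congr1 val (E2 (j, b)); rewrite !ffunE/= !inordK ?ltn_pmod//.
 have -> : #|bad a k| = #|fintype.image_mem enc (mem (bad a k))| by rewrite card_in_image.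
 have : (#|fintype.image_mem enc (mem (bad a k))| <= #|[predX (pffun_on ord0 D (mem 'I_Kn)) & (predT : pred {ffun 'I_n * bool -> 'I_C})]|)%N.
  apply: subset_leq_card; apply/fintype.subsetP => _ /fintype.imageP[f _ ->]; rewrite !inE andbT.
  apply/pffun_onP; split=> //; apply/fintype.subsetP => y; rewrite !inE ffunE.
  by case: ifP => // _; rewrite eqxx.
 rewrite cardX card_pffun_on card_ffun card_prod card_bool !card_ord -cD expnD => h.
 by rewrite mulnAC leq_mul2r [(2 * n)%N]mulnC h orbT.
have [f Hf] : exists f, forall a k, ~~ bad a k f.
 apply: contrapT => H.
 have ex f : {ak : A * {ffun 'I_e -> 'I_(2 * Kn).+1} | bad ak.1 ak.2 f}.
  apply: cid; apply: contrapT => h; apply: H; exists f => a k; apply/negP => hb; apply: h; by exists (a, k).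
 have c1 : (Kn ^ (2 * nw) <= \sum_(ak : A * {ffun 'I_e -> 'I_(2 * Kn).+1}) #|bad ak.1 ak.2|)%N.
  have -> : (Kn ^ (2 * nw) = \sum_(f : {ffun W -> 'I_Kn}) 1)%N.
   by rewrite sum1_card card_ffun card_prod card_bool !card_ord mulnC.
  apply: (@leq_trans (\sum_(f : {ffun W -> 'I_Kn}) \sum_(ak : A * {ffun 'I_e -> 'I_(2 * Kn).+1}) bad ak.1 ak.2 f)).
   by apply: leq_sum => f _; rewrite (bigD1 (sval (ex f)))//= (svalP (ex f)).
  rewrite exchange_big; apply: leq_sum => ak _; rewrite -sum1_card [leqRHS]big_mkcond/=.
  by apply: leq_sum => f _; rewrite -topredE/=; case: (bad _ _ _).
 have c2 : (Kn ^ (2 * nw) * Kn ^ (2 * n) <= #|A| * (2 * Kn).+1 ^ e * (Kn ^ (2 * nw) * C ^ (2 * n)))%N.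
  apply: (leq_trans (leq_mul c1 (leqnn _))); rewrite big_distrl/=.
  apply: (@leq_trans (\sum_(ak : A * {ffun 'I_e -> 'I_(2 * Kn).+1}) Kn ^ (2 * nw) * C ^ (2 * n))%N).
   by apply: leq_sum => ak _; exact: card_bad.
  by rewrite sum_nat_const card_prod card_ffun !card_ord.
 have K1' : (0 < Kn ^ (2 * nw))%N by rewrite expn_gt0.
 rewrite mulnCA leq_pmul2l// in c2.
 have c3 : ((2 * Kn).+1 ^ e <= 3 ^ e * Kn ^ (2 * n).-1)%N.
  have K3 : ((2 * Kn).+1 <= 3 * Kn)%N by have : (0 < Kn)%N by []; move: (Kn); clear; lia.
  apply: (@leq_trans ((3 * Kn) ^ e)).
   by elim: (e) => [|e' IH]; rewrite ?expn0// !expnS leq_mul.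
  by rewrite expnMn leq_mul2l leq_pexp2l ?orbT// -ltnS prednK// (leq_trans _ en).
 have c4 : (Kn ^ (2 * n) <= Kn.-1 * Kn ^ (2 * n).-1)%N.
  apply: (leq_trans c2); rewrite /Kn [(_.+1).-1]/= -/Kn.
  rewrite -!mulnA leq_mul2l; apply/orP; right; rewrite mulnC [leqRHS]mulnCA leq_mul2l.
  by rewrite c3 orbT.
 move: c4; rewrite -{1}(prednK (_ : 0 < 2 * n)%N) ?(leq_trans _ en)// expnS leq_pmul2r ?expn_gt0//.
 by rewrite /Kn/= ltnn.
exists (cc f), Kn%:R^-1; split; first by rewrite invr_gt0.
move=> a x hx.
have tx i : 0 <= (x ord0 i + 1) * Kn%:R <= 2 * Kn%:R.
 have := hx i; rewrite ler_norml => /andP[h1 h2]; rewrite mulr_ge0 ?(ltW KnR) ?ler_pM2r//=; lra.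
have tlt i : (Num.truncn ((x ord0 i + 1) * Kn%:R) < (2 * Kn).+1)%N.
 have /andP[h1 h2] := tx i; rewrite ltnS -(ler_nat R) natrM (le_trans _ h2)//.
 by have /andP[] := truncn_itv h1.
pose k : {ffun 'I_e -> 'I_(2 * Kn).+1} := [ffun i => Ordinal (tlt i)].
have lx : l1 (xx k - x) <= e%:R / Kn%:R.
 have -> : e%:R / Kn%:R = \sum_(i < e) Kn%:R^-1 :> R by rewrite sumr_const card_ord -[RHS]mulr_natl.
 apply: ler_sum => i _; rewrite !mxE ffunE /=.
 have /andP[h1 h2] := tx i; have /andP[h3 h4] := truncn_itv h1.
 have nK (v : R) : `|v| * Kn%:R = `|v * Kn%:R| by rewrite normrM (ger0_norm (ltW KnR)).
 rewrite -(ler_pM2r KnR) mulVf ?gt_eqF// nK mulrBl divfK ?gt_eqF//.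
 move: h3 h4; rewrite -natr1 mulrDl mul1r; clear => h3 h4.
 by rewrite ler_norml; apply/andP; split; lra.
have := Hf a k; rewrite negb_forall => /existsP[b]; rewrite -ltNge => hb; exists b.
set S := \sum_w _; set S' := \sum_w _ in hb.
have dS : nc (S' - S) <= 2 * nw%:R * K * e%:R / Kn%:R.
 rewrite /S /S' -sumrB (le_trans (nc_sum _ _ _))//.
 have -> : 2 * nw%:R * K * e%:R / Kn%:R = \sum_(w < nw) 2 * (K * (e%:R / Kn%:R)).
  by rewrite sumr_const card_ord -[RHS]mulr_natl; ring.
 apply: ler_sum => w _; rewrite -mulrBr ncM ler_pM ?nc_ge0//; last first.
  by rewrite (le_trans (lR _ _ _ _ _))// ler_wpM2l.
 rewrite /cc (le_trans (nc_le_ReIm _))//= -[2]/(1 + 1) lerD// ger0_norm ?divr_ge0 ?(ltW KnR)//;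
  by rewrite ler_pdivrMr// mul1r ler_nat ltnW.
have h : nc S' - nc S <= nc (S' - S) := nc_sub _ _.
have hro : ro / Kn%:R = 2 * nw%:R * K * e%:R / Kn%:R + Kn%:R^-1 by rewrite /ro mulrDl mul1r.
by move: hb dS h; rewrite hro; clear; move: (nc _) (nc _) (nc _) => u1 u2 u3; lra.
Qed.

End generic.

(** * Maximal isotropic sublattices and the index *)

Section isotropic.
Context {R : realType} (d : nat).
Local Notation m := (d + d)%N.
Implicit Types (N B : 'M[R]_m).

Definition iso N n (C : 'M[int]_(n, m)) := forall i j, symp (lat N (row i C)) (lat N (row j C)) \is a Num.int.

Lemma symp_suml I (r : seq I) (F : I -> 'rV[R]_m) z : symp (\sum_(i <- r) F i) z = \sum_(i <- r) symp (F i) z.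
Proof. by elim/big_rec2: _ => [|i x y _ <-]; rewrite ?symp0l ?sympDl. Qed.
Lemma symp_sumr I (r : seq I) (F : I -> 'rV[R]_m) z : symp z (\sum_(i <- r) F i) = \sum_(i <- r) symp z (F i).
Proof. by rewrite symp_anti symp_suml -sumrN; apply: eq_bigr => i _; rewrite -symp_anti. Qed.
Lemma lat_sum N (k : 'rV[int]_m) : lat N k = \sum_i (k ord0 i)%:~R *: row i N.
Proof. by rewrite /lat mulmx_sum_row; apply: eq_bigr => i _; rewrite mxE. Qed.
Lemma symp_sumE N (k l : 'rV[int]_m) : symp (lat N k) (lat N l) =
 \sum_i \sum_j (k ord0 i)%:~R * (l ord0 j)%:~R * symp (row i N) (row j N).
Proof.
rewrite !lat_sum symp_suml; apply: eq_bigr => i _.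
by rewrite sympZl symp_sumr mulr_sumr; apply: eq_bigr => j _; rewrite sympZr mulrA.
Qed.

Lemma iso_int N n (C : 'M[int]_(n, m)) (u v : 'rV[int]_n) : iso N C ->
 symp (lat N (u *m C)) (lat N (v *m C)) \is a Num.int.
Proof.
move=> H; have E (w : 'rV[int]_n) : lat N (w *m C) = \sum_i (w ord0 i)%:~R *: lat N (row i C).
 rewrite /lat map_mxM -mulmxA mulmx_sum_row; apply: eq_bigr => i _.
 by rewrite mxE row_mul map_row.
rewrite !E symp_suml rpred_sum// => i _; rewrite sympZl rpredM ?intr_int//.
by rewrite symp_sumr rpred_sum// => j _; rewrite sympZr rpredM ?intr_int.
Qed.

(** Smith normal form gives a basis [C'] of the lattice generated by [C] and [k]; the index of [C]
    in it exceeds 1, since [k] is not in [C]. *)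
Lemma isotropic_extend N (C : 'M[int]_m) (k : 'rV[int]_m) : \det C != 0 -> iso N C ->
 (forall i, symp (lat N k) (lat N (row i C)) \is a Num.int) -> ~ (exists l, k = l *m C) ->
 exists C' : 'M[int]_m, [/\ \det C' != 0, iso N C' & (`|\det C'| < `|\det C|)%N].
Proof.
move=> dC iC ik nk; pose A0 : 'M[int]_(m + 1, m) := col_mx C k.
have rk : row ord0 k = k by apply/rowP => j; rewrite mxE.
have iA : iso N A0.
 have s0 z : symp z z = 0 :> R by rewrite symp_beta subrr.
 move=> i j; rewrite /A0; case: (split_ordP i) => i' ->; case: (split_ordP j) => j' ->;
  rewrite ?rowKu ?rowKd ?(ord1 i') ?(ord1 j') ?rk.
 - exact: iC.
 - by rewrite symp_anti rpredN.
 - exact: ik.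
 - by rewrite s0.
have [L uL [Q uQ [s _ AE]]] := int_Smith_normal_form A0.
set Dg := \matrix_(i, j) _ in AE.
pose C' : 'M[int]_m := usubmx (Dg *m Q).
have Dd : dsubmx (Dg *m Q) = 0.
 rewrite -mul_dsub_mx (_ : dsubmx Dg = 0) ?mul0mx//; apply/matrixP => i j; rewrite !mxE/=.
 by rewrite (ord1 i) addn0 (gtn_eqF (ltn_ord j)).
have AL : A0 = lsubmx L *m C'.
 by rewrite AE -mulmxA -{1}(hsubmxK L) -(vsubmxK (Dg *m Q)) Dd mul_row_col mulmx0 addr0.
pose Xu := usubmx (lsubmx L); pose xd := dsubmx (lsubmx L).
have CE : C = Xu *m C' by rewrite /Xu mul_usub_mx -AL col_mxKu.
have kE : k = xd *m C' by rewrite /xd mul_dsub_mx -AL col_mxKd.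
have dE : \det C = \det Xu * \det C' by rewrite CE det_mulmx.
have dX0 : \det Xu != 0 by apply: contra dC => /eqP h; rewrite dE h mul0r.
have dC0 : \det C' != 0 by apply: contra dC => /eqP h; rewrite dE h mulr0.
exists C'; split=> //.
 have rE i : row i C' = row (lshift 1 i) (invmx L) *m A0.
  rewrite -row_mul AE -!mulmxA mulKmx// /C'; move: (Dg *m Q) => Z; by apply/rowP => a; rewrite !mxE.
 by move=> i j; rewrite !rE; exact: iso_int.
rewrite dE abszM ltn_Pmull ?absz_gt0//; rewrite ltn_neqAle absz_gt0 dX0 andbT eq_sym.
apply/negP => /eqP d1; apply: nk; exists (xd *m invmx Xu).
have uX : Xu \in unitmx by rewrite unitmxE qualifE/=; move: d1; clear; move: (\det Xu) => x; lia.
by rewrite CE mulmxA mulmxKV.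
Qed.

(** The sublattice q Z^(2d) is isotropic; each extension lowers the absolute determinant, so
    extensions terminate. *)
Lemma max_isotropic N (q : nat) : (0 < q)%N -> (forall i j, q%:R * symp (row i N) (row j N) \is a Num.int) ->
 exists C : 'M[int]_m, [/\ \det C != 0, iso N C &
  forall k, (forall i, symp (lat N k) (lat N (row i C)) \is a Num.int) -> exists l, k = l *m C].
Proof.
move=> q0 Hq.
have P n (C : 'M[int]_m) : (absz (\det C) <= n)%N -> \det C != 0 -> iso N C -> exists C : 'M[int]_m, [/\ \det C != 0, iso N C &
  forall k, (forall i, symp (lat N k) (lat N (row i C)) \is a Num.int) -> exists l, k = l *m C].
 elim: n C => [|n IH] C Cn dC iC; first by move: dC; rewrite -absz_gt0 ltnNge Cn.
 have [H|] := pselect (forall k, (forall i, symp (lat N k) (lat N (row i C)) \is a Num.int) -> exists l, k = l *m C).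
  by exists C.
 move=> /existsNP[k /not_implyP[ik nk]]; have [C' [d' i' lt]] := isotropic_extend dC iC ik nk.
 by apply: (IH C') => //; rewrite -ltnS (leq_trans lt).
have dq : \det ((q%:Z)%:M : 'M[int]_m) != 0 by rewrite det_scalar expf_neq0// -lt0n.
apply: (P _ _ (leqnn _) dq) => i j.
have E l : lat N (row l ((q%:Z)%:M : 'M[int]_m)) = q%:R *: row l N.
 rewrite /lat (_ : map_mx intr _ = q%:R *: delta_mx ord0 l :> 'rV[R]_m); last first.
  by apply/rowP => a; rewrite !mxE eqxx/= [a == l]eq_sym; case: (l == a); rewrite ?mulr1 ?mulr0.
 by rewrite -scalemxAl -rowE.
by rewrite !E sympZl sympZr mulrCA; apply: rpredM => //; rewrite natr_int.
Qed.

Lemma adj_coords B (z : 'rV[R]_m) : B \in unitmx -> (\row_j symp (row j B) z) *m adj B = z.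
Proof.
move=> uB; have -> : \row_j symp (row j B) z = z *m (sJ d)^T *m B^T.
 have -> : z *m (sJ d)^T *m B^T = (B *m sJ d *m z^T)^T by rewrite !trmx_mul trmxK mulmxA.
 by apply/rowP => j; rewrite mxE [RHS]mxE sympE -row_mul -row_mul mxE.
rewrite /adj -!mulmxA (mulmxA B^T) -trmx_mul mulVmx// trmx1 mul1mx sJ_trl mulmx1//.
Qed.

(** The isotropic lattice B lies in its own adjoint with index |det B|^2. Every vector of the
    lattice of [N] pairs integrally with B, hence lies in the adjoint of B; two such vectors
    congruent modulo B differ by an element pairing integrally with the whole lattice. So the index
    of the radical is at most |det B|^2. *)
Lemma nindex_le N (C : 'M[int]_m) : N \in unitmx -> \det C != 0 -> iso (adj N) C ->
 (nindex (range (lat N)) <= (`|\det (map_mx intr C *m adj N)|)%:E)%E.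
Proof.
move=> uN dC iC; pose B := map_mx intr C *m adj N.
have uC : map_mx intr C \in @unitmx R m by rewrite unitmxE det_map_mx unitfE intr_eq0.
have uB : B \in unitmx by rewrite unitmx_mul uC adj_unit.
have latBE l : lat B l = lat (adj N) (l *m C) by rewrite /B /lat map_mxM mulmxA.
have rB i : row i B = lat (adj N) (row i C) by rewrite /B row_mul /lat map_row.
have Sint i j : symp (row i B) (row j B) \is a Num.int by rewrite !rB.
pose A : 'M[int]_m := \matrix_(i, j) Num.floor (symp (row j B) (row i B)).
have AE : B = map_mx intr A *m adj B.
 apply/row_matrixP => i; rewrite row_mul -[LHS](adj_coords _ uB); congr (_ *m _).
 by apply/rowP => j; rewrite !mxE floorK.
have dA : (absz (\det A))%:R = `|\det B| ^+ 2 :> R.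
 have := congr1 determinant AE; rewrite (det_mulmx (map_mx intr A)) (det_map_mx _ A) => E.
 have nB : `|\det B| != 0 by rewrite normr_eq0 -unitfE -unitmxE.
 have E2 := congr1 Num.norm E; rewrite normrM (det_adj uB) -intr_norm -abszE in E2.
 by rewrite expr2 {2}E2 mulrCA mulfV// mulr1.
have dA0 : \det A != 0.
 rewrite -absz_gt0 -(ltr_nat R) dA exprn_gt0// normr_gt0 -unitfE -unitmxE//.
have [x [_ [_ xcov]]] := @lattice_reps R _ A dA0.
have key g : range (lat N) g -> exists i, exists l, g = lat (adj B) (x i) + lat B l.
 move=> [k _ <-].
 have [k' k'E] : exists k' : 'rV[int]_m, lat N k = lat (adj B) k'.
  exists (\row_j Num.floor (symp (row j B) (lat N k))); rewrite -[LHS](adj_coords _ uB) /lat; congr (_ *m _).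
  apply/rowP => j; rewrite !mxE floorK// symp_anti rpredN rB /lat symp_adj// mxE rpred_sum// => a _.
  by rewrite !mxE rpredM ?intr_int.
 have [i [l E]] := xcov k'; exists i, l; rewrite k'E E latD; congr (_ + _).
 by rewrite /lat map_mxM -mulmxA -AE.
pose Cs := cosets (range (lat N)) (symp_dual (range (lat N))).
pose idx (c : set 'rV[R]_m) (i : 'I_(absz (\det A))) := exists g, [/\ range (lat N) g,
  c = [set g + h | h in symp_dual (range (lat N))] & exists l, g = lat (adj B) (x i) + lat B l].
have idx_ex c : Cs c -> exists i, idx c i.
 by move=> [g Gg <-]; have [i [l E]] := key g Gg; exists i, g; split=> //; exists l.
have idx_inj c c' i : idx c i -> idx c' i -> c = c'.
 move=> [g [[k _ <-] -> [l E]]] [g' [[k' _ <-] -> [l' E']]].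
 have D : symp_dual (range (lat N)) (lat N k - lat N k').
  split; first by exists (k - k') => //; rewrite latB.
  move=> _ [a _ <-]; rewrite E E' opprD addrACA subrr add0r -latB latBE.
  by rewrite symp_anti rpredN /lat symp_adj// mxE rpred_sum// => b _; rewrite !mxE rpredM ?intr_int.
 have sub (u v : 'rV[R]_m) : symp_dual (range (lat N)) (u - v) -> [set u + h | h in symp_dual (range (lat N))] `<=` [set v + h | h in symp_dual (range (lat N))].
  move=> [[a _ aE] Huv] _ [h [[b _ bE] Hh] <-]; exists (u - v + h); last by rewrite addrA [v + _]addrC subrK.
  split; first by exists (a + b) => //; rewrite latD aE bE.
  by move=> g0 Gg0; rewrite sympDl rpredD ?Huv ?Hh.
 apply/seteqP; split; apply: sub => //.
 case: D => [[a _ aE] Ha]; split; first by exists (- a) => //; rewrite latN aE opprB.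
 by move=> g0 Gg0; rewrite -opprB sympNl rpredN; exact: Ha.
have fin : finite_set Cs.
 pose F (i : 'I_(absz (\det A))) : set 'rV[R]_m := xget set0 [set c | idx c i].
 apply: (@sub_finite_set _ _ (F @` [set: 'I_(absz (\det A))])); last exact: finite_image.
 move=> c /idx_ex[i ci]; exists i => //; rewrite /F; case: xgetP => [c' _ ci'|/(_ c)//].
 exact: idx_inj ci' ci.
rewrite /nindex -/Cs asboolT// lee_fin -(ger0_norm (normr_ge0 (\det B))) -sqrtr_sqr ler_wsqrtr//.
rewrite -dA ler_nat.
have ix (c : fset_set Cs) : {i | idx (val c) i}.
 by apply: cid; apply: idx_ex; have := valP c; rewrite in_fset_set// => /set_mem.
rewrite cardfE -[leqRHS]card_ord; apply: (@leq_card _ _ (fun c : fset_set Cs => sval (ix c))) => c c' E.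
apply/val_inj; have := svalP (ix c); rewrite E => h; exact: idx_inj h (svalP (ix c')).
Qed.

End isotropic.

(** * Brackets over the dual torus of an isotropic lattice *)

Section brackets.
Context {R : realType} (d : nat).
Local Notation m := (d + d)%N.
Local Notation X := 'rV[R]_d.

Definition hsum (T : eqType) (F : T -> R[i]) : R[i] := xget 0 [set S | hs F S].

Lemma hsumP (T : eqType) (F : T -> R[i]) M : bs (fun i => nc (F i)) M -> hs F (hsum F).
Proof. by move=> /hs_ex[S HS]; rewrite /hsum; case: xgetP => // /(_ S). Qed.
Lemma hsumE (T : eqType) (F : T -> R[i]) S : hs F S -> hsum F = S.
Proof.
move=> H; rewrite /hsum; case: xgetP => [S' _ H'|/(_ S)//]; exact: hs_unique H' H.
Qed.

Variable B : 'M[R]_m.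
Hypotheses (uB : B \in unitmx) (iB : forall i j, symp (row i B) (row j B) \is a Num.int).

(** The strictly upper triangular half of the symplectic form on B: integer valued, and the form is
    its antisymmetrisation, see [symp_up]. *)
Definition up (l k : 'rV[int]_m) : R := \sum_(i < m) \sum_(j < m | (i < j)%N) (l ord0 i)%:~R * (k ord0 j)%:~R * symp (row i B) (row j B).

Lemma up_int l k : up l k \is a Num.int.
Proof. by do 2 (apply: rpred_sum => ? _); rewrite !rpredM ?intr_int. Qed.
Lemma upD l k : up (l + k) (l + k) = up l l + up l k + up k l + up k k.
Proof.
rewrite /up -!big_split; apply: eq_bigr => i _; rewrite -!big_split; apply: eq_bigr => j _ /=.
by rewrite !mxE !intrD; ring.
Qed.

Lemma symp_up l k : symp (lat B l) (lat B k) = up l k - up k l.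
Proof.
rewrite symp_sumE /up.
pose F (i j : 'I_m) := (l ord0 i)%:~R * (k ord0 j)%:~R * symp (row i B) (row j B).
have E1 i : \sum_(j < m) F i j = \sum_(j < m | (i < j)%N) F i j + \sum_(j < m | (j < i)%N) F i j.
 rewrite (bigID (fun j : 'I_m => (i < j)%N))/=; congr (_ + _).
 rewrite (bigD1 i)/= ?ltnn// {1}/F symp_beta subrr mulr0 add0r; apply: eq_bigl => j.
 by rewrite -leqNgt [RHS]ltn_neqAle andbC.
rewrite (eq_bigr _ (fun i _ => E1 i)) big_split/=; congr (_ + _).
rewrite -sumrN (exchange_big_dep predT)//=; apply: eq_bigr => i _; rewrite -sumrN; apply: eq_bigr => j _.
by rewrite /F symp_anti; ring.
Qed.

(** On an isotropic lattice the shifts [rho] commute but compose up to signs; the phase removes the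
    signs, giving a true representation of Z^(2d), see [ptM]. *)
Definition pt (l : 'rV[int]_m) (f : X -> R[i]) : X -> R[i] := fun x => ee (up l l / 2) * rho (lat B l) f x.

Lemma nice_pt l f : nice f -> nice (pt l f).
Proof. by move=> nf0; apply: niceZ; exact: nice_rho. Qed.
Lemma rhoZ z c (f : X -> R[i]) : rho z (fun x => c * f x) = fun x => c * rho z f x.
Proof. by apply/funext => x; rewrite /rho tfZ mulrCA. Qed.
Lemma ptM l k f : pt l (pt k f) = pt (l + k) f.
Proof.
rewrite /pt rhoZ rho_comp; apply/funext => x; rewrite -latD; move: (rho _ f x) => w.
rewrite !mulrA -!eD; congr (_ * w).
have -> : up (l + k) (l + k) / 2 = up l l / 2 + up k k / 2 + - (symp (lat B l) (lat B k) / 2) + up l k.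
 by rewrite upD symp_up; field.
by rewrite [RHS]eD (e_Num_int (up_int l k)) mulr1.
Qed.

Lemma L2_rho z (f g : X -> R[i]) : nice f -> nice g -> L2inner (rho z f) (rho z g) = L2inner f g.
Proof.
move=> nf0 ng; rewrite Vr_cov// subrr (VrE _ nf0 ng) /V tf0 beta0r mul0r e0 mul1r.
by rewrite symp_anti symp0l oppr0 mul0r oppr0 e0 mul1r.
Qed.

Lemma L2_pt l (f g : X -> R[i]) : nice f -> nice g -> L2inner (pt l f) (pt l g) = L2inner f g.
Proof.
move=> nf0 ng; rewrite /pt L2innerZl; [|exact: nice_rho|by apply: niceZ; exact: nice_rho].
rewrite L2innerZr; [|exact: nice_rho|exact: nice_rho].
by rewrite L2_rho// mulrA mul_conj nc_e expr1n mul1r.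
Qed.

Definition cf (x y : X -> R[i]) (l : 'rV[int]_m) := L2inner x (pt l y).

Lemma cf_pt l k x y : nice x -> nice y -> L2inner (pt l x) (pt k y) = cf x y (k - l).
Proof. by move=> nx ny; rewrite /cf -(L2_pt l nx (nice_pt _ ny)) ptM addrC subrK. Qed.
Lemma cfE x y l : nice x -> nice y -> cf x y l = ((ee (up l l / 2))^*)%C * Vr x y (lat B l).
Proof. by move=> nx ny; rewrite /cf /pt L2innerZr//; exact: nice_rho. Qed.
Lemma nc_cf x y l : nice x -> nice y -> nc (cf x y l) = nc (V x y (lat B l)).
Proof. by move=> nx ny; rewrite cfE// ncM nc_conj nc_e mul1r nc_Vr. Qed.
Lemma nc_cfB x y (l : 'rV[int]_m) c : nice x -> nice y -> nc (cf x y l - c * (l == 0)%:R) = nc (V x y (lat B l) - c * (l == 0)%:R).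
Proof.
move=> nx ny; have [->|l0] := eqVneq l 0; last by rewrite !mulr0 !subr0 nc_cf.
suff -> : cf x y 0 = V x y (lat B 0) by [].
rewrite cfE// VrE// lat0 beta0r mul0r e0 mul1r.
have -> : up 0 0 = 0 by rewrite /up big1// => i _; rewrite big1// => j _; rewrite mxE mul0r mul0r.
by rewrite mul0r e0 conjc1 mul1r.
Qed.

Lemma bs_cf x y : nice x -> nice y -> exists2 M, 0 < M &
 bs (fun l => nc (cf x y l) * (1 + l1 (map_mx intr l : 'rV[R]_m))) M.
Proof.
move=> nx ny; have [C C0 HC] := V_decay (2 * m).+1 nx ny.
have [c c0 [eta eta0 low]] := lat_lower uB.
have nm00 : nm (B - B) <= eta.
 by rewrite subrr /nm big1 ?ltW// => i _; rewrite big1// => j _; rewrite mxE normr0.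
have l1p (z : 'rV[R]_m) : 0 < 1 + l1 z by rewrite ltr_wpDr// l1_ge0.
pose F (z : 'rV[R]_m) : R[i] := V x y z * (1 + l1 z)%:C%C.
have FC z : nc (F z) <= C * ((1 + l1 z) ^+ (2 * m))^-1.
 rewrite /F ncM nc_real (gtr0_norm (l1p z)) (le_trans (ler_wpM2r (ltW (l1p z)) (HC z)))//.
 by rewrite exprS invfM -mulrA [_^-1 * _]mulrC !mulrA divfK ?gt_eqF.
pose K := C * (1 + c^-1) ^+ (2 * m) * 2 ^+ m.
have K0 : 0 <= K by rewrite !mulr_ge0// ?exprn_ge0 ?addr_ge0 ?invr_ge0 ?(ltW c0).
have ci0 : 0 < c^-1 by rewrite invr_gt0.
exists ((1 + c^-1) * (K * 2 ^+ m) + 1); first by rewrite ltr_wpDl// !mulr_ge0// ?exprn_ge0// addr_ge0// ltW.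
apply: (@bs_mono _ _ _ ((1 + c^-1) * (K * 2 ^+ m))); first by rewrite lerDl.
have := bsZ (addr_ge0 ler01 (ltW ci0)) (bsZ K0 (@bs_wt R m)); apply: bs_le => l.
have h := bs_decay c0 (fun k => low B nm00 _) C0 FC l.
rewrite nc_cf// (le_trans _ (ler_wpM2l _ h)) ?addr_ge0 ?(ltW ci0)//.
rewrite /F ncM nc_real (gtr0_norm (l1p _)) mulrCA ler_wpM2l ?nc_ge0//.
rewrite mulrDl mul1r -addrA lerD2l; have hl := low B nm00 (map_mx intr l).
rewrite -(ler_pM2l c0) (le_trans hl)// mulrDr mulrA mulfV ?gt_eqF// mul1r.
by rewrite addrA lerDr addr_ge0// mulr_ge0 ?l1_ge0// ltW.
Qed.

Definition dt (l : 'rV[int]_m) (y : 'rV[R]_m) : R := \sum_i (l ord0 i)%:~R * y ord0 i.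

Lemma dtD l y y' : dt l (y + y') = dt l y + dt l y'.
Proof. by rewrite /dt -big_split; apply: eq_bigr => i _; rewrite mxE mulrDr. Qed.
Lemma dtDl l k y : dt (l + k) y = dt l y + dt k y.
Proof. by rewrite /dt -big_split; apply: eq_bigr => i _; rewrite mxE intrD mulrDl. Qed.
(** The Fourier series of the Gram coefficients along B. It turns shifts by B into multiplication by
    characters ([br_shift]), and joint conjugation by any [rho z] into a translation of the torus
    ([br_char]). *)
Definition br x y (t : 'rV[R]_m) := hsum (fun l => cf x y l * ee (dt l t)).

Lemma bs_cf0 x y : nice x -> nice y -> exists2 M, 0 < M & bs (fun l => nc (cf x y l)) M.
Proof.
move=> nx ny; have [M M0 bM] := bs_cf nx ny; exists M => //; apply: bs_le bM => l.
by rewrite ler_peMr ?nc_ge0// lerDl l1_ge0.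
Qed.

Lemma br_hs x y t : nice x -> nice y -> hs (fun l => cf x y l * ee (dt l t)) (br x y t).
Proof.
move=> nx ny; have [M M0 bM] := bs_cf0 nx ny; apply: (@hsumP _ _ M); apply: bs_le bM => l.
by rewrite ncM nc_e mulr1.
Qed.

Lemma br_bounds x y : nice x -> nice y -> exists2 M, 0 < M & (forall t, nc (br x y t) <= M) /\
 (forall t t', nc (br x y t - br x y t') <= M * l1 (t - t')).
Proof.
move=> nx ny; have [M M0 bM] := bs_cf nx ny.
have p1 : 0 < 4 * pi :> R by rewrite mulr_gt0 ?pi_gt0.
exists (M + 4 * pi * M); first by rewrite addr_gt0// mulr_gt0.
split=> [t|t t'].
 apply: (@le_trans _ _ M); last by rewrite lerDl ltW// mulr_gt0.
 apply: hs_bound (br_hs t nx ny) _; apply: bs_le bM => l.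
 by rewrite ncM nc_e mulr1 ler_peMr ?nc_ge0// lerDl l1_ge0.
have h := hsD (br_hs t nx ny) (hsZ (-1) (br_hs t' nx ny)).
rewrite -[- br x y t']mulN1r (le_trans (_ : _ <= 4 * pi * l1 (t - t') * M))//; last first.
 rewrite (_ : (M + 4 * pi * M) * _ = M * l1 (t - t') + 4 * pi * l1 (t - t') * M); last by ring.
 by rewrite lerDr mulr_ge0 ?l1_ge0// ltW.
apply: hs_bound h _.
have c0 : 0 <= 4 * pi * l1 (t - t') by rewrite mulr_ge0 ?l1_ge0// ltW.
apply: bs_le (bsZ c0 bM) => l.
have -> : cf x y l * ee (dt l t) + -1 * (cf x y l * ee (dt l t')) = cf x y l * (ee (dt l t) - ee (dt l t')) by ring.
rewrite ncM mulrCA ler_wpM2l ?nc_ge0// (le_trans (nc_eB _ _))// -!mulrA ler_wpM2l// ler_wpM2l ?pi_ge0//.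
have -> : dt l t - dt l t' = dt l (t - t').
 by rewrite dtD; congr (_ + _); rewrite /dt -sumrN; apply: eq_bigr => i _; rewrite mxE mulrN.
rewrite /dt (le_trans (ler_norm_sum _ _ _))//.
apply: (@le_trans _ _ (\sum_i l1 (map_mx intr l : 'rV[R]_m) * `|(t - t') ord0 i|)).
 apply: ler_sum => i _; rewrite normrM ler_wpM2r//.
 by rewrite (le_trans _ (l1_le _ i))// mxE.
by rewrite -mulr_sumr -/(l1 _) mulrC ler_wpM2l ?l1_ge0// lerDr.
Qed.

Lemma br_shift l0 x y t : nice x -> nice y -> br (pt l0 x) y t = ee (dt l0 t) * br x y t.
Proof.
move=> nx ny; apply: hsumE.
have := hsZ (ee (dt l0 t)) (br_hs t nx ny).
move=> /(hs_bij (f := fun l => l - l0) (g := fun l => l + l0) _ _ (addrNK l0) (addrK l0)).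
have key l : cf (pt l0 x) y l = cf x y (l - l0) by exact: cf_pt.
apply: hs_ext => l; rewrite (key l) mulrCA -eD -dtDl (_ : l0 + (l - l0) = l); last by rewrite addrC subrK.
reflexivity.
Qed.

Lemma br_char z x y t : nice x -> nice y -> br (rho z x) (rho z y) t = br x y (t + \row_i symp (row i B) z).
Proof.
move=> nx ny; apply: hsumE; apply: hs_ext (br_hs (t + \row_i symp (row i B) z) nx ny) => l.
rewrite dtD eD !cfE//; try exact: nice_rho.
rewrite Vr_conj//; have -> : symp (lat B l) z = dt l (\row_i symp (row i B) z).
 by rewrite lat_sum symp_suml /dt; apply: eq_bigr => i _; rewrite sympZl mxE.
set w1 := (_^*)%C; set w2 := Vr _ _ _; set w3 := ee (dt l t); set w4 := ee _; clearbody w1 w2 w3 w4; ring.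
Qed.

Lemma br_suml I (r : seq I) (c : I -> R[i]) (F : I -> X -> R[i]) y t : (forall i, nice (F i)) -> nice y ->
 br (fun x => \sum_(i <- r) c i * F i x) y t = \sum_(i <- r) c i * br (F i) y t.
Proof.
move=> nF ny; apply: hsumE; have := hs_sum r (fun i => hsZ (c i) (br_hs t (nF i) ny)).
apply: hs_ext => l; rewrite /cf L2inner_suml; [|by move=> i; exact: niceZ|exact: nice_pt].
rewrite mulr_suml; apply: eq_bigr => i _; rewrite L2innerZl ?mulrA//; exact: nice_pt.
Qed.

Definition upt (p : nat) (u : {ffun 'I_m -> 'I_p}) : 'rV[R]_m := - (\row_s ((u s : nat)%:R / p%:R)).

(** Summing over the p^(2d) translates by points of order p keeps only the coefficients indexed by
    multiples of p. *)
Lemma br_trace (p : nat) x y t : (0 < p)%N -> nice x -> nice y ->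
 \sum_u br x y (t + @upt p u) = (p ^ m)%:R * hsum (fun l => cf x y (l *+ p) * ee (dt (l *+ p) t)).
Proof.
move=> p0 nx ny; pose S := hsum (fun l => cf x y (l *+ p) * ee (dt (l *+ p) t)).
pose mp (l : 'rV[int]_m) := l *+ p.
pose dv (l : 'rV[int]_m) : 'rV[int]_m := \row_s (l ord0 s %/ p)%Z.
have mpK : cancel mp dv.
 move=> l; apply/rowP => s; rewrite mxE mulmxnE -mulr_natr natz mulzK//; move: p0; clear; lia.
have HS : hs (fun l => cf x y (mp l) * ee (dt (mp l) t)) S.
 have [M _ bM] := bs_cf0 nx ny; apply: (@hsumP _ _ M).
 have := bs_inj (can_inj mpK) bM; apply: bs_le => l; by rewrite ncM nc_e mulr1.
pose G l := cf x y l * ee (dt l t) * [forall s, (p %| l ord0 s)%Z]%:R.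
have HG : hs G S.
 apply: (hs_injV (f := mp) (g := dv) mpK) => [l ll|].
  rewrite /G; case: (boolP [forall s, _]) => [/forallP h|_]; last by rewrite mulr0.
  case/eqP: ll; apply/rowP => s; rewrite mulmxnE mxE -mulr_natr natz; exact: divzK (h s).
 apply: hs_ext HS => l; rewrite /G (_ : [forall s, _] = true) ?mulr1//.
 by apply/forallP => s; rewrite mulmxnE -mulr_natr natz dvdz_mull.
have H := hs_sum (index_enum {ffun 'I_m -> 'I_p}) (fun u => br_hs (t + @upt p u) nx ny).
apply: hs_unique H _; apply: hs_ext (hsZ (p ^ m)%:R HG) => l.
rewrite /G mulrCA -(char_sum (R := R) l p0) mulr_sumr; apply: eq_bigr => u _.
rewrite dtD eD mulrA; congr (_ * ee _); rewrite /dt; apply: eq_bigr => s _.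
by rewrite !mxE; ring.
Qed.

(** The average [S] of the p^(2d) bracket matrices differs from the identity by row sums at most
    1/2, hence has full rank t. If every fibre had rank at most n - 1, the rank of [S] would not
    exceed (n - 1) p^(2d) < t. *)
Lemma fibre_rank (p t n : nat) (psi psi' : 'I_t -> X -> R[i]) : (0 < p)%N -> (forall j, nice (psi j)) -> (forall j, nice (psi' j)) ->
 (forall j, bs (fun x => nc (err B p psi psi' j x)) (1 / 2)) -> (n.-1 * p ^ m < t)%N -> forall y, exists u,
 (n <= \rank (\matrix_(j, j') br (psi j) (psi' j') (y + @upt p u)))%N.
Proof.
move=> p0 np np' E0 nt y.
pose S : 'M[R[i]]_t := \matrix_(j, j') hsum (fun l => cf (psi j) (psi' j') (l *+ p) * ee (dt (l *+ p) y)).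
pose F j j' l := (cf (psi j) (psi' j') (l *+ p) - (j == j')%:R * (l == 0)%:R) * ee (dt (l *+ p) y).
have p1 (l : 'rV[int]_m) : (l *+ p == 0) = (l == 0).
 apply/eqP/eqP => [/rowP h|->]; last by rewrite mul0rn.
 apply/rowP => s; have := h s; rewrite mulmxnE !mxE => /eqP; rewrite mulrn_eq0 => /orP[/eqP pz|/eqP//].
 by rewrite pz in p0.
have ncF j j' l : nc (F j j' l) = nc (err B p psi psi' j (j', l)).
 rewrite /F ncM nc_e mulr1 /err /= lat_scale -(p1 l) (nc_cfB _ _ (np j) (np' j')).
 by rewrite -natrM mulnb.
have HF j j' : hs (F j j') (S j j' - (j == j')%:R).
 have [M _ bM] := bs_cf0 (np j) (np' j').
 have HS : hs (fun l : 'rV[int]_m => cf (psi j) (psi' j') (l *+ p) * ee (dt (l *+ p) y)) (S j j').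
  rewrite mxE; apply: (@hsumP _ _ M).
  have pinj : injective (fun l : 'rV[int]_m => l *+ p).
   by move=> l l' /eqP; rewrite -subr_eq0 -mulrnBl p1 subr_eq0 => /eqP.
  have := bs_inj pinj bM; apply: bs_le => l; by rewrite ncM nc_e mulr1.
 have H0 : hs (fun l : 'rV[int]_m => - ((j == j')%:R * (l == 0)%:R) : R[i]) (- (j == j')%:R).
  move=> eps e0; exists [:: 0] => A uA sA; rewrite (bigD1_seq 0) ?sA ?mem_head//= eqxx mulr1 big1 ?addr0 ?subrr ?nc0 ?ltW//.
  by move=> l /negbTE ->; rewrite mulr0 oppr0.
 apply: hs_ext (hsD HS H0) => l; rewrite /F; have [->|l0] := eqVneq l 0; last by rewrite !mulr0 oppr0 !addr0.
 have -> : dt (0 *+ p) y = 0 by rewrite /dt big1// => i _; rewrite mul0rn mxE mul0r.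
 by rewrite e0 !mulr1.
have row_half j : \sum_j' nc (S j j' - (j == j')%:R) <= 1 / 2.
 pose z j' := S j j' - (j == j')%:R.
 (* Unimodular multipliers that turn the row of complex entries into their moduli, so that the l^1
    bound applies to the whole row at once. *)
 pose th j' : R[i] := if z j' == 0 then 0 else ((z j')^*)%C * ((nc (z j'))^-1)%:C%C.
 have thz j' : th j' * z j' = (nc (z j'))%:C%C.
  rewrite /th; case: eqP => [->|/eqP z0]; first by rewrite mul0r nc0.
  by rewrite mulrAC [(_^*)%C * _]mulrC mul_conj -rcM expr2 mulfK// nc_eq0.
 have th1 j' : nc (th j') <= 1.
  rewrite /th; case: eqP => [_|/eqP z0]; first by rewrite nc0.
  by rewrite ncM nc_conj nc_real ger0_norm ?invr_ge0 ?nc_ge0// mulfV// nc_eq0.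
 have H : hs (fun x : 'I_t * 'rV[int]_m => th x.1 * F j x.1 x.2) (\sum_(j' <- index_enum 'I_t) th j' * z j').
  apply: hs_rows; first exact: index_enum_uniq.
   by move=> j' l; rewrite mem_index_enum.
  move=> j'; have := hsZ (th j') (HF j j'); rewrite -/(z j') => H; apply: hs_ext H => l; reflexivity.
 have : nc (\sum_j' th j' * z j') <= 1 / 2.
  apply: hs_bound H _; apply: bs_le (E0 j) => -[j' l].
  by rewrite ncM ncF/= ler_piMl ?nc_ge0.
 have -> : \sum_j' th j' * z j' = (\sum_j' nc (z j'))%:C%C by rewrite rmorph_sum; apply: eq_bigr => j' _; exact: thz.
 rewrite nc_real ger0_norm; first exact.
 by apply: sumr_ge0 => j' _; exact: nc_ge0.
have uS : \rank S = t.
 apply/eqP; rewrite -/(row_free S) row_free_unit -unitmx_tr unitmxE unitfE; apply/det0P => -[v v0 vS].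
 have /rV0Pn[j0 vj0] := v0.
 have [j _ jmax] := @arg_maxP _ _ _ j0 predT (fun j => nc (v ord0 j)) isT.
 have vj : 0 < nc (v ord0 j) by rewrite (lt_le_trans _ (jmax j0 isT))// nc_gt0.
 have E : v ord0 j = - \sum_j' v ord0 j' * (S j j' - (j == j')%:R).
  have := congr1 (fun x : 'rV[R[i]]_t => x ord0 j) vS; rewrite mxE [RHS]mxE => h.
  under [X in - X]eq_bigr do rewrite mulrBr.
  rewrite sumrB (eq_bigr (fun j' => v ord0 j' * S^T j' j)) => [|j' _]; last by rewrite [S^T _ _]mxE.
  rewrite h sub0r opprK (bigD1 j)//= eqxx mulr1 big1 ?addr0// => j' /negbTE; rewrite eq_sym => ->; exact: mulr0.
 have : nc (v ord0 j) <= 1 / 2 * nc (v ord0 j).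
  rewrite {1}E ncN (le_trans (nc_sum _ _ _))// (le_trans _ (ler_wpM2r (nc_ge0 _) (row_half j)))// mulr_suml.
  by apply: ler_sum => j' _; rewrite ncM mulrC ler_wpM2l ?nc_ge0//; exact: jmax.
 by move: vj; lra.
apply: contrapT => /forallNP H; have {}H u : (\rank (\matrix_(j, j') br (psi j) (psi' j') (y + @upt p u)) <= n.-1)%N.
 by have := H u; move=> /negP; rewrite -ltnNge; clear; lia.
have SE : (p ^ m)%:R *: S = \sum_u \matrix_(j, j') br (psi j) (psi' j') (y + @upt p u).
 apply/matrixP => j j'; rewrite summxE !mxE -br_trace//; apply: eq_bigr => u _; by rewrite mxE.
have pm0 : (p ^ m)%:R != 0 :> R[i] by rewrite pnatr_eq0 expn_eq0 negb_and -lt0n p0.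
have : (\rank ((p ^ m)%:R *: S) <= \sum_(u : {ffun 'I_m -> 'I_p}) n.-1)%N.
 rewrite SE; elim/big_rec2: _ => [|u k M _ IH]; first by rewrite mxrank0.
 by rewrite (leq_trans (mxrank_add _ _))// leq_add.
by rewrite (eqmx_scale _ pm0) uS sum_nat_const card_ffun !card_ord mulnC leqNgt nt.
Qed.

Lemma rho_pt z l (f : X -> R[i]) : rho z (pt l f) = fun x => ee (- symp z (lat B l)) * pt l (rho z f) x.
Proof.
rewrite /pt rhoZ !rho_comp; apply/funext => x; rewrite [z + _]addrC (symp_anti (lat B l) z).
move: (rho _ f x) => w; rewrite !mulrA -!eD; congr (ee _ * w); by field.
Qed.

Lemma brZ c (x y : X -> R[i]) t : nice x -> nice y -> br (fun u => c * x u) y t = c * br x y t.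
Proof.
move=> nx ny; apply: hsumE; apply: hs_ext (hsZ c (br_hs t nx ny)) => l.
have key : cf (fun u => c * x u) y l = c * cf x y l by rewrite /cf (L2innerZl c nx (nice_pt l ny)).
by rewrite key mulrA.
Qed.

End brackets.

(** * The rational case *)

Section rational.
Context {R : realType} (d : nat).
Local Notation m := (d + d)%N.
Local Notation X := 'rV[R]_d.

(** Parseval's identity on the grid of points of order Q; it is exact when the frequencies are
    distinct modulo Q. *)
Lemma parseval_fin (Q : nat) (I : eqType) (s : seq I) (k : I -> 'rV[int]_m) (u : I -> R[i]) (P : pred I) : (0 < Q)%N -> uniq s ->
 (forall a b, a \in s -> b \in s -> P a -> P b -> [forall i, (Q %| (k a - k b) ord0 i)%Z] -> a = b) ->
 \sum_(y : {ffun 'I_m -> 'I_Q}) nc (\sum_(a <- s | P a) u a * ee (dt (k a) (@upt R d Q y))) ^+ 2 =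
 (Q ^ m)%:R * \sum_(a <- s | P a) nc (u a) ^+ 2.
Proof.
move=> Q0 us H; apply: (@complexI R); rewrite rcM rc_nat !rmorph_sum.
have E y : (nc (\sum_(a <- s | P a) u a * ee (dt (k a) (@upt R d Q y))) ^+ 2)%:C%C =
  \sum_(a <- s | P a) \sum_(b <- s | P b) u a * ((u b)^*)%C * ee (\sum_i - ((y i : nat)%:R / Q%:R * ((k a - k b) ord0 i)%:~R)).
 rewrite -mul_conj conj_sum mulr_suml; apply: eq_bigr => a _; rewrite mulr_sumr; apply: eq_bigr => b _.
 rewrite cjM -eN mulrACA -eD; congr (_ * ee _).
 rewrite /dt -sumrN -big_split; apply: eq_bigr => i _ /=; rewrite !mxE intrB; ring.
rewrite (eq_bigr _ (fun y _ => E y)) exchange_big mulr_sumr big_seq_cond [RHS]big_seq_cond.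
apply: eq_bigr => a /andP[sa Pa]; transitivity ((Q ^ m)%:R * (u a * ((u a)^*)%C)); last by rewrite mul_conj.
rewrite exchange_big.
rewrite big_mkcond (bigD1_seq a)//= Pa -mulr_sumr (char_sum (R := R) (k a - k a) Q0) [X in _ + X]big1_seq ?addr0.
 rewrite (_ : [forall _, _] = true) ?mulr1 1?mulrC//; apply/forallP => i; by rewrite subrr mxE dvdz0.
move=> b /andP[ba sb]; case: ifP => // Pb; rewrite -mulr_sumr (char_sum (R := R) (k a - k b) Q0).
case: (boolP [forall _, _]) => [h|h]; last by rewrite !mulr0.
by move: ba; rewrite (H a b sa sb Pa Pb h) eqxx.
Qed.

Lemma hs_trunc (T : eqType) (F : T -> R[i]) S (A : seq T) (tau : R) : hs F S -> uniq A ->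
 (forall s, uniq s -> \sum_(l <- s | l \notin A) nc (F l) <= tau) -> nc (S - \sum_(l <- A) F l) <= tau.
Proof.
move=> hF uA tl; apply/ler_addgt0Pr => eps e0; have [A1 H] := hF eps e0.
pose B1 := undup (A1 ++ A); have uB1 : uniq B1 by exact: undup_uniq.
have s1 : {subset A1 <= B1} by move=> l lA; rewrite mem_undup mem_cat lA.
have s2 : {subset A <= B1} by move=> l lA; rewrite mem_undup mem_cat lA orbT.
have := H B1 uB1 s1; rewrite (sum_split F uA uB1 s2) => h.
have := tl B1 uB1; have := nc_sum B1 (fun l => l \notin A) F.
move: h; set X1 := \sum_(l <- A) F l; set X2 := \sum_(l <- B1 | _) F l => h h1 h2.
have -> : S - X1 = X2 - (X1 + X2 - S) by ring.
by rewrite (le_trans (ncBD _ _))//; move: h1 h2 h; move: (nc _) (nc _) (\sum_(_ <- _ | _) _); clear => *; lra.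
Qed.

(** With W the total weight and S the weighted sum, W times the difference of the two sides is the
    sum of w_i (x_i W - S)^2; a zero total weight is treated apart. *)
Lemma weighted_cs (I : eqType) (s : seq I) (w x : I -> R) : (forall i, 0 <= w i) ->
 (\sum_(i <- s) w i * x i) ^+ 2 <= (\sum_(i <- s) w i) * \sum_(i <- s) w i * x i ^+ 2.
Proof.
move=> w0; set S := \sum_(i <- s) w i * x i; set W := \sum_(i <- s) w i; set Y := \sum_(i <- s) _ * _ ^+ 2.
have W0 : 0 <= W by apply: sumr_ge0.
have h : 0 <= W * (W * Y - S ^+ 2).
 have -> : W * (W * Y - S ^+ 2) = \sum_(i <- s) w i * (x i * W - S) ^+ 2.
  rewrite (eq_bigr (fun i => W ^+ 2 * (w i * x i ^+ 2) + ((- 2 * W * S) * (w i * x i) + S ^+ 2 * w i))); last by move=> i _; ring.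
  by rewrite !big_split/= -!mulr_sumr -/S -/W -/Y; ring.
 by apply: sumr_ge0 => i _; rewrite mulr_ge0// sqr_ge0.
have [W1|W1] := eqVneq W 0; last first.
 by move: h; rewrite pmulr_rge0 ?subr_ge0// lt_neqAle eq_sym W1.
suff -> : S = 0 by rewrite W1 mul0r expr0n.
rewrite /S big1_seq// => i /andP[_ si]; suff -> : w i = 0 by rewrite mul0r.
apply/eqP; rewrite eq_le w0 andbT -W1 /W; elim: s si {S W Y W0 h W1} => // j s IH.
rewrite inE big_cons => /predU1P[->|/IH h]; first by rewrite lerDl sumr_ge0.
by rewrite (le_trans h)// lerDr.
Qed.

(** Extends the parameters from the box to the whole space, where [generic] asks for its bounds,
    while keeping them 1-Lipschitz. *)
Definition clamp (x : R) : R := if x <= -1 then -1 else if 1 <= x then 1 else x.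

Lemma clamp_le x : `|clamp x| <= 1.
Proof. by rewrite /clamp ler_norml; case: (leP x (-1)) => h; case: (leP 1 x) => h'; apply/andP; split; lra. Qed.
Lemma clamp_lip x y : `|clamp x - clamp y| <= `|x - y|.
Proof.
wlog xy : x y / x <= y.
 by move=> H; have [|/ltW] := leP x y; [exact: H|rewrite (distrC (clamp x)) (distrC x); exact: H].
rewrite (distrC (clamp x)) (distrC x) [leRHS]ger0_norm ?subr_ge0//.
rewrite /clamp ler_norml; case: (leP x (-1)) => h1; case: (leP 1 x) => h2; case: (leP y (-1)) => h3; case: (leP 1 y) => h4;
 by apply/andP; split; lra.
Qed.
Lemma clamp_id x : `|x| <= 1 -> clamp x = x.
Proof. by rewrite /clamp ler_norml => /andP[h1 h2]; case: (leP x (-1)) => h; case: (leP 1 x) => h'; lra. Qed.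

Variables (N : 'M[R]_m) (C : 'M[int]_m) (q n1 : nat).
Hypotheses (uN : N \in unitmx) (dC : \det C != 0) (iC : iso N C) (q0 : (0 < q)%N).
Hypothesis Hq : forall i j, q%:R * symp (row i N) (row j N) \is a Num.int.
Hypothesis maxC : forall k, (forall i, symp (lat N k) (lat N (row i C)) \is a Num.int) -> exists l, k = l *m C.
Let B := map_mx intr C *m N.
Hypotheses (n1_gt : (n1.-1)%:R < `|\det B|) (n1_1 : (1 < n1)%N) (rn : (`|\det C| + d <= n1)%N).

Let uB : B \in unitmx.
Proof. by rewrite unitmx_mul uN andbT unitmxE det_map_mx unitfE intr_eq0. Qed.
Let latBE l : lat B l = lat N (l *m C).
Proof. by rewrite /B /lat map_mxM mulmxA. Qed.
Let rBE i : row i B = lat N (row i C). Proof. by rewrite /B row_mul /lat map_row. Qed.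
Let iB i j : symp (row i B) (row j B) \is a Num.int. Proof. by rewrite !rBE. Qed.
Lemma q_int (k l : 'rV[int]_m) : q%:R * symp (lat N k) (lat N l) \is a Num.int.
Proof.
rewrite symp_sumE mulr_sumr rpred_sum// => i _; rewrite mulr_sumr rpred_sum// => j _.
by rewrite mulrCA rpredM// rpredM ?intr_int.
Qed.

Definition lq (v : {ffun 'I_m -> 'I_q}) : 'rV[int]_m := \row_s ((v s : nat)%:Z).

(* The characters of B/qB given by the cosets of B in the full lattice are distinct, because B is maximal isotropic. *)
Lemma coset_sum (k : 'rV[int]_m) : \sum_v ee (symp (lat N k) (lat B (lq v))) =
 (q ^ m)%:R * (`[< exists l, k = l *m C >])%:R :> R[i].
Proof.
have qR : q%:R != 0 :> R by rewrite pnatr_eq0 -lt0n.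
pose n : 'rV[int]_m := \row_i - Num.floor (q%:R * symp (lat N k) (row i B)).
have nE i : (n ord0 i)%:~R = - (q%:R * symp (lat N k) (row i B)) :> R.
 by rewrite mxE intrN floorK// rBE q_int.
have -> : `[< exists l, k = l *m C >] = [forall s, (q %| n ord0 s)%Z].
 apply/asboolP/forallP => [[l kE] s|H].
  have : symp (lat N k) (row s B) \is a Num.int.
   by rewrite kE rBE (_ : lat N (row s C) = lat N (delta_mx ord0 s *m C)) ?iso_int// -rowE.
  move=> /intrP[z zE]; apply/dvdzP; exists (- z); apply: (@intr_inj R).
  by rewrite nE zE intrM intrN -[(q : int)%:~R]/(q%:R); ring.
 apply: maxC => i; have /dvdzP[z zE] := H i.
 have := nE i; rewrite zE intrM -[(q : int)%:~R]/(q%:R : R) => h.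
 apply/intrP; exists (- z); apply: (mulfI qR); rewrite -rBE intrN mulrN [_ * z%:~R]mulrC h opprK//.
rewrite -(char_sum (R := R) n q0); apply: eq_bigr => v _; congr ee.
rewrite (lat_sum B) symp_sumr; apply: eq_bigr => s _; rewrite nE sympZr mxE -[((v s : nat)%:Z)%:~R]/((v s : nat)%:R : R).
by field.
Qed.

(** The shifts of [g] along the lattice are the shifts along B of the r functions [ra a g], one per
    coset. They form a Riesz sequence once, over each torus point, the r bracket rows against the
    fixed functions [h'] are uniformly independent. [g] is a combination of translates of the packed
    vectors with coefficients given by [generic]; a discretised Parseval argument passes from the
    fibres back to the coefficients. *)
Theorem rational_riesz : exists2 g : X -> R[i], nice g & riesz N g.
Proof.
have n0 : 0 < (n1.-1)%:R :> R by rewrite ltr0n -ltnS prednK// (ltn_trans _ n1_1).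
have [p [t [psi [psi' [p0 pt0 np np' E0]]]]] := packing uB n0 n1_gt.
have tp : (n1.-1 * p ^ m < t)%N by move: pt0; rewrite -natrX -natrM ltr_nat.
have [x [xinj [_ xcov]]] := @lattice_reps R _ C dC.
have [r1 rE] : exists r1, absz (\det C) = r1.+1 by exists (absz (\det C)).-1; rewrite prednK// absz_gt0.
move: rn x xinj xcov; rewrite rE => rn' x xinj xcov.
pose I := 'I_r1.+1.
pose ra (a : I) := rho (lat N (x a)).
pose Wt : finType := ({ffun 'I_m -> 'I_q} * {ffun 'I_m -> 'I_p} * 'I_t)%type.
pose Bt : finType := (I * {ffun 'I_m -> 'I_p} * 'I_t)%type.
pose h (w : Wt) := pt B (lq w.1.1) (rho (zpt B w.1.2) (psi w.2)).
pose h' (b : Bt) := ra b.1.1 (rho (zpt B b.1.2) (psi' b.2)).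
have nh w : nice (h w) by apply: nice_pt; apply: nice_rho.
have nh' b : nice (h' b) by do 2 apply: nice_rho.
have nra a f : nice f -> nice (ra a f) by exact: nice_rho.
have bex (y : I * Wt * Bt) : {M : R | 0 < M /\ ((forall t, nc (br B (ra y.1.1 (h y.1.2)) (h' y.2) t) <= M) /\
  (forall t t', nc (br B (ra y.1.1 (h y.1.2)) (h' y.2) t - br B (ra y.1.1 (h y.1.2)) (h' y.2) t') <= M * l1 (t - t')))}.
 by apply: cid; have [M M0 HM] := br_bounds uB (nra y.1.1 _ (nh y.1.2)) (nh' y.2); exists M.
pose Mb : R := \sum_y sval (bex y).
have Mbl y : sval (bex y) <= Mb.
 by rewrite /Mb (bigD1 y)//= lerDl; apply: sumr_ge0 => y' _; apply: ltW; exact: (svalP (bex y')).1.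
have Mb0 : 0 <= Mb by apply: sumr_ge0 => y _; apply: ltW; exact: (svalP (bex y)).1.
(* A torus point and r - 1 complex numbers: a vector over the cosets normalised to have entry 1 at a
   largest coordinate [a0], which is the finite parameter of [generic]. The requirement e < 2 n1 is
   r + d <= n1. *)
pose e := (m + (r1 + r1))%N.
pose vv (a0 : I) (z : 'rV[R]_e) (a : I) : R[i] := if unlift a0 a is Some b then
 (clamp (lsubmx (rsubmx z) ord0 b) +i* clamp (rsubmx (rsubmx z) ord0 b))%C else 1.
have vv2 a0 z a : nc (vv a0 z a) <= 2.
 rewrite /vv; case: unlift => [b|]; last by rewrite nc1 ler1n.
 by rewrite (le_trans (nc_le_ReIm _))//= -[2]/(1 + 1) lerD// clamp_le.
have l1s (z : 'rV[R]_e) : l1 z = l1 (lsubmx z) + (l1 (lsubmx (rsubmx z)) + l1 (rsubmx (rsubmx z))).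
 by rewrite -{1}(hsubmxK z) l1_row -{1}(hsubmxK (rsubmx z)) l1_row.
have vvl a0 z z' a : nc (vv a0 z a - vv a0 z' a) <= l1 (z - z').
 rewrite /vv; case: unlift => [b|]; last by rewrite subrr nc0 l1_ge0.
 rewrite (le_trans (nc_le_ReIm _))//= (le_trans (lerD (clamp_lip _ _) (clamp_lip _ _)))//.
 rewrite l1s !linearB/= -[leLHS]add0r lerD ?l1_ge0// lerD//.
  by rewrite (le_trans _ (l1_le _ b))// [X in _ <= `|X|]mxE [X in _ <= `|_ + X|]mxE.
 by rewrite (le_trans _ (l1_le _ b))// [X in _ <= `|X|]mxE [X in _ <= `|_ + X|]mxE.
pose Rm (a0 : I) (z : 'rV[R]_e) : 'M[R[i]]_(#|Wt|, #|Bt|) := \matrix_(w, b)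
 \sum_a vv a0 z a * br B (ra a (h (enum_val w))) (h' (enum_val b)) (lsubmx z).
pose K : R := (r1.+1)%:R * (4 * Mb) + 1.
have K1 : 1 <= K by rewrite lerDr mulr_ge0// mulr_ge0.
have rsum (c0 : R) : \sum_(a : I) c0 = (r1.+1)%:R * c0 by rewrite sumr_const card_ord mulr_natl.
have bR a0 z w b : nc (Rm a0 z w b) <= K.
 rewrite mxE (le_trans (nc_sum _ _ _))//; apply: (@le_trans _ _ (\sum_(a : I) 4 * Mb)); last by rewrite rsum lerDl.
 apply: ler_sum => a _; rewrite ncM (_ : 4 * Mb = 2 * (2 * Mb)); last by ring.
 rewrite ler_pM ?nc_ge0// (le_trans ((svalP (bex (a, enum_val w, enum_val b))).2.1 _))// (le_trans (Mbl _))//.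
 by rewrite ler_peMl// ler1n.
have lR a0 z z' w b : nc (Rm a0 z w b - Rm a0 z' w b) <= K * l1 (z - z').
 rewrite !mxE -sumrB (le_trans (nc_sum _ _ _))//.
 apply: (@le_trans _ _ (\sum_(a : I) 4 * Mb * l1 (z - z'))).
  apply: ler_sum => a _; set u := vv a0 z a; set u' := vv a0 z' a.
  set c0 := br _ _ _ _; set c1 := br _ _ _ _.
  have -> : u * c0 - u' * c1 = (u - u') * c0 + u' * (c0 - c1) by ring.
  have [HM1 HM2] := (svalP (bex (a, enum_val w, enum_val b))).2.
  have h1 : nc c0 <= Mb := le_trans (HM1 _) (Mbl _).
  have h2 : nc (c0 - c1) <= Mb * l1 (z - z').
   rewrite (le_trans (HM2 _ _))//; apply: ler_pM => //; [exact: ltW (svalP (bex _)).1|exact: l1_ge0|].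
   by rewrite l1s linearB/= lerDl addr_ge0 ?l1_ge0.
  have l0 := l1_ge0 (z - z').
  rewrite (le_trans (ncD _ _))// ncM (ncM u').
  apply: (@le_trans _ _ (l1 (z - z') * Mb + 2 * (Mb * l1 (z - z')))).
   by apply: lerD; apply: ler_pM; rewrite ?nc_ge0//; [exact: vvl|exact: vv2].
  have : 0 <= Mb * l1 (z - z') by rewrite mulr_ge0.
  by move: (l1 _) => y; clear; nra.
 by rewrite rsum mulrA ler_wpM2r ?l1_ge0// lerDl.
(* Weighting the translates by B modulo q with the characters [kap] isolates the coset [a0], by
   [coset_sum]. What remains is a multiple of a bracket matrix at a translated torus point, to which
   [fibre_rank] applies; hence the rank bound for every vector with entry 1 at [a0]. *)
have rR a0 z : (n1 <= \rank (Rm a0 z))%N.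
 pose y := lsubmx z.
 have [u Hu] := fibre_rank uB p0 np np' E0 tp (y + \row_i symp (row i B) (lat N (x a0))).
 apply: (leq_trans Hu); set P := \matrix_(_, _) _.
 pose kap (v : {ffun 'I_m -> 'I_q}) : R[i] := ee (- dt (lq v) y) * ee (symp (lat N (x a0)) (lat B (lq v))).
 pose K1m : 'M[R[i]]_(t, #|Wt|) := \matrix_(j, w) (kap (enum_val w).1.1 * ((enum_val w).1.2 == u)%:R * ((enum_val w).2 == j)%:R).
 pose K2m : 'M[R[i]]_(#|Bt|, t) := \matrix_(b, j) (enum_val b == (a0, u, j))%:R.
 have qm0 : (q ^ m)%:R != 0 :> R[i] by rewrite pnatr_eq0 expn_eq0 negb_and -lt0n q0.
 suff E : K1m *m Rm a0 z *m K2m = (q ^ m)%:R *: P.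
  have : (\rank ((q ^ m)%:R *: P) <= \rank (Rm a0 z))%N.
   by rewrite -E (leq_trans (mxrankM_maxl _ _))// mxrankM_maxr.
  by rewrite (eqmx_scale _ qm0).
 have zE : \row_i symp (row i B) (zpt B u) = @upt R d p u.
  apply/rowP => i; rewrite /zpt /upt !mxE sympNr sympZr.
  have -> : row i B = lat B (delta_mx ord0 i).
   by rewrite rowE /lat map_delta_mx.
  rewrite latE symp_adj// mxE (bigD1 i)//= big1 ?addr0 => [|k /negbTE ki]; rewrite !mxE eqxx ?ki ?mul1r ?mul0r//.
  by rewrite eqxx mul1r mulrC.
 apply/matrixP => j j'; rewrite mxE (bigD1 (enum_rank (a0, u, j')))//= [X in _ + X]big1 ?addr0 => [|b bn]; last first.
  rewrite [X in _ * X]mxE (_ : (enum_val b == (a0, u, j')) = false) ?mulr0//.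
  by apply: contraNF bn => /eqP <-; rewrite enum_valK.
 rewrite [X in _ * X]mxE enum_rankK eqxx mulr1 mxE.
 pose T1 (w : Wt) := kap w.1.1 * (w.1.2 == u)%:R * (w.2 == j)%:R * \sum_a vv a0 z a * br B (ra a (h w)) (h' (a0, u, j')) y.
 have -> : \sum_w K1m j w * Rm a0 z w (enum_rank (a0, u, j')) = \sum_(w : Wt) T1 w.
  rewrite [RHS](reindex (fun w : 'I_#|Wt| => enum_val w)); last by apply: onW_bij; exact: enum_val_bij.
  by apply: eq_bigr => w _; rewrite /T1 !mxE enum_rankK.
 rewrite -(pair_bigA _ (fun w1 w2 => T1 (w1, w2)))/= exchange_big (bigD1 j)//= [X in _ + X]big1 ?addr0; last first.
  by move=> j2 /negbTE h2; rewrite big1// => w _; rewrite /T1/= h2 mulr0 mul0r.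
 rewrite -(pair_bigA _ (fun w1 w2 => T1 (w1, w2, j)))/= exchange_big (bigD1 u)//= [X in _ + X]big1 ?addr0; last first.
  by move=> u2 /negbTE h2; rewrite big1// => w _; rewrite /T1/= h2 mulr0 !mul0r.
 pose br0 a := br B (ra a (rho (zpt B u) (psi j))) (h' (a0, u, j')) y.
 have nz0 : nice (rho (zpt B u) (psi j)) by exact: nice_rho.
 have T1E v : T1 (v, u, j) = \sum_a vv a0 z a * br0 a * ee (symp (lat N (x a0 - x a)) (lat B (lq v))).
  rewrite /T1/= !eqxx !mulr1 mulr_sumr; apply: eq_bigr => a _.
  rewrite /h/= /ra rho_pt; rewrite (brZ uB); [|by apply: nice_pt; exact: nice_rho|exact: nh'].
  rewrite (br_shift uB iB); [|exact: nra|exact: nh'].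
  rewrite -/(ra a) -/(br0 a) /kap latB sympDl sympNl eD eN.
  have -> : ee (- symp (lat N (x a)) (lat B (lq v))) = ((ee (symp (lat N (x a)) (lat B (lq v))))^*)%C :> R[i] by rewrite eN.
  have e1 : ((ee (dt (lq v) y))^*)%C * ee (dt (lq v) y) = 1 by rewrite mulrC mul_conj nc_e expr1n.
  move: e1; set k1 := (ee (dt (lq v) y)); set k2 := ((k1)^*)%C; set k3 := ee (symp _ _); set k4 := (_^*)%C; set k5 := vv _ _ _; set k6 := br0 a.
  clearbody k1 k2 k3 k4 k5 k6 => e1.
  have -> : k2 * k3 * (k5 * (k4 * (k1 * k6))) = k2 * k1 * (k5 * k6 * (k3 * k4)) by ring.
  by rewrite e1 mul1r.
 rewrite (eq_bigr _ (fun v _ => T1E v)) exchange_big (bigD1 a0)//= [X in _ + X]big1 ?addr0 => [|a an]; last first.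
  rewrite -mulr_sumr coset_sum asboolF ?mulr0// => -[l El]; move/eqP: an; apply.
  by apply/esym; exact: (xinj _ _ l).
 rewrite -mulr_sumr coset_sum asboolT ?mulr1; last by exists 0; rewrite subrr mul0mx.
 rewrite /vv unlift_none mul1r mulrC !mxE; congr (_ * _).
 rewrite /br0 /h'/= /ra (br_char uB); [|exact: nice_rho|exact: nice_rho].
 by rewrite (br_char uB)// zE.
have en : (e < 2 * n1)%N by move: rn'; rewrite /e; clear; lia.
have [cg [dl [dl0 Hg]]] := generic en K1 bR lR rR.
pose g := fun y : X => \sum_w cg w * h (enum_val w) y.
have ng : nice g by apply: nice_sum => w; exact: niceZ.
have brg a b y : br B (ra a g) (h' b) y = \sum_w cg w * br B (ra a (h (enum_val w))) (h' b) y.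
 by rewrite /ra /g rho_sum (br_suml uB)// => w; exact: nra.
(* Homogeneity: divide by an entry of largest modulus to enter the box of [generic]. *)
have low (y : 'rV[R]_m) (v : I -> R[i]) : (forall i, `|y ord0 i| <= 1) -> exists b, forall a,
  dl * nc (v a) <= nc (\sum_a v a * br B (ra a g) (h' b) y).
 move=> hy; have [a0 _ amax] := @arg_maxP _ _ _ (ord0 : I) predT (fun a => nc (v a)) isT.
 have [v0|v0] := eqVneq (v a0) 0.
  exists (ord0, [ffun=> Ordinal p0], Ordinal (leq_ltn_trans (leq0n _) tp)) => a.
  suff -> : nc (v a) = 0 by rewrite mulr0 nc_ge0.
  by apply/eqP; rewrite eq_le nc_ge0 andbT (le_trans (amax a isT))// v0 nc0.
 pose v' a := v a / v a0.
 have v'1 a : nc (v' a) <= 1 by rewrite /v' ncM ncV ler_pdivrMr ?nc_gt0// mul1r; exact: amax.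
 pose z : 'rV[R]_e := row_mx y (row_mx (\row_b Re (v' (lift a0 b))) (\row_b Im (v' (lift a0 b)))).
 have vz a : vv a0 z a = v' a.
  rewrite /vv; case: unliftP => [b|] ->; last by rewrite /v' divff.
  rewrite /z row_mxKr row_mxKl row_mxKr !mxE !clamp_id ?(le_trans (Re_le_nc _))// ?(le_trans (Im_le_nc _))//.
  by case: (v' _).
 have [|b Hb] := Hg a0 z.
  move=> i; rewrite /z; case: (split_ordP i) => i' ->; rewrite ?row_mxEl ?row_mxEr//.
  by case: (split_ordP i') => i2 ->; rewrite ?row_mxEl ?row_mxEr mxE ?(le_trans (Re_le_nc _))// (le_trans (Im_le_nc _)).
 exists (enum_val b) => a.
 have E : \sum_w cg w * Rm a0 z w b = (v a0)^-1 * \sum_a v a * br B (ra a g) (h' (enum_val b)) y.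
  under eq_bigr do rewrite mxE mulr_sumr; rewrite exchange_big mulr_sumr; apply: eq_bigr => a1 _.
  rewrite brg !mulr_sumr; apply: eq_bigr => w _; rewrite vz /v' /z row_mxKl; ring.
 move: Hb; rewrite E ncM ncV mulrC ler_pdivlMr ?nc_gt0// => Hb.
 by rewrite (le_trans _ Hb)// ler_wpM2l ?(ltW dl0)//; exact: amax.
exists g => //.
have bess b : {M : R | 0 < M /\ forall f, L2fun f -> forall s, uniq s ->
  \sum_(k <- s) nc (L2inner f (tfshift (lat B k) (h' b))) ^+ 2 <= M * nf f}.
 by apply: cid; have [M M0 HM] := bessel uB (nh' b); exists M.
pose BB : R := \sum_b sval (bess b) + 1.
have BB0 : 0 < BB by rewrite ltr_wpDl// sumr_ge0// => b _; apply: ltW; exact: (svalP (bess b)).1.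
pose rr : R := (r1.+1)%:R. have rr0 : 0 < rr by rewrite ltr0n.
pose nb : R := #|Bt|%:R. have nb0 : 0 <= nb by exact: ler0n.
(* Truncation error of the brackets: the first bound costs at most half of [dl] on each fibre, the
   second at most half of [kap] in the final inequality. *)
pose tau : R := Num.min (dl / (2 * rr)) (dl / (4 * rr * (nb + 1))).
have tau0 : 0 < tau by rewrite lt_min !divr_gt0// ?mulr_gt0// ltr_wpDl.
have tauex (y : I * Bt) : {s : seq 'rV[int]_m | forall s', uniq s' -> \sum_(l <- s' | l \notin s) nc (cf B (ra y.1 g) (h' y.2) l) <= tau}.
 apply: cid; have [M M0 bM] := bs_cf0 uB (nra y.1 _ ng) (nh' y.2).
 by have [s _ Hs] := bs_tail (fun l => nc_ge0 _) bM tau0; exists s.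
pose T : seq 'rV[int]_m := undup (flatten [seq sval (tauex y) | y <- enum {: I * Bt}]).
have uT : uniq T by exact: undup_uniq.
have tail a b s' : uniq s' -> \sum_(l <- s' | l \notin T) nc (cf B (ra a g) (h' b) l) <= tau.
 move=> us; apply: le_trans (svalP (tauex (a, b)) s' us).
 rewrite [leLHS]big_mkcond [leRHS]big_mkcond; apply: ler_sum => l _.
 case: (boolP (l \in T)) => [lT|lT]/=; first by case: ifP => // _; exact: nc_ge0.
 rewrite ifT//; apply: contra lT => lt; rewrite mem_undup; apply/flatten_mapP; exists (a, b) => //; by rewrite mem_enum.
(* After truncation one component has modulus at least dl/2 times the largest entry, and the sum of
   the r squared entries is at most r times the largest square. *)
pose kap := dl ^+ 2 / (4 * rr).
have kap0 : 0 < kap by rewrite divr_gt0 ?exprn_gt0 ?mulr_gt0.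
exists (kap / (4 * BB)); first by rewrite divr_gt0// mulr_gt0.
move=> s c0 us; set Sg := \sum_(k <- s) _.
have kx k : {ai : I * 'rV[int]_m | k = x ai.1 + ai.2 *m C} by apply: cid; have [i [l kE]] := xcov k; exists (i, l).
pose aa k := (sval (kx k)).1; pose ll k := (sval (kx k)).2.
have kE k : k = x (aa k) + ll k *m C := svalP (kx k).
have all_inj k k' : aa k = aa k' -> ll k = ll k' -> k = k' by move=> h1 h2; rewrite (kE k) (kE k') h1 h2.
pose th k : R := - (up B (ll k) (ll k) / 2) + symp (lat B (ll k)) (lat N (x (aa k))) / 2 + beta (lat N k) (lat N k) / 2.
have tfE k : tfshift (lat N k) g = fun y => ee (th k) * pt B (ll k) (ra (aa k) g) y.
 apply/funext => y; rewrite /pt /ra rho_comp.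
 have -> : lat B (ll k) + lat N (x (aa k)) = lat N k by rewrite latBE -latD addrC -kE.
 rewrite /rho; move: (tfshift (lat N k) g y) => w; rewrite !mulrA -!eD -[LHS]mul1r -e0; congr (ee _ * w).
 by rewrite /th; ring.
pose c' k := c0 k * ee (th k).
have ncc k : nc (c' k) = nc (c0 k) by rewrite /c' ncM nc_e mulr1.
pose f := syn N s c0 g.
have fE : f = fun y => \sum_(k <- s) c' k * pt B (ll k) (ra (aa k) g) y.
 by apply/funext => y; rewrite /f /syn; apply: eq_bigr => k _; rewrite tfE mulrA.
have nf0 : nice f by exact: nice_syn.
pose Dv b l := cf B f (h' b) l.
have npt k : nice (pt B (ll k) (ra (aa k) g)) by apply: nice_pt; exact: nra.
have DvE b l : Dv b l = \sum_(k <- s) c' k * cf B (ra (aa k) g) (h' b) (l - ll k).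
 have E k : L2inner (pt B (ll k) (ra (aa k) g)) (pt B l (h' b)) = cf B (ra (aa k) g) (h' b) (l - ll k).
  exact: (cf_pt iB (ll k) l (nra (aa k) _ ng) (nh' b)).
 rewrite (eq_bigr (fun k => c' k * L2inner (pt B (ll k) (ra (aa k) g)) (pt B l (h' b)))); last by move=> k _; rewrite (E k).
 rewrite /Dv /cf fE L2inner_suml; [|by move=> k; exact: niceZ|exact: nice_pt].
 by apply: eq_bigr => k _; exact: (L2innerZl _ (npt k) (nice_pt _ _ (nh' b))).
pose DT b l := \sum_(k <- s) c' k * (if l - ll k \in T then cf B (ra (aa k) g) (h' b) (l - ll k) else 0).
pose L := undup [seq ll k + l | k <- s, l <- T].
have uL : uniq L by exact: undup_uniq.
have by_a (G : 'rV[int]_m -> R) : \sum_(k <- s) G k = \sum_(a : I) \sum_(k <- s | aa k == a) G k.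
 by rewrite (partition_big aa predT).
(* Schur's test for the truncated part: a row sum is at most tau, a column sum at most r tau, as
   each coset contributes distinct indices. *)
have errB b : \sum_(l <- L) nc (Dv b l - DT b l) ^+ 2 <= rr * tau ^+ 2 * Sg.
 pose w k l := if l - ll k \in T then 0 else nc (cf B (ra (aa k) g) (h' b) (l - ll k)).
 have w0 k l : 0 <= w k l by rewrite /w; case: ifP => // _; exact: nc_ge0.
 have w1 k : \sum_(l <- L) w k l <= tau.
  have um : uniq [seq l - ll k | l <- L] by rewrite map_inj_uniq//; exact: addIr.
  have := tail (aa k) b _ um; rewrite big_map big_mkcond; apply: le_trans; apply: ler_sum => l _.
  by rewrite /w; case: (l - ll k \in T).
 have w2 l : \sum_(k <- s) w k l <= rr * tau.
  rewrite by_a /rr -rsum; apply: ler_sum => a _.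
  have um : uniq [seq l - ll k | k <- s & aa k == a].
   rewrite map_inj_in_uniq ?filter_uniq// => k k'; rewrite !mem_filter => /andP[/eqP h1 _] /andP[/eqP h2 _].
   by move=> /addrI/oppr_inj; apply: all_inj; rewrite h1.
  have hk := tail a b _ um; rewrite big_map big_filter_cond in hk; apply: le_trans hk.
  rewrite [leLHS]big_mkcond [leRHS]big_mkcond; apply: ler_sum => k _.
  by rewrite /w; case: eqP => [->|]//=; case: (l - ll k \in T).
 have pw l : nc (Dv b l - DT b l) ^+ 2 <= rr * tau * \sum_(k <- s) w k l * nc (c0 k) ^+ 2.
  have hle : nc (Dv b l - DT b l) <= \sum_(k <- s) w k l * nc (c0 k).
   rewrite DvE /DT -sumrB (le_trans (nc_sum _ _ _))//; apply: ler_sum => k _.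
   rewrite -mulrBr ncM ncc mulrC ler_wpM2r ?nc_ge0// /w; case: ifP => _; first by rewrite subrr nc0.
   by rewrite subr0.
  apply: (@le_trans _ _ ((\sum_(k <- s) w k l * nc (c0 k)) ^+ 2)).
   by rewrite lerXn2r ?nnegrE ?nc_ge0// sumr_ge0// => k _; rewrite mulr_ge0 ?nc_ge0.
  rewrite (le_trans (weighted_cs s (fun k => nc (c0 k)) (fun k => w0 k l)))// ler_wpM2r// sumr_ge0// => k _.
  by rewrite mulr_ge0 ?exprn_ge0 ?nc_ge0.
 apply: (le_trans (ler_sum _ (fun l _ => pw l))); rewrite -mulr_sumr exchange_big/=.
 have -> : rr * tau ^+ 2 * Sg = rr * tau * \sum_(k <- s) tau * nc (c0 k) ^+ 2 by rewrite -mulr_sumr -/Sg; ring.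
 rewrite ler_wpM2l ?mulr_ge0 ?(ltW rr0) ?(ltW tau0)//; apply: ler_sum => k _.
 by rewrite -mulr_suml ler_wpM2r ?exprn_ge0 ?nc_ge0.
pose Mq := (\sum_(l <- L ++ map ll s) \sum_i absz (l ord0 i))%N.
have Mql l i : l \in L ++ map ll s -> (absz (l ord0 i) <= Mq)%N.
 move=> lL; rewrite /Mq (big_rem l lL)/= (bigD1 i)//= -addnA leq_addr//.
(* Larger than the spread of all indices involved, so that distinct ones remain distinct modulo Q
   and the grid Parseval identity is exact. *)
pose Q := (2 * Mq).+1.
have Qinj l l' : l \in L ++ map ll s -> l' \in L ++ map ll s -> [forall i, (Q %| (l - l') ord0 i)%Z] -> l = l'.
 move=> h1 h2 /forallP H; apply/rowP => i; have := Mql l i h1; have := Mql l' i h2.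
 have := H i; rewrite !mxE => /dvdzP[z zE] b2 b1.
 have zz : z = 0.
  apply/eqP; apply: contraT => z_n0; have : (Q <= absz (l ord0 i - l' ord0 i)%R)%N.
   by rewrite zE abszM leq_pmull// absz_gt0.
  by move: b1 b2; rewrite /Q; clear; lia.
 by move: zE; rewrite zz mul0r => /eqP; rewrite subr_eq0 => /eqP.
have par1 b : \sum_(y : {ffun 'I_m -> 'I_Q}) nc (\sum_(l <- L) DT b l * ee (dt l (@upt R d Q y))) ^+ 2 =
  (Q ^ m)%:R * \sum_(l <- L) nc (DT b l) ^+ 2.
 by apply: (parseval_fin (k := id) (DT b) (P := predT)) => // l l' h1 h2 _ _; apply: Qinj; rewrite mem_cat ?h1 ?h2.
pose va (y : 'rV[R]_m) (a : I) := \sum_(k <- s | aa k == a) c' k * ee (dt (ll k) y).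
have par2 a : \sum_(y : {ffun 'I_m -> 'I_Q}) nc (va (@upt R d Q y) a) ^+ 2 = (Q ^ m)%:R * \sum_(k <- s | aa k == a) nc (c' k) ^+ 2.
 apply: parseval_fin => // k k' h1 h2 /eqP h3 /eqP h4 h5; apply: all_inj; first by rewrite h3.
 by apply: Qinj h5; rewrite mem_cat map_f ?orbT.
pose Sf b a y := \sum_(l <- T) cf B (ra a g) (h' b) l * ee (dt l y).
have inner b y : \sum_(l <- L) DT b l * ee (dt l y) = \sum_a va y a * Sf b a y.
 have -> : \sum_a va y a * Sf b a y = \sum_(k <- s) c' k * ee (dt (ll k) y) * Sf b (aa k) y.
  rewrite [RHS](partition_big aa predT)//=; apply: eq_bigr => a _; rewrite /va mulr_suml.
  by apply: eq_bigr => k /eqP ->.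
 under eq_bigr do rewrite /DT mulr_suml.
 rewrite exchange_big; apply: eq_big_seq => k ks.
 have um : uniq [seq ll k + l | l <- T] by rewrite map_inj_uniq//; exact: addrI.
 have sm : {subset [seq ll k + l | l <- T] <= L}.
  by move=> _ /mapP[l lT ->]; rewrite mem_undup; apply/allpairsP; exists (k, l).
 rewrite (sum_split _ um uL sm) big_map [X in _ + X]big1 ?addr0 => [|l lm].
  rewrite /Sf mulr_sumr; apply: eq_big_seq => l lT; rewrite addrC addKr.
  rewrite lT dtDl eD; move: (cf _ _ _ _) (ee _) (ee _) (c' k) => z1 z2 z3 z4; ring.
 case: ifP => lT; last by rewrite mulr0 mul0r.
 by move: lm; rewrite -[l](subrK (ll k)) addrC map_f.
(* The fibrewise lower bound for the truncated brackets, now finite trigonometric sums that can be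
   averaged over the grid. *)
have lowS (y : 'rV[R]_m) : (forall i, `|y ord0 i| <= 1) -> kap * (\sum_a nc (va y a) ^+ 2) <= \sum_b nc (\sum_a va y a * Sf b a y) ^+ 2.
 move=> hy; have [b Hb] := low y (va y) hy.
 have [a0 _ amax] := @arg_maxP _ _ _ (ord0 : I) predT (fun a => nc (va y a)) isT.
 have Sd a : nc (br B (ra a g) (h' b) y - Sf b a y) <= tau.
  apply: hs_trunc (br_hs uB y (nra a _ ng) (nh' b)) uT _ => s' us'.
  by under eq_bigr do rewrite ncM nc_e mulr1; exact: tail.
 set w := nc (va y a0) in amax *; have w0 : 0 <= w by exact: nc_ge0.
 have h1 : dl / 2 * w <= nc (\sum_a va y a * Sf b a y).
  have h2 : nc (\sum_a va y a * br B (ra a g) (h' b) y - \sum_a va y a * Sf b a y) <= rr * (w * tau).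
   rewrite -sumrB (le_trans (nc_sum _ _ _))// /rr -rsum; apply: ler_sum => a _.
   by rewrite -mulrBr ncM ler_pM ?nc_ge0//; exact: amax.
  have h3 := Hb a0; rewrite -/w in h3.
  have h4 := nc_sub (\sum_a va y a * br B (ra a g) (h' b) y) (\sum_a va y a * Sf b a y).
  have h5 : rr * (w * tau) <= dl / 2 * w.
   have : tau <= dl / (2 * rr) by rewrite ge_min lexx.
   rewrite ler_pdivlMr ?mulr_gt0// => h6.
   by rewrite (_ : rr * (w * tau) = rr * tau * w) ?ler_wpM2r//; [move: h6; lra|ring].
  by move: h2 h3 h4 h5; clear; move: (nc _) (nc _) (nc _) => *; lra.
 apply: (@le_trans _ _ (kap * (rr * w ^+ 2))).
  rewrite ler_wpM2l ?(ltW kap0)// /rr -rsum; apply: ler_sum => a _.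
  by rewrite lerXn2r ?nnegrE ?nc_ge0//; exact: amax.
 apply: (@le_trans _ _ ((dl / 2 * w) ^+ 2)).
  by rewrite le_eqVlt; apply/orP; left; apply/eqP; rewrite /kap; field; rewrite gt_eqF.
 apply: (@le_trans _ _ (nc (\sum_a va y a * Sf b a y) ^+ 2)).
  by rewrite lerXn2r ?nnegrE ?nc_ge0// mulr_ge0// divr_ge0// ltW.
 by rewrite [leRHS](bigD1 b)//= lerDl sumr_ge0// => b' _; rewrite exprn_ge0 ?nc_ge0.
have Qm0 : 0 < (Q ^ m)%:R :> R by rewrite ltr0n expn_gt0.
have main : kap * Sg <= \sum_b \sum_(l <- L) nc (DT b l) ^+ 2.
 rewrite -(ler_pM2l Qm0) [leRHS]mulr_sumr; under [leRHS]eq_bigr do rewrite -par1.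
 rewrite exchange_big.
 have -> : (Q ^ m)%:R * (kap * Sg) = \sum_(y : {ffun 'I_m -> 'I_Q}) kap * (\sum_a nc (va (@upt R d Q y) a) ^+ 2).
  rewrite -mulr_sumr exchange_big (eq_bigr _ (fun a _ => par2 a)) -mulr_sumr mulrCA /Sg by_a.
  by do 2 congr (_ * _); apply: eq_bigr => a _; apply: eq_bigr => k _; rewrite ncc.
 apply: ler_sum => y _; under [leRHS]eq_bigr do rewrite inner; apply: lowS => i.
 rewrite /upt !mxE normrN ger0_norm ?divr_ge0// ler_pdivrMr ?ltr0n// mul1r ler_nat; exact: ltnW.
have besB b : \sum_(l <- L) nc (Dv b l) ^+ 2 <= sval (bess b) * nf f.
 have := (svalP (bess b)).2 f (nice_L2 nf0) L uL; apply: le_trans; apply: ler_sum => l _.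
 by rewrite /Dv nc_cf; [exact: lexx|exact: nf0|exact: nh'].
have nf_0 := nf_ge0 f.
have Sg0 : 0 <= Sg by apply: sumr_ge0 => k _; rewrite exprn_ge0 ?nc_ge0.
have up1 : \sum_b \sum_(l <- L) nc (DT b l) ^+ 2 <= 2 * (BB * nf f) + 2 * (nb * (rr * tau ^+ 2 * Sg)).
 apply: (@le_trans _ _ (\sum_b (2 * (sval (bess b) * nf f) + 2 * (rr * tau ^+ 2 * Sg)))).
  apply: ler_sum => b _; apply: (@le_trans _ _ (\sum_(l <- L) (2 * nc (Dv b l) ^+ 2 + 2 * nc (Dv b l - DT b l) ^+ 2))).
   apply: ler_sum => l _; have hB := ncBD (Dv b l) (Dv b l - DT b l).
   rewrite (_ : Dv b l - (Dv b l - DT b l) = DT b l) in hB; last by ring.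
   move: hB (nc_ge0 (DT b l)); move: (nc _) (nc _) (nc _) => u1 u2 u3; move=> hu hu0.
   apply: (@le_trans _ _ ((u2 + u1) ^+ 2)); first by rewrite lerXn2r ?nnegrE// (le_trans hu0 hu).
   rewrite -subr_ge0 (_ : _ - _ = (u2 - u1) ^+ 2) ?sqr_ge0//; ring.
  rewrite big_split/= -!mulr_sumr; apply: lerD; apply: ler_wpM2l => //; first [exact: besB|exact: errB].
 rewrite big_split/= -mulr_sumr -mulr_suml lerD//.
  by rewrite ler_wpM2l// ler_wpM2r// /BB lerDl.
 by rewrite sumr_const -[leLHS]mulr_natl -/nb mulrCA.
have tau2 : 2 * (nb * (rr * tau ^+ 2)) <= kap / 2.
 have htau : tau <= dl / (4 * rr * (nb + 1)) by rewrite ge_min lexx orbT.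
 have nb1 : 0 < nb + 1 by rewrite ltr_wpDl.
 have h2 : tau ^+ 2 <= (dl / (4 * rr * (nb + 1))) ^+ 2.
  by rewrite lerXn2r ?nnegrE ?(ltW tau0)// divr_ge0 ?(ltW dl0)// !mulr_ge0// ltW.
 apply: (@le_trans _ _ (2 * (nb * (rr * (dl / (4 * rr * (nb + 1))) ^+ 2)))).
  by rewrite !ler_wpM2l// ltW.
 have -> : 2 * (nb * (rr * (dl / (4 * rr * (nb + 1))) ^+ 2)) = kap / 2 * (nb / (nb + 1) ^+ 2).
  by rewrite /kap; field; rewrite !gt_eqF.
 apply: ler_piMr; first by rewrite divr_ge0 ?(ltW kap0).
 rewrite ler_pdivrMr ?exprn_gt0// mul1r.
 by rewrite -subr_ge0 (_ : _ - _ = nb ^+ 2 + nb + 1) ?addr_ge0 ?exprn_ge0//; ring.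
have fin : kap / 2 * Sg <= 2 * (BB * nf f).
 have := le_trans main up1; have := ler_wpM2r Sg0 tau2.
 have -> : 2 * (nb * (rr * tau ^+ 2)) * Sg = 2 * (nb * (rr * tau ^+ 2 * Sg)) by ring.
 by rewrite (mulrAC kap); move: (kap * Sg) (2 * (nb * _)) => u1 u2; lra.
rewrite mulrAC ler_pdivrMr ?mulr_gt0//; move: fin; rewrite -/f; clear; lra.
Qed.

End rational.

(** If every 4 S i j is rational, a common denominator is 4 times the product of the individual
    ones; the factor 4 fits the doubled lattice vectors of the irrational case. *)
Lemma rational_or_irrational (R : realType) (I : finType) (S : I -> I -> R) :
 (exists2 q : nat, (0 < q)%N & forall i j, q%:R * S i j \is a Num.int) \/
 (exists i j, forall (q : nat) (w : int), (0 < q)%N -> q%:R * (4 * S i j) <> w%:~R).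
Proof.
have [H|H] := pselect (exists i j, forall (q : nat) (w : int), (0 < q)%N -> q%:R * (4 * S i j) <> w%:~R); [by right|left].
have ex (ij : I * I) : {q : nat | (0 < q)%N /\ q%:R * (4 * S ij.1 ij.2) \is a Num.int}.
 apply: cid; apply: contrapT => h; apply: H; exists ij.1, ij.2 => q w q0 E; apply: h.
 by exists q; split=> //; rewrite E intr_int.
exists (4 * \prod_ij sval (ex ij))%N.
 by rewrite muln_gt0/= prodn_gt0// => ij; exact: (svalP (ex ij)).1.
move=> i j; rewrite (bigD1 (i, j))//= mulnCA natrM mulnC natrM.
rewrite (_ : _ * _ * _ = (\prod_(ij | ij != (i, j)) sval (ex ij))%:R * ((sval (ex (i, j)))%:R * (4 * S i j))); last first.
 by ring.
by rewrite rpredM ?natr_int//; exact: (svalP (ex (i, j))).2.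
Qed.

Lemma nat_ceil (R : realType) (x : R) : 0 < x -> exists n : nat, [/\ (0 < n)%N, x <= n%:R & (n.-1)%:R < x].
Proof.
move=> x0; have /andP[h1 h2] := truncn_itv (ltW x0).
have [h|h] := leP x (Num.truncn x)%:R; last by exists (Num.truncn x).+1; rewrite ltW.
have t0 : (0 < Num.truncn x)%N by rewrite -(ltr_nat R) (lt_le_trans x0).
by exists (Num.truncn x); split=> //; rewrite (lt_le_trans _ h1)// ltr_nat prednK.
Qed.

Theorem theorem1p3 (R : realType) (d : nat) (hd : (1 <= d)%N)
    (G : set 'rV[R]_(d + d)) (hG : is_lattice G)
    (hcovol : ((covol G)%:E < 1%:E - (d%:R - 1)%:E / nindex G)%E) :
  exists g : 'rV[R]_d -> R[i], schwartz g /\ gabor_frame G g.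
Proof.
have [M uM GE] := hG; rewrite GE covolE// in hcovol *; pose N := M^T.
have uN : N \in unitmx by rewrite unitmx_tr.
have MN : M = N^T by rewrite trmxK.
(* Duality moves the problem to the adjoint lattice, whose covolume is the inverse of the given
   one. *)
suff [g ng rg] : exists2 g : 'rV[R]_d -> R[i], nice g & riesz (adj N) g.
 by exists g; split; [exact: nice_schwartz|rewrite MN; exact: duality].
have dMN : `|\det M| = `|\det N| by rewrite det_tr.
have dN0 : 0 < `|\det N| by rewrite normr_gt0 -unitfE -unitmxE.
have d1 : 0 <= d%:R - 1 :> R by rewrite subr_ge0 ler1n.
have uL : adj N \in unitmx by exact: adj_unit.
have ind0 : (0 <= nindex (lattice_of M))%E.
 by rewrite /nindex; case: ifP => // _; rewrite lee_fin sqrtr_ge0.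
have [[q q0 Hq]|[iy [ix irr]]] := rational_or_irrational (fun i j => symp (row i (adj N)) (row j (adj N))); last first.
 apply: irrational_riesz irr => //; rewrite det_adj// invf_gt1// -dMN -lte_fin (lt_le_trans hcovol)//.
 by rewrite -[leRHS]sube0; apply: leeB => //; apply: mule_ge0; rewrite ?lee_fin ?inve_ge0.
have [C [dC iC maxC]] := max_isotropic q0 Hq.
pose N0 := `|\det (map_mx intr C *m adj N)|.
have N0E : N0 = (absz (\det C))%:R / `|\det N|.
 by rewrite /N0 det_mulmx normrM det_map_mx det_adj// -intr_norm -abszE.
have r0 : (0 < absz (\det C))%N by rewrite absz_gt0.
have N00 : 0 < N0 by rewrite N0E divr_gt0// ltr0n.
have nle : (nindex (lattice_of M) <= N0%:E)%E := nindex_le uN dC iC.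
have [n1 [n1_0 n1l n1g]] := nat_ceil N00.
(* r = covol * N0 and N0 >= n_Gamma, so the covolume hypothesis multiplied by N0 reads r < N0 - (d -
   1). *)
have key : (absz (\det C))%:R + d%:R - 1 < N0.
 have E : (absz (\det C))%:R = `|\det N| * N0 by rewrite N0E mulrC divfK// gt_eqF.
 suff : `|\det N| < 1 - (d%:R - 1) / N0.
  rewrite -(ltr_pM2r N00) mulrBl divfK ?gt_eqF// mul1r E; lra.
 move: hcovol nle ind0; rewrite dMN; case: (nindex _) => [nu| |]//; rewrite lee_fin => hc nl nu0.
 (* The value 0 is handled by the convention that its inverse is infinite: for d = 1 the quotient is
    then 0, and for d > 1 the hypothesis would put the covolume below minus infinity. *)
 rewrite lee_fin in nu0; rewrite inver in hc; move: hc; case: eqP => [nuz|/eqP nuz].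
  have [->|d2] := eqVneq (d%:R - 1 : R) 0; first by rewrite mul0e sube0 lte_fin mul0r subr0.
  by rewrite gt0_muley ?lte_fin ?lt_neqAle ?d1 1?eq_sym ?d2// addeNy; case: (_ : \bar R).
 rewrite -EFinM -EFinB lte_fin => hc; apply: (lt_le_trans hc).
 by rewrite lerD2l lerN2 ler_wpM2l// lef_pV2 ?posrE// lt_neqAle eq_sym nuz.
have rn : (absz (\det C) + d <= n1)%N.
 rewrite -ltnS -(ltr_nat R) -natr1 natrD; move: key n1l; lra.
apply: (@rational_riesz R d (adj N) C q n1) => //.
by rewrite (leq_trans _ rn)// -addn1 leq_add.
Qed.
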